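(* Let $N\in\mathbb{N}$, let $\mu,\nu,w\in\mathbb{C}$ be such that ${}_{\mu}K_{\nu}^{(N)}(z,w)$ is defined, and let $m\in\mathbb{N}\cup\{0\}$. Let $\delta>0$. As $z\to\infty$ in the sector $|\arg(z)|\le \frac{\pi}{2}-\delta$, $$\begin{aligned}{}_\mu K_{\nu}^{(N)}(z, w) &= \frac{2^{3\mu+2\nu+2w+\frac{1}{N}-1} \pi^{(1-N)\nu-N} }{z^{2\mu+\nu+w+\frac1N}}\sin (\pi(\mu+\nu))\prod_{i=2}^{N}\sin \left(\pi \left( \mu+\nu+w-\tfrac{i-1}{N}\right) \right) \\ &\quad\times\sum_{k=0}^{m}\frac{(-1)^{k(N+1)+N}}{k!}\left\{\prod_{i=1}^{2N-1}\Gamma\left( \tfrac{i}{2N}+\mu+\nu+w+k\right)\right\} \Gamma \left(\tfrac12+\mu+w +k\right) \Gamma\left(1+\mu+\nu +k\right)\left(\frac z2 \right)^{-2k}\\ &\quad+ \mathcal{O}\left(z^{-2m-2-\frac1N-2\mu-\nu-w} \right).\end{aligned}$$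
   Context: $\langle c_i\rangle_{i=r}^{s}$ denotes the list $c_r,\dots,c_s$. The Meijer $G$-function: for integers $0\le m\le q$, $0\le n\le p$ and complex $a_1,\dots,a_p$, $b_1,\dots,b_q$ with $a_i-b_j\notin\mathbb{N}$ for $1\le i\le n$, $1\le j\le m$, $$G_{p,q}^{m,n}\left(\begin{matrix} a_1,\dots,a_p\\ b_1,\dots,b_m;b_{m+1},\dots,b_q\end{matrix}\Big|X\right)=\frac1{2\pi i}\int_L\frac{\prod_{j=1}^m\Gamma(b_j-s)\prod_{j=1}^n\Gamma(1-a_j+s)\,X^s}{\prod_{j=m+1}^q\Gamma(1-b_j+s)\prod_{j=n+1}^p\Gamma(a_j-s)}\,ds,$$ where $L$ goes from $-i\infty$ to $+i\infty$ and separates the poles of the $\Gamma(1-a_j+s)$ from those of the $\Gamma(b_j-s)$; the integral converges absolutely if $p+q<2(m+n)$ and $|\arg X|<(m+n-\frac{p+q}2)\pi$. The function ${}_{\mu}K_{\nu}^{(N)}$ is $${}_{\mu}K_{\nu}^{(N)}(z, w) := 2^{\mu + \frac{2}{N}-1}\pi^{(1-N)\nu}z^{w+\nu-\frac{2}{N}} G_{1,\,2N+1}^{N+1,\,1}\left( \begin{matrix} 1+\frac{1}{2N}-\mu-\nu-w \\ \frac{1}{2}+\frac{1}{2N}-\nu, \langle \frac{i}{N} \rangle_{i=1}^N; 1+\frac{1}{2N}-w, \langle 1+\frac{3}{2N} - \frac{i}{N} \rangle_{i=2}^N \end{matrix} \Big | \frac{z^2}{4} \right),$$ defined when the parameter condition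 $a_1-b_j\notin\mathbb{N}$ ($1\le j\le N+1$) holds. Powers are principal values; the implied constant may depend on $\mu,\nu,w,N,m,\delta$, and $\mathcal O(z^{c})$ for complex $c$ means $\mathcal O(|z|^{\mathrm{Re}(c)})$. *)

(* Defs.v *)
From Stdlib Require Import Reals Factorial List ClassicalEpsilon.
From Coquelicot Require Import Coquelicot.
Import ListNotations.
Open Scope C_scope.

(** * Elementary complex functions *)

Definition Cexp (z : C) : C :=
  RtoC (exp (Re z)) * (cos (Im z), sin (Im z)).

Definition Csin (z : C) : C :=
  (Cexp (Ci * z) - Cexp (- (Ci * z))) / (2 * Ci).

(** Principal argument, with values in (-PI, PI] for z <> 0. *)
Definition Carg (z : C) : R :=
  if Rle_dec 0 (Im z) then acos (Re z / Cmod z)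
  else (- acos (Re z / Cmod z))%R.

Definition Clog (z : C) : C := (ln (Cmod z), Carg z).

(** Principal value of z^c for z <> 0.  ([z ^ n] is Coquelicot's power with
    exponent n : nat.) *)
Definition Cpowc (z c : C) : C := Cexp (c * Clog z).

Definition Cprod (l : list C) : C := fold_right Cmult (RtoC 1) l.

Definition Cnat (n : nat) : C := RtoC (INR n).

(** * The Gamma function *)

(** Gauss' formula  Gamma(s) = lim n! n^s / (s (s+1) ... (s+n)).
    At a pole s = 0, -1, -2, ... the quotients are eventually x / 0 = 0, so
    that [Gamma s = 0] there; as also [/ 0 = 0], the expression [/ Gamma s] is
    the entire function 1/Gamma, with value 0 at the poles of Gamma. *)
Definition Gamma_seq (s : C) (n : nat) : C :=
  Cnat (fact n) * Cpowc (Cnat n) s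
  / Cprod (map (fun k => s + Cnat k) (seq 0 (S n))).

Definition Gamma (s : C) : C :=
  (real (Lim_seq (fun n => Re (Gamma_seq s n))),
   real (Lim_seq (fun n => Im (Gamma_seq s n)))).

Definition Gamma_regular (s : C) : Prop := forall n : nat, s <> - Cnat n.

(** * The Meijer G-function

    The parameters are four lists: a1 = <a_1, ..., a_n>,
    a2 = <a_(n+1), ..., a_p>, b1 = <b_1, ..., b_m>, b2 = <b_(m+1), ..., b_q>. *)

(** No a_i - b_j (i <= n, j <= m) is a positive integer, that is, no pole of a
    Gamma(1 - a_i + s) is a pole of a Gamma(b_j - s). *)
Definition MeijerG_defined (a1 b1 : list C) : Prop :=
  forall a b, In a a1 -> In b b1 -> forall n : nat, a - b <> Cnat (S n).

Definition MeijerG_integrand (a1 a2 b1 b2 : list C) (X s : C) : C :=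
  Cprod (map (fun b => Gamma (b - s)) b1)
  * Cprod (map (fun a => Gamma (1 - a + s)) a1)
  * Cpowc X s
  / (Cprod (map (fun b => Gamma (1 - b + s)) b2)
     * Cprod (map (fun a => Gamma (a - s)) a2)).

(** A contour from -i oo to +i oo, within a vertical strip, given by a C^1
    parametrization L : R -> C with derivative dL.  The derivative may vanish,
    so piecewise C^1 contours are covered as well. *)
Definition contour (L dL : R -> C) : Prop :=
  (forall t, @is_derive R_AbsRing C_R_NormedModule L t (dL t)) /\
  (forall t, continuous dL t) /\
  (exists B : R, forall t, (Rabs (Re (L t)) <= B)%R) /\
  filterlim (fun t => Im (L t)) (Rbar_locally m_infty) (Rbar_locally m_infty) /\
  filterlim (fun t => Im (L t)) (Rbar_locally p_infty) (Rbar_locally p_infty).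

(** The total variation along L of arg (s - p): it is PI for a point p to the
    left of L and - PI for a point p to the right of L. *)
Definition arg_variation (L dL : R -> C) (p : C) (v : R) : Prop :=
  (forall t, L t <> p) /\
  is_RInt_gen (fun t => Im (dL t / (L t - p)))
    (Rbar_locally m_infty) (Rbar_locally p_infty) v.

(** The poles a - 1 - n of the Gamma(1 - a + s) lie to the left of L, the poles
    b + n of the Gamma(b - s) lie to the right of L. *)
Definition separates (L dL : R -> C) (a1 b1 : list C) : Prop :=
  (forall a (n : nat), In a a1 -> arg_variation L dL (a - 1 - Cnat n) PI) /\
  (forall b (n : nat), In b b1 -> arg_variation L dL (b + Cnat n) (- PI)).

Definition is_MeijerG (a1 a2 b1 b2 : list C) (X v : C) : Prop :=
  exists (L dL : R -> C) (I : C),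
    contour L dL /\ separates L dL a1 b1 /\
    @is_RInt_gen C_R_NormedModule
      (fun t => MeijerG_integrand a1 a2 b1 b2 X (L t) * dL t)
      (Rbar_locally m_infty) (Rbar_locally p_infty) I /\
    v = / (2 * RtoC PI * Ci) * I.

(** By Cauchy's theorem the value does not depend on the contour. *)
Definition MeijerG (a1 a2 b1 b2 : list C) (X : C) : C :=
  epsilon (inhabits (RtoC 0)) (is_MeijerG a1 a2 b1 b2 X).

(** * The function K *)

Definition K_a1 (N : nat) (mu nu w : C) : list C :=
  [1 + 1 / (2 * Cnat N) - mu - nu - w].

Definition K_b1 (N : nat) (nu : C) : list C :=
  (1 / 2 + 1 / (2 * Cnat N) - nu)
  :: map (fun i => Cnat i / Cnat N) (seq 1 N).

Definition K_b2 (N : nat) (w : C) : list C :=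
  (1 + 1 / (2 * Cnat N) - w)
  :: map (fun i => 1 + 3 / (2 * Cnat N) - Cnat i / Cnat N) (seq 2 (N - 1)).

Definition K_defined (N : nat) (mu nu w : C) : Prop :=
  MeijerG_defined (K_a1 N mu nu w) (K_b1 N nu).

Definition K (N : nat) (mu nu z w : C) : C :=
  Cpowc 2 (mu + 2 / Cnat N - 1)
  * Cpowc (RtoC PI) ((1 - Cnat N) * nu)
  * Cpowc z (w + nu - 2 / Cnat N)
  * MeijerG (K_a1 N mu nu w) [] (K_b1 N nu) (K_b2 N w) (z ^ 2 / 4).

(** * The asymptotic expansion *)

Definition K_term (N : nat) (mu nu w z : C) (k : nat) : C :=
  (- (1)) ^ (k * (N + 1) + N) / Cnat (fact k)
  * Cprod (map (fun i => Gamma (Cnat i / (2 * Cnat N) + mu + nu + w + Cnat k))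
             (seq 1 (2 * N - 1)))
  * Gamma (1 / 2 + mu + w + Cnat k)
  * Gamma (1 + mu + nu + Cnat k)
  * / (z / 2) ^ (2 * k).

Definition K_expansion (N m : nat) (mu nu w z : C) : C :=
  Cpowc 2 (3 * mu + 2 * nu + 2 * w + 1 / Cnat N - 1)
  * Cpowc (RtoC PI) ((1 - Cnat N) * nu - Cnat N)
  / Cpowc z (2 * mu + nu + w + 1 / Cnat N)
  * Csin (RtoC PI * (mu + nu))
  * Cprod (map (fun i => Csin (RtoC PI * (mu + nu + w - (Cnat i - 1) / Cnat N)))
             (seq 2 (N - 1)))
  * sum_n (K_term N mu nu w z) m.

(** No Gamma factor of [K_expansion] is evaluated at a pole. *)
Definition expansion_regular (N : nat) (p : C * C * C) : Prop :=
  let '(mu, nu, w) := p in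
  (forall i : nat, (1 <= i <= 2 * N - 1)%nat ->
     Gamma_regular (Cnat i / (2 * Cnat N) + mu + nu + w)) /\
  Gamma_regular (1 / 2 + mu + w) /\
  Gamma_regular (1 + mu + nu).

(** [K_defined] does not exclude that some Gamma(i/(2N)+mu+nu+w+k) with i even,
    or Gamma(1+mu+nu+k), has a pole; a sine factor then vanishes, and the
    expansion is to be read as the value [v] of its continuous extension in the
    parameters.  Where all Gamma factors are regular this is just
    [v = K_expansion N m mu nu w z] (see [K_expansion_value_regular]). *)
Definition K_expansion_value (N m : nat) (mu nu w z v : C) : Prop :=
  filterlim (fun p : C * C * C => let '(mu', nu', w') := p in
               K_expansion N m mu' nu' w' z)
    (within (expansion_regular N) (locally (mu, nu, w)))
    (locally v).

Lemma K_expansion_value_regular (N m : nat) (mu nu w z v : C) :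
  expansion_regular N (mu, nu, w) ->
  K_expansion_value N m mu nu w z v -> v = K_expansion N m mu nu w z.
Proof.
  intros Hreg Hlim; symmetry; apply eq_close; intros eps.
  apply ball_sym.
  assert (H := Hlim (ball v eps) (locally_ball v eps)).
  exact (locally_singleton _ _ H Hreg).
Qed.

(* Main.v *)
Require Import Defs.
From Stdlib Require Import Reals Lra Lia List Arith FinFun ClassicalEpsilon.
From Coquelicot Require Import Coquelicot.
Import ListNotations.
Open Scope C_scope.

(** Gauss' product writes Gamma on Re s > 0 as the exponential of a primitive of the digamma function, so Gamma is smooth and
    nonvanishing there, and 1/Gamma is entire. The reflection formula comes from the integrals of [cos t ^ (2m) * cos (s t)]
    over [[0, PI/2]], which satisfy a two-term recursion producing Euler's product for the sine. In Gauss' product,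
    |Gamma(x + iy)| / Gamma(x) increases with [x]; combined with |Gamma(1 + iy)|^2 = PI y / sinh (PI y) this yields decay
    exp(- PI |y| / 2), up to powers of [|y|], uniformly in vertical strips.

    Let [a] be the upper parameter. An admissible contour is compared with the line Re s = Re a - 1 - M - 1/2 after subtracting
    principal parts: the smooth remainder has a primitive, and a simple pole contributes the variation of the argument along the
    contour. Hence the G-function is the sum of the residues at a - 1 - k, k <= M, plus an integral over the line, which is
    O(|X|^(Re a - 1 - M - 1/2)). Here M > m is large enough for the line to lie to the left of the poles of the Gamma(b - s);
    the residues with k > m are of the order of the error term. The reflection formula turns the factors 1/Gamma of the
    residues into the sines of the statement, first for generic parameters and then
    for all by continuity. *)

(** The contour in [is_MeijerG] is an arbitrary C^1 curve in a vertical strip, known only through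
    its argument variations, and [MeijerG] is picked by [epsilon]. Two facts are therefore needed:
    an admissible contour with convergent integral exists, and all admissible contours give the same
    value. No homotopy is used. Over a strip the integrand is a smooth function divided by a
    polynomial, and partial fractions apply: smooth functions and the powers (s - p)^(-j) with j >=
    2 have primitives, so Cauchy's theorem is only ever the fundamental theorem of calculus. A pole
    on the same side of the contour and of the line contributes nothing, whatever its order; this
    matters because poles of different Gamma(b - s) may coincide. Only the poles to the left of the
    contour and to the right of the line, all simple, leave residues.

    Each of the N + 2 Gamma factors in the numerator gives decay at rate PI/2, and each of the N in
    the denominator takes PI/2 away, so the integrand decays at rate PI, whereas |arg X| = 2 |arg z|
    <= PI - 2 delta. This margin makes the estimates uniform in the sector. *)

Ltac Cvars := repeat match goal with x : UniformSpace.sort _ |- _ => change C in x end; repeat match goal with x : AbsRing.sort R_AbsRing |- _ => change R in x end; cbv beta.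
Ltac Cring := Cvars; match goal with |- @eq _ ?a ?b => change (@eq C a b) end; ring.
Ltac Cfield := Cvars; match goal with |- @eq _ ?a ?b => change (@eq C a b) end; field.

(** * Moduli and the topology of the complex plane *)

Lemma Cmod_sub_sym (a b : C) : Cmod (a - b) = Cmod (b - a).
Proof. rewrite <- Cmod_opp; f_equal; ring. Qed.

Lemma Cmod_triangle_sub (a b : C) : (Cmod (a - b) <= Cmod a + Cmod b)%R.
Proof. unfold Cminus; eapply Rle_trans; [apply Cmod_triangle|rewrite Cmod_opp; lra]. Qed.

Lemma Cmod_triangle_inv (a b : C) : (Cmod a - Cmod b <= Cmod (a - b))%R.
Proof.
  replace (Cmod a) with (Cmod ((a - b) + b)) by (f_equal; ring).
  generalize (Cmod_triangle (a - b) b); lra.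
Qed.

Lemma im_le_Cmod (c : C) : (Rabs (Im c) <= Cmod c)%R.
Proof.
  eapply Rle_trans; [|apply Rmax_Cmod]; apply Rmax_r.
Qed.

Lemma Cmod_le_Re_Im (c : C) : (Cmod c <= Rabs (Re c) + Rabs (Im c))%R.
Proof.
  replace c with (RtoC (Re c) + Ci * RtoC (Im c)).
  2:{ destruct c; unfold Re, Im; simpl; unfold Cplus, Cmult, Ci, RtoC; simpl; f_equal; ring. }
  eapply Rle_trans; [apply Cmod_triangle|].
  rewrite Cmod_mult, Cmod_Ci, !Cmod_R.
  right. destruct c; unfold Re, Im, Ci, RtoC; simpl.
  rewrite !Rmult_0_l, !Rmult_0_r, !Rmult_1_l, ?Rplus_0_r, ?Rplus_0_l, ?Rminus_0_r, ?Rplus_0_l; f_equal; f_equal; ring.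
Qed.

Lemma C_ball_iff (x y : C) (e : R) :
  @ball C_UniformSpace x e y <-> (Rabs (Re (y - x)) < e /\ Rabs (Im (y - x)) < e)%R.
Proof. reflexivity. Qed.

(** The balls of [C] as a product space are squares. The disc of radius d lies in the square of
    half-side d, and the square of half-side d/2 lies in the disc of radius d because |c| <= |Re c|
    + |Im c|. *)
Lemma locally_C_iff (x : C) (P : C -> Prop) :
  @locally C_UniformSpace x P <->
  exists d : R, (0 < d)%R /\ forall y, (Cmod (y - x) < d)%R -> P y.
Proof.
  split.
  - intros [d Hd]; exists d; split; [apply cond_pos|]; intros y Hy; apply Hd, C_ball_iff; split.
    + eapply Rle_lt_trans; [apply re_le_Cmod|exact Hy].
    + eapply Rle_lt_trans; [apply im_le_Cmod|exact Hy].
  - intros [d [Hd H]]; assert (Hd2 : (0 < d / 2)%R) by lra.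
    exists (mkposreal _ Hd2); intros y Hy; apply H.
    destruct (proj1 (C_ball_iff _ _ _) Hy) as [Hy1 Hy2]; generalize (Cmod_le_Re_Im (y - x)).
    change (pos (mkposreal _ Hd2)) with (d / 2)%R in Hy1, Hy2; lra.
Qed.

Lemma filterlim_C {T : Type} (F : (T -> Prop) -> Prop) {FF : Filter F} (f : T -> C) (l : C) :
  filterlim f F (@locally C_UniformSpace l) <->
  forall e : R, (0 < e)%R -> F (fun y => (Cmod (f y - l) < e)%R).
Proof.
  split.
  - intros H e He; apply (H (fun y => (Cmod (y - l) < e)%R)).
    apply locally_C_iff; exists e; split; auto.
  - intros H P HP; apply locally_C_iff in HP; destruct HP as [d [Hd HP]].
    unfold filtermap; generalize (H d Hd); apply filter_imp; auto.
Qed.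

(** * Limits and continuity of complex-valued functions *)

Section Limits.
Context {T : Type} (F : (T -> Prop) -> Prop) {FF : Filter F}.
Implicit Types f g : T -> C.
Notation "f --> l" := (filterlim f F (@locally C_UniformSpace l)) (at level 70).

Lemma flim_const (a : C) : (fun _ : T => a) --> a.
Proof.
  apply filterlim_C; auto; intros e He; apply filter_forall; intros _.
  replace (a - a) with (RtoC 0) by ring; rewrite Cmod_0; exact He.
Qed.

Lemma flim_ext f g (l : C) : F (fun x => f x = g x) -> f --> l -> g --> l.
Proof. intros H; apply filterlim_ext_loc, H. Qed.

Lemma flim_plus f g (a b : C) : f --> a -> g --> b -> (fun x => f x + g x) --> (a + b).
Proof.
  rewrite !filterlim_C; auto; intros Hf Hg e He.
  generalize (filter_and (F := F) _ _ (Hf (e / 2)%R ltac:(lra)) (Hg (e / 2)%R ltac:(lra))).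
  apply filter_imp; intros x [H1 H2].
  replace (f x + g x - (a + b)) with ((f x - a) + (g x - b)) by ring.
  generalize (Cmod_triangle (f x - a) (g x - b)); lra.
Qed.

Lemma flim_opp f (a : C) : f --> a -> (fun x => - f x) --> (- a).
Proof.
  rewrite !filterlim_C; auto; intros Hf e He; generalize (Hf e He); apply filter_imp.
  intros x Hx; replace (- f x - - a) with (- (f x - a)) by ring; rewrite Cmod_opp; exact Hx.
Qed.

Lemma flim_minus f g (a b : C) : f --> a -> g --> b -> (fun x => f x - g x) --> (a - b).
Proof. intros Hf Hg; apply flim_plus; [exact Hf|apply flim_opp, Hg]. Qed.

Lemma flim_mult f g (a b : C) : f --> a -> g --> b -> (fun x => f x * g x) --> (a * b).
Proof.
  rewrite !filterlim_C; auto; intros Hf Hg e He.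
  set (A := (Cmod a + Cmod b + 1)%R).
  assert (Ha := Cmod_ge_0 a); assert (Hb := Cmod_ge_0 b).
  assert (HA : (0 < A)%R) by (unfold A; lra).
  set (d := Rmin 1 (e / (2 * A))%R).
  assert (Hd : (0 < d)%R).
  { unfold d; apply Rmin_case; [lra|]; apply Rdiv_lt_0_compat; lra. }
  generalize (filter_and (F := F) _ _ (Hf d Hd) (Hg d Hd)).
  apply filter_imp; intros x [H1 H2].
  replace (f x * g x - a * b) with ((f x - a) * (g x - b) + (a * (g x - b) + b * (f x - a))) by ring.
  eapply Rle_lt_trans; [apply Cmod_triangle|].
  eapply Rle_lt_trans; [apply Rplus_le_compat_l, Cmod_triangle|].
  rewrite !Cmod_mult.
  assert (d <= 1)%R by apply Rmin_l.
  assert (d * A <= e / 2)%R.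
  { apply Rle_trans with (e / (2 * A) * A)%R; [apply Rmult_le_compat_r; [lra|apply Rmin_r]|right; field; lra]. }
  assert (P1 := Cmod_ge_0 (f x - a)); assert (P2 := Cmod_ge_0 (g x - b)).
  assert (Cmod (f x - a) * Cmod (g x - b) <= d * 1)%R by (apply Rmult_le_compat; lra).
  assert (Cmod a * Cmod (g x - b) <= Cmod a * d)%R by (apply Rmult_le_compat_l; lra).
  assert (Cmod b * Cmod (f x - a) <= Cmod b * d)%R by (apply Rmult_le_compat_l; lra).
  unfold A in *; lra.
Qed.

Lemma flim_inv f (a : C) : a <> 0 -> f --> a -> (fun x => / f x) --> (/ a).
Proof.
  rewrite !filterlim_C; auto; intros Ha Hf e He.
  assert (Pa := proj1 (Cmod_gt_0 a) Ha).
  set (d := Rmin (Cmod a / 2) (e * (Cmod a * Cmod a) / 2)%R).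
  assert (Paa : (0 < Cmod a * Cmod a)%R) by (apply Rmult_lt_0_compat; lra).
  assert (Hd : (0 < d)%R).
  { unfold d; apply Rmin_case; [lra|]. apply Rdiv_lt_0_compat; [apply Rmult_lt_0_compat; lra|lra]. }
  generalize (Hf d Hd); apply filter_imp; intros x Hx.
  assert (d <= Cmod a / 2)%R by apply Rmin_l.
  assert (d <= e * (Cmod a * Cmod a) / 2)%R by apply Rmin_r.
  assert (Hm : (Cmod a / 2 < Cmod (f x))%R).
  { generalize (Cmod_triangle_inv a (f x)); rewrite Cmod_sub_sym; lra. }
  assert (Hn : f x <> 0) by (apply Cmod_gt_0; lra).
  replace (/ f x - / a) with ((a - f x) / (f x * a)) by (field; auto).
  rewrite Cmod_div, Cmod_mult by (apply Cmult_neq_0; auto).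
  apply Rmult_lt_reg_r with (Cmod (f x) * Cmod a)%R; [apply Rmult_lt_0_compat; lra|].
  unfold Rdiv; rewrite Rmult_assoc, Rinv_l, Rmult_1_r by (apply Rgt_not_eq, Rmult_lt_0_compat; lra).
  rewrite Cmod_sub_sym; eapply Rlt_le_trans; [exact Hx|].
  apply Rle_trans with (e * (Cmod a / 2 * Cmod a))%R; [lra|].
  apply Rmult_le_compat_l; [lra|]; apply Rmult_le_compat_r; lra.
Qed.

Lemma flim_div f g (a b : C) : b <> 0 -> f --> a -> g --> b -> (fun x => f x / g x) --> (a / b).
Proof. intros Hb Hf Hg; apply flim_mult; [exact Hf|apply flim_inv; auto]. Qed.

Lemma flim_pow f (a : C) (n : nat) : f --> a -> (fun x => f x ^ n) --> (a ^ n).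
Proof.
  intros H; induction n; simpl; [apply flim_const|apply flim_mult; auto].
Qed.

Lemma flim_RtoC (f : T -> R) (a : R) :
  filterlim f F (locally a) -> (fun x => RtoC (f x)) --> (RtoC a).
Proof.
  intros H; apply filterlim_C; auto; intros e He.
  generalize (proj1 (filterlim_locally f a) H (mkposreal e He)); apply filter_imp; intros x Hx.
  rewrite <- RtoC_minus, Cmod_R; exact Hx.
Qed.

Lemma flim_Re f (a : C) : f --> a -> filterlim (fun x => Re (f x)) F (locally (Re a)).
Proof.
  intros H; apply (filterlim_comp _ _ _ f Re _ _ _ H).
  apply continuous_fst.
Qed.

Lemma flim_Im f (a : C) : f --> a -> filterlim (fun x => Im (f x)) F (locally (Im a)).
Proof.
  intros H; apply (filterlim_comp _ _ _ f Im _ _ _ H).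
  apply continuous_snd.
Qed.

Lemma flim_pair (f g : T -> R) (a b : R) :
  filterlim f F (locally a) -> filterlim g F (locally b) -> (fun x => (f x, g x)) --> (a, b).
Proof.
  intros Hf Hg; apply filterlim_C; auto; intros e He.
  assert (He2 : (0 < e / 2)%R) by lra.
  generalize (filter_and (F := F) _ _ (proj1 (filterlim_locally f a) Hf (mkposreal _ He2))
    (proj1 (filterlim_locally g b) Hg (mkposreal _ He2))); apply filter_imp; intros x [H1 H2].
  eapply Rle_lt_trans; [apply Cmod_le_Re_Im|]; unfold ball in *; simpl in *.
  unfold AbsRing_ball, abs, minus, plus, opp in *; simpl in *; lra.
Qed.

Lemma flim_Cmod f (a : C) : f --> a -> filterlim (fun x => Cmod (f x)) F (locally (Cmod a)).
Proof.
  rewrite filterlim_C; auto; intros H; apply filterlim_locally; intros e.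
  generalize (H e (cond_pos e)); apply filter_imp; intros x Hx.
  unfold ball; simpl; unfold AbsRing_ball, abs, minus, plus, opp; simpl.
  apply Rabs_def1; [generalize (Cmod_triangle_inv (f x) a); lra|].
  generalize (Cmod_triangle_inv a (f x)); rewrite (Cmod_sub_sym a); lra.
Qed.

Lemma flim_le_0 f (l : C) (g : T -> R) :
  F (fun x => (Cmod (f x - l) <= g x)%R) -> filterlim g F (locally 0%R) -> f --> l.
Proof.
  intros H Hg; apply filterlim_C; auto; intros e He.
  generalize (filter_and (F := F) _ _ H (proj1 (filterlim_locally g 0%R) Hg (mkposreal e He))).
  apply filter_imp; intros x [H1 H2].
  unfold ball in H2; simpl in H2; unfold AbsRing_ball, abs, minus, plus, opp in H2; simpl in H2.
  rewrite Ropp_0, Rplus_0_r in H2; generalize (Rle_abs (g x)); lra.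
Qed.

End Limits.

Lemma flim_unique {T : Type} (F : (T -> Prop) -> Prop) {FF : ProperFilter F} (f : T -> C) (a b : C) :
  filterlim f F (@locally C_UniformSpace a) -> filterlim f F (@locally C_UniformSpace b) -> a = b.
Proof.
  intros Ha Hb; apply (filterlim_locally_unique (K := R_AbsRing) (V := C_R_NormedModule) f a b Ha Hb).
Qed.

Definition cont_C {T : UniformSpace} (f : T -> C) (x : T) : Prop := @continuous T C_UniformSpace f x.

Section Continuity.
Context {T : UniformSpace}.
Implicit Types f g : T -> C.

Lemma cont_const (a : C) (x : T) : cont_C (fun _ => a) x.
Proof. apply flim_const; apply locally_filter. Qed.
Lemma cont_plus f g x : cont_C f x -> cont_C g x -> cont_C (fun y => f y + g y) x.
Proof. apply flim_plus; apply locally_filter. Qed.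
Lemma cont_opp f x : cont_C f x -> cont_C (fun y => - f y) x.
Proof. apply flim_opp; apply locally_filter. Qed.
Lemma cont_minus f g x : cont_C f x -> cont_C g x -> cont_C (fun y => f y - g y) x.
Proof. apply flim_minus; apply locally_filter. Qed.
Lemma cont_mult f g x : cont_C f x -> cont_C g x -> cont_C (fun y => f y * g y) x.
Proof. apply flim_mult; apply locally_filter. Qed.
Lemma cont_inv f x : f x <> 0 -> cont_C f x -> cont_C (fun y => / f y) x.
Proof. apply flim_inv; apply locally_filter. Qed.
Lemma cont_div f g x : g x <> 0 -> cont_C f x -> cont_C g x -> cont_C (fun y => f y / g y) x.
Proof. apply flim_div; apply locally_filter. Qed.
Lemma cont_pow f n x : cont_C f x -> cont_C (fun y => f y ^ n) x.
Proof. apply flim_pow; apply locally_filter. Qed.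
Lemma cont_RtoC (f : T -> R) x : continuous f x -> cont_C (fun y => RtoC (f y)) x.
Proof. apply flim_RtoC; apply locally_filter. Qed.
Lemma cont_Re f x : cont_C f x -> continuous (fun y => Re (f y)) x.
Proof. apply flim_Re. Qed.
Lemma cont_Im f x : cont_C f x -> continuous (fun y => Im (f y)) x.
Proof. apply flim_Im. Qed.
Lemma cont_pair (f g : T -> R) x :
  continuous f x -> continuous g x -> cont_C (fun y => (f y, g y)) x.
Proof. apply flim_pair; apply locally_filter. Qed.
Lemma cont_Cmod f x : cont_C f x -> continuous (fun y => Cmod (f y)) x.
Proof. apply flim_Cmod; apply locally_filter. Qed.
Lemma cont_comp (f : C -> C) g x : cont_C g x -> cont_C f (g x) -> cont_C (fun y => f (g y)) x.
Proof. intros Hg Hf; apply (filterlim_comp _ _ _ g f _ _ _ Hg Hf). Qed.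
Lemma cont_ext_loc f g x : locally x (fun y => f y = g y) -> cont_C f x -> cont_C g x.
Proof.
  intros H Hf; unfold cont_C, continuous; rewrite <- (locally_singleton _ _ H).
  apply (flim_ext _ f); auto.
Qed.
Lemma cont_prod {A : Type} (l : list A) (f : A -> T -> C) x :
  (forall a, In a l -> cont_C (f a) x) -> cont_C (fun y => Cprod (map (fun a => f a y) l)) x.
Proof.
  induction l; intros H; simpl; [apply cont_const|].
  apply cont_mult; [apply H; left; auto|apply IHl; intros b Hb; apply H; right; auto].
Qed.
End Continuity.

Lemma cont_id (x : C) : cont_C (fun y : C => y) x.
Proof. apply filterlim_id. Qed.

Lemma cont_eps (f : C -> C) (z : C) :
  cont_C f z <-> forall e, (0 < e)%R -> exists d, (0 < d)%R /\
    forall s, (Cmod (s - z) < d)%R -> (Cmod (f s - f z) < e)%R.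
Proof.
  unfold cont_C, continuous; rewrite filterlim_C by apply locally_filter.
  split; intros H e He; [apply locally_C_iff, H, He|apply locally_C_iff, H, He].
Qed.

(** Caratheodory's form of the complex derivative. *)
Definition Cderiv (f : C -> C) (z l : C) : Prop :=
  exists phi : C -> C,
    @locally C_UniformSpace z (fun s => f s = f z + (s - z) * phi s) /\
    cont_C phi z /\ phi z = l.

Lemma Cderiv_cont f z l : Cderiv f z l -> cont_C f z.
Proof.
  intros [phi [H [Hc _]]].
  apply (cont_ext_loc (fun s => f z + (s - z) * phi s)).
  - revert H; apply filter_imp; intros s ->; auto.
  - apply cont_plus; [apply cont_const|apply cont_mult; auto].
    apply cont_minus; [apply cont_id|apply cont_const].
Qed.

Lemma Cderiv_const a z : Cderiv (fun _ => a) z 0.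
Proof.
  exists (fun _ => RtoC 0); split; [apply filter_forall; intros; Cring|].
  split; [apply cont_const|auto].
Qed.

Lemma Cderiv_id z : Cderiv (fun s => s) z 1.
Proof.
  exists (fun _ => RtoC 1); split; [apply filter_forall; intros; Cring|].
  split; [apply cont_const|auto].
Qed.

Lemma Cderiv_plus (f g : C -> C) (z a b : C) :
  Cderiv f z a -> Cderiv g z b -> Cderiv (fun s => f s + g s) z (a + b).
Proof.
  intros [p [Hp [Cp <-]]] [q [Hq [Cq <-]]]; exists (fun s => p s + q s); split; [|split].
  - generalize (filter_and _ _ Hp Hq); apply filter_imp; intros s [-> ->]; Cring.
  - apply cont_plus; auto.
  - auto.
Qed.

Lemma Cderiv_mult (f g : C -> C) (z a b : C) :
  Cderiv f z a -> Cderiv g z b -> Cderiv (fun s => f s * g s) z (a * g z + f z * b).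
Proof.
  intros Hf Hg; assert (Cg := Cderiv_cont _ _ _ Hg).
  destruct Hf as [p [Hp [Cp <-]]]; destruct Hg as [q [Hq [Cq <-]]].
  exists (fun s => p s * g s + f z * q s); split; [|split].
  - generalize (filter_and _ _ Hp Hq); apply filter_imp; intros s [H1 H2].
    rewrite H1 at 1; transitivity (f z * g s + (s - z) * p s * g s); [Cring|rewrite H2 at 1; Cring].
  - apply cont_plus; apply cont_mult; auto; apply cont_const.
  - auto.
Qed.

Lemma Cderiv_comp (f g : C -> C) (z a b : C) :
  Cderiv f (g z) a -> Cderiv g z b -> Cderiv (fun s => f (g s)) z (a * b).
Proof.
  intros Hf Hg; assert (Cg := Cderiv_cont _ _ _ Hg).
  destruct Hf as [p [Hp [Cp <-]]]; destruct Hg as [q [Hq [Cq <-]]].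
  exists (fun s => p (g s) * q s); split; [|split].
  - generalize (filter_and _ _ Hq (Cg _ Hp)); apply filter_imp; intros s [H1 H2].
    rewrite H2, H1 at 1; ring_simplify; rewrite H1; Cring.
  - apply cont_mult; auto; apply cont_comp; auto.
  - auto.
Qed.

Lemma Cderiv_inv (f : C -> C) (z a : C) : f z <> 0 -> Cderiv f z a -> Cderiv (fun s => / f s) z (- a / (f z * f z)).
Proof.
  intros Hz Hf; assert (Cf := Cderiv_cont _ _ _ Hf); destruct Hf as [p [Hp [Cp <-]]].
  exists (fun s => - p s / (f s * f z)); split; [|split; auto].
  - assert (Hn : @locally C_UniformSpace z (fun s => f s <> 0)).
    { apply (Cf (fun y : C => y <> 0)), locally_C_iff; exists (Cmod (f z)); split.
      - apply Cmod_gt_0; auto.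
      - intros y Hy E; subst; revert Hy; replace (0 - f z) with (- f z) by Cring; rewrite Cmod_opp; lra. }
    generalize (filter_and _ _ Hp Hn); apply filter_imp; intros s [H1 H2].
    replace (/ f s) with (/ f z - (f s - f z) / (f s * f z)) by (Cfield; auto).
    replace (f s - f z) with ((s - z) * p s) by (rewrite H1 at 1; ring); Cfield; auto.
  - apply cont_div; [apply Cmult_neq_0; auto|apply cont_opp; auto|].
    apply cont_mult; auto; apply cont_const.
Qed.

Lemma Cderiv_ext_loc f g z a :
  @locally C_UniformSpace z (fun s => f s = g s) -> Cderiv f z a -> Cderiv g z a.
Proof.
  intros H [p [Hp [Cp <-]]]; exists p; split; [|split; auto].
  rewrite <- (locally_singleton _ _ H).
  generalize (filter_and _ _ H Hp); apply filter_imp; intros s [<- <-]; auto.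
Qed.

Lemma Cderiv_ext f g z a : (forall s, f s = g s) -> Cderiv f z a -> Cderiv g z a.
Proof. intros H; apply Cderiv_ext_loc, filter_forall; auto. Qed.

Lemma Cderiv_eq f z a b : Cderiv f z a -> a = b -> Cderiv f z b.
Proof. intros H <-; auto. Qed.

Lemma Cderiv_affine (a b z : C) : Cderiv (fun s => a * s + b) z a.
Proof.
  eapply Cderiv_eq; [apply Cderiv_plus; [apply Cderiv_mult; [apply Cderiv_const|apply Cderiv_id]|
    apply Cderiv_const]|cbv beta; ring].
Qed.

(** The difference quotient, completed by the value [l] at [z], is the slope function required by
    [Cderiv]. *)
Lemma Cderiv_eps (f : C -> C) (z l : C) :
  (forall e, (0 < e)%R -> exists d, (0 < d)%R /\ forall h, (Cmod h < d)%R ->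
     (Cmod (f (z + h)%C - f z - h * l) <= e * Cmod h)%R) -> Cderiv f z l.
Proof.
  intros H.
  exists (fun s => if Ceq_dec s z then l else (f s - f z) / (s - z)); split; [|split].
  - apply filter_forall; intros s; cbv beta; destruct (Ceq_dec s z) as [->|Hn]; [Cring|].
    Cfield; intros E; apply Hn, Ceq_minus, E.
  - apply cont_eps; intros e He; destruct (H (e / 2)%R ltac:(lra)) as [d [Hd Hd']].
    exists d; split; auto; intros s Hs.
    destruct (Ceq_dec z z) as [_|[]]; auto; destruct (Ceq_dec s z) as [->|Hn].
    + replace (l - l) with (RtoC 0) by ring; rewrite Cmod_0; auto.
    + assert (Hn' : s - z <> 0) by (intros E; apply Hn, Ceq_minus, E).
      specialize (Hd' (s - z) Hs); replace (z + (s - z)) with s in Hd' by ring.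
      replace ((f s - f z) / (s - z) - l) with ((f s - f z - (s - z) * l) / (s - z)) by (field; auto).
      rewrite Cmod_div by auto; assert (P := proj1 (Cmod_gt_0 _) Hn').
      apply Rle_lt_trans with (e / 2)%R; [|lra].
      apply Rmult_le_reg_r with (Cmod (s - z)); auto; unfold Rdiv at 1.
      rewrite Rmult_assoc, Rinv_l by lra; lra.
  - destruct (Ceq_dec z z) as [_|[]]; auto.
Qed.

(** * Integrals of complex functions of a real variable *)

Definition is_derive_C (f : R -> C) (t : R) (l : C) : Prop :=
  @is_derive R_AbsRing C_R_NormedModule f t l.

Lemma is_derive_C_pair (f : R -> C) (t : R) (l : C) :
  is_derive (fun u => Re (f u)) t (Re l) -> is_derive (fun u => Im (f u)) t (Im l) ->
  is_derive_C f t l.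
Proof.
  intros [_ H1] [_ H2]; split.
  - apply is_linear_scal_l.
  - intros x Hx; specialize (H1 x Hx); specialize (H2 x Hx); intros e.
    assert (He : (0 < e / 2)%R) by (generalize (cond_pos e); lra).
    generalize (filter_and _ _ (H1 (mkposreal _ He)) (H2 (mkposreal _ He))).
    apply filter_imp; intros y [A B]; simpl in A, B.
    rewrite <- Cmod_norm.
    eapply Rle_trans; [apply Cmod_le_Re_Im|].
    unfold norm, minus, plus, opp, scal in *; simpl in *; unfold abs, mult, plus, opp in *; simpl in *.
    unfold Re, Im in *; simpl in *.
    unfold scal; simpl; unfold mult; simpl; lra.
Qed.

Lemma is_derive_C_Re (f : R -> C) t l : is_derive_C f t l -> is_derive (fun u => Re (f u)) t (Re l).
Proof.
  intros [_ H1]; split; [apply is_linear_scal_l|].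
  intros x Hx; specialize (H1 x Hx); intros e; generalize (H1 e); apply filter_imp; intros y A.
  eapply Rle_trans; [|exact A]; rewrite <- Cmod_norm.
  eapply Rle_trans; [|apply re_le_Cmod]; right; reflexivity.
Qed.

Lemma is_derive_C_Im (f : R -> C) t l : is_derive_C f t l -> is_derive (fun u => Im (f u)) t (Im l).
Proof.
  intros [_ H1]; split; [apply is_linear_scal_l|].
  intros x Hx; specialize (H1 x Hx); intros e; generalize (H1 e); apply filter_imp; intros y A.
  eapply Rle_trans; [|exact A]; rewrite <- Cmod_norm.
  eapply Rle_trans; [|apply im_le_Cmod]; right; reflexivity.
Qed.

Lemma is_derive_C_cont (f : R -> C) t l : is_derive_C f t l -> cont_C f t.
Proof.
  intros H; apply (ex_derive_continuous (K := R_AbsRing) (V := C_R_NormedModule)); exists l; exact H.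
Qed.

(** Chain rule along a curve, by multiplying slopes: if g u - g t = (u - t) q(u), then the increment
    of the composite is (u - t) phi(g u) q(u), and this product of slopes is continuous at [t]. *)
Lemma is_derive_C_comp (f : C -> C) (g : R -> C) t a b :
  Cderiv f (g t) a -> is_derive_C g t b -> is_derive_C (fun u => f (g u)) t (a * b).
Proof.
  intros [phi [Hphi [Cphi <-]]] Hg; assert (Cg := is_derive_C_cont _ _ _ Hg).
  (* The slope of [g] at [t], filled in by the derivative; its continuity at [t] is the
     differentiability of [g]. *)
  set (q := fun u => if Req_dec_T u t then b else (g u - g t) / RtoC (u - t)).
  assert (Hq : cont_C q t /\ forall u, g u = g t + RtoC (u - t) * q u).
  { split.
    - unfold cont_C, continuous; apply filterlim_C; [apply locally_filter|]; intros e He.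
      destruct Hg as [_ Hg]; specialize (Hg t (fun P H => H)).
      assert (He2 : (0 < e / 2)%R) by lra.
      generalize (Hg (mkposreal _ He2)); apply filter_imp; intros u Hu; unfold q.
      destruct (Req_dec_T t t) as [_|[]]; auto.
      destruct (Req_dec_T u t) as [->|Hn].
      { replace (b - b) with (RtoC 0) by ring; rewrite Cmod_0; auto. }
      rewrite <- Cmod_norm in Hu.
      assert (Hu' : (Cmod (g u - g t - RtoC (u - t) * b) <= e / 2 * Rabs (u - t))%R).
      { rewrite <- scal_R_Cmult; exact Hu. }
      assert (Hn' : RtoC (u - t) <> 0) by (intros E; apply RtoC_inj in E; lra).
      replace ((g u - g t) / RtoC (u - t) - b) with ((g u - g t - RtoC (u - t) * b) / RtoC (u - t))
        by (field; auto).
      rewrite Cmod_div by auto; rewrite Cmod_R.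
      assert (P : (0 < Rabs (u - t))%R) by (apply Rabs_pos_lt; lra).
      apply Rle_lt_trans with (e / 2)%R; [|lra].
      apply Rmult_le_reg_r with (Rabs (u - t)); auto; unfold Rdiv at 1.
      rewrite Rmult_assoc, Rinv_l by lra; lra.
    - intros u; unfold q; destruct (Req_dec_T u t) as [->|Hn].
      + replace (t - t)%R with 0%R by ring; ring.
      + field; intros E; apply RtoC_inj in E; lra. }
  destruct Hq as [Cq Hq].
  assert (Eq : q t = b) by (unfold q; destruct (Req_dec_T t t) as [_|[]]; auto).
  assert (Cc : cont_C (fun u => phi (g u) * q u) t) by (apply cont_mult; auto; apply cont_comp; auto).
  split; [apply is_linear_scal_l|].
  intros x Hx e.
  assert (x = t) by (symmetry; apply (is_filter_lim_locally_unique (K := R_AbsRing) (V := R_NormedModule)), Hx).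
  subst x.
  unfold cont_C, continuous in Cc; rewrite filterlim_C in Cc by apply locally_filter.
  assert (Hg1 : locally t (fun u => f (g u) = f (g t) + (g u - g t) * phi (g u))) by exact (Cg _ Hphi).
  generalize (filter_and _ _ Hg1 (Cc e (cond_pos e))); apply filter_imp; intros u [H1 H2].
  rewrite <- Cmod_norm.
  assert (HH : (Cmod (f (g u) - f (g t) - RtoC (u - t) * (phi (g t) * b)) <= e * Rabs (u - t))%R).
  { replace (f (g u) - f (g t) - RtoC (u - t) * (phi (g t) * b))
      with (RtoC (u - t) * (phi (g u) * q u - phi (g t) * q t)).
    - rewrite Cmod_mult, Cmod_R, Rmult_comm.
      apply Rmult_le_compat_r; [apply Rabs_pos|apply Rlt_le, H2].
    - rewrite H1, Eq.
      replace (g u - g t) with (RtoC (u - t) * q u) by (rewrite (Hq u); ring); ring. }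
  rewrite <- scal_R_Cmult in HH; exact HH.
Qed.

Lemma is_derive_C_mult (f g : R -> C) (t : R) (a b : C) :
  is_derive_C f t a -> is_derive_C g t b -> is_derive_C (fun u => f u * g u) t (a * g t + f t * b).
Proof.
  intros Hf Hg.
  assert (F1 := is_derive_C_Re _ _ _ Hf); assert (F2 := is_derive_C_Im _ _ _ Hf).
  assert (G1 := is_derive_C_Re _ _ _ Hg); assert (G2 := is_derive_C_Im _ _ _ Hg).
  apply is_derive_C_pair.
  - replace (Re (a * g t + f t * b)) with ((Re a * Re (g t) + Re (f t) * Re b) - (Im a * Im (g t) + Im (f t) * Im b))%R
      by (unfold Re, Im; simpl; ring).
    apply (is_derive_minus (K := R_AbsRing) (V := R_NormedModule) (fun u => Re (f u) * Re (g u))%R (fun u => Im (f u) * Im (g u))%R);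
      apply Derive.is_derive_mult; auto.
  - replace (Im (a * g t + f t * b)) with ((Re a * Im (g t) + Re (f t) * Im b) + (Im a * Re (g t) + Im (f t) * Re b))%R
      by (unfold Re, Im; simpl; ring).
    apply (is_derive_plus (K := R_AbsRing) (V := R_NormedModule) (fun u => Re (f u) * Im (g u))%R (fun u => Im (f u) * Re (g u))%R);
      apply Derive.is_derive_mult; auto.
Qed.

(** A total function: it always has a value, which carries information only when [is_CInt] holds. *)
Definition CInt (f : R -> C) (a b : R) : C :=
  (RInt (fun t => Re (f t)) a b, RInt (fun t => Im (f t)) a b).

Definition is_CInt (f : R -> C) (a b : R) (l : C) : Prop := @is_RInt C_R_NormedModule f a b l.

Lemma is_CInt_iff f a b l :
  is_CInt f a b l <->
  is_RInt (fun t => Re (f t)) a b (Re l) /\ is_RInt (fun t => Im (f t)) a b (Im l).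
Proof.
  split.
  - intros H; split; [apply (is_RInt_fct_extend_fst (U := R_NormedModule) (V := R_NormedModule) _ _ _ _ H)|
      apply (is_RInt_fct_extend_snd (U := R_NormedModule) (V := R_NormedModule) _ _ _ _ H)].
  - intros [H1 H2]; destruct l as [l1 l2].
    apply (is_RInt_fct_extend_pair (U := R_NormedModule) (V := R_NormedModule) f a b l1 l2 H1 H2).
Qed.

Lemma is_CInt_unique f a b l : is_CInt f a b l -> CInt f a b = l.
Proof.
  intros H; apply is_CInt_iff in H; destruct H as [H1 H2]; unfold CInt.
  rewrite (is_RInt_unique _ _ _ _ H1), (is_RInt_unique _ _ _ _ H2); destruct l; auto.
Qed.

Lemma CInt_correct f a b :
  (forall t, (Rmin a b <= t <= Rmax a b)%R -> cont_C f t) -> is_CInt f a b (CInt f a b).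
Proof.
  intros H; apply is_CInt_iff; split; apply (RInt_correct (V := R_CompleteNormedModule));
  apply (ex_RInt_continuous (V := R_CompleteNormedModule)); intros t Ht.
  - apply cont_Re, H, Ht.
  - apply cont_Im, H, Ht.
Qed.

Lemma is_CInt_derive (f df : R -> C) a b :
  (forall t, (Rmin a b <= t <= Rmax a b)%R -> is_derive_C f t (df t)) ->
  (forall t, (Rmin a b <= t <= Rmax a b)%R -> cont_C df t) ->
  is_CInt df a b (f b - f a).
Proof.
  intros H1 H2; apply is_CInt_iff; split.
  - apply (is_RInt_derive (V := R_CompleteNormedModule) (fun t => Re (f t))); intros t Ht.
    + apply is_derive_C_Re, H1, Ht.
    + apply cont_Re, H2, Ht.
  - apply (is_RInt_derive (V := R_CompleteNormedModule) (fun t => Im (f t))); intros t Ht.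
    + apply is_derive_C_Im, H1, Ht.
    + apply cont_Im, H2, Ht.
Qed.

Lemma is_CInt_ext f g a b l :
  (forall t, (Rmin a b < t < Rmax a b)%R -> f t = g t) -> is_CInt f a b l -> is_CInt g a b l.
Proof. apply (is_RInt_ext (V := C_R_NormedModule)). Qed.

Lemma is_CInt_plus (f g : R -> C) (a b : R) (l m : C) :
  is_CInt f a b l -> is_CInt g a b m -> is_CInt (fun t => f t + g t) a b (l + m).
Proof. apply (is_RInt_plus (V := C_R_NormedModule)). Qed.

Lemma is_CInt_minus (f g : R -> C) (a b : R) (l m : C) :
  is_CInt f a b l -> is_CInt g a b m -> is_CInt (fun t => f t - g t) a b (l - m).
Proof. apply (is_RInt_minus (V := C_R_NormedModule)). Qed.

Lemma is_CInt_scal (f : R -> C) (a b : R) (l c : C) : is_CInt f a b l -> is_CInt (fun t => c * f t) a b (c * l).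
Proof.
  rewrite !is_CInt_iff; intros [H1 H2]; split.
  - apply (is_RInt_minus (V := R_NormedModule) (fun t => Re c * Re (f t))%R (fun t => Im c * Im (f t))%R);
      apply (is_RInt_scal (V := R_NormedModule)); auto.
  - apply (is_RInt_plus (V := R_NormedModule) (fun t => Re c * Im (f t))%R (fun t => Im c * Re (f t))%R);
      apply (is_RInt_scal (V := R_NormedModule)); auto.
Qed.

Lemma is_CInt_Chasles (f : R -> C) (a b c : R) (l m : C) :
  is_CInt f a b l -> is_CInt f b c m -> is_CInt f a c (l + m).
Proof. apply (is_RInt_Chasles (V := C_R_NormedModule)). Qed.

Lemma is_CInt_bound (f : R -> C) (a b : R) (l : C) (M : R) :
  (a <= b)%R -> (forall t, (a <= t <= b)%R -> (Cmod (f t) <= M)%R) -> is_CInt f a b l ->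
  (Cmod l <= (b - a) * M)%R.
Proof.
  intros Hab H Hl; rewrite Cmod_norm.
  apply (norm_RInt_le_const (V := C_R_NormedModule) f a b l M Hab); auto.
  intros t Ht; rewrite <- Cmod_norm; auto.
Qed.

Lemma is_CInt_bound_fun (f : R -> C) (g : R -> R) (a b : R) (l : C) (lg : R) :
  (a <= b)%R -> (forall t, (a <= t <= b)%R -> (Cmod (f t) <= g t)%R) -> is_CInt f a b l ->
  is_RInt g a b lg -> (Cmod l <= lg)%R.
Proof.
  intros Hab H Hl Hg; rewrite Cmod_norm.
  apply (norm_RInt_le (V := C_R_NormedModule) f g a b l lg Hab); auto.
  intros t Ht; rewrite <- Cmod_norm; auto.
Qed.

Lemma is_CInt_const (a b : R) (c : C) : is_CInt (fun _ => c) a b (RtoC (b - a) * c).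
Proof.
  rewrite <- scal_R_Cmult; apply (is_RInt_const (V := C_R_NormedModule)).
Qed.

Lemma is_derive_C_RtoC (f : R -> R) (t l : R) : is_derive f t l -> is_derive_C (fun u => RtoC (f u)) t (RtoC l).
Proof.
  intros H; apply is_derive_C_pair; simpl; [exact H|].
  apply (is_derive_ext (fun _ => 0%R)); [reflexivity|apply (is_derive_const (K := R_AbsRing) (V := R_NormedModule))].
Qed.

Lemma is_derive_C_eq (f : R -> C) (t : R) (a b : C) : is_derive_C f t a -> a = b -> is_derive_C f t b.
Proof. intros H <-; auto. Qed.

(** * Integrals along segments *)

Definition seg (a b : C) (t : R) : C := a + RtoC t * (b - a).

Lemma seg_0 a b : seg a b 0 = a.
Proof. unfold seg; ring. Qed.
Lemma seg_1 a b : seg a b 1 = b.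
Proof. unfold seg; ring. Qed.

Lemma seg_derive a b t : is_derive_C (seg a b) t (b - a).
Proof.
  unfold seg.
  assert (H := is_derive_C_comp (fun s => (b - a) * s + a) (fun u => RtoC u) t (b - a) 1
    (Cderiv_affine _ _ _) (is_derive_C_RtoC (fun u => u) t 1 (is_derive_id _))).
  apply (@is_derive_ext R_AbsRing C_R_NormedModule) with (f := fun u => (b - a) * RtoC u + a);
    [intros u; Cring|exact (is_derive_C_eq _ _ _ _ H (Cmult_1_r _))].
Qed.

Lemma seg_cont a b t : cont_C (seg a b) t.
Proof. eapply is_derive_C_cont, seg_derive. Qed.

Lemma ftc_seg (f f' : C -> C) (a b : C) :
  (forall t, (0 <= t <= 1)%R -> Cderiv f (seg a b t) (f' (seg a b t))) ->
  (forall t, (0 <= t <= 1)%R -> cont_C f' (seg a b t)) ->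
  is_CInt (fun t => (b - a) * f' (seg a b t)) 0 1 (f b - f a).
Proof.
  intros H1 H2.
  replace (f b - f a) with (f (seg a b 1) - f (seg a b 0)) by (rewrite seg_0, seg_1; auto).
  apply (is_CInt_derive (fun t => f (seg a b t))); rewrite Rmin_left, Rmax_right by lra; intros t Ht.
  - eapply is_derive_C_eq; [apply is_derive_C_comp; [apply H1, Ht|apply seg_derive]|ring].
  - apply cont_mult; [apply cont_const|]; apply (cont_comp f' (seg a b)); [apply seg_cont|apply H2, Ht].
Qed.

(** The left-hand side is the modulus of the integral of (b - a) (f' - l) along the segment. It
    stands in for the mean value theorem, which fails for complex values. *)
Lemma mean_value_seg (f f' : C -> C) (a b l : C) (M : R) :
  (forall t, (0 <= t <= 1)%R -> Cderiv f (seg a b t) (f' (seg a b t))) ->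
  (forall t, (0 <= t <= 1)%R -> cont_C f' (seg a b t)) ->
  (forall t, (0 <= t <= 1)%R -> (Cmod (f' (seg a b t) - l) <= M)%R) ->
  (Cmod (f b - f a - (b - a) * l) <= Cmod (b - a) * M)%R.
Proof.
  intros H1 H2 H3.
  assert (H := ftc_seg f f' a b H1 H2).
  assert (Hc : is_CInt (fun _ => (b - a) * l) 0 1 ((b - a) * l)).
  { generalize (is_CInt_const 0 1 ((b - a) * l)); rewrite Rminus_0_r, Cmult_1_l; auto. }
  assert (HH := is_CInt_minus _ _ _ _ _ _ H Hc).
  replace (Cmod (b - a) * M)%R with ((1 - 0) * (Cmod (b - a) * M))%R by ring.
  eapply is_CInt_bound; [lra| |exact HH]; intros t Ht; cbv beta.
  replace ((b - a) * f' (seg a b t) - (b - a) * l) with ((b - a) * (f' (seg a b t) - l)) by ring.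
  rewrite Cmod_mult; apply Rmult_le_compat_l; [apply Cmod_ge_0|apply H3, Ht].
Qed.

(** Uniform continuity on a neighbourhood of a compact segment, although [f] is only known to be
    continuous at the points of the segment. It allows differentiation under the integral sign. *)
Lemma uniform_tube (f : C -> C) (a b : C) :
  (forall t, (0 <= t <= 1)%R -> cont_C f (seg a b t)) ->
  forall e, (0 < e)%R -> exists d, (0 < d)%R /\
    forall t h, (0 <= t <= 1)%R -> (Cmod h < d)%R ->
      (Cmod (f (seg a b t + h)%C - f (seg a b t)) < e)%R.
Proof.
  intros Hf e He.
  assert (H : forall t, exists d : posreal, (0 <= t <= 1)%R ->
    forall s, (Cmod (s - seg a b t) < d)%R -> (Cmod (f s - f (seg a b t)) < e / 2)%R).
  { intros t; destruct (Rle_dec 0 t) as [h0|h0]; [destruct (Rle_dec t 1) as [h1|h1]|].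
    - destruct (proj1 (cont_eps _ _) (Hf t (conj h0 h1)) (e / 2)%R ltac:(lra)) as [d [Hd Hd']].
      exists (mkposreal d Hd); intros _; exact Hd'.
    - exists (mkposreal 1 Rlt_0_1); intros; lra.
    - exists (mkposreal 1 Rlt_0_1); intros; lra. }
  set (K := (Cmod (b - a) + 1)%R).
  assert (HK : (0 < K)%R) by (unfold K; generalize (Cmod_ge_0 (b - a)); lra).
  (* A change of the parameter by [dl t] moves the point by at most [dl t * K], half of the allowed
     distance; the other half is left for the perturbation [h]. *)
  set (dl := fun t => let d := proj1_sig (constructive_indefinite_description _ (H t)) in
    mkposreal (d / (2 * K))%R ltac:(apply Rdiv_lt_0_compat; [apply cond_pos|lra])).
  assert (Hdl : forall t, (0 <= t <= 1)%R -> forall s,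
     (Cmod (s - seg a b t) < dl t * (2 * K))%R -> (Cmod (f s - f (seg a b t)) < e / 2)%R).
  { intros t Ht s; unfold dl; destruct constructive_indefinite_description as [d Hd]; simpl.
    intros Hs; apply Hd; auto; revert Hs; unfold Rdiv; rewrite Rmult_assoc, Rinv_l by lra; lra. }
  destruct (Compactness.compactness_value_1d 0 1 dl) as [d Hd].
  exists (d * K)%R; split; [apply Rmult_lt_0_compat; [apply cond_pos|auto]|].
  intros t h Ht Hh.
  (* Compactness yields the covering point under a double negation only, which is eliminated because
     the goal is decidable. *)
  destruct (Rlt_dec (Cmod (f (seg a b t + h) - f (seg a b t))) e) as [|Hn]; [auto|exfalso].
  apply (Hd t Ht); intros [u [Hu [Htu Hdu]]]; apply Hn.
  assert (Hclose : (Cmod (seg a b t - seg a b u) <= dl u * K)%R).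
  { replace (seg a b t - seg a b u) with (RtoC (t - u) * (b - a)) by (unfold seg; rewrite RtoC_minus; ring).
    rewrite Cmod_mult, Cmod_R; apply Rmult_le_compat; [apply Rabs_pos|apply Cmod_ge_0|lra|unfold K; lra]. }
  assert (Pd := cond_pos (dl u)).
  assert (P1 : (d * K <= dl u * K)%R) by (apply Rmult_le_compat_r; lra).
  assert (PK : (0 < dl u * K)%R) by (apply Rmult_lt_0_compat; auto).
  replace (f (seg a b t + h) - f (seg a b t))
    with ((f (seg a b t + h) - f (seg a b u)) - (f (seg a b t) - f (seg a b u))) by ring.
  eapply Rle_lt_trans; [apply Cmod_triangle_sub|].
  assert (A1 : (Cmod (f (seg a b t + h)%C - f (seg a b u)) < e / 2)%R).
  { apply Hdl; auto.
    replace (seg a b t + h - seg a b u) with ((seg a b t - seg a b u) + h) by ring.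
    eapply Rle_lt_trans; [apply Cmod_triangle|]; lra. }
  assert (A2 : (Cmod (f (seg a b t) - f (seg a b u)) < e / 2)%R) by (apply Hdl; auto; lra).
  lra.
Qed.

(** * Complex exponential *)

Lemma Cexp_plus a b : Cexp (a + b) = Cexp a * Cexp b.
Proof.
  destruct a as [a1 a2], b as [b1 b2]; unfold Cexp, Cplus, Cmult, RtoC, Re, Im; simpl.
  rewrite exp_plus, cos_plus, sin_plus; f_equal; ring.
Qed.

Lemma Cexp_0 : Cexp 0 = 1.
Proof. unfold Cexp, Cmult, RtoC, Re, Im; simpl; rewrite exp_0, cos_0, sin_0; f_equal; ring. Qed.

Lemma Cexp_neq_0 a : Cexp a <> 0.
Proof.
  intros H; assert (E : Cexp (a + - a) = 0) by (rewrite Cexp_plus, H; ring).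
  replace (a + - a) with (RtoC 0) in E by ring; rewrite Cexp_0 in E; apply RtoC_inj in E; lra.
Qed.

Lemma Cexp_opp a : Cexp (- a) = / Cexp a.
Proof.
  assert (E : Cexp a * Cexp (- a) = 1).
  { rewrite <- Cexp_plus; replace (a + - a) with (RtoC 0) by ring; apply Cexp_0. }
  assert (Ha := Cexp_neq_0 a).
  transitivity (/ Cexp a * (Cexp a * Cexp (- a))); [field; auto|rewrite E; ring].
Qed.

Lemma Cexp_minus a b : Cexp (a - b) = Cexp a / Cexp b.
Proof. unfold Cminus; rewrite Cexp_plus, Cexp_opp; auto. Qed.

Lemma Cexp_RtoC x : Cexp (RtoC x) = RtoC (exp x).
Proof. unfold Cexp, Cmult, RtoC, Re, Im; simpl; rewrite cos_0, sin_0; f_equal; ring. Qed.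

Lemma Cmod_Cexp a : Cmod (Cexp a) = exp (Re a).
Proof.
  unfold Cexp; rewrite Cmod_mult, Cmod_R, Rabs_pos_eq by (apply Rlt_le, exp_pos).
  unfold Cmod; simpl; replace (cos (Im a) * (cos (Im a) * 1) + sin (Im a) * (sin (Im a) * 1))%R with 1%R.
  - rewrite sqrt_1; ring.
  - generalize (sin2_cos2 (Im a)); unfold Rsqr; lra.
Qed.

Lemma cont_Cexp z : cont_C Cexp z.
Proof.
  unfold Cexp; apply cont_mult; [apply cont_RtoC|apply cont_pair].
  - apply (continuous_comp Re exp); [apply continuous_fst|].
    apply continuity_pt_filterlim, derivable_continuous_pt, derivable_pt_exp.
  - apply (continuous_comp Im cos); [apply continuous_snd|].
    apply continuity_pt_filterlim, continuity_cos.
  - apply (continuous_comp Im sin); [apply continuous_snd|].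
    apply continuity_pt_filterlim, continuity_sin.
Qed.

Lemma is_derive_C_Cexp_lin h t : is_derive_C (fun u => Cexp (RtoC u * h)) t (h * Cexp (RtoC t * h)).
Proof.
  destruct h as [x y]; apply is_derive_C_pair; unfold Cexp, Cmult, RtoC, Re, Im; simpl;
  auto_derive; auto; unfold Rminus; ring.
Qed.

(** At 0, e^h - 1 - h is the integral over [0, 1] of h (e^(th) - 1), which is o(h) by continuity;
    the functional equation moves this to [z]. *)
Lemma Cderiv_Cexp z : Cderiv Cexp z (Cexp z).
Proof.
  apply Cderiv_eps; intros e He.
  assert (Pz := proj1 (Cmod_gt_0 _) (Cexp_neq_0 z)).
  destruct (proj1 (cont_eps _ _) (cont_Cexp (RtoC 0)) (e / Cmod (Cexp z))%R) as [d [Hd H]].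
  { apply Rdiv_lt_0_compat; auto. }
  exists d; split; auto; intros h Hh.
  assert (HI : is_CInt (fun t => h * (Cexp (RtoC t * h) - 1)) 0 1 (Cexp h - 1 - h)).
  { replace (Cexp h - 1 - h) with ((Cexp (RtoC 1 * h) - RtoC 1 * h) - (Cexp (RtoC 0 * h) - RtoC 0 * h)).
    2:{ replace (RtoC 0 * h) with (RtoC 0) by ring; rewrite Cexp_0; replace (RtoC 1 * h) with h by ring; ring. }
    apply (is_CInt_derive (fun t => Cexp (RtoC t * h) - RtoC t * h)); intros t _.
    - apply (@is_derive_ext R_AbsRing C_R_NormedModule)
        with (f := fun u => minus (Cexp (RtoC u * h)) (seg 0 h u)).
      { intros u; unfold seg; match goal with |- @eq _ ?a ?b => change (@eq C (Cexp (RtoC u * h) - (0 + RtoC u * (h - 0))) b) end; ring. }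
      replace (h * (Cexp (RtoC t * h) - 1)) with (h * Cexp (RtoC t * h) - (h - 0)) by ring.
      apply (@is_derive_minus R_AbsRing C_R_NormedModule); [apply is_derive_C_Cexp_lin|apply seg_derive].
    - apply cont_mult; [apply cont_const|apply cont_minus; [|apply cont_const]].
      eapply is_derive_C_cont, is_derive_C_Cexp_lin. }
  replace (Cexp (z + h) - Cexp z - h * Cexp z) with (Cexp z * (Cexp h - 1 - h)) by (rewrite Cexp_plus; ring).
  rewrite Cmod_mult.
  assert (HB : (Cmod (Cexp h - 1 - h) <= (1 - 0) * (Cmod h * (e / Cmod (Cexp z))))%R).
  { eapply is_CInt_bound; [lra| |exact HI]; intros t Ht; cbv beta; rewrite Cmod_mult.
    apply Rmult_le_compat_l; [apply Cmod_ge_0|]; apply Rlt_le; rewrite <- Cexp_0; apply H.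
    replace (RtoC t * h - 0) with (RtoC t * h) by ring; rewrite Cmod_mult, Cmod_R, Rabs_pos_eq by lra.
    eapply Rle_lt_trans; [|exact Hh]; rewrite <- (Rmult_1_l (Cmod h)) at 2.
    apply Rmult_le_compat_r; [apply Cmod_ge_0|lra]. }
  apply Rle_trans with (Cmod (Cexp z) * ((1 - 0) * (Cmod h * (e / Cmod (Cexp z)))))%R.
  - apply Rmult_le_compat_l; lra.
  - right; field; lra.
Qed.

(** * Infinitely differentiable functions on a domain *)

Definition open_C (U : C -> Prop) : Prop := forall z, U z -> @locally C_UniformSpace z U.
Definition convex_C (U : C -> Prop) : Prop :=
  forall a b t, U a -> U b -> (0 <= t <= 1)%R -> U (seg a b t).

(** Coinductive formulation: [f] belongs to a family closed under derivation. *)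
Definition smooth (U : C -> Prop) (f : C -> C) : Prop :=
  exists Fam : (C -> C) -> Prop, Fam f /\
    forall g, Fam g -> exists g', Fam g' /\ forall z, U z -> Cderiv g z (g' z).

Lemma smooth_deriv U f : smooth U f -> exists f', smooth U f' /\ forall z, U z -> Cderiv f z (f' z).
Proof.
  intros [Fam [Hf HF]]; destruct (HF f Hf) as [f' [Hf' H]]; exists f'; split; auto.
  exists Fam; auto.
Qed.

Lemma smooth_cont U f z : smooth U f -> U z -> cont_C f z.
Proof. intros H Hz; destruct (smooth_deriv _ _ H) as [f' [_ Hf]]; eapply Cderiv_cont, Hf, Hz. Qed.

(** The algebra generated by the smooth functions under the usual operations. It is closed under
    derivation, so it is itself the family that witnesses the smoothness of all its members; every
    closure property follows at once. *)
Inductive smooth_alg (U : C -> Prop) : (C -> C) -> Prop :=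
| sa_base f : smooth U f -> smooth_alg U f
| sa_const a : smooth_alg U (fun _ => a)
| sa_id : smooth_alg U (fun s => s)
| sa_plus (f g : C -> C) : smooth_alg U f -> smooth_alg U g -> smooth_alg U (fun s => f s + g s)
| sa_mult (f g : C -> C) : smooth_alg U f -> smooth_alg U g -> smooth_alg U (fun s => f s * g s)
| sa_inv (f : C -> C) : (forall z, U z -> f z <> 0) -> smooth_alg U f -> smooth_alg U (fun s => / f s)
| sa_exp f : smooth_alg U f -> smooth_alg U (fun s => Cexp (f s)).

Lemma smooth_alg_smooth U f : smooth_alg U f -> smooth U f.
Proof.
  intros Hf; exists (smooth_alg U); split; auto; clear f Hf.
  intros f Hf; induction Hf.
  - destruct (smooth_deriv _ _ H) as [f' [S D]]; exists f'; split; auto; apply sa_base; auto.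
  - exists (fun _ => RtoC 0); split; [apply sa_const|intros; apply Cderiv_const].
  - exists (fun _ => RtoC 1); split; [apply sa_const|intros; apply Cderiv_id].
  - destruct IHHf1 as [f' [Sf Df]]; destruct IHHf2 as [g' [Sg Dg]].
    exists (fun s => f' s + g' s); split; [apply sa_plus; auto|intros; apply Cderiv_plus; auto].
  - destruct IHHf1 as [f' [Sf Df]]; destruct IHHf2 as [g' [Sg Dg]].
    exists (fun s => f' s * g s + f s * g' s); split; [|intros; apply Cderiv_mult; auto].
    apply sa_plus; apply sa_mult; auto.
  - destruct IHHf as [f' [Sf Df]].
    exists (fun s => RtoC (-1) * f' s * (/ f s * / f s)); split.
    + apply sa_mult; [apply sa_mult; [apply sa_const|auto]|apply sa_mult; apply sa_inv; auto].
    + intros z Hz; eapply Cderiv_eq; [apply (Cderiv_inv f z (f' z)); auto|].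
      cbv beta; field; auto.
  - destruct IHHf as [f' [Sf Df]].
    exists (fun s => Cexp (f s) * f' s); split; [apply sa_mult; auto; apply sa_exp; auto|].
    intros z Hz; apply (Cderiv_comp Cexp f); auto; apply Cderiv_Cexp.
Qed.

Lemma smooth_const U a : smooth U (fun _ => a).
Proof. apply smooth_alg_smooth, sa_const. Qed.
Lemma smooth_id U : smooth U (fun s => s).
Proof. apply smooth_alg_smooth, sa_id. Qed.
Lemma smooth_plus U f g : smooth U f -> smooth U g -> smooth U (fun s => f s + g s).
Proof. intros; apply smooth_alg_smooth, sa_plus; apply sa_base; auto. Qed.
Lemma smooth_mult U f g : smooth U f -> smooth U g -> smooth U (fun s => f s * g s).
Proof. intros; apply smooth_alg_smooth, sa_mult; apply sa_base; auto. Qed.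
Lemma smooth_inv U (f : C -> C) : (forall z, U z -> f z <> 0) -> smooth U f -> smooth U (fun s => / f s).
Proof. intros; apply smooth_alg_smooth, sa_inv; auto; apply sa_base; auto. Qed.
Lemma smooth_exp U f : smooth U f -> smooth U (fun s => Cexp (f s)).
Proof. intros; apply smooth_alg_smooth, sa_exp; apply sa_base; auto. Qed.

Lemma smooth_ext (U : C -> Prop) (f g : C -> C) :
  open_C U -> (forall z, U z -> f z = g z) -> smooth U f -> smooth U g.
Proof.
  intros HU H Hf; exists (fun g => exists f, smooth U f /\ forall z, U z -> f z = g z); split; [eauto|].
  clear f g H Hf; intros g [f [Hf H]]; destruct (smooth_deriv _ _ Hf) as [f' [S D]].
  exists f'; split; [exists f'; auto|]; intros z Hz.
  apply (Cderiv_ext_loc f); auto; generalize (HU z Hz); apply filter_imp; auto.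
Qed.

Lemma smooth_prod {A : Type} (U : C -> Prop) (l : list A) (f : A -> C -> C) :
  (forall a, In a l -> smooth U (f a)) -> smooth U (fun s => Cprod (map (fun a => f a s) l)).
Proof.
  induction l as [|a l IH]; intros H; simpl; [apply smooth_const|].
  apply smooth_mult; [apply H; left; auto|apply IH; intros b Hb; apply H; right; auto].
Qed.

Lemma smooth_affine (U V : C -> Prop) (f : C -> C) (a b : C) :
  smooth V f -> (forall z, U z -> V (a * z + b)) -> smooth U (fun s => f (a * s + b)).
Proof.
  intros Hf HUV; exists (fun h => exists g, smooth V g /\ h = (fun s => g (a * s + b))); split; [eauto|].
  clear f Hf; intros h [g [Hg ->]]; destruct (smooth_deriv _ _ Hg) as [g' [S D]].
  exists (fun s => g' (a * s + b) * a); split.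
  - exists (fun s => g' s * a); split; auto; apply smooth_mult; auto; apply smooth_const.
  - intros z Hz; apply (Cderiv_comp g (fun s => a * s + b)); [apply D, HUV, Hz|apply Cderiv_affine].
Qed.

(** For j = 0 this is the integral of Hadamard's lemma. The weights t^j occur because each
    derivative in [s] brings out one factor t from the inner point p + t (s - p). *)
Definition seg_moment (j : nat) (f : C -> C) (p s : C) : C :=
  CInt (fun t => RtoC t ^ j * f (seg p s t)) 0 1.

Lemma seg_moment_correct U j f p s : convex_C U -> smooth U f -> U p -> U s ->
  is_CInt (fun t => RtoC t ^ j * f (seg p s t)) 0 1 (seg_moment j f p s).
Proof.
  intros HU Hf Hp Hs; apply CInt_correct; rewrite Rmin_left, Rmax_right by lra; intros t Ht.
  apply cont_mult; [apply cont_pow, cont_RtoC, continuous_id|].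
  apply (cont_comp f (seg p s)); [apply seg_cont|].
  apply (smooth_cont U); auto.
Qed.

(** Differentiation under the integral sign. The increment of [f] between the two segments is
    linearised by [mean_value_seg], with an error uniform in t thanks to [uniform_tube]. *)
Lemma seg_moment_deriv U j f f' p s : open_C U -> convex_C U -> smooth U f -> smooth U f' ->
  (forall z, U z -> Cderiv f z (f' z)) -> U p -> U s ->
  Cderiv (seg_moment j f p) s (seg_moment (S j) f' p s).
Proof.
  intros HO HU Sf Sf' D Hp Hs; apply Cderiv_eps; intros e He.
  destruct (uniform_tube f' p s) with (e := e) as [d1 [Hd1 Ht]]; auto.
  { intros t Ht; apply (smooth_cont U); auto. }
  destruct (proj1 (locally_C_iff _ _) (HO s Hs)) as [d2 [Hd2 Hb]].
  exists (Rmin d1 d2); split; [apply Rmin_case; auto|]; intros h Hh.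
  assert (Hh1 : (Cmod h < d1)%R) by (eapply Rlt_le_trans; [exact Hh|apply Rmin_l]).
  assert (Hh2 : (Cmod h < d2)%R) by (eapply Rlt_le_trans; [exact Hh|apply Rmin_r]).
  assert (Hsh : U (s + h)) by (apply Hb; replace (s + h - s) with h by ring; auto).
  assert (I := is_CInt_minus _ _ _ _ _ _
    (is_CInt_minus _ _ _ _ _ _ (seg_moment_correct U j f p _ HU Sf Hp Hsh) (seg_moment_correct U j f p _ HU Sf Hp Hs))
    (is_CInt_scal _ _ _ _ h (seg_moment_correct U (S j) f' p _ HU Sf' Hp Hs))).
  replace (e * Cmod h)%R with ((1 - 0) * (e * Cmod h))%R by ring.
  eapply is_CInt_bound; [lra| |exact I]; intros t Htt; cbv beta.
  replace (RtoC t ^ j * f (seg p (s + h) t) - RtoC t ^ j * f (seg p s t) - h * (RtoC t ^ S j * f' (seg p s t)))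
    with (RtoC t ^ j * (f (seg p (s + h) t) - f (seg p s t) - (seg p (s + h) t - seg p s t) * f' (seg p s t))).
  2:{ unfold seg at 3 4; simpl; ring. }
  rewrite Cmod_mult, Cmod_pow, Cmod_R, Rabs_pos_eq by lra.
  assert (E : seg p (s + h) t - seg p s t = RtoC t * h) by (unfold seg; ring).
  assert (Hth : forall u, (0 <= u <= 1)%R -> (Cmod (RtoC u * (RtoC t * h)) <= Cmod h)%R).
  { intros u Hu; rewrite !Cmod_mult, !Cmod_R, !Rabs_pos_eq by lra.
    assert (P := Cmod_ge_0 h); assert (t * Cmod h <= 1 * Cmod h)%R by (apply Rmult_le_compat_r; lra).
    assert (0 <= t * Cmod h)%R by (apply Rmult_le_pos; lra).
    assert (u * (t * Cmod h) <= 1 * (t * Cmod h))%R by (apply Rmult_le_compat_r; lra); lra. }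
  assert (B : (Cmod (f (seg p (s + h) t) - f (seg p s t) - (seg p (s + h) t - seg p s t) * f' (seg p s t))
     <= Cmod (seg p (s + h) t - seg p s t) * e)%R).
  { apply mean_value_seg with (f' := f').
    - intros u Hu; apply D, HU; auto.
    - intros u Hu; apply (smooth_cont U); auto.
    - intros u Hu; apply Rlt_le; unfold seg at 1; rewrite E; apply Ht; auto.
      eapply Rle_lt_trans; [apply Hth, Hu|auto]. }
  eapply Rle_trans; [apply Rmult_le_compat_l; [apply pow_le; lra|exact B]|].
  rewrite E.
  assert (B2 := Hth 1%R ltac:(lra)); replace (RtoC 1 * (RtoC t * h)) with (RtoC t * h) in B2 by ring.
  assert (B3 : (t ^ j <= 1)%R).
  { rewrite <- (pow1 j); apply pow_incr; lra. }
  assert (P := Cmod_ge_0 (RtoC t * h)).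
  apply Rle_trans with (1 * (Cmod (RtoC t * h) * e))%R.
  - apply Rmult_le_compat_r; [apply Rmult_le_pos; lra|auto].
  - rewrite Rmult_1_l, Rmult_comm; apply Rmult_le_compat_l; lra.
Qed.

Lemma seg_moment_smooth U j f p : open_C U -> convex_C U -> smooth U f -> U p -> smooth U (seg_moment j f p).
Proof.
  intros HO HU Sf Hp; exists (fun h => exists j f, smooth U f /\ h = seg_moment j f p); split; [eauto|].
  clear j f Sf; intros h [j [f [Sf ->]]]; destruct (smooth_deriv _ _ Sf) as [f' [Sf' D]].
  exists (seg_moment (S j) f' p); split; [eauto|]; intros z Hz; apply (seg_moment_deriv U); auto.
Qed.

(** Hadamard's lemma: integrate f' from [p] to [s]. It removes singularities and divides by s - p
    without Cauchy's formula. *)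
Lemma smooth_quotient U f p : open_C U -> convex_C U -> smooth U f -> U p ->
  exists g, smooth U g /\ forall s, U s -> f s = f p + (s - p) * g s.
Proof.
  intros HO HU Sf Hp; destruct (smooth_deriv _ _ Sf) as [f' [Sf' D]].
  exists (seg_moment 0 f' p); split; [apply seg_moment_smooth; auto|]; intros s Hs.
  assert (E : f s - f p = (s - p) * seg_moment 0 f' p s).
  { rewrite <- (is_CInt_unique _ _ _ _ (is_CInt_scal _ _ _ _ (s - p) (seg_moment_correct U 0 f' p s HU Sf' Hp Hs))).
    symmetry; apply is_CInt_unique.
    apply (is_CInt_ext (fun t => (s - p) * f' (seg p s t))); [intros; simpl; ring|].
    apply ftc_seg; intros t Ht; [apply D, HU; auto|apply (smooth_cont U); auto]. }
  rewrite <- E; ring.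
Qed.

(** Cauchy's theorem on a convex domain. The derivative of the proposed primitive is the integral
    over [0, 1] of f + (s - p) t f' at p + t (s - p), and this integrand is the t-derivative of t
    f(p + t (s - p)). *)
Lemma smooth_primitive U f p : open_C U -> convex_C U -> smooth U f -> U p ->
  forall s, U s -> Cderiv (fun s => (s - p) * seg_moment 0 f p s) s (f s).
Proof.
  intros HO HU Sf Hp s Hs; destruct (smooth_deriv _ _ Sf) as [f' [Sf' D]].
  assert (D1 : Cderiv (fun s => s - p) s 1).
  { apply (Cderiv_ext (fun s => 1 * s + - p)); [intros; ring|apply Cderiv_affine]. }
  eapply Cderiv_eq; [apply Cderiv_mult; [exact D1|apply (seg_moment_deriv U 0 f f'); auto]|].
  assert (I := is_CInt_plus _ _ _ _ _ _ (seg_moment_correct U 0 f p s HU Sf Hp Hs)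
    (is_CInt_scal _ _ _ _ (s - p) (seg_moment_correct U 1 f' p s HU Sf' Hp Hs))).
  assert (J : is_CInt (fun t => RtoC t ^ 0 * f (seg p s t) + (s - p) * (RtoC t ^ 1 * f' (seg p s t))) 0 1
    (RtoC 1 * f (seg p s 1) - RtoC 0 * f (seg p s 0))).
  { apply (is_CInt_derive (fun t => RtoC t * f (seg p s t))); rewrite Rmin_left, Rmax_right by lra; intros t Ht.
    - assert (K := is_derive_C_comp f (seg p s) t _ _ (D _ (HU p s t Hp Hs Ht)) (seg_derive p s t)).
      eapply is_derive_C_eq; [apply is_derive_C_mult;
        [exact (is_derive_C_RtoC (fun u => u) t 1 (is_derive_id _))|exact K]|].
      cbv beta; simpl; ring.
    - apply cont_plus; [|apply cont_mult; [apply cont_const|]]; apply cont_mult;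
        try (apply cont_pow, cont_RtoC, continuous_id); 
        apply (cont_comp _ (seg p s)); try apply seg_cont; apply (smooth_cont U); auto. }
  rewrite seg_1 in J.
  assert (E := eq_trans (eq_sym (is_CInt_unique _ _ _ _ I)) (is_CInt_unique _ _ _ _ J)).
  rewrite Cmult_1_l; transitivity (seg_moment 0 f p s + (s - p) * seg_moment 1 f' p s); [reflexivity|].
  rewrite E; ring.
Qed.

(** * Convergence with explicit rates and differentiation of limits *)

Lemma lim_seq_inv_n (A : R) : filterlim (fun n => (A / INR n)%R) eventually (locally 0%R).
Proof.
  change (is_lim_seq (fun n => A / INR n)%R 0).
  apply (is_lim_seq_ext (fun n => A * / INR n)%R); [reflexivity|].
  replace (Finite 0) with (Rbar_mult A 0) by (simpl; f_equal; ring).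
  apply is_lim_seq_scal_l.
  apply (is_lim_seq_inv INR p_infty); [apply is_lim_seq_INR|discriminate].
Qed.

Lemma small_eventually (r : nat -> R) (e : R) : is_lim_seq r 0 -> (0 < e)%R ->
  exists N, forall n, (N <= n)%nat -> (r n < e)%R.
Proof.
  intros H He; destruct (proj1 (filterlim_locally _ _) H (mkposreal e He)) as [N HN].
  exists N; intros n Hn; specialize (HN n Hn); unfold ball in HN; simpl in HN.
  unfold AbsRing_ball, abs, minus, plus, opp in HN; simpl in HN.
  rewrite Ropp_0, Rplus_0_r in HN; apply Rabs_lt_between in HN; apply HN.
Qed.

Lemma cauchy_rate (u : nat -> C) (r : nat -> R) :
  (forall n m, (n <= m)%nat -> (Cmod (u m - u n) <= r n)%R) -> is_lim_seq r 0 ->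
  exists l : C, forall n, (Cmod (u n - l) <= r n)%R.
Proof.
  intros H Hr.
  assert (G : forall f : C -> R, (forall z w, Rabs (f z - f w) <= Cmod (z - w))%R ->
    exists l : R, is_lim_seq (fun n => f (u n)) l).
  { intros f Hf; apply ex_lim_seq_cauchy_corr; intros e.
    destruct (small_eventually r e Hr (cond_pos e)) as [N HN]; exists N.
    assert (G : forall n m, (N <= n)%nat -> (n <= m)%nat -> (Rabs (f (u n) - f (u m)) < e)%R).
    { intros n m Hn Hm; eapply Rle_lt_trans; [apply Hf|]; rewrite Cmod_sub_sym.
      eapply Rle_lt_trans; [apply H, Hm|apply HN, Hn]. }
    intros n m Hn Hm; destruct (le_dec n m); [apply G; auto|].
    rewrite Rabs_minus_sym; apply G; auto; lia. }
  destruct (G Re) as [l1 H1].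
  { intros z w; apply (re_le_Cmod (z - w)). }
  destruct (G Im) as [l2 H2].
  { intros z w; apply (im_le_Cmod (z - w)). }
  exists (l1, l2); intros n.
  assert (L : filterlim u eventually (@locally C_UniformSpace (l1, l2))).
  { apply (filterlim_ext (fun n => (Re (u n), Im (u n)))); [intros k; destruct (u k); auto|].
    apply flim_pair; auto; apply eventually_filter. }
  assert (L2 : filterlim (fun k => Cmod (u k - u n)) eventually (locally (Cmod ((l1, l2) - u n)))).
  { apply flim_Cmod; [apply eventually_filter|]; apply flim_minus; auto; try apply eventually_filter.
    apply flim_const, eventually_filter. }
  rewrite Cmod_sub_sym.
  apply (is_lim_seq_le_loc (fun k => Cmod (u k - u n)) (fun _ => r n) (Cmod ((l1, l2) - u n)) (r n));
    [|exact L2|apply is_lim_seq_const].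
  exists n; intros m Hm; apply H, Hm.
Qed.

(** The increments sum to at most A (1/n - 1/m), hence a Cauchy sequence with rate A / n. *)
Lemma telescoping_limit (u : nat -> C) (A : R) :
  (forall n, (1 <= n)%nat -> (Cmod (u (S n) - u n) <= A * (/ INR n - / INR (S n)))%R) ->
  exists l : C, forall n, (1 <= n)%nat -> (Cmod (u n - l) <= A / INR n)%R.
Proof.
  intros H.
  assert (HA : (0 <= A)%R).
  { generalize (Rle_trans _ _ _ (Cmod_ge_0 _) (H 1%nat (le_n _))); simpl; lra. }
  assert (B : forall n k, (1 <= n)%nat -> (Cmod (u (n + k)%nat - u n) <= A * (/ INR n - / INR (n + k)))%R).
  { intros n k Hn; induction k.
    - rewrite Nat.add_0_r; unfold Cminus; rewrite Cplus_opp_r, Cmod_0; lra.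
    - rewrite Nat.add_succ_r.
      replace (u (S (n + k)) - u n) with ((u (S (n + k)) - u (n + k)%nat) + (u (n + k)%nat - u n)) by ring.
      eapply Rle_trans; [apply Cmod_triangle|]; generalize (H (n + k)%nat ltac:(lia)); lra. }
  (* The index is shifted by one since A / n is a meaningful rate only from n = 1 on. *)
  destruct (cauchy_rate (fun n => u (S n)) (fun n => A / INR (S n))%R) as [l Hl].
  - intros n m Hnm; replace (S m) with (S n + (m - n))%nat by lia.
    eapply Rle_trans; [apply B; lia|]; unfold Rdiv.
    assert (0 < / INR (S n + (m - n)))%R by (apply Rinv_0_lt_compat, lt_0_INR; lia).
    assert (0 <= A * / INR (S n + (m - n)))%R by (apply Rmult_le_pos; lra); lra.
  - apply (is_lim_seq_incr_1 (fun n => A / INR n)%R), lim_seq_inv_n.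
  - exists l; intros [|n] Hn; [lia|apply Hl].
Qed.

Section Derivative_of_limit.
Variables (U : C -> Prop) (fn fn' : nat -> C -> C) (f g : C -> C) (A : R).
Hypothesis HO : open_C U.
Hypothesis HU : convex_C U.
Hypothesis HA : (0 <= A)%R.
Hypothesis Hd : forall n z, (1 <= n)%nat -> U z -> Cderiv (fn n) z (fn' n z).
Hypothesis Hc : forall n z, (1 <= n)%nat -> U z -> cont_C (fn' n) z.
Hypothesis Hf : forall z, U z -> filterlim (fun n => fn n z) eventually (@locally C_UniformSpace (f z)).
Hypothesis Hg : forall n z, (1 <= n)%nat -> U z -> (Cmod (fn' n z - g z) <= A * (1 + Cmod z) / INR n)%R.

Lemma small_index (B e : R) : (0 < e)%R -> exists n, (1 <= n)%nat /\ (B / INR n < e)%R.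
Proof.
  intros He; destruct (small_eventually _ e (lim_seq_inv_n B) He) as [N HN].
  exists (S N); split; [lia|apply HN; lia].
Qed.

Lemma uniform_limit_cont z : U z -> cont_C g z.
Proof.
  intros Hz; apply cont_eps; intros e He.
  destruct (small_index (A * (2 + Cmod z)) (e / 3)) as [n [Hn Hs]]; [lra|].
  destruct (proj1 (cont_eps _ _) (Hc n z Hn Hz) (e / 3)%R) as [d1 [Hd1 H1]]; [lra|].
  destruct (proj1 (locally_C_iff _ _) (HO z Hz)) as [d2 [Hd2 H2]].
  assert (Hin : (0 < / INR n)%R) by (apply Rinv_0_lt_compat, lt_0_INR; lia).
  assert (G : forall s, U s -> (Cmod (s - z) < 1)%R -> (Cmod (fn' n s - g s) < e / 3)%R).
  { intros s Us Hs'; eapply Rle_lt_trans; [apply Hg; auto|]; eapply Rle_lt_trans; [|exact Hs].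
    apply Rmult_le_compat_r; [lra|]; apply Rmult_le_compat_l; auto.
    generalize (Cmod_triangle_inv s z); lra. }
  exists (Rmin 1 (Rmin d1 d2)); split; [repeat apply Rmin_case; lra|]; intros s Hs'.
  assert (Hs1 : (Cmod (s - z) < 1)%R) by (eapply Rlt_le_trans; [exact Hs'|apply Rmin_l]).
  assert (Hs2 : (Cmod (s - z) < Rmin d1 d2)%R) by (eapply Rlt_le_trans; [exact Hs'|apply Rmin_r]).
  assert (Us : U s) by (apply H2; eapply Rlt_le_trans; [exact Hs2|apply Rmin_r]).
  specialize (H1 s (Rlt_le_trans _ _ _ Hs2 (Rmin_l _ _))).
  assert (G1 := G s Us Hs1).
  assert (G2 : (Cmod (fn' n z - g z) < e / 3)%R).
  { apply G; auto; replace (z - z) with (RtoC 0) by ring; rewrite Cmod_0; lra. }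
  replace (g s - g z) with ((fn' n s - fn' n z) + ((fn' n z - g z) - (fn' n s - g s))) by ring.
  eapply Rle_lt_trans; [apply Cmod_triangle|].
  generalize (Cmod_triangle_sub (fn' n z - g z) (fn' n s - g s)); lra.
Qed.

(** The mean value inequality for [fn n] on the segment from [z] to [z + h] is compared with [g z]
    uniformly in n and then passed to the limit. The rate in [Hg] may grow linearly in |z|, as it
    does for the digamma function; near [z] it is bounded. *)
Lemma Cderiv_limit z : U z -> Cderiv f z (g z).
Proof.
  intros Hz; apply Cderiv_eps; intros e He.
  destruct (proj1 (cont_eps _ _) (uniform_limit_cont z Hz) (e / 2)%R) as [d1 [Hd1 H1]]; [lra|].
  destruct (proj1 (locally_C_iff _ _) (HO z Hz)) as [d2 [Hd2 H2]].
  exists (Rmin 1 (Rmin d1 d2)); split; [repeat apply Rmin_case; lra|]; intros h Hh.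
  assert (Hh1 : (Cmod h < 1)%R) by (eapply Rlt_le_trans; [exact Hh|apply Rmin_l]).
  assert (Hh2 : (Cmod h < Rmin d1 d2)%R) by (eapply Rlt_le_trans; [exact Hh|apply Rmin_r]).
  assert (Uh : forall h', (Cmod h' <= Cmod h)%R -> U (z + h')).
  { intros h' L; apply H2; replace (z + h' - z) with h' by ring; eapply Rle_lt_trans; [exact L|].
    eapply Rlt_le_trans; [exact Hh2|apply Rmin_r]. }
  assert (Hseg : forall t, (0 <= t <= 1)%R -> exists h', seg z (z + h) t = z + h' /\ (Cmod h' <= Cmod h)%R).
  { intros t Ht; exists (RtoC t * h); split; [unfold seg; ring|].
    rewrite Cmod_mult, Cmod_R, Rabs_pos_eq by lra.
    assert (t * Cmod h <= 1 * Cmod h)%R by (apply Rmult_le_compat_r; [apply Cmod_ge_0|lra]); lra. }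
  assert (Uz : U (z + h)) by (apply Uh; lra).
  assert (L : filterlim (fun n => Cmod (fn n (z + h) - fn n z - h * g z)) eventually
     (locally (Cmod (f (z + h) - f z - h * g z)))).
  { apply flim_Cmod; [apply eventually_filter|].
    repeat (apply flim_minus; try apply eventually_filter); auto; apply flim_const, eventually_filter. }
  apply (is_lim_seq_le_loc (fun n => Cmod (fn n (z + h) - fn n z - h * g z)) (fun _ => (e * Cmod h)%R)
     (Cmod (f (z + h) - f z - h * g z)) (e * Cmod h)%R); [|exact L|apply is_lim_seq_const].
  destruct (small_eventually _ (e / 2) (lim_seq_inv_n (A * (2 + Cmod z))) ltac:(lra)) as [N HN].
  exists (S N); intros n Hn; specialize (HN n ltac:(lia)); cbv beta in HN.
  assert (Hin : (0 < / INR n)%R) by (apply Rinv_0_lt_compat, lt_0_INR; lia).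
  replace h with ((z + h) - z) at 2 by ring.
  rewrite Rmult_comm; replace h with ((z + h) - z) at 3 by ring.
  apply mean_value_seg with (f' := fn' n); intros t Ht; destruct (Hseg t Ht) as [h' [-> Hh']].
  - apply Hd; [lia|auto].
  - apply Hc; [lia|auto].
  - replace (fn' n (z + h') - g z) with ((fn' n (z + h') - g (z + h')) + (g (z + h') - g z)) by ring.
    eapply Rle_trans; [apply Cmod_triangle|].
    assert (G1 : (Cmod (g (z + h')%C - g z) < e / 2)%R).
    { apply H1; replace (z + h' - z) with h' by ring; eapply Rle_lt_trans; [exact Hh'|].
      eapply Rlt_le_trans; [exact Hh2|apply Rmin_l]. }
    assert (G2 : (Cmod (fn' n (z + h')%C - g (z + h')%C) <= A * (2 + Cmod z) / INR n)%R).
    { eapply Rle_trans; [apply Hg; [lia|auto]|].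
      apply Rmult_le_compat_r; [lra|]; apply Rmult_le_compat_l; auto.
      generalize (Cmod_triangle z h'); lra. }
    lra.
Qed.
End Derivative_of_limit.

Lemma smooth_of_deriv U f f' : smooth U f' -> (forall z, U z -> Cderiv f z (f' z)) -> smooth U f.
Proof.
  intros H D; exists (fun h => h = f \/ smooth U h); split; [left; auto|].
  intros g [->|Hg]; [exists f'; auto|].
  destruct (smooth_deriv _ _ Hg) as [g' [S Dg]]; exists g'; auto.
Qed.

(** * The Gamma function *)

Definition rhp (s : C) : Prop := (0 < Re s)%R.

Lemma rhp_open : open_C rhp.
Proof.
  intros z Hz; apply locally_C_iff; exists (Re z); split; [exact Hz|]; intros y Hy.
  unfold rhp in *; generalize (re_le_Cmod (y - z)); change (Re (y - z)) with (Re y - Re z)%R.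
  intros H; apply Rabs_le_between in H; lra.
Qed.

Lemma Re_seg a b t : Re (seg a b t) = ((1 - t) * Re a + t * Re b)%R.
Proof. unfold seg, Re; simpl; ring. Qed.

Lemma Im_seg a b t : Im (seg a b t) = ((1 - t) * Im a + t * Im b)%R.
Proof. unfold seg, Im; simpl; ring. Qed.

Lemma rhp_convex : convex_C rhp.
Proof.
  intros a b t Ha Hb Ht; unfold rhp in *; rewrite Re_seg.
  destruct (Req_dec_T t 0) as [->|Hn]; [lra|].
  assert (0 < t * Re b)%R by (apply Rmult_lt_0_compat; lra).
  assert (0 <= (1 - t) * Re a)%R by (apply Rmult_le_pos; lra); lra.
Qed.

Lemma Cnat_S n : Cnat (S n) = Cnat n + 1.
Proof. unfold Cnat; rewrite S_INR, RtoC_plus; auto. Qed.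

Lemma Re_plus_Cnat s n : Re (s + Cnat n) = (Re s + INR n)%R.
Proof. reflexivity. Qed.

Lemma rhp_plus_n_neq s n : rhp s -> s + Cnat n <> 0.
Proof.
  intros H E; unfold rhp in H; assert (R0 : Re (s + Cnat n) = 0%R) by (rewrite E; auto).
  rewrite Re_plus_Cnat in R0; generalize (pos_INR n); lra.
Qed.

(** Partial sums, with n + 1 terms, of the Hurwitz zeta series at exponent [j]; for j = 1 the
    harmonic part of the digamma function. *)
Fixpoint inv_pow_sum (j n : nat) (s : C) : C :=
  match n with
  | O => (/ (s + Cnat 0)) ^ j
  | S n' => inv_pow_sum j n' s + (/ (s + Cnat (S n'))) ^ j
  end.

Lemma inv_pow_sum_S j n s : inv_pow_sum j (S n) s = inv_pow_sum j n s + (/ (s + Cnat (S n))) ^ j.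
Proof. reflexivity. Qed.

Lemma Cpow_1 (x : C) : x ^ 1 = x.
Proof. simpl; ring. Qed.

Lemma Cderiv_pow_inv (j : nat) (a s : C) : s + a <> 0 ->
  Cderiv (fun s => (/ (s + a)) ^ j) s (- Cnat j * (/ (s + a)) ^ S j).
Proof.
  intros H.
  assert (D1 : Cderiv (fun s => s + a) s 1).
  { eapply Cderiv_eq; [apply Cderiv_plus; [apply Cderiv_id|apply Cderiv_const]|ring]. }
  assert (D2 := Cderiv_inv (fun s => s + a) s 1 H D1); cbv beta in D2.
  induction j.
  - eapply Cderiv_eq; [apply (Cderiv_const 1 s)|]; unfold Cnat; simpl; ring.
  - change (Cderiv (fun s0 => / (s0 + a) * (/ (s0 + a)) ^ j) s (- Cnat (S j) * (/ (s + a)) ^ S (S j))).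
    eapply Cderiv_eq; [apply Cderiv_mult; [exact D2|exact IHj]|]; rewrite Cnat_S; simpl; field; auto.
Qed.

Lemma inv_pow_sum_deriv j n s : rhp s -> Cderiv (inv_pow_sum j n) s (- Cnat j * inv_pow_sum (S j) n s).
Proof.
  intros Hs; induction n.
  - apply Cderiv_pow_inv, rhp_plus_n_neq, Hs.
  - eapply Cderiv_eq; [apply Cderiv_plus; [exact IHn|apply Cderiv_pow_inv, rhp_plus_n_neq, Hs]|].
    simpl; ring.
Qed.

Lemma inv_diff n : (1 <= n)%nat -> (/ INR n - / INR (S n))%R = (/ (INR n * INR (S n)))%R.
Proof.
  intros Hn; assert (0 < INR n)%R by (apply lt_0_INR; lia); rewrite S_INR; field; lra.
Qed.

Lemma Cmod_plus_n_ge s n : rhp s -> (INR n <= Cmod (s + Cnat n))%R.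
Proof.
  intros Hs; eapply Rle_trans; [|apply re_le_Cmod]; rewrite Re_plus_Cnat.
  eapply Rle_trans; [|apply Rle_abs]; unfold rhp in Hs; lra.
Qed.

(** On the right half-plane |s + k| >= k, so the new term is at most 1 / (n + 1)^2 <= 1/n - 1/(n +
    1). *)
Lemma inv_pow_sum_step j n s : (2 <= j)%nat -> (1 <= n)%nat -> rhp s ->
  (Cmod (inv_pow_sum j (S n) s - inv_pow_sum j n s) <= 1 * (/ INR n - / INR (S n)))%R.
Proof.
  intros Hj Hn Hs; simpl inv_pow_sum.
  replace (inv_pow_sum j n s + (/ (s + Cnat (S n))) ^ j - inv_pow_sum j n s) with ((/ (s + Cnat (S n))) ^ j) by ring.
  rewrite Cmod_pow, Cmod_inv by (apply rhp_plus_n_neq, Hs).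
  assert (P := Cmod_plus_n_ge s (S n) Hs).
  assert (P1 : (1 <= INR (S n))%R) by (rewrite S_INR; generalize (pos_INR n); lra).
  assert (P2 : (1 <= INR n)%R) by (apply (le_INR 1); lia).
  set (x := (/ Cmod (s + Cnat (S n)))%R).
  assert (Hx : (0 < x <= / INR (S n))%R).
  { unfold x; split; [apply Rinv_0_lt_compat; lra|apply Rinv_le_contravar; lra]. }
  assert (Hx1 : (x <= 1)%R).
  { eapply Rle_trans; [apply Hx|]; rewrite <- Rinv_1; apply Rinv_le_contravar; lra. }
  replace j with (2 + (j - 2))%nat by lia; rewrite pow_add.
  assert (x ^ (j - 2) <= 1)%R by (rewrite <- (pow1 (j - 2)); apply pow_incr; lra).
  assert (0 <= x ^ (j - 2))%R by (apply pow_le; lra).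
  rewrite inv_diff, Rmult_1_l, Rinv_mult by auto.
  assert (x * x <= / INR n * / INR (S n))%R.
  { apply Rmult_le_compat; try lra; eapply Rle_trans; [apply Hx|]; apply Rinv_le_contravar; [lra|].
    rewrite S_INR; lra. }
  assert (0 <= x * x)%R by (apply Rmult_le_pos; lra).
  replace (x ^ 2)%R with (x * x)%R by ring.
  apply Rle_trans with (x * x * 1)%R; [apply Rmult_le_compat_l; lra|lra].
Qed.

(** The logarithmic derivative of Gauss' quotient [Gamma_seq s n]. *)
Definition psi_seq (n : nat) (s : C) : C := RtoC (ln (INR n)) - inv_pow_sum 1 n s.

Lemma ln_step n : (1 <= n)%nat ->
  (/ INR (S n) <= ln (INR (S n)) - ln (INR n) <= / INR n)%R.
Proof.
  intros Hn; assert (P : (0 < INR n)%R) by (apply lt_0_INR; lia).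
  assert (P1 : (0 < INR (S n))%R) by (apply lt_0_INR; lia).
  assert (E : forall x, (0 < x)%R -> (ln x <= x - 1)%R).
  { intros x Hx; generalize (exp_ineq1_le (ln x)); rewrite exp_ln by auto; lra. }
  split.
  - generalize (E (INR n / INR (S n))%R ltac:(apply Rdiv_lt_0_compat; auto)); unfold Rdiv.
    rewrite ln_mult, ln_Rinv by (auto; apply Rinv_0_lt_compat; auto).
    replace (INR n * / INR (S n) - 1)%R with (- / INR (S n))%R; [lra|].
    rewrite S_INR in *; field; lra.
  - generalize (E (INR (S n) / INR n)%R ltac:(apply Rdiv_lt_0_compat; auto)); unfold Rdiv.
    rewrite ln_mult, ln_Rinv by (auto; apply Rinv_0_lt_compat; auto).
    replace (INR (S n) * / INR n - 1)%R with (/ INR n)%R; [lra|].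
    rewrite S_INR in *; field; lra.
Qed.

(** The increment is ln(n + 1) - ln n - 1/(n + 1), which lies between 0 and 1/n - 1/(n + 1), plus s
    / ((n + 1) (s + n + 1)), which is bounded by |s| times the same difference. *)
Lemma psi_step n s : (1 <= n)%nat -> rhp s ->
  (Cmod (psi_seq (S n) s - psi_seq n s) <= (1 + Cmod s) * (/ INR n - / INR (S n)))%R.
Proof.
  intros Hn Hs; unfold psi_seq; rewrite inv_pow_sum_S.
  assert (P : (1 <= INR n)%R) by (apply (le_INR 1); lia).
  assert (HN := rhp_plus_n_neq s (S n) Hs); assert (HG := Cmod_plus_n_ge s (S n) Hs).
  assert (P1 : (1 <= INR (S n))%R) by (rewrite S_INR; lra).
  assert (N1 : RtoC (INR (S n)) <> 0) by (intros E; apply RtoC_inj in E; lra).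
  replace (RtoC (ln (INR (S n))) - (inv_pow_sum 1 n s + (/ (s + Cnat (S n))) ^ 1) - (RtoC (ln (INR n)) - inv_pow_sum 1 n s))
    with (RtoC (ln (INR (S n)) - ln (INR n) - / INR (S n)) + s / (Cnat (S n) * (s + Cnat (S n)))).
  2:{ rewrite !RtoC_minus, RtoC_inv by lra; rewrite Cpow_1; unfold Cnat in *; field; split; auto. }
  eapply Rle_trans; [apply Cmod_triangle|].
  rewrite Cmod_R, Cmod_div, Cmod_mult by (apply Cmult_neq_0; auto).
  assert (E : Cmod (Cnat (S n)) = INR (S n)) by (unfold Cnat; rewrite Cmod_R; apply Rabs_pos_eq; lra).
  rewrite E.
  assert (A1 : (Rabs (ln (INR (S n)) - ln (INR n) - / INR (S n)) <= / INR n - / INR (S n))%R).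
  { generalize (ln_step n Hn); intros; rewrite Rabs_pos_eq; lra. }
  assert (A2 : (Cmod s / (INR (S n) * Cmod (s + Cnat (S n))) <= Cmod s * (/ INR n - / INR (S n)))%R).
  { rewrite inv_diff by auto; apply Rmult_le_compat_l; [apply Cmod_ge_0|].
    apply Rinv_le_contravar; [apply Rmult_lt_0_compat; lra|].
    rewrite Rmult_comm; apply Rmult_le_compat; try lra.
    eapply Rle_trans; [|exact HG]; rewrite S_INR; lra. }
  lra.
Qed.

(** The Hurwitz zeta function at integers j >= 2. Like [digamma], it is characterised by its rate of
    convergence, which is the form in which [Cderiv_limit] consumes it. *)
Definition zetaC (j : nat) (s : C) : C :=
  epsilon (inhabits (RtoC 0)) (fun l => forall n, (1 <= n)%nat -> (Cmod (inv_pow_sum j n s - l) <= 1 / INR n)%R).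

Definition digamma (s : C) : C :=
  epsilon (inhabits (RtoC 0))
    (fun l => forall n, (1 <= n)%nat -> (Cmod (psi_seq n s - l) <= (1 + Cmod s) / INR n)%R).

Lemma zetaC_spec j s n : (2 <= j)%nat -> rhp s -> (1 <= n)%nat -> (Cmod (inv_pow_sum j n s - zetaC j s) <= 1 / INR n)%R.
Proof.
  intros Hj Hs; revert n; unfold zetaC; apply epsilon_spec.
  apply telescoping_limit; intros n Hn; apply inv_pow_sum_step; auto.
Qed.

Lemma digamma_spec s n : rhp s -> (1 <= n)%nat -> (Cmod (psi_seq n s - digamma s) <= (1 + Cmod s) / INR n)%R.
Proof.
  intros Hs; revert n; unfold digamma; apply epsilon_spec.
  apply telescoping_limit; intros n Hn; apply psi_step; auto.
Qed.

Lemma flim_rate (u : nat -> C) (l : C) (A : R) :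
  (forall n, (1 <= n)%nat -> (Cmod (u n - l) <= A / INR n)%R) ->
  filterlim u eventually (@locally C_UniformSpace l).
Proof.
  intros H; apply (flim_le_0 eventually u l (fun n => A / INR n)%R).
  - exists 1%nat; exact H.
  - apply lim_seq_inv_n.
Qed.

Lemma smooth_chain (U : C -> Prop) (F : nat -> C -> C) (c : nat -> C) :
  (forall j z, U z -> Cderiv (F j) z (c j * F (S j) z)) -> forall j, smooth U (F j).
Proof.
  intros H j; exists (fun h => exists a i, forall s, h s = a * F i s); split.
  - exists (RtoC 1), j; intros s; ring.
  - intros h [a [i Hh]]; exists (fun s => (a * c i) * F (S i) s); split; [eauto|]; intros z Hz.
    apply (Cderiv_ext (fun s => a * F i s)); [auto|].
    eapply Cderiv_eq; [apply Cderiv_mult; [apply Cderiv_const|apply H, Hz]|cbv beta; ring].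
Qed.

Lemma inv_pow_sum_smooth j n : smooth rhp (inv_pow_sum j n).
Proof.
  apply (smooth_chain rhp (fun j => inv_pow_sum j n) (fun j => - Cnat j)); intros; apply inv_pow_sum_deriv; auto.
Qed.

Lemma zetaC_deriv j s : (2 <= j)%nat -> rhp s -> Cderiv (zetaC j) s (- Cnat j * zetaC (S j) s).
Proof.
  intros Hj Hs.
  apply (Cderiv_limit rhp (inv_pow_sum j) (fun n s => - Cnat j * inv_pow_sum (S j) n s) _ (fun s => - Cnat j * zetaC (S j) s) (INR j));
    auto using rhp_open, rhp_convex, pos_INR.
  - intros n z _ Hz; apply inv_pow_sum_deriv, Hz.
  - intros n z _ Hz; apply cont_mult; [apply cont_const|apply (smooth_cont rhp); auto; apply inv_pow_sum_smooth].
  - intros z Hz; apply flim_rate with (A := 1%R); intros n Hn; apply zetaC_spec; auto.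
  - intros n z Hn Hz; replace (- Cnat j * inv_pow_sum (S j) n z - - Cnat j * zetaC (S j) z)
      with (- Cnat j * (inv_pow_sum (S j) n z - zetaC (S j) z)) by ring.
    rewrite Cmod_mult, Cmod_opp; unfold Cnat; rewrite Cmod_R, (Rabs_pos_eq _ (pos_INR j)).
    assert (E := zetaC_spec (S j) z n ltac:(lia) Hz Hn).
    unfold Rdiv in *; rewrite !Rmult_assoc; apply Rmult_le_compat_l; [apply pos_INR|].
    eapply Rle_trans; [exact E|]; apply Rmult_le_compat_r;
      [apply Rlt_le, Rinv_0_lt_compat, lt_0_INR; lia|generalize (Cmod_ge_0 z); lra].
Qed.

Lemma zetaC_smooth j : (2 <= j)%nat -> smooth rhp (zetaC j).
Proof.
  intros Hj; replace j with (2 + (j - 2))%nat by lia.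
  apply (smooth_chain rhp (fun i => zetaC (2 + i)) (fun i => - Cnat (2 + i))).
  intros i z Hz; apply zetaC_deriv; auto; lia.
Qed.

Lemma psi_seq_deriv n s : rhp s -> Cderiv (psi_seq n) s (inv_pow_sum 2 n s).
Proof.
  intros Hs; unfold psi_seq.
  apply (Cderiv_ext (fun s => RtoC (ln (INR n)) + RtoC (-1) * inv_pow_sum 1 n s)); [intros; ring|].
  eapply Cderiv_eq; [apply Cderiv_plus; [apply Cderiv_const|
    apply Cderiv_mult; [apply Cderiv_const|apply inv_pow_sum_deriv, Hs]]|].
  unfold Cnat; simpl; ring.
Qed.

Lemma psi_seq_smooth n : smooth rhp (psi_seq n).
Proof.
  apply (smooth_of_deriv _ _ (inv_pow_sum 2 n)); [apply inv_pow_sum_smooth|intros; apply psi_seq_deriv; auto].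
Qed.

Lemma digamma_smooth : smooth rhp digamma.
Proof.
  apply (smooth_of_deriv _ _ (zetaC 2)); [apply zetaC_smooth; auto|]; intros s Hs.
  apply (Cderiv_limit rhp psi_seq (inv_pow_sum 2) _ _ 1);
    auto using rhp_open, rhp_convex, Rle_0_1.
  - intros n z _ Hz; apply psi_seq_deriv, Hz.
  - intros n z _ Hz; apply (smooth_cont rhp); auto; apply inv_pow_sum_smooth.
  - intros z Hz; apply flim_rate with (A := (1 + Cmod z)%R); intros n Hn; apply digamma_spec; auto.
  - intros n z Hn Hz; eapply Rle_trans; [apply zetaC_spec; auto|].
    apply Rmult_le_compat_r; [apply Rlt_le, Rinv_0_lt_compat, lt_0_INR; lia|].
    generalize (Cmod_ge_0 z); lra.
Qed.

(** * Gauss' quotients and their limits *)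

Lemma Cprod_app l1 l2 : Cprod (l1 ++ l2) = Cprod l1 * Cprod l2.
Proof. induction l1; simpl; [ring|]; unfold Cprod in *; simpl; rewrite IHl1; ring. Qed.

Definition poch (n : nat) (s : C) : C := Cprod (map (fun k => s + Cnat k) (seq 0 n)).

Lemma poch_S n s : poch (S n) s = poch n s * (s + Cnat n).
Proof.
  unfold poch; rewrite seq_S, map_app, Cprod_app; unfold Cprod at 2; simpl; ring.
Qed.

Lemma poch_S_l n s : poch (S n) s = s * poch n (s + 1).
Proof.
  induction n.
  - unfold poch, Cprod, Cnat; simpl; ring.
  - rewrite poch_S, IHn, poch_S, Cnat_S; ring.
Qed.

Lemma Gamma_seq_poch s n : Gamma_seq s n = Cnat (fact n) * Cpowc (Cnat n) s / poch (S n) s.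
Proof. reflexivity. Qed.

Lemma Carg_pos x : (0 < x)%R -> Carg (RtoC x) = 0%R.
Proof.
  intros Hx; unfold Carg; simpl; destruct (Rle_dec 0 0) as [_|n]; [|exfalso; apply n; lra].
  rewrite Cmod_R, Rabs_pos_eq by lra; unfold Rdiv; rewrite Rinv_r by lra; apply acos_1.
Qed.

Lemma Cpowc_pos x s : (0 < x)%R -> Cpowc (RtoC x) s = Cexp (s * RtoC (ln x)).
Proof.
  intros Hx; unfold Cpowc, Clog; rewrite Carg_pos, Cmod_R, Rabs_pos_eq by lra; reflexivity.
Qed.

Lemma Cpowc_nat n s : (1 <= n)%nat -> Cpowc (Cnat n) s = Cexp (s * RtoC (ln (INR n))).
Proof. intros Hn; apply Cpowc_pos, lt_0_INR; lia. Qed.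

Lemma Cnat_neq_0 n : (1 <= n)%nat -> Cnat n <> 0.
Proof. intros Hn E; apply RtoC_inj in E; apply (not_0_INR n); auto; lia. Qed.

Lemma Cnat_mult a b : Cnat (a * b) = Cnat a * Cnat b.
Proof. unfold Cnat; rewrite mult_INR, RtoC_mult; auto. Qed.

Lemma poch_neq_0 n s : (forall k, (k < n)%nat -> s + Cnat k <> 0) -> poch n s <> 0.
Proof.
  induction n; intros H; [unfold poch, Cprod; simpl; apply C1_nz|].
  rewrite poch_S; apply Cmult_neq_0; [apply IHn; intros; apply H; lia|apply H; lia].
Qed.

Lemma poch_deriv n s : rhp s -> Cderiv (poch (S n)) s (poch (S n) s * inv_pow_sum 1 n s).
Proof.
  intros Hs.
  assert (DL : forall k, Cderiv (fun s => s + Cnat k) s 1).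
  { intros k; eapply Cderiv_eq; [apply Cderiv_plus; [apply Cderiv_id|apply Cderiv_const]|ring]. }
  induction n.
  - apply (Cderiv_ext (fun s => s + Cnat 0)); [intros u; unfold poch, Cprod, Cnat; simpl; ring|].
    eapply Cderiv_eq; [apply DL|].
    assert (N := rhp_plus_n_neq s 0 Hs); unfold poch, Cprod; simpl; field; auto.
  - apply (Cderiv_ext (fun s => poch (S n) s * (s + Cnat (S n)))); [intros; rewrite (poch_S (S n)); auto|].
    eapply Cderiv_eq; [apply Cderiv_mult; [exact IHn|apply DL]|].
    assert (N := rhp_plus_n_neq s (S n) Hs); rewrite (poch_S (S n)); rewrite inv_pow_sum_S, Cpow_1; field; auto.
Qed.

Lemma Gamma_seq_deriv n s : (1 <= n)%nat -> rhp s ->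
  Cderiv (fun s => Gamma_seq s n) s (Gamma_seq s n * psi_seq n s).
Proof.
  intros Hn Hs.
  assert (P : (0 < INR n)%R) by (apply lt_0_INR; lia).
  assert (NP : poch (S n) s <> 0) by (apply poch_neq_0; intros; apply rhp_plus_n_neq, Hs).
  set (L := RtoC (ln (INR n))).
  apply (Cderiv_ext (fun s => Cnat (fact n) * (Cexp (L * s + 0) * / poch (S n) s))).
  { intros u; rewrite Gamma_seq_poch; rewrite Cpowc_nat by auto; fold L.
    replace (u * L) with (L * u + 0) by ring; unfold Cdiv; ring. }
  assert (D1 : Cderiv (fun s => Cexp (L * s + 0)) s (Cexp (L * s + 0) * L)).
  { apply (Cderiv_comp Cexp (fun s => L * s + 0)); [apply Cderiv_Cexp|apply Cderiv_affine]. }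
  eapply Cderiv_eq; [apply Cderiv_mult; [apply Cderiv_const|apply Cderiv_mult; [exact D1|]]|].
  - apply (Cderiv_inv (poch (S n)) s (poch (S n) s * inv_pow_sum 1 n s) NP), poch_deriv, Hs.
  - rewrite Gamma_seq_poch; rewrite Cpowc_nat by auto; fold L.
    replace (s * L) with (L * s + 0) by ring; unfold psi_seq; fold L; cbv beta; field; auto.
Qed.

Lemma Gamma_seq_1 n : (1 <= n)%nat -> Gamma_seq 1 n = Cnat n / Cnat (S n).
Proof.
  intros Hn; assert (P : (0 < INR n)%R) by (apply lt_0_INR; lia).
  assert (E : forall m, poch m 1 = Cnat (fact m)).
  { induction m; [reflexivity|].
    rewrite poch_S, IHm, fact_simpl, Cnat_mult, (Cnat_S m); ring. }
  rewrite Gamma_seq_poch, E, fact_simpl, Cnat_mult; rewrite Cpowc_nat by auto.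
  replace (1 * RtoC (ln (INR n))) with (RtoC (ln (INR n))) by ring; rewrite Cexp_RtoC, exp_ln by auto.
  fold (Cnat n); field; split; apply Cnat_neq_0; try lia; apply lt_O_fact.
Qed.

(** The primitive of the digamma function that vanishes at 1: a single-valued branch of log Gamma on
    the right half-plane. *)
Definition lgamma (s : C) : C := (s - 1) * seg_moment 0 digamma 1 s.

Lemma rhp_1 : rhp 1.
Proof. unfold rhp; simpl; lra. Qed.

Lemma lgamma_deriv s : rhp s -> Cderiv lgamma s (digamma s).
Proof.
  apply (smooth_primitive rhp digamma 1); auto using rhp_open, rhp_convex, digamma_smooth, rhp_1.
Qed.

Lemma lgamma_smooth : smooth rhp lgamma.
Proof.
  apply (smooth_of_deriv _ _ digamma); [apply digamma_smooth|apply lgamma_deriv].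
Qed.

Lemma Cderiv_zero_const U f a b : convex_C U -> (forall z, U z -> Cderiv f z 0) -> U a -> U b -> f b = f a.
Proof.
  intros HU H Ha Hb.
  assert (B := mean_value_seg f (fun _ => RtoC 0) a b 0 0 (fun t Ht => H _ (HU _ _ _ Ha Hb Ht))
    (fun t _ => cont_const _ _)).
  assert (E : (Cmod (f b - f a - (b - a) * 0) <= 0)%R).
  { eapply Rle_trans; [apply B; intros t _|lra].
    replace (0 - 0) with (RtoC 0) by ring; rewrite Cmod_0; lra. }
  apply Ceq_minus; replace (f b - f a) with (f b - f a - (b - a) * 0) by ring.
  apply Cmod_eq_0; generalize (Cmod_ge_0 (f b - f a - (b - a) * 0)); lra.
Qed.

(** Let d be the primitive, zero at 1, of the error psi_seq n - digamma. Then Gamma_seq times exp(-d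
    - lgamma) has derivative zero, so it equals its value at 1, namely n / (n + 1). *)
Lemma Gamma_seq_rhp n s : (1 <= n)%nat -> rhp s ->
  exists d, (Cmod d <= Cmod (s - 1) * (3 + Cmod s) / INR n)%R /\
    Gamma_seq s n = Cnat n / Cnat (S n) * Cexp d * Cexp (lgamma s).
Proof.
  intros Hn Hs; assert (P : (0 < INR n)%R) by (apply lt_0_INR; lia).
  set (p := fun s => psi_seq n s + RtoC (-1) * digamma s).
  assert (Sp : smooth rhp p).
  { apply smooth_plus; [apply psi_seq_smooth|apply smooth_mult; [apply smooth_const|apply digamma_smooth]]. }
  set (d := fun s => (s - 1) * seg_moment 0 p 1 s).
  assert (Dd : forall z, rhp z -> Cderiv d z (p z)).
  { apply (smooth_primitive rhp p 1); auto using rhp_open, rhp_convex, rhp_1. }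
  exists (d s); split.
  - unfold d; rewrite Cmod_mult; unfold Rdiv; rewrite Rmult_assoc; apply Rmult_le_compat_l; [apply Cmod_ge_0|].
    replace ((3 + Cmod s) * / INR n)%R with ((1 - 0) * ((3 + Cmod s) / INR n))%R by (unfold Rdiv; ring).
    eapply is_CInt_bound; [lra| |apply (seg_moment_correct rhp 0 p 1 s); auto using rhp_convex, rhp_1].
    intros t Ht; cbv beta; simpl Cpow; rewrite Cmult_1_l.
    assert (Ht' : rhp (seg 1 s t)) by (apply rhp_convex; auto using rhp_1).
    unfold p; replace (psi_seq n (seg 1 s t) + RtoC (-1) * digamma (seg 1 s t))
      with (psi_seq n (seg 1 s t) - digamma (seg 1 s t)) by ring.
    eapply Rle_trans; [apply digamma_spec; auto|].
    apply Rmult_le_compat_r; [apply Rlt_le, Rinv_0_lt_compat, P|].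
    (* On the segment from 1 to s the point has modulus at most 1 + |s - 1| <= 2 + |s|; this is the
       origin of the constant 3. *)
    unfold seg; generalize (Cmod_triangle 1 (RtoC t * (s - 1))); rewrite Cmod_1, Cmod_mult, Cmod_R, Rabs_pos_eq by lra.
    generalize (Cmod_triangle_sub s 1); rewrite Cmod_1.
    assert (t * Cmod (s - 1) <= 1 * Cmod (s - 1))%R by (apply Rmult_le_compat_r; [apply Cmod_ge_0|lra]); lra.
  - set (q := fun s => Gamma_seq s n * Cexp (RtoC (-1) * (d s + lgamma s))).
    assert (Dq : forall z, rhp z -> Cderiv q z 0).
    { intros z Hz; unfold q.
      assert (D2 : Cderiv (fun s => RtoC (-1) * (d s + lgamma s)) z (RtoC (-1) * psi_seq n z)).
      { eapply Cderiv_eq; [apply Cderiv_mult; [apply Cderiv_const|apply Cderiv_plus; [apply Dd, Hz|apply lgamma_deriv, Hz]]|].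
        unfold p; ring. }
      assert (D3 := Cderiv_comp Cexp _ z _ _ (Cderiv_Cexp _) D2).
      eapply Cderiv_eq; [apply Cderiv_mult; [apply Gamma_seq_deriv; auto|exact D3]|cbv beta; ring]. }
    assert (E := Cderiv_zero_const rhp q 1 s rhp_convex Dq rhp_1 Hs).
    unfold q in E; rewrite Gamma_seq_1 in E by auto.
    replace (d 1 + lgamma 1) with (RtoC 0) in E by (unfold d, lgamma; ring).
    replace (RtoC (-1) * RtoC 0) with (RtoC 0) in E by ring; rewrite Cexp_0 in E.
    replace (RtoC (-1) * (d s + lgamma s)) with (- (d s + lgamma s)) in E by ring.
    rewrite Cexp_opp in E; rewrite <- Cmult_assoc, <- Cexp_plus.
    transitivity (Gamma_seq s n * / Cexp (d s + lgamma s) * Cexp (d s + lgamma s));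
      [field; apply Cexp_neq_0|rewrite E; ring].
Qed.

Lemma lim_n_Sn : filterlim (fun n => Cnat n / Cnat (S n)) eventually (@locally C_UniformSpace (RtoC 1)).
Proof.
  apply flim_rate with (A := 1%R); intros n Hn.
  assert (P : (0 < INR n)%R) by (apply lt_0_INR; lia).
  assert (E : Cnat n / Cnat (S n) - 1 = - / Cnat (S n)).
  { rewrite Cnat_S; field; rewrite <- Cnat_S; apply Cnat_neq_0; lia. }
  rewrite E, Cmod_opp, Cmod_inv by (apply Cnat_neq_0; lia).
  unfold Cnat; rewrite Cmod_R, Rabs_pos_eq by apply pos_INR; unfold Rdiv; rewrite Rmult_1_l.
  apply Rinv_le_contravar; auto; rewrite S_INR; lra.
Qed.

Lemma Gamma_seq_lim_rhp s : rhp s ->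
  filterlim (Gamma_seq s) eventually (@locally C_UniformSpace (Cexp (lgamma s))).
Proof.
  intros Hs.
  assert (H : forall n, exists d, (1 <= n)%nat -> (Cmod d <= Cmod (s - 1) * (3 + Cmod s) / INR n)%R /\
    Gamma_seq s n = Cnat n / Cnat (S n) * Cexp d * Cexp (lgamma s)).
  { intros n; destruct (le_dec 1 n) as [Hn|Hn]; [|exists (RtoC 0); lia].
    destruct (Gamma_seq_rhp n s Hn Hs) as [d Hd]; exists d; auto. }
  set (d := fun n => proj1_sig (constructive_indefinite_description _ (H n))).
  assert (Hd : forall n, (1 <= n)%nat -> (Cmod (d n) <= Cmod (s - 1) * (3 + Cmod s) / INR n)%R /\
    Gamma_seq s n = Cnat n / Cnat (S n) * Cexp (d n) * Cexp (lgamma s)).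
  { intros n; unfold d; destruct constructive_indefinite_description; auto. }
  apply (flim_ext eventually (fun n => Cnat n / Cnat (S n) * Cexp (d n) * Cexp (lgamma s))).
  { exists 1%nat; intros n Hn; symmetry; apply Hd, Hn. }
  apply (eq_rect _ (fun l => filterlim _ eventually (@locally C_UniformSpace l)))
    with (2 := ltac:(ring) : 1 * 1 * Cexp (lgamma s) = Cexp (lgamma s)).
  apply flim_mult; [apply eventually_filter| |apply flim_const, eventually_filter].
  apply flim_mult; [apply eventually_filter|apply lim_n_Sn|].
  rewrite <- Cexp_0.
  apply (filterlim_comp _ _ _ d Cexp _ (@locally C_UniformSpace (RtoC 0))); [|apply cont_Cexp].
  apply flim_rate with (A := (Cmod (s - 1) * (3 + Cmod s))%R); intros n Hn.
  replace (d n - RtoC 0) with (d n) by ring; apply Hd, Hn.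
Qed.

Lemma Gamma_of_lim s l : filterlim (Gamma_seq s) eventually (@locally C_UniformSpace l) -> Gamma s = l.
Proof.
  intros H; unfold Gamma.
  rewrite (is_lim_seq_unique (fun n => Re (Gamma_seq s n)) (Re l)) by exact (flim_Re _ _ _ H).
  rewrite (is_lim_seq_unique (fun n => Im (Gamma_seq s n)) (Im l)) by exact (flim_Im _ _ _ H).
  destruct l; reflexivity.
Qed.

Lemma Gamma_rhp s : rhp s -> Gamma s = Cexp (lgamma s).
Proof. intros H; apply Gamma_of_lim, Gamma_seq_lim_rhp, H. Qed.

Lemma Cpowc_pos_plus x a b : (0 < x)%R -> Cpowc (RtoC x) (a + b) = Cpowc (RtoC x) a * Cpowc (RtoC x) b.
Proof. intros Hx; rewrite !Cpowc_pos by auto; rewrite <- Cexp_plus; f_equal; ring. Qed.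

Lemma Cpowc_pos_1 x : (0 < x)%R -> Cpowc (RtoC x) 1 = RtoC x.
Proof. intros Hx; rewrite Cpowc_pos, Cmult_1_l, Cexp_RtoC, exp_ln by auto; auto. Qed.

Lemma Gamma_seq_step (s : C) n : (1 <= n)%nat -> (forall k, s + Cnat k <> 0) ->
  Gamma_seq s n = Gamma_seq (s + 1) n * ((s + Cnat (S n)) / (s * Cnat n)).
Proof.
  intros Hn H; assert (P : (0 < INR n)%R) by (apply lt_0_INR; lia).
  rewrite !Gamma_seq_poch, poch_S_l, (poch_S n (s + 1)).
  replace (Cpowc (Cnat n) (s + 1)) with (Cpowc (Cnat n) s * Cnat n)
    by (unfold Cnat; rewrite Cpowc_pos_plus, Cpowc_pos_1 by auto; auto).
  assert (H0 : s <> 0) by (generalize (H O); unfold Cnat; simpl; rewrite Cplus_0_r; auto).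
  assert (H1 : s + 1 + Cnat n <> 0) by (generalize (H (S n)); rewrite Cnat_S; intros E E'; apply E; rewrite <- E'; ring).
  assert (H2 : poch n (s + 1) <> 0).
  { apply poch_neq_0; intros k _; generalize (H (S k)); rewrite Cnat_S; intros E E'; apply E; rewrite <- E'; ring. }
  rewrite Cnat_S.
  field; repeat split; auto; apply Cnat_neq_0; auto.
Qed.

Lemma Gamma_regular_iff s : Gamma_regular s <-> forall k, s + Cnat k <> 0.
Proof.
  split; intros H k E; apply (H k).
  - replace s with ((s + Cnat k) - Cnat k) by ring; rewrite E; ring.
  - rewrite E; ring.
Qed.

Lemma Gamma_regular_S s : Gamma_regular s -> Gamma_regular (s + 1).
Proof.
  rewrite !Gamma_regular_iff; intros H k; generalize (H (S k)); rewrite Cnat_S; intros E E'; apply E.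
  rewrite <- E'; ring.
Qed.

Lemma Gamma_seq_lim_step s l : Gamma_regular s ->
  filterlim (Gamma_seq (s + 1)) eventually (@locally C_UniformSpace l) ->
  filterlim (Gamma_seq s) eventually (@locally C_UniformSpace (l / s)).
Proof.
  intros Hs Hl; assert (Hr := proj1 (Gamma_regular_iff s) Hs).
  assert (H0 : s <> 0) by (generalize (Hr O); unfold Cnat; simpl; rewrite Cplus_0_r; auto).
  apply (flim_ext eventually (fun n => Gamma_seq (s + 1) n * ((s + 1) / s * / Cnat n + / s))).
  { exists 1%nat; intros n Hn; rewrite (Gamma_seq_step s n) by auto; f_equal; rewrite Cnat_S.
    field; split; auto; apply Cnat_neq_0; auto. }
  replace (l / s) with (l * ((s + 1) / s * 0 + / s)) by (field; auto).
  apply flim_mult; [apply eventually_filter|auto|].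
  apply flim_plus; [apply eventually_filter| |apply flim_const, eventually_filter].
  apply flim_mult; [apply eventually_filter|apply flim_const, eventually_filter|].
  apply flim_rate with (A := 1%R); intros n Hn.
  replace (/ Cnat n - 0) with (/ Cnat n) by ring; rewrite Cmod_inv by (apply Cnat_neq_0; auto).
  unfold Cnat; rewrite Cmod_R, Rabs_pos_eq by apply pos_INR; lra.
Qed.

(** Induction on the number of unit shifts needed to enter the right half-plane; convergence and a
    nonzero limit are carried back by the functional equation. *)
Lemma Gamma_seq_converges s : Gamma_regular s ->
  exists l : C, l <> 0 /\ filterlim (Gamma_seq s) eventually (@locally C_UniformSpace l).
Proof.
  destruct (nfloor_ex (Rmax 0 (- Re s))%R (Rmax_l _ _)) as [N [_ HN]].
  assert (H : (- INR (S N) < Re s)%R).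
  { rewrite S_INR; generalize (Rmax_r 0 (- Re s)); lra. }
  revert H; clear HN; generalize (S N); clear N; intros N; revert s; induction N; intros s H Hs.
  - exists (Cexp (lgamma s)); split; [apply Cexp_neq_0|apply Gamma_seq_lim_rhp].
    unfold rhp; simpl in H; lra.
  - destruct (IHN (s + 1)) as [l [Hl L]]; [|apply Gamma_regular_S, Hs|].
    + rewrite S_INR in H; unfold Re in *; simpl in *; lra.
    + assert (H0 : s <> 0).
      { generalize (proj1 (Gamma_regular_iff s) Hs O); unfold Cnat; simpl; rewrite Cplus_0_r; auto. }
      exists (l / s); split; [|apply Gamma_seq_lim_step; auto].
      intros E; apply Hl; replace l with (l / s * s) by (field; auto); rewrite E; ring.
Qed.

Lemma Gamma_lim s : Gamma_regular s -> filterlim (Gamma_seq s) eventually (@locally C_UniformSpace (Gamma s)).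
Proof.
  intros Hs; destruct (Gamma_seq_converges s Hs) as [l [_ L]]; rewrite (Gamma_of_lim s l L); exact L.
Qed.

Lemma Gamma_neq_0 s : Gamma_regular s -> Gamma s <> 0.
Proof.
  intros Hs; destruct (Gamma_seq_converges s Hs) as [l [Hl L]]; rewrite (Gamma_of_lim s l L); exact Hl.
Qed.

(** From n = k on, the denominator of Gauss' quotient contains the factor 0, and division by 0 gives
    0. *)
Lemma Gamma_pole k : Gamma (- Cnat k) = 0.
Proof.
  apply Gamma_of_lim, (flim_ext eventually (fun _ => RtoC 0)); [|apply flim_const, eventually_filter].
  exists k; intros n Hn; rewrite Gamma_seq_poch.
  assert (E : forall m, (k <= m)%nat -> poch (S m) (- Cnat k) = 0).
  { induction m; intros Hm; rewrite poch_S.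
    - replace k with O by lia; ring.
    - destruct (Nat.eq_dec k (S m)) as [->|]; [ring|rewrite IHm by lia; ring]. }
  rewrite E by auto; unfold Cdiv.
  replace (/ RtoC 0) with (RtoC 0); [ring|].
  unfold Cinv, RtoC; simpl; f_equal; unfold Rdiv; ring.
Qed.

Lemma Gamma_succ (s : C) : s <> 0 -> Gamma (s + 1) = s * Gamma s.
Proof.
  intros H0; destruct (excluded_middle_informative (Gamma_regular s)) as [Hs|Hs].
  - rewrite (Gamma_of_lim s _ (Gamma_seq_lim_step s _ Hs (Gamma_lim _ (Gamma_regular_S _ Hs)))).
    field; auto.
  - assert (H : exists k, s = - Cnat k).
    { apply Classical_Prop.NNPP; intros H; apply Hs; intros k E; apply H; exists k; auto. }
    destruct H as [k ->]; rewrite Gamma_pole; destruct k.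
    + exfalso; apply H0; unfold Cnat; simpl; ring.
    + replace (- Cnat (S k) + 1) with (- Cnat k) by (rewrite Cnat_S; ring); rewrite Gamma_pole; ring.
Qed.

Lemma Cinv_0 : / RtoC 0 = RtoC 0.
Proof. unfold Cinv, RtoC; simpl; f_equal; unfold Rdiv; ring. Qed.

(** Holds for every [s]: at the poles both sides are 0 by the convention on 1/0. This is what makes
    1/Gamma entire, since finitely many shifts lead into the right half-plane. *)
Lemma rGamma_succ (s : C) : / Gamma s = s * / Gamma (s + 1).
Proof.
  destruct (Ceq_dec s 0) as [->|H0].
  - replace (RtoC 0) with (- Cnat 0) at 1 by (unfold Cnat; simpl; ring); rewrite Gamma_pole, Cinv_0; ring.
  - rewrite Gamma_succ by auto; destruct (Ceq_dec (Gamma s) 0) as [E|E].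
    + rewrite E, Cmult_0_r, Cinv_0; ring.
    + field; auto.
Qed.

Lemma rGamma_poch n s : / Gamma s = poch n s * / Gamma (s + Cnat n).
Proof.
  induction n.
  - unfold poch, Cprod, Cnat; simpl; replace (s + 0) with s by ring; ring.
  - rewrite IHn, rGamma_succ, poch_S, Cnat_S, Cplus_assoc; ring.
Qed.

Lemma Cinv_total (x y : C) : / (x * y) = / x * / y.
Proof.
  destruct (Ceq_dec x 0) as [->|Hx]; [rewrite Cmult_0_l, Cinv_0; ring|].
  destruct (Ceq_dec y 0) as [->|Hy]; [rewrite Cmult_0_r, Cinv_0; ring|field; auto].
Qed.

Lemma Cinv_involutive (x : C) : / / x = x.
Proof. destruct (Ceq_dec x 0) as [->|Hx]; [rewrite !Cinv_0; auto|field; auto]. Qed.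

(** Holds at the poles too, both sides being [0] there. *)
Lemma Gamma_poch n s : Gamma s = Gamma (s + Cnat n) / poch n s.
Proof.
  rewrite <- (Cinv_involutive (Gamma s)), (rGamma_poch n), Cinv_total, Cinv_involutive.
  unfold Cdiv; ring.
Qed.

Lemma Gamma_smooth : smooth rhp Gamma.
Proof.
  apply (smooth_ext rhp (fun s => Cexp (lgamma s))); [apply rhp_open| |].
  - intros z Hz; symmetry; apply Gamma_rhp, Hz.
  - apply smooth_exp, lgamma_smooth.
Qed.

Lemma rhp_regular s : rhp s -> Gamma_regular s.
Proof. intros H; apply Gamma_regular_iff; intros k; apply rhp_plus_n_neq, H. Qed.

Lemma rhp_shift s : exists n, rhp (s + Cnat n).
Proof.
  destruct (nfloor_ex (Rmax 0 (- Re s))%R (Rmax_l _ _)) as [N [_ HN]]; exists (S N).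
  unfold rhp; rewrite Re_plus_Cnat, S_INR; generalize (Rmax_r 0 (- Re s)); lra.
Qed.

Lemma cont_poch n s : cont_C (poch n) s.
Proof.
  apply (cont_prod (seq 0 n) (fun k s => s + Cnat k)); intros k _.
  apply cont_plus; [apply cont_id|apply cont_const].
Qed.

Lemma rGamma_cont s : cont_C (fun s => / Gamma s) s.
Proof.
  destruct (rhp_shift s) as [n Hn].
  apply (cont_ext_loc (fun s => poch n s * / Gamma (s + Cnat n))).
  - apply filter_forall; intros z; symmetry; apply rGamma_poch.
  - apply cont_mult; [apply cont_poch|apply cont_inv].
    + apply Gamma_neq_0, rhp_regular, Hn.
    + apply (cont_comp Gamma (fun s => s + Cnat n)).
      * apply cont_plus; [apply cont_id|apply cont_const].
      * apply (smooth_cont rhp); [apply Gamma_smooth|exact Hn].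
Qed.

Lemma Gamma_cont s : Gamma_regular s -> cont_C Gamma s.
Proof.
  intros Hs; assert (N := Gamma_neq_0 s Hs).
  apply (cont_ext_loc (fun s => / (/ Gamma s))).
  - apply filter_forall; intros z; apply Cinv_involutive.
  - apply cont_inv; [|apply rGamma_cont].
    intros E; apply N; replace (Gamma s) with (Gamma s * Gamma s * / Gamma s) by (field; auto).
    rewrite E; ring.
Qed.

(** * The reflection formula *)

Lemma Ci2 : Ci * Ci = RtoC (-1).
Proof. unfold Ci, Cmult, RtoC; simpl; f_equal; ring. Qed.

(** cos(s t), and next sin(s t), for complex s, viewed as curves in the real variable t. *)
Definition cos_lin (s : C) (t : R) : C := (Cexp (RtoC t * (Ci * s)) + Cexp (RtoC t * - (Ci * s))) / 2.
Definition sin_lin (s : C) (t : R) : C := (Cexp (RtoC t * (Ci * s)) - Cexp (RtoC t * - (Ci * s))) / (2 * Ci).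

Lemma C2_nz : RtoC 2 <> 0.
Proof. intros E; apply RtoC_inj in E; lra. Qed.

Lemma cos_lin_derive s t : is_derive_C (cos_lin s) t (- s * sin_lin s t).
Proof.
  assert (A := is_derive_C_Cexp_lin (Ci * s) t); assert (B := is_derive_C_Cexp_lin (- (Ci * s)) t).
  assert (D := is_derive_C_mult _ _ _ _ _ (@is_derive_plus R_AbsRing C_R_NormedModule _ _ _ _ _ A B)
    (@is_derive_const R_AbsRing C_R_NormedModule (/ 2) t)).
  eapply is_derive_C_eq; [exact D|].
  change (((Ci * s * Cexp (RtoC t * (Ci * s)) + - (Ci * s) * Cexp (RtoC t * - (Ci * s))) * / 2 +
    (Cexp (RtoC t * (Ci * s)) + Cexp (RtoC t * - (Ci * s))) * 0) = - s * sin_lin s t).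
  unfold sin_lin; generalize (Cexp (RtoC t * (Ci * s))) (Cexp (RtoC t * - (Ci * s))); intros x y.
  assert (Hi := Ci_nz); assert (H2 := C2_nz).
  transitivity ((Ci * Ci) * s * (x - y) / (2 * Ci)); [field; auto|rewrite Ci2; field; auto].
Qed.

Lemma sin_lin_derive s t : is_derive_C (sin_lin s) t (s * cos_lin s t).
Proof.
  assert (A := is_derive_C_Cexp_lin (Ci * s) t); assert (B := is_derive_C_Cexp_lin (- (Ci * s)) t).
  assert (D := is_derive_C_mult _ _ _ _ _ (@is_derive_minus R_AbsRing C_R_NormedModule _ _ _ _ _ A B)
    (@is_derive_const R_AbsRing C_R_NormedModule (/ (2 * Ci)) t)).
  eapply is_derive_C_eq; [exact D|].
  change (((Ci * s * Cexp (RtoC t * (Ci * s)) - - (Ci * s) * Cexp (RtoC t * - (Ci * s))) * / (2 * Ci) +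
    (Cexp (RtoC t * (Ci * s)) - Cexp (RtoC t * - (Ci * s))) * 0) = s * cos_lin s t).
  unfold cos_lin; generalize (Cexp (RtoC t * (Ci * s))) (Cexp (RtoC t * - (Ci * s))); intros x y.
  assert (Hi := Ci_nz); assert (H2 := C2_nz); field; auto.
Qed.

Lemma cos_lin_cont s t : cont_C (cos_lin s) t.
Proof. eapply is_derive_C_cont, cos_lin_derive. Qed.
Lemma sin_lin_0 s : sin_lin s 0 = 0.
Proof.
  unfold sin_lin; replace (RtoC 0 * (Ci * s)) with (RtoC 0) by ring.
  replace (RtoC 0 * - (Ci * s)) with (RtoC 0) by ring; unfold Cdiv; ring.
Qed.

Lemma continuous_cos_pow n t : continuous (fun t => cos t ^ n)%R t.
Proof.
  apply (ex_derive_continuous (K := R_AbsRing) (V := R_NormedModule)); auto_derive; auto.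
Qed.

Definition wallis (m : nat) (s : C) : C := CInt (fun t => RtoC (cos t ^ (2 * m)) * cos_lin s t) 0 (PI / 2).

Lemma wallis_correct m s : is_CInt (fun t => RtoC (cos t ^ (2 * m)) * cos_lin s t) 0 (PI / 2) (wallis m s).
Proof.
  apply CInt_correct; intros t _; apply cont_mult; [|apply cos_lin_cont].
  apply cont_RtoC, continuous_cos_pow.
Qed.

(** Integration by parts twice. *)
Lemma wallis_step m (s : C) : (4 * Cnat (S m) * Cnat (S m) - s * s) * wallis (S m) s =
  2 * Cnat (S m) * (2 * Cnat m + 1) * wallis m s.
Proof.
  assert (Hex : exists n, n = (2 * S m)%nat) by eauto; destruct Hex as [n En].
  assert (Hn : Cnat n = 2 * Cnat (S m)) by (rewrite En; rewrite Cnat_mult; auto).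
  assert (I := is_CInt_minus _ _ _ _ _ _
    (is_CInt_scal _ _ _ _ (4 * Cnat (S m) * Cnat (S m) - s * s) (wallis_correct (S m) s))
    (is_CInt_scal _ _ _ _ (2 * Cnat (S m) * (2 * Cnat m + 1)) (wallis_correct m s))).
  (* [Phi] gathers the boundary terms of both integrations by parts. It vanishes at 0 because of the
     sines, and at PI/2 because n - 1 >= 1 leaves a factor cos. *)
  set (Phi := fun t => RtoC (INR n * cos t ^ (n - 1) * sin t) * cos_lin s t - RtoC (cos t ^ n) * (s * sin_lin s t)).
  assert (J : is_CInt (fun t => (4 * Cnat (S m) * Cnat (S m) - s * s) * (RtoC (cos t ^ (2 * S m)) * cos_lin s t) -
    2 * Cnat (S m) * (2 * Cnat m + 1) * (RtoC (cos t ^ (2 * m)) * cos_lin s t)) 0 (PI / 2) (Phi (PI / 2)%R - Phi 0%R)).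
  { apply (is_CInt_derive Phi).
    - intros t _.
      assert (D1 : is_derive (fun t => INR n * cos t ^ (n - 1) * sin t)%R t
         (INR n * (INR (n - 1) * (- sin t) * cos t ^ (n - 2) * sin t + cos t ^ (n - 1) * cos t))%R).
      { auto_derive; auto; replace (Init.Nat.pred (n - 1)) with (n - 2)%nat by lia; ring. }
      assert (D2 : is_derive (fun t => cos t ^ n)%R t (INR n * (- sin t) * cos t ^ (n - 1))%R).
      { auto_derive; auto; replace (Init.Nat.pred n) with (n - 1)%nat by lia; ring. }
      assert (D3 := is_derive_C_mult _ _ _ _ _ (is_derive_C_RtoC _ _ _ D1) (cos_lin_derive s t)).
      assert (D4 := is_derive_C_mult _ _ _ _ _ (is_derive_C_RtoC _ _ _ D2)
        (is_derive_C_mult _ _ _ _ _ (@is_derive_const R_AbsRing C_R_NormedModule s t) (sin_lin_derive s t))).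
      assert (D := @is_derive_minus R_AbsRing C_R_NormedModule _ _ _ _ _ D3 D4).
      eapply is_derive_C_eq; [exact D|].
      match goal with |- minus (?a + ?b) (?c + ?d * (?e + ?f)) = _ => change (a + b - (c + d * (0 * sin_lin s t + f)) = (4 * Cnat (S m) * Cnat (S m) - s * s) * (RtoC (cos t ^ (2 * S m)) * cos_lin s t) -
    2 * Cnat (S m) * (2 * Cnat m + 1) * (RtoC (cos t ^ (2 * m)) * cos_lin s t)) end.
      cbv beta.
      replace (cos t ^ n)%R with (cos t * cos t * cos t ^ (2 * m))%R
        by (rewrite En; replace (2 * S m)%nat with (S (S (2 * m))) by lia; simpl; ring).
      replace (cos t ^ (2 * S m))%R with (cos t * cos t * cos t ^ (2 * m))%R
        by (replace (2 * S m)%nat with (S (S (2 * m))) by lia; simpl; ring).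
      replace (cos t ^ (n - 1))%R with (cos t * cos t ^ (2 * m))%R
        by (rewrite En; replace (2 * S m - 1)%nat with (S (2 * m)) by lia; simpl; ring).
      replace (n - 2)%nat with (2 * m)%nat by lia.
      replace (INR (n - 1)) with (2 * INR m + 1)%R
        by (rewrite En; replace (2 * S m - 1)%nat with (S (2 * m)) by lia; rewrite S_INR, mult_INR; simpl; ring).
      assert (S2 : (sin t * sin t = 1 - cos t * cos t)%R) by (generalize (sin2_cos2 t); unfold Rsqr; lra).
      replace (INR n * ((2 * INR m + 1) * - sin t * cos t ^ (2 * m) * sin t + cos t * cos t ^ (2 * m) * cos t))%R
        with (INR n * ((2 * INR m + 1) * - (1 - cos t * cos t) * cos t ^ (2 * m) + cos t * cos t ^ (2 * m) * cos t))%R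
        by (rewrite <- S2; ring).
      replace (INR n) with (2 * (INR m + 1))%R by (rewrite En; rewrite mult_INR, (S_INR m); simpl; ring).
      unfold Cnat; rewrite S_INR.
      generalize (cos t) (cos t ^ (2 * m))%R (sin t) (INR m); intros x y z k.
      repeat (rewrite ?RtoC_mult, ?RtoC_plus, ?RtoC_minus, ?RtoC_opp); ring.
    - intros t _; apply cont_minus; (apply cont_mult; [apply cont_const|apply cont_mult; [|apply cos_lin_cont]]);
        apply cont_RtoC, continuous_cos_pow. }
  assert (E := eq_trans (eq_sym (is_CInt_unique _ _ _ _ I)) (is_CInt_unique _ _ _ _ J)).
  apply Ceq_minus; rewrite E; unfold Phi.
  rewrite cos_PI2, sin_0, sin_lin_0, !pow_i by lia.
  rewrite !Rmult_0_r, Rmult_0_l; ring.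
Qed.

Fixpoint wallis_0 (m : nat) : R :=
  match m with O => (PI / 2)%R | S m' => (wallis_0 m' * (2 * INR m' + 1) / (2 * INR (S m')))%R end.

Lemma wallis_0_pos m : (0 < wallis_0 m)%R.
Proof.
  induction m; [simpl; generalize PI_RGT_0; lra|].
  change (wallis_0 (S m)) with (wallis_0 m * (2 * INR m + 1) / (2 * INR (S m)))%R.
  assert (0 < INR (S m))%R by (apply lt_0_INR; lia).
  apply Rdiv_lt_0_compat; [apply Rmult_lt_0_compat; auto; generalize (pos_INR m); lra|lra].
Qed.

Lemma cos_lin_0_l t : cos_lin 0 t = 1.
Proof.
  unfold cos_lin; replace (RtoC t * (Ci * 0)) with (RtoC 0) by ring.
  replace (RtoC t * - (Ci * 0)) with (RtoC 0) by ring; rewrite Cexp_0; field; apply C2_nz.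
Qed.

Lemma wallis_0_l (s : C) : s * wallis 0 s = sin_lin s (PI / 2).
Proof.
  rewrite <- (is_CInt_unique _ _ _ _ (is_CInt_scal _ _ _ _ s (wallis_correct 0 s))).
  replace (sin_lin s (PI / 2)) with (sin_lin s (PI / 2) - sin_lin s 0) by (rewrite sin_lin_0; ring).
  apply is_CInt_unique.
  apply (is_CInt_ext (fun t => s * cos_lin s t)); [intros; simpl; ring|].
  apply is_CInt_derive; intros t _; [apply sin_lin_derive|apply cont_mult; [apply cont_const|apply cos_lin_cont]].
Qed.

Lemma wallis_0_r m : wallis m 0 = RtoC (wallis_0 m).
Proof.
  induction m.
  - apply is_CInt_unique; unfold wallis_0.
    apply (is_CInt_ext (fun _ => RtoC 1)); [intros; rewrite cos_lin_0_l; simpl; ring|].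
    generalize (is_CInt_const 0 (PI / 2) 1); rewrite Cmult_1_r, Rminus_0_r; auto.
  - assert (H := wallis_step m 0); rewrite IHm in H.
    assert (Hn := Cnat_neq_0 (S m) ltac:(lia)); assert (H2 := C2_nz).
    assert (Hr : (0 < INR (S m))%R) by (apply lt_0_INR; lia).
    apply (f_equal (fun x => x / (4 * Cnat (S m) * Cnat (S m)))) in H.
    transitivity ((4 * Cnat (S m) * Cnat (S m) - 0 * 0) * wallis (S m) 0 / (4 * Cnat (S m) * Cnat (S m))).
    + assert (H4 : RtoC 4 <> 0) by (intros E; apply RtoC_inj in E; lra).
      field; auto.
    + rewrite H; change (wallis_0 (S m)) with (wallis_0 m * (2 * INR m + 1) / (2 * INR (S m)))%R.
      unfold Rdiv; rewrite !RtoC_mult, RtoC_inv, RtoC_mult, RtoC_plus, RtoC_mult by lra.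
      replace (RtoC 4) with (RtoC 2 * RtoC 2) by (rewrite <- RtoC_mult; f_equal; ring).
      fold (Cnat m); fold (Cnat (S m)); field; auto.
Qed.

Lemma Cmod_Cexp_sub1 u : (Cmod (Cexp u - 1) <= Cmod u * exp (Cmod u))%R.
Proof.
  assert (B := mean_value_seg Cexp Cexp 0 u 0 (exp (Cmod u)) (fun t _ => Cderiv_Cexp _) (fun t _ => cont_Cexp _)).
  rewrite Cexp_0 in B.
  replace (Cexp u - 1 - (u - 0) * 0) with (Cexp u - 1) in B by ring.
  replace (u - 0) with u in B by ring; apply B; intros t Ht.
  replace (Cexp (seg 0 u t) - 0) with (Cexp (seg 0 u t)) by ring; rewrite Cmod_Cexp.
  assert (H : (Re (seg 0 u t) <= Cmod u)%R).
  { rewrite Re_seg; simpl; generalize (re_le_Cmod u) (Rle_abs (Re u)) (Cmod_ge_0 u); intros.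
    assert (t * Re u <= t * Cmod u)%R by (apply Rmult_le_compat_l; lra).
    assert (t * Cmod u <= 1 * Cmod u)%R by (apply Rmult_le_compat_r; lra); lra. }
  destruct H as [H|H]; [apply Rlt_le, exp_increasing, H|rewrite H; lra].
Qed.

Lemma exp_le x y : (x <= y)%R -> (exp x <= exp y)%R.
Proof. intros [H| ->]; [apply Rlt_le, exp_increasing, H|lra]. Qed.

(** With u = i s t, cos(s t) - 1 = (e^u - 1)^2 e^(-u) / 2, and each factor e^u - 1 is O(t). The
    constants are generous. *)
Lemma cos_lin_sub1 s t : (0 <= t <= PI / 2)%R ->
  (Cmod (cos_lin s t - 1) <= 4 * Cmod s * Cmod s * exp (4 * PI * Cmod s) * (t * t))%R.
Proof.
  intros Ht; assert (P := PI_RGT_0); assert (Ps := Cmod_ge_0 s).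
  set (u := RtoC t * (Ci * s)); set (h := RtoC (/ 2) * u).
  assert (E : cos_lin s t - 1 = (Cexp u - 1) * (Cexp u - 1) * Cexp (- u) / 2).
  { unfold cos_lin; fold u; replace (RtoC t * - (Ci * s)) with (- u) by (unfold u; ring).
    rewrite Cexp_opp; field; apply Cexp_neq_0. }
  assert (Mu : Cmod u = (t * Cmod s)%R).
  { unfold u; rewrite !Cmod_mult, Cmod_Ci, Cmod_R, Rabs_pos_eq by lra; ring. }
  rewrite E; unfold Cdiv; rewrite !Cmod_mult, Cmod_Cexp.
  replace (Cmod (/ 2)) with (/ 2)%R by (rewrite <- RtoC_inv, Cmod_R, Rabs_pos_eq by lra; lra).
  assert (B := Cmod_Cexp_sub1 u); rewrite Mu in B.
  assert (Hb : (t * Cmod s <= PI / 2 * Cmod s)%R) by (apply Rmult_le_compat_r; lra).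
  set (ex := exp (PI * Cmod s)).
  assert (B1 : (Cmod (Cexp u - 1) <= t * Cmod s * ex)%R).
  { eapply Rle_trans; [exact B|]; apply Rmult_le_compat_l; [apply Rmult_le_pos; lra|].
    apply exp_le; assert (0 <= PI * Cmod s)%R by (apply Rmult_le_pos; lra); lra. }
  assert (B2 : (exp (Re (- u)) <= ex)%R).
  { apply exp_le; generalize (re_le_Cmod (- u)) (Rle_abs (Re (- u))); rewrite Cmod_opp, Mu.
    assert (0 <= PI * Cmod s)%R by (apply Rmult_le_pos; lra); lra. }
  assert (Hex : (1 <= ex)%R).
  { unfold ex; rewrite <- exp_0; apply exp_le, Rmult_le_pos; lra. }
  assert (E4 : exp (4 * PI * Cmod s) = (ex * ex * ex * ex)%R).
  { unfold ex; rewrite <- !exp_plus; f_equal; ring. }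
  rewrite E4; assert (Pe := exp_pos (Re (- u))); assert (Pc := Cmod_ge_0 (Cexp u - 1)).
  set (a := (t * Cmod s * ex)%R) in *.
  assert (Pa : (0 <= a)%R) by lra.
  assert (Q1 : (Cmod (Cexp u - 1) * Cmod (Cexp u - 1) <= a * a)%R) by (apply Rmult_le_compat; lra).
  assert (Q2 : (Cmod (Cexp u - 1) * Cmod (Cexp u - 1) * exp (Re (- u)) <= a * a * ex)%R).
  { apply Rmult_le_compat; try lra; apply Rmult_le_pos; lra. }
  assert (Q3 : (a * a * ex * 1 <= a * a * ex * ex)%R).
  { apply Rmult_le_compat_l; auto; apply Rmult_le_pos; [apply Rmult_le_pos|]; lra. }
  assert (Q4 : (0 <= a * a * ex * ex)%R) by (repeat apply Rmult_le_pos; lra).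
  replace (4 * Cmod s * Cmod s * (ex * ex * ex * ex) * (t * t))%R with (4 * (a * a * ex * ex))%R by (unfold a; ring).
  lra.
Qed.

(** The inequality t <= tan t: sin x - x cos x has derivative x sin x >= 0. *)
Lemma t_cos_le_sin t : (0 <= t <= PI / 2)%R -> (t * cos t <= sin t)%R.
Proof.
  intros Ht.
  destruct (MVT_gen (fun x => sin x - x * cos x)%R 0 t (fun x => x * sin x)%R) as [c [Hc E]].
  - intros x _; auto_derive; auto; ring.
  - intros x _; reg.
  - rewrite Rmin_left, Rmax_right in Hc by lra; rewrite sin_0 in E.
    assert (0 <= sin c)%R by (apply sin_ge_0; generalize PI_RGT_0; lra).
    assert (0 <= c * sin c * (t - 0))%R by (repeat apply Rmult_le_pos; lra).
    lra.
Qed.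

(** By t cos t <= sin t, cos^(2m+2) t^2 <= cos^(2m) sin^2 = cos^(2m) - cos^(2m+2). The quadratic
    error of [cos_lin_sub1] thus integrates to a difference of consecutive Wallis integrals. *)
Lemma wallis_close s : exists A, (0 <= A)%R /\ forall m, 
  (Cmod (wallis (S m) s - RtoC (wallis_0 (S m))) <= A * (wallis_0 m - wallis_0 (S m)))%R.
Proof.
  exists (4 * Cmod s * Cmod s * exp (4 * PI * Cmod s))%R.
  set (A := (4 * Cmod s * Cmod s * exp (4 * PI * Cmod s))%R).
  assert (HA : (0 <= A)%R).
  { unfold A; assert (P := Cmod_ge_0 s); assert (P2 := exp_pos (4 * PI * Cmod s)).
    repeat apply Rmult_le_pos; lra. }
  split; [exact HA|]; intros m.
  assert (I := is_CInt_minus _ _ _ _ _ _ (wallis_correct (S m) s) (wallis_correct (S m) 0)).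
  assert (K : is_RInt (fun t => A * (cos t ^ (2 * m) - cos t ^ (2 * S m)))%R 0 (PI / 2) (A * (wallis_0 m - wallis_0 (S m)))%R).
  { apply (is_RInt_scal (V := R_NormedModule) (fun t => cos t ^ (2 * m) - cos t ^ (2 * S m))%R).
    assert (W : forall k, is_RInt (fun t => cos t ^ (2 * k))%R 0 (PI / 2) (wallis_0 k)).
    { intros k; assert (H := proj1 (proj1 (is_CInt_iff _ _ _ _) (wallis_correct k 0))).
      rewrite wallis_0_r in H; revert H; apply is_RInt_ext; intros t _; rewrite cos_lin_0_l, Cmult_1_r; reflexivity. }
    apply (is_RInt_minus (V := R_NormedModule)); apply W. }
  rewrite <- wallis_0_r; assert (Pp := PI_RGT_0).
  eapply is_CInt_bound_fun; [|  |exact I|exact K]; [lra|]; intros t Ht; cbv beta; rewrite cos_lin_0_l.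
  replace (RtoC (cos t ^ (2 * S m)) * cos_lin s t - RtoC (cos t ^ (2 * S m)) * 1)
    with (RtoC (cos t ^ (2 * S m)) * (cos_lin s t - 1)) by ring.
  assert (Hc : (0 <= cos t)%R) by (apply cos_ge_0; lra).
  rewrite Cmod_mult, Cmod_R, Rabs_pos_eq by (apply pow_le; auto).
  replace (cos t ^ (2 * S m))%R with (cos t * cos t * cos t ^ (2 * m))%R
    by (replace (2 * S m)%nat with (S (S (2 * m))) by lia; simpl; ring).
  assert (Hp : (0 <= cos t ^ (2 * m))%R) by (apply pow_le; auto).
  assert (B := cos_lin_sub1 s t Ht); fold A in B.
  eapply Rle_trans; [apply Rmult_le_compat_l; [|exact B]; repeat apply Rmult_le_pos; auto|].
  assert (Hs := t_cos_le_sin t Ht).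
  assert (Q : (t * cos t * (t * cos t) <= sin t * sin t)%R).
  { apply Rmult_le_compat; auto; apply Rmult_le_pos; lra. }
  replace (sin t * sin t)%R with (1 - cos t * cos t)%R in Q by (generalize (sin2_cos2 t); unfold Rsqr; lra).
  replace (cos t * cos t * cos t ^ (2 * m) * (A * (t * t)))%R
    with (A * cos t ^ (2 * m) * (t * cos t * (t * cos t)))%R by ring.
  replace (A * (cos t ^ (2 * m) - cos t * cos t * cos t ^ (2 * m)))%R
    with (A * cos t ^ (2 * m) * (1 - cos t * cos t))%R by ring.
  apply Rmult_le_compat_l; auto; apply Rmult_le_pos; auto.
Qed.

(** The recursion gives wallis_0 m - wallis_0 (m + 1) = wallis_0 m / (2 (m + 1)), so the relative
    error is O(1/m). *)
Lemma wallis_ratio s : filterlim (fun m => wallis m s / RtoC (wallis_0 m)) eventually (@locally C_UniformSpace (RtoC 1)).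
Proof.
  destruct (wallis_close s) as [A [HA H]].
  apply flim_rate with (A := A); intros n Hn; destruct n as [|m]; [lia|].
  assert (P := wallis_0_pos (S m)); assert (N : RtoC (wallis_0 (S m)) <> 0) by (intros E; apply RtoC_inj in E; lra).
  replace (wallis (S m) s / RtoC (wallis_0 (S m)) - RtoC 1) with ((wallis (S m) s - RtoC (wallis_0 (S m))) / RtoC (wallis_0 (S m)))
    by (field; auto).
  rewrite Cmod_div, Cmod_R, Rabs_pos_eq by (auto; lra).
  apply Rmult_le_reg_r with (wallis_0 (S m)); auto; unfold Rdiv at 1; rewrite Rmult_assoc, Rinv_l, Rmult_1_r by lra.
  eapply Rle_trans; [apply H|]; unfold Rdiv; rewrite Rmult_assoc; apply Rmult_le_compat_l; auto.
  change (wallis_0 (S m)) with (wallis_0 m * (2 * INR m + 1) / (2 * INR (S m)))%R.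
  assert (Pm := wallis_0_pos m); assert (Pi := pos_INR m); rewrite S_INR.
  replace (wallis_0 m - wallis_0 m * (2 * INR m + 1) / (2 * (INR m + 1)))%R with (wallis_0 m / (2 * (INR m + 1)))%R by (field; lra).
  replace (/ (INR m + 1) * (wallis_0 m * (2 * INR m + 1) / (2 * (INR m + 1))))%R
    with (wallis_0 m / (2 * (INR m + 1)) * ((2 * INR m + 1) / (INR m + 1)))%R by (field; lra).
  rewrite <- (Rmult_1_r (wallis_0 m / (2 * (INR m + 1)))) at 1.
  apply Rmult_le_compat_l; [apply Rlt_le, Rdiv_lt_0_compat; lra|].
  apply Rmult_le_reg_r with (INR m + 1)%R; [lra|]; unfold Rdiv; rewrite Rmult_assoc, Rinv_l by lra; lra.
Qed.

Lemma Csin_opp z : Csin (- z) = - Csin z.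
Proof.
  unfold Csin; replace (- (Ci * - z)) with (Ci * z) by ring; replace (Ci * - z) with (- (Ci * z)) by ring.
  field; apply Ci_nz.
Qed.

Lemma sin_lin_Csin s t : sin_lin s t = Csin (RtoC t * s).
Proof.
  unfold sin_lin, Csin; replace (RtoC t * (Ci * s)) with (Ci * (RtoC t * s)) by ring.
  replace (RtoC t * - (Ci * s)) with (- (Ci * (RtoC t * s))) by ring; auto.
Qed.

(** Euler's product truncated at n, the Wallis quotient being the remainder. The argument 2s turns
    the factor 4 (n + 1)^2 - (2s)^2 of [wallis_step] into 4 (n + 1 - s) (n + 1 + s), the two new
    factors of the rising factorials. *)
Lemma sine_product n (s : C) :
  poch (S n) s * poch n (1 - s) * (wallis n (2 * s) / RtoC (wallis_0 n)) * RtoC PI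
  = Cnat (fact n) * Cnat (fact n) * Csin (RtoC PI * s).
Proof.
  assert (PP := PI_RGT_0); assert (H2 := C2_nz).
  induction n.
  - assert (E := wallis_0_l (2 * s)); rewrite sin_lin_Csin in E.
    replace (RtoC (PI / 2) * (2 * s)) with (RtoC PI * s) in E.
    2:{ unfold Rdiv; rewrite RtoC_mult, RtoC_inv by lra; field; auto. }
    rewrite <- E; simpl wallis_0; unfold Rdiv; rewrite RtoC_mult, RtoC_inv by lra.
    assert (RtoC PI <> 0) by (intros E'; apply RtoC_inj in E'; lra).
    unfold poch, Cprod, Cnat; simpl; field; auto.
  - assert (W := wallis_step n (2 * s)).
    assert (Hn := Cnat_neq_0 (S n) ltac:(lia)).
    assert (Pw := wallis_0_pos n); assert (Nw : RtoC (wallis_0 n) <> 0) by (intros E; apply RtoC_inj in E; lra).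
    assert (Hi := pos_INR n).
    assert (Nk : RtoC (2 * INR n + 1) <> 0) by (intros E; apply RtoC_inj in E; lra).
    assert (HE : RtoC (wallis_0 (S n)) = RtoC (wallis_0 n) * RtoC (2 * INR n + 1) / (2 * Cnat (S n))).
    { change (wallis_0 (S n)) with (wallis_0 n * (2 * INR n + 1) / (2 * INR (S n)))%R.
      assert (0 < INR (S n))%R by (apply lt_0_INR; lia).
      unfold Rdiv; rewrite !RtoC_mult, RtoC_inv, RtoC_mult by lra; auto. }
    rewrite fact_simpl, Cnat_mult, (poch_S (S n)), (poch_S n (1 - s)).
    transitivity (Cnat (S n) * Cnat (S n) * (Cnat (fact n) * Cnat (fact n) * Csin (RtoC PI * s))); [|ring].
    rewrite <- IHn.
    replace (wallis n (2 * s)) with ((4 * Cnat (S n) * Cnat (S n) - 2 * s * (2 * s)) * wallis (S n) (2 * s)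
      / (2 * Cnat (S n) * RtoC (2 * INR n + 1))).
    2:{ rewrite W, RtoC_plus, RtoC_mult; fold (Cnat n); field; repeat split; auto.
        unfold Cnat; rewrite <- RtoC_mult, <- RtoC_plus; auto. }
    rewrite HE; replace (1 - s + Cnat n) with (Cnat (S n) - s) by (rewrite Cnat_S; ring).
    replace (RtoC 4) with (RtoC 2 * RtoC 2) by (rewrite <- RtoC_mult; f_equal; ring).
    field; auto.
Qed.

(** In the product of the Gauss quotients at s and 1 - s the powers combine to n^s n^(1-s) = n. By
    [sine_product] what remains is the Wallis quotient and the factor n / (n + 1 - s), both tending
    to 1. *)
Lemma Gamma_reflection s : Gamma_regular s -> Gamma_regular (1 - s) ->
  Gamma s * Gamma (1 - s) * Csin (RtoC PI * s) = RtoC PI.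
Proof.
  intros Hs Hs1.
  assert (L := flim_mult eventually _ _ _ _
    (flim_mult eventually _ _ _ _ (Gamma_lim s Hs) (Gamma_lim _ Hs1))
    (flim_const eventually (Csin (RtoC PI * s)))).
  apply (flim_unique eventually _ _ _ L).
  assert (A := proj1 (Gamma_regular_iff _) Hs); assert (B := proj1 (Gamma_regular_iff _) Hs1).
  apply (flim_ext eventually (fun n => RtoC PI * (wallis n (2 * s) / RtoC (wallis_0 n)) * / (1 + (1 - s) * / Cnat n))).
  { exists 1%nat; intros n Hn; rewrite !Gamma_seq_poch.
    assert (P := sine_product n s).
    assert (N1 : poch (S n) s <> 0) by (apply poch_neq_0; auto).
    assert (N2 : poch n (1 - s) <> 0) by (apply poch_neq_0; auto).
    assert (N3 := B n); assert (N4 := Cnat_neq_0 n Hn).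
    assert (E : Cpowc (Cnat n) s * Cpowc (Cnat n) (1 - s) = Cnat n).
    { unfold Cnat; assert (0 < INR n)%R by (apply lt_0_INR; lia); rewrite <- Cpowc_pos_plus by auto.
      replace (s + (1 - s)) with (RtoC 1) by ring; apply Cpowc_pos_1; auto. }
    rewrite (poch_S n (1 - s)).
    transitivity ((Cnat (fact n) * Cnat (fact n) * Csin (RtoC PI * s)) * (Cpowc (Cnat n) s * Cpowc (Cnat n) (1 - s))
      / (poch (S n) s * (poch n (1 - s) * (1 - s + Cnat n)))); [|field; auto].
    rewrite E, <- P.
    assert (N5 : RtoC (wallis_0 n) <> 0) by (intros E'; apply RtoC_inj in E'; generalize (wallis_0_pos n); lra).
    field; auto. }
  assert (HE : RtoC PI * 1 * / (1 + (1 - s) * 0) = RtoC PI).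
  { field; replace (1 + (1 - s) * 0) with (RtoC 1) by ring; apply C1_nz. }
  apply (eq_rect _ (fun l => filterlim _ eventually (@locally C_UniformSpace l)))
    with (2 := HE).
  apply flim_mult; [apply eventually_filter| |].
  - apply flim_mult; [apply eventually_filter|apply flim_const, eventually_filter|apply wallis_ratio].
  - apply flim_inv; [apply eventually_filter| |].
    + replace (1 + (1 - s) * 0) with (RtoC 1) by ring; apply C1_nz.
    + apply flim_plus; [apply eventually_filter|apply flim_const, eventually_filter|].
      apply flim_mult; [apply eventually_filter|apply flim_const, eventually_filter|].
      apply flim_rate with (A := 1%R); intros n Hn.
      replace (/ Cnat n - 0) with (/ Cnat n) by ring; rewrite Cmod_inv by (apply Cnat_neq_0; auto).
      unfold Cnat; rewrite Cmod_R, Rabs_pos_eq by apply pos_INR; lra.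
Qed.

Lemma Csin_pi_nat k : Csin (RtoC PI * - Cnat k) = 0.
Proof.
  replace (RtoC PI * - Cnat k) with (- (RtoC PI * Cnat k)) by ring; rewrite Csin_opp.
  assert (E : forall x, Csin (RtoC x) = RtoC (sin x)).
  { intros x; unfold Csin.
    assert (E1 : Cexp (Ci * RtoC x) = (cos x, sin x)).
    { replace (Ci * RtoC x) with ((0%R, x) : C) by (unfold Ci, Cmult, RtoC; simpl; f_equal; ring).
      unfold Cexp; simpl; rewrite exp_0; ring. }
    rewrite Cexp_opp, E1.
    assert (S2 := sin2_cos2 x); unfold Rsqr in S2.
    assert (E2 : / (cos x, sin x) = (cos x, - sin x)%R).
    { unfold Cinv; simpl; replace (cos x * (cos x * 1) + sin x * (sin x * 1))%R with 1%R by lra.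
      f_equal; field. }
    rewrite E2; unfold Cdiv, Cinv, Ci, Cminus, Cmult, Cplus, Copp, RtoC; simpl; f_equal; field. }
  unfold Cnat; rewrite <- RtoC_mult, E.
  replace (sin (PI * INR k)) with 0%R; [ring|].
  symmetry; induction k; [simpl; rewrite Rmult_0_r; apply sin_0|].
  rewrite S_INR, Rmult_plus_distr_l, Rmult_1_r, neg_sin, IHk; ring.
Qed.

Lemma not_regular s : ~ Gamma_regular s -> exists k, s = - Cnat k.
Proof. intros Hs; apply Classical_Prop.NNPP; intros H; apply Hs; intros k E; apply H; exists k; auto. Qed.

(** At a pole of Gamma(s) the left side is 0 by convention and the right side by the zero of the
    sine, so only 1 - s has to be regular. *)
Lemma rGamma_reflection s : Gamma_regular (1 - s) ->
  / Gamma s = Gamma (1 - s) * Csin (RtoC PI * s) / RtoC PI.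
Proof.
  intros H1; assert (NP : RtoC PI <> 0) by (intros E; apply RtoC_inj in E; generalize PI_RGT_0; lra).
  destruct (excluded_middle_informative (Gamma_regular s)) as [Hs|Hs].
  - assert (N := Gamma_neq_0 s Hs); assert (R := Gamma_reflection s Hs H1).
    revert R; generalize (Csin (RtoC PI * s)); intros X R.
    transitivity (Gamma s * Gamma (1 - s) * X / (Gamma s * RtoC PI)); [rewrite R|]; field; auto.
  - destruct (not_regular s Hs) as [k ->]; rewrite Gamma_pole, Cinv_0, Csin_pi_nat; unfold Cdiv; ring.
Qed.

(** * Growth of Gamma in vertical strips *)

Lemma Rmult_shuffle (a p b q : R) : (a * p * (b * q) = a * b * (p * q))%R.
Proof. ring. Qed.

Lemma Cprod_cons x l : Cprod (x :: l) = x * Cprod l.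
Proof. reflexivity. Qed.

Lemma Cmod_Gamma_seq n s : (1 <= n)%nat -> Gamma_regular s ->
  Cmod (Gamma_seq s n) = (INR (fact n) * exp (Re s * ln (INR n)) / Cmod (poch (S n) s))%R.
Proof.
  intros Hn Hs; rewrite Gamma_seq_poch, Cmod_div, Cmod_mult, Cpowc_nat, Cmod_Cexp by
    (auto; apply poch_neq_0; intros; apply Gamma_regular_iff; auto).
  unfold Cnat; rewrite Cmod_R, (Rabs_pos_eq _ (pos_INR _)).
  replace (Re (s * RtoC (ln (INR n)))) with (Re s * ln (INR n))%R; auto.
  unfold Re; simpl; ring.
Qed.

Lemma Cmod_sq (z : C) : (Cmod z * Cmod z = Re z * Re z + Im z * Im z)%R.
Proof. generalize (Cmod2_alt z); simpl; lra. Qed.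

Lemma Cmod_le_sq (a b : R) : (0 <= b)%R -> (a * a <= b * b)%R -> (a <= b)%R.
Proof. intros Hb H; apply Rnot_lt_le; intros L; assert (b * b < a * a)%R by (apply Rmult_le_0_lt_compat; lra); lra. Qed.

Lemma Cmod_Gamma_conj (x y : R) : (0 < x)%R -> Cmod (Gamma (x, y)) = Cmod (Gamma (x, (- y)%R)).
Proof.
  intros Hx.
  assert (R1 : Gamma_regular (x, y)) by (apply rhp_regular; exact Hx).
  assert (R2 : Gamma_regular (x, (- y)%R)) by (apply rhp_regular; exact Hx).
  assert (L1 := flim_Cmod eventually _ _ (Gamma_lim _ R1)).
  assert (L2 := flim_Cmod eventually _ _ (Gamma_lim _ R2)).
  apply (filterlim_locally_unique (F := eventually) (K := R_AbsRing) (V := R_NormedModule) _ _ _ L1).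
  revert L2; apply filterlim_ext_loc; exists 1%nat; intros n Hn.
  rewrite !Cmod_Gamma_seq by auto; f_equal.
  unfold poch; generalize (seq 0 (S n)); intros l; induction l as [|k l IH]; [reflexivity|]; cbn [map]; rewrite !Cprod_cons.
  rewrite !Cmod_mult, IH; f_equal.
  unfold Cmod, Cplus, Cnat, RtoC; simpl; f_equal; ring.
Qed.

(** Monotonicity of [|Gamma(x + iy)| / Gamma(x)], cross-multiplied; it holds factor by factor in Gauss' product. *)
Lemma Gamma_ratio_mono (x x' y : R) : (0 < x)%R -> (x <= x')%R ->
  (Cmod (Gamma (x, y)) * Cmod (Gamma (RtoC x')) <= Cmod (Gamma (x', y)) * Cmod (Gamma (RtoC x)))%R.
Proof.
  intros Hx Hxx.
  assert (RR : forall u v, (0 < u)%R -> Gamma_regular (u, v)) by (intros; apply rhp_regular; auto).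
  assert (LL : forall u v, (0 < u)%R -> filterlim (fun n => Cmod (Gamma_seq (u, v) n)) eventually
    (locally (Cmod (Gamma (u, v))))).
  { intros u v Hu; apply (flim_Cmod eventually), Gamma_lim; auto. }
  assert (L1 := is_lim_seq_mult' _ _ _ _ (LL x y Hx) (LL x' 0%R ltac:(lra))).
  assert (L2 := is_lim_seq_mult' _ _ _ _ (LL x' y ltac:(lra)) (LL x 0%R Hx)).
  refine (is_lim_seq_le_loc _ _ _ _ _ L1 L2); exists 1%nat; intros n Hn.
  rewrite !Cmod_Gamma_seq by (auto; apply RR; lra); simpl Re.
  assert (PN : forall u v, (0 < u)%R -> (0 < Cmod (poch (S n) (u, v)))%R).
  { intros u v Hu; apply Cmod_gt_0, poch_neq_0; intros k _; apply Gamma_regular_iff; auto. }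
  set (E := exp (x * ln (INR n))); set (E' := exp (x' * ln (INR n))); set (f := INR (fact n)).
  assert (P1 := PN x y Hx); assert (P2 := PN x' 0%R ltac:(lra)).
  assert (P3 := PN x' y ltac:(lra)); assert (P4 := PN x 0%R Hx).
  (* These products are the denominators, hence the reversed order. For a single factor, after
     squaring, the claim is y^2 (x + k)^2 <= y^2 (x' + k)^2. *)
  assert (HK : (Cmod (poch (S n) (x', y)) * Cmod (poch (S n) (x, 0%R)) <=
     Cmod (poch (S n) (x, y)) * Cmod (poch (S n) (x', 0%R)))%R).
  { clear - Hx Hxx; unfold poch; generalize (seq 0 (S n)); intros l; induction l as [|k l IH].
    - unfold Cprod; simpl; rewrite Cmod_1; lra.
    - cbn [map]; rewrite !Cprod_cons, !Cmod_mult.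
      rewrite (Rmult_shuffle (Cmod ((x', y) + Cnat k))), (Rmult_shuffle (Cmod ((x, y) + Cnat k))).
      apply Rmult_le_compat; [apply Rmult_le_pos; apply Cmod_ge_0|apply Rmult_le_pos; apply Cmod_ge_0| |exact IH].
      rewrite <- !Cmod_mult; apply Cmod_le_sq; [apply Cmod_ge_0|].
      rewrite !Cmod_mult.
      rewrite (Rmult_shuffle (Cmod ((x', y) + Cnat k))), (Rmult_shuffle (Cmod ((x, y) + Cnat k))).
      rewrite !Cmod_sq; unfold Re, Im, Cnat; simpl.
      assert (Hk := pos_INR k); generalize dependent (INR k); intros c Hc.
      assert (H1 : ((x + c) * (x + c) <= (x' + c) * (x' + c))%R) by (apply Rmult_le_compat; lra).
      assert (H2 : (0 <= y * y)%R) by (apply Rle_0_sqr).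
      assert (H3 : (y * y * ((x + c) * (x + c)) <= y * y * ((x' + c) * (x' + c)))%R) by (apply Rmult_le_compat_l; lra).
      lra. }
  assert (Pf : (0 < f)%R) by (unfold f; apply lt_0_INR, lt_O_fact).
  assert (PE : (0 < E)%R) by apply exp_pos; assert (PE' : (0 < E')%R) by apply exp_pos.
  apply Rmult_le_reg_r with (Cmod (poch (S n) (x, y)) * Cmod (poch (S n) (x', 0%R)) *
    (Cmod (poch (S n) (x', y)) * Cmod (poch (S n) (x, 0%R))))%R; [repeat apply Rmult_lt_0_compat; auto|].
  apply Rle_trans with (f * f * E * E' * (Cmod (poch (S n) (x', y)) * Cmod (poch (S n) (x, 0%R))))%R;
    [right; field; lra|].
  apply Rle_trans with (f * f * E * E' * (Cmod (poch (S n) (x, y)) * Cmod (poch (S n) (x', 0%R))))%R;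
    [|right; field; lra].
  apply Rmult_le_compat_l; auto; repeat apply Rmult_le_pos; lra.
Qed.

Lemma Cmod_Csin_i (y : R) : (0 < y)%R -> Cmod (Csin (Ci * RtoC y)) = ((exp y - exp (- y)) / 2)%R.
Proof.
  intros Hy; unfold Csin.
  replace (Ci * (Ci * RtoC y)) with (RtoC (- y)) by (rewrite Cmult_assoc, Ci2, <- RtoC_mult; f_equal; ring).
  replace (- RtoC (- y)) with (RtoC y) by (rewrite <- RtoC_opp; f_equal; ring).
  rewrite !Cexp_RtoC, <- RtoC_minus, Cmod_div, Cmod_mult, Cmod_Ci, !Cmod_R
    by (apply Cmult_neq_0; [apply C2_nz|apply Ci_nz]).
  rewrite (Rabs_pos_eq 2), Rmult_1_r by lra.
  assert (exp (- y) < exp y)%R by (apply exp_increasing; lra).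
  rewrite <- Rabs_Ropp, Rabs_pos_eq by lra; field.
Qed.

(** The reflection formula at s = iy, with Gamma(1 + iy) = iy Gamma(iy) and |Gamma(1 - iy)| =
    |Gamma(1 + iy)|. *)
Lemma Gamma_1_iy (y : R) : (0 < y)%R ->
  (Cmod (Gamma (1%R, y)) * Cmod (Gamma (1%R, y)) * ((exp (PI * y) - exp (- (PI * y))) / 2) = PI * y)%R.
Proof.
  intros Hy; assert (PP := PI_RGT_0).
  assert (H0 : ((0%R, y) : C) <> 0) by (intros E; apply (f_equal snd) in E; simpl in E; lra).
  assert (R1 : Gamma_regular (0%R, y)).
  { apply Gamma_regular_iff; intros k E; apply (f_equal snd) in E; simpl in E; lra. }
  assert (R2 : Gamma_regular (1 - (0%R, y))).
  { apply Gamma_regular_iff; intros k E; apply (f_equal snd) in E; simpl in E; lra. }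
  assert (E := Gamma_reflection _ R1 R2).
  replace (RtoC PI * (0%R, y)) with (Ci * RtoC (PI * y)) in E
    by (unfold Ci, RtoC, Cmult; simpl; f_equal; ring).
  assert (E1 : Gamma (1%R, y) = (0%R, y) * Gamma (0%R, y)).
  { rewrite <- Gamma_succ by auto; f_equal; unfold Cplus, RtoC; simpl; f_equal; ring. }
  replace (1 - (0%R, y)) with ((1%R, (- y)%R) : C) in E
    by (unfold Cminus, Cplus, Copp, RtoC; simpl; f_equal; ring).
  apply (f_equal Cmod) in E; rewrite !Cmod_mult, Cmod_Csin_i, Cmod_R, Rabs_pos_eq in E
    by (try apply Rmult_lt_0_compat; lra).
  rewrite <- Cmod_Gamma_conj in E by lra.
  rewrite E1 at 1; rewrite Cmod_mult.
  replace (Cmod (0%R, y)) with y.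
  2:{ replace ((0%R, y) : C) with (Ci * RtoC y) by (unfold Ci, RtoC, Cmult; simpl; f_equal; ring).
      rewrite Cmod_mult, Cmod_Ci, Cmod_R, Rabs_pos_eq by lra; ring. }
  transitivity (y * (Cmod (Gamma (0%R, y)) * Cmod (Gamma (1%R, y)) * ((exp (PI * y) - exp (- (PI * y))) / 2)))%R;
    [ring|rewrite E; ring].
Qed.

Lemma Gamma_1_bounds (y : R) : (1 <= Rabs y)%R ->
  (exp (- (PI / 2 * Rabs y)) <= Cmod (Gamma (1%R, y)) <= 4 * (1 + Rabs y) * exp (- (PI / 2 * Rabs y)))%R.
Proof.
  intros Hy.
  assert (E : Cmod (Gamma (1%R, y)) = Cmod (Gamma (1%R, Rabs y))).
  { unfold Rabs; destruct Rcase_abs; auto; apply Cmod_Gamma_conj; lra. }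
  rewrite E; clear E; revert Hy; generalize (Rabs y); clear y; intros y Hy.
  assert (H := Gamma_1_iy y ltac:(lra)); assert (P := Cmod_ge_0 (Gamma (1%R, y))).
  revert H P; generalize (Cmod (Gamma (1%R, y))); intros g H P.
  assert (PP := PI_RGT_0); assert (P3 : (3 < PI)%R) by (generalize PI2_3_2; unfold PI2; lra).
  assert (P4 := PI_4).
  (* With g = |Gamma(1 + iy)| the identity reads g^2 (1 - e^4) = 2 PI y e^2. As y >= 1, e^2 =
     exp(-PI y) <= 1 / (1 + PI y) <= 1/4, so 1 - e^4 is close to 1 and both bounds follow. *)
  set (e := exp (- (PI / 2 * y))) in *.
  assert (Ee : (0 < e)%R) by apply exp_pos.
  assert (E2 : exp (- (PI * y)) = (e * e)%R) by (unfold e; rewrite <- exp_plus; f_equal; field).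
  assert (E3 : exp (PI * y) = (/ (e * e))%R).
  { rewrite <- E2, exp_Ropp, Rinv_inv; auto. }
  rewrite E2, E3 in H.
  assert (Pee : (0 < e * e)%R) by (apply Rmult_lt_0_compat; auto).
  assert (Hs : (e * e <= / 4)%R).
  { rewrite <- E2, exp_Ropp; apply Rinv_le_contravar; [lra|].
    generalize (exp_ineq1_le (PI * y)); assert (3 * 1 <= PI * y)%R by (apply Rmult_le_compat; lra); lra. }
  assert (H' : (g * g * (1 - e * e * (e * e)) = 2 * (PI * y) * (e * e))%R).
  { rewrite <- H; field; lra. }
  assert (Hq : (0 <= e * e * (e * e) <= / 4 * / 4)%R).
  { split; [apply Rmult_le_pos; lra|apply Rmult_le_compat; lra]. }
  assert (Pg : (0 <= g * g)%R) by (apply Rmult_le_pos; auto).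
  assert (PIy : (3 <= PI * y <= 4 * y)%R).
  { split; [replace 3%R with (3 * 1)%R by ring; apply Rmult_le_compat; lra|apply Rmult_le_compat_r; lra]. }
  split.
  - apply Cmod_le_sq; auto.
    assert (g * g * (1 - e * e * (e * e)) <= g * g * 1)%R by (apply Rmult_le_compat_l; lra).
    assert (2 * (PI * y) * (e * e) >= 2 * 3 * (e * e))%R by (apply Rle_ge, Rmult_le_compat_r; lra); lra.
  - apply Cmod_le_sq; [repeat apply Rmult_le_pos; lra|].
    assert (g * g * (1 - / 4 * / 4) <= g * g * (1 - e * e * (e * e)))%R by (apply Rmult_le_compat_l; lra).
    assert (2 * (PI * y) * (e * e) <= 2 * (4 * y) * (e * e))%R by (apply Rmult_le_compat_r; lra).
    replace (4 * (1 + y) * e * (4 * (1 + y) * e))%R with (16 * ((1 + y) * (1 + y)) * (e * e))%R by ring.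
    assert (y * (e * e) <= (1 + y) * (1 + y) * (e * e))%R.
    { apply Rmult_le_compat_r; [lra|].
      assert (0 <= y * y)%R by (apply Rle_0_sqr); lra. }
    assert (0 <= (1 + y) * (1 + y) * (e * e))%R by (repeat apply Rmult_le_pos; lra).
    lra.
Qed.

Lemma Gamma_real_bounds (B : R) : (1 <= B)%R -> exists c D, (0 < c)%R /\ (0 < D)%R /\
  forall x, (1 <= x <= B)%R -> (c <= Cmod (Gamma (RtoC x)) <= D)%R.
Proof.
  intros HB.
  assert (Hc : forall x, (1 <= x <= B)%R -> continuity_pt (fun x => Cmod (Gamma (RtoC x))) x).
  { intros x Hx; apply continuity_pt_filterlim; apply (cont_Cmod (fun x => Gamma (RtoC x))).
    apply (cont_comp Gamma RtoC); [apply cont_RtoC, continuous_id|].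
    apply Gamma_cont, rhp_regular; unfold rhp; simpl; lra. }
  assert (HP : forall x, (1 <= x)%R -> (0 < Cmod (Gamma (RtoC x)))%R).
  { intros x Hx; apply Cmod_gt_0, Gamma_neq_0, rhp_regular; unfold rhp; simpl; lra. }
  destruct (continuity_ab_maj _ 1 B HB Hc) as [M [HM M1]].
  destruct (continuity_ab_min _ 1 B HB Hc) as [m [Hm m1]].
  exists (Cmod (Gamma (RtoC m))), (Cmod (Gamma (RtoC M))); split; [apply HP, m1|].
  split; [apply HP, M1|]; intros x Hx; split; [apply Hm, Hx|apply HM, Hx].
Qed.

Lemma Cmod_poch_bound n (s : C) : (Cmod (poch n s) <= (Cmod s + INR n) ^ n)%R.
Proof.
  assert (G : forall j, (j <= n)%nat -> (Cmod (poch j s) <= (Cmod s + INR n) ^ j)%R).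
  { induction j; intros Hj; [unfold poch, Cprod; simpl; rewrite Cmod_1; lra|].
    rewrite poch_S, Cmod_mult; simpl pow; rewrite Rmult_comm.
    apply Rmult_le_compat; try apply Cmod_ge_0; [|apply IHj; lia].
    eapply Rle_trans; [apply Cmod_triangle|].
    unfold Cnat; rewrite Cmod_R, (Rabs_pos_eq _ (pos_INR _)).
    assert (INR j <= INR n)%R by (apply le_INR; lia); lra. }
  apply G; auto.
Qed.

Lemma Cmod_poch_ge1 n (s : C) : (1 <= Rabs (Im s))%R -> (1 <= Cmod (poch n s))%R.
Proof.
  intros H; induction n; [unfold poch, Cprod; simpl; rewrite Cmod_1; lra|].
  rewrite poch_S, Cmod_mult; rewrite <- (Rmult_1_l 1); apply Rmult_le_compat; try lra.
  eapply Rle_trans; [exact H|]; eapply Rle_trans; [|apply im_le_Cmod]; right; f_equal.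
  unfold Cnat, Im; simpl; ring.
Qed.

(** After k unit shifts the strip lies in 1 <= Re <= K + 1. There [Gamma_ratio_mono] compares a
    point with the points of the same height at the abscissas 1 and K + 1, where the size is known
    from [Gamma_1_bounds] and the functional equation. *)
Lemma Gamma_strip_bounds (al be : R) : exists (D : R) (A : nat), (0 < D)%R /\
  forall u : C, (al <= Re u <= be)%R -> (1 <= Rabs (Im u))%R ->
    (Cmod (Gamma u) <= D * (1 + Rabs (Im u)) ^ A * exp (- (PI / 2 * Rabs (Im u))))%R /\
    (Cmod (/ Gamma u) <= D * (1 + Rabs (Im u)) ^ A * exp (PI / 2 * Rabs (Im u)))%R.
Proof.
  destruct (nfloor_ex (Rabs al) (Rabs_pos _)) as [k0 [_ Hk0]].
  set (k := S (S k0)).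
  assert (Hk : (1 <= al + INR k)%R).
  { unfold k; rewrite !S_INR; unfold Rabs in Hk0; destruct Rcase_abs; lra. }
  destruct (nfloor_ex (Rabs (be + INR k)) (Rabs_pos _)) as [K [_ HK]].
  assert (HKb : (be + INR k <= INR K + 1)%R).
  { unfold Rabs in HK; destruct Rcase_abs; generalize (pos_INR K); lra. }
  destruct (Gamma_real_bounds (INR K + 1)) as [c [D [Hc [HD HcD]]]]; [generalize (pos_INR K); lra|].
  set (Q := (Rabs al + Rabs be + INR k + INR K + 2)%R).
  assert (HQ : (1 <= Q)%R).
  { unfold Q; generalize (Rabs_pos al) (Rabs_pos be) (pos_INR k) (pos_INR K); lra. }
  (* One constant and one exponent serve for Gamma and for 1/Gamma; neither is sharp. *)
  exists ((D / c + D / c) * Q ^ (k + K) * 4 + 1)%R, (k + K + 1)%nat.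
  assert (Hdc : (0 < D / c)%R) by (apply Rdiv_lt_0_compat; auto).
  assert (HQp : forall n, (1 <= Q ^ n)%R) by (intros; apply pow_R1_Rle; auto).
  split.
  { assert (0 < (D / c + D / c) * Q ^ (k + K))%R by (apply Rmult_lt_0_compat; [lra|generalize (HQp (k + K)%nat); lra]); lra. }
  intros u Hu Hy.
  set (y := Im u) in *; set (ay := Rabs y) in *.
  set (x := (Re u + INR k)%R).
  assert (Hx : (1 <= x <= INR K + 1)%R) by (unfold x; lra).
  assert (Eu : u + Cnat k = (x, y)).
  { unfold x, y, Cnat, Cplus, RtoC, Re, Im; destruct u; simpl; f_equal; ring. }
  assert (Hreg : Gamma_regular u).
  { apply Gamma_regular_iff; intros j E; apply (f_equal Im) in E.
    assert (Ej : Im (u + Cnat j) = y) by (unfold y, Im, Cnat; simpl; ring).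
    rewrite Ej in E; simpl in E; unfold ay in Hy; rewrite E, Rabs_R0 in Hy; lra. }
  assert (B1 := Gamma_1_bounds y Hy); fold ay in B1.
  set (e := exp (- (PI / 2 * ay))) in *.
  assert (He : (0 < e)%R) by apply exp_pos.
  assert (EI : exp (PI / 2 * ay) = (/ e)%R).
  { unfold e; rewrite exp_Ropp, Rinv_inv; auto. }
  assert (G1 : Cmod (Gamma (RtoC 1)) = 1%R).
  { rewrite (Gamma_of_lim (RtoC 1) (RtoC 1)); [apply Cmod_1|].
    apply (flim_ext eventually (fun n => Cnat n / Cnat (S n))); [|apply lim_n_Sn].
    exists 1%nat; intros n Hn; symmetry; apply Gamma_seq_1, Hn. }
  assert (GK : (Cmod (Gamma ((INR K + 1)%R, y)) <= (Q * (1 + ay)) ^ K * Cmod (Gamma (1%R, y)))%R).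
  { assert (R1 : Gamma_regular (1%R, y)) by (apply rhp_regular; unfold rhp; simpl; lra).
    rewrite (Gamma_poch K (1%R, y)).
    replace ((1%R, y) + Cnat K) with (((INR K + 1)%R, y) : C)
      by (unfold Cplus, Cnat, RtoC; simpl; f_equal; ring).
    assert (NP : poch K (1%R, y) <> 0) by (apply poch_neq_0; intros; apply Gamma_regular_iff; auto).
    rewrite Cmod_div by auto; assert (P := proj1 (Cmod_gt_0 _) NP).
    unfold Rdiv; rewrite <- Rmult_assoc, (Rmult_comm _ (Cmod (Gamma _))), Rmult_assoc.
    rewrite <- (Rmult_1_r (Cmod (Gamma ((INR K + 1)%R, y)))) at 1.
    apply Rmult_le_compat_l; [apply Cmod_ge_0|].
    apply Rmult_le_reg_r with (Cmod (poch K (1%R, y))); auto; rewrite Rmult_assoc, Rinv_l, Rmult_1_l, Rmult_1_r by lra.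
    eapply Rle_trans; [apply Cmod_poch_bound|]; apply pow_incr; split.
    - generalize (Cmod_ge_0 (1%R, y)) (pos_INR K); lra.
    - generalize (Cmod_le_Re_Im (1%R, y)); simpl; rewrite Rabs_R1; fold ay; intros.
      assert (1 * ay <= Q * ay)%R by (apply Rmult_le_compat_r; lra).
      unfold Q in *; generalize (Rabs_pos al) (Rabs_pos be) (pos_INR k); lra. }
  (* Monotonicity between the abscissas x and K + 1; the values on the real axis lie between c and
     D. *)
  assert (Up : (Cmod (Gamma (x, y)) <= D / c * ((Q * (1 + ay)) ^ K * (4 * (1 + ay) * e)))%R).
  { assert (M := Gamma_ratio_mono x (INR K + 1) y ltac:(lra) ltac:(lra)).
    assert (CK := HcD (INR K + 1)%R ltac:(generalize (pos_INR K); lra)); assert (C2 := HcD x Hx).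
    assert (Pg := Cmod_ge_0 (Gamma (x, y))); assert (Pg2 := Cmod_ge_0 (Gamma ((INR K + 1)%R, y))).
    assert (QK : (0 <= (Q * (1 + ay)) ^ K)%R) by (apply pow_le, Rmult_le_pos; lra).
    assert (M2 : (Cmod (Gamma (x, y)) * c <= Cmod (Gamma ((INR K + 1)%R, y)) * D)%R).
    { eapply Rle_trans; [apply Rmult_le_compat_l; [auto|apply CK]|].
      eapply Rle_trans; [exact M|]; apply Rmult_le_compat_l; lra. }
    apply Rmult_le_reg_r with c; auto; eapply Rle_trans; [exact M2|].
    replace (D / c * ((Q * (1 + ay)) ^ K * (4 * (1 + ay) * e)) * c)%R
      with ((Q * (1 + ay)) ^ K * (4 * (1 + ay) * e) * D)%R by (field; lra).
    apply Rmult_le_compat_r; [lra|]; eapply Rle_trans; [exact GK|].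
    apply Rmult_le_compat_l; lra. }
  (* Monotonicity between the abscissas 1 and x, with Gamma(1) = 1. *)
  assert (Lo : (c / D * e <= Cmod (Gamma (x, y)))%R).
  { assert (M := Gamma_ratio_mono 1 x y ltac:(lra) ltac:(lra)); rewrite G1, Rmult_1_r in M.
    assert (C2 := HcD x Hx).
    assert (e * c <= Cmod (Gamma (1%R, y)) * Cmod (Gamma (RtoC x)))%R by (apply Rmult_le_compat; lra).
    apply Rle_trans with (c / D * e * 1)%R; [lra|].
    assert (1 <= D / c)%R.
    { apply Rmult_le_reg_r with c; auto; unfold Rdiv; rewrite Rmult_assoc, Rinv_l by lra; lra. }
    assert (c <= D)%R by lra.
    assert (C3 := HcD 1%R ltac:(generalize (pos_INR K); lra)); rewrite G1 in C3.
    apply Rle_trans with (e * c)%R; [|lra].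
    replace (c / D * e * 1)%R with (e * c * / D)%R by (field; lra).
    rewrite <- (Rmult_1_r (e * c)) at 2; apply Rmult_le_compat_l; [apply Rmult_le_pos; lra|].
    rewrite <- Rinv_1; apply Rinv_le_contravar; lra. }
  assert (Hay : (1 <= 1 + ay)%R) by lra.
  assert (Hap : forall n, (1 <= (1 + ay) ^ n)%R) by (intros; apply pow_R1_Rle; auto).
  assert (NP : poch k u <> 0) by (apply poch_neq_0; intros; apply Gamma_regular_iff; auto).
  assert (Pp : (1 <= Cmod (poch k u))%R) by (apply Cmod_poch_ge1; auto).
  assert (Pp2 : (Cmod (poch k u) <= (Q * (1 + ay)) ^ k)%R).
  { eapply Rle_trans; [apply Cmod_poch_bound|]; apply pow_incr; split.
    - generalize (Cmod_ge_0 u) (pos_INR k); lra.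
    - generalize (Cmod_le_Re_Im u); fold y; fold ay; intros.
      assert (Rabs (Re u) <= Rabs al + Rabs be)%R by (unfold Rabs; repeat destruct Rcase_abs; lra).
      assert (1 * ay <= Q * ay)%R by (apply Rmult_le_compat_r; lra).
      unfold Q in *; generalize (pos_INR K); lra. }
  assert (Hpow : forall n m, (n <= m)%nat -> (Q ^ n <= Q ^ m)%R) by (intros; apply Rle_pow; auto).
  assert (Hpow2 : forall n m, (n <= m)%nat -> ((1 + ay) ^ n <= (1 + ay) ^ m)%R) by (intros; apply Rle_pow; auto).
  split.
  - rewrite (Gamma_poch k u), Eu, Cmod_div by auto.
    apply Rle_trans with (Cmod (Gamma (x, y))).
    { unfold Rdiv; rewrite <- (Rmult_1_r (Cmod (Gamma (x, y)))) at 2; apply Rmult_le_compat_l; [apply Cmod_ge_0|].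
      rewrite <- Rinv_1; apply Rinv_le_contravar; lra. }
    eapply Rle_trans; [exact Up|].
    apply Rle_trans with (((D / c + D / c) * Q ^ (k + K) * 4) * (1 + ay) ^ (k + K + 1) * e)%R.
    2:{ apply Rmult_le_compat_r; [lra|]; apply Rmult_le_compat_r; [generalize (Hap (k + K + 1)%nat); lra|lra]. }
    rewrite Rpow_mult_distr.
    replace (D / c * (Q ^ K * (1 + ay) ^ K * (4 * (1 + ay) * e)))%R
      with ((D / c * Q ^ K * 4) * (1 + ay) ^ (K + 1) * e)%R by (rewrite pow_add; simpl; ring).
    apply Rmult_le_compat_r; [lra|]; apply Rmult_le_compat.
    + generalize (HQp K); intros; apply Rmult_le_pos; [apply Rmult_le_pos|]; lra.
    + generalize (Hap (K + 1)%nat); lra.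
    + apply Rmult_le_compat_r; [lra|]; apply Rmult_le_compat; try lra; [generalize (HQp K); lra|apply Hpow; lia].
    + apply Hpow2; lia.
  - rewrite (rGamma_poch k u), Eu, Cmod_mult.
    assert (NG : Gamma (x, y) <> 0) by (apply Gamma_neq_0, rhp_regular; unfold rhp; simpl; lra).
    rewrite Cmod_inv, EI by auto.
    assert (Pcd : (0 < c / D)%R) by (apply Rdiv_lt_0_compat; auto).
    assert (L2 : (/ Cmod (Gamma (x, y)) <= D / c * / e)%R).
    { replace (D / c * / e)%R with (/ (c / D * e))%R by (field; lra).
      apply Rinv_le_contravar; auto; apply Rmult_lt_0_compat; auto. }
    apply Rle_trans with ((Q * (1 + ay)) ^ k * (D / c * / e))%R.
    { apply Rmult_le_compat; auto; [apply Cmod_ge_0|].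
      apply Rlt_le, Rinv_0_lt_compat, Cmod_gt_0; auto. }
    assert (Pei : (0 < / e)%R) by (apply Rinv_0_lt_compat; auto).
    apply Rle_trans with (((D / c + D / c) * Q ^ (k + K) * 4) * (1 + ay) ^ (k + K + 1) * / e)%R.
    2:{ apply Rmult_le_compat_r; [lra|]; apply Rmult_le_compat_r; [generalize (Hap (k + K + 1)%nat); lra|lra]. }
    rewrite Rpow_mult_distr.
    replace (Q ^ k * (1 + ay) ^ k * (D / c * / e))%R with ((D / c * Q ^ k * 1) * (1 + ay) ^ k * / e)%R by ring.
    apply Rmult_le_compat_r; [lra|]; apply Rmult_le_compat.
    + generalize (HQp k); intros; apply Rmult_le_pos; [apply Rmult_le_pos|]; lra.
    + generalize (Hap k); lra.
    + apply Rmult_le_compat; try lra; [generalize (HQp k); intros; apply Rmult_le_pos; lra|].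
      apply Rmult_le_compat; try lra; [generalize (HQp k); lra|apply Hpow; lia].
    + apply Hpow2; lia.
Qed.

(** * Exponential growth rates in vertical strips *)

(** Powers of |Im s| are kept apart from the exponential so that the rates add exactly under
    products. The threshold T passes over the poles of [f]. *)
Definition growth (al be r : R) (f : C -> C) : Prop :=
  exists (D : R) (A : nat) (T : R), (0 <= D)%R /\
    forall s, (al <= Re s <= be)%R -> (T <= Rabs (Im s))%R ->
      (Cmod (f s) <= D * (1 + Rabs (Im s)) ^ A * exp (r * Rabs (Im s)))%R.

Lemma growth_const al be a : growth al be 0 (fun _ => a).
Proof.
  exists (Cmod a), O, 0%R; split; [apply Cmod_ge_0|]; intros s _ _.
  rewrite Rmult_0_l, exp_0; simpl; lra.
Qed.

Lemma growth_mult al be r q (f g : C -> C) :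
  growth al be r f -> growth al be q g -> growth al be (r + q) (fun s => f s * g s).
Proof.
  intros [D [A [T [HD Hf]]]] [D' [A' [T' [HD' Hg]]]].
  exists (D * D')%R, (A + A')%nat, (Rmax T T'); split; [apply Rmult_le_pos; auto|]; intros s Hs HT.
  specialize (Hf s Hs (Rle_trans _ _ _ (Rmax_l _ _) HT)); specialize (Hg s Hs (Rle_trans _ _ _ (Rmax_r _ _) HT)).
  rewrite Cmod_mult, pow_add, Rmult_plus_distr_r, exp_plus.
  eapply Rle_trans; [apply Rmult_le_compat; [apply Cmod_ge_0|apply Cmod_ge_0|exact Hf|exact Hg]|].
  right; ring.
Qed.

Lemma growth_ext al be r (f g : C -> C) : (forall s, f s = g s) -> growth al be r f -> growth al be r g.
Proof.
  intros E [D [A [T [HD Hf]]]]; exists D, A, T; split; auto; intros s; rewrite <- E; auto.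
Qed.

Lemma growth_prod {I : Type} al be r (l : list I) (f : I -> C -> C) :
  (forall i, In i l -> growth al be r (f i)) ->
  growth al be (INR (length l) * r) (fun s => Cprod (map (fun i => f i s) l)).
Proof.
  induction l as [|i l IH]; intros H.
  - simpl; rewrite Rmult_0_l; apply growth_const.
  - change (length (i :: l)) with (S (length l)); rewrite S_INR.
    replace ((INR (length l) + 1) * r)%R with (r + INR (length l) * r)%R by ring.
    apply (growth_mult _ _ _ _ (f i)); [apply H; left; auto|apply IH; intros; apply H; right; auto].
Qed.

(** The affine change alters |Im s| by at most |Im c|, which costs only the constants (1 + |Im c|)^A
    and exp(|r| |Im c|). *)
Lemma growth_affine (al be r : R) (f : C -> C) (c : C) (sg : R) :
  (sg = 1 \/ sg = -1)%R ->
  (forall al be, exists (D : R) (A : nat), (0 < D)%R /\ forall u : C, (al <= Re u <= be)%R -> (1 <= Rabs (Im u))%R ->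
    (Cmod (f u) <= D * (1 + Rabs (Im u)) ^ A * exp (r * Rabs (Im u)))%R) ->
  growth al be r (fun s => f (c + RtoC sg * s)).
Proof.
  intros Hsg H.
  destruct (H (Re c - Rabs al - Rabs be)%R (Re c + Rabs al + Rabs be)%R) as [D [A [HD HB]]].
  set (v := Rabs (Im c)); assert (Hv := Rabs_pos (Im c)); fold v in Hv.
  exists (D * (1 + v) ^ A * exp (Rabs r * v))%R, A, (1 + v)%R; split.
  { repeat apply Rmult_le_pos; try lra; [apply pow_le; lra|apply Rlt_le, exp_pos]. }
  intros s Hs HT.
  assert (ER : Re (c + RtoC sg * s) = (Re c + sg * Re s)%R) by (unfold Re; simpl; ring).
  assert (EI : Im (c + RtoC sg * s) = (Im c + sg * Im s)%R) by (unfold Im; simpl; ring).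
  assert (B : (Rabs (Im s) - v <= Rabs (Im c + sg * Im s) <= Rabs (Im s) + v)%R).
  { unfold v, Rabs; destruct Hsg; subst sg; repeat destruct Rcase_abs; lra. }
  eapply Rle_trans; [apply HB|].
  - rewrite ER; unfold Rabs; destruct Hsg; subst sg; repeat destruct Rcase_abs; lra.
  - rewrite EI; lra.
  - rewrite EI; set (y := Rabs (Im s)) in *; set (w := Rabs (Im c + sg * Im s)) in *.
    replace (D * (1 + v) ^ A * exp (Rabs r * v) * (1 + y) ^ A * exp (r * y))%R
      with (D * ((1 + v) * (1 + y)) ^ A * exp (Rabs r * v + r * y))%R
      by (rewrite Rpow_mult_distr, exp_plus; ring).
    assert (0 <= v * y)%R by (apply Rmult_le_pos; lra).
    apply Rmult_le_compat.
    + apply Rmult_le_pos; [lra|apply pow_le; lra].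
    + apply Rlt_le, exp_pos.
    + apply Rmult_le_compat_l; [lra|]; apply pow_incr; lra.
    + apply exp_le.
      assert (r * (w - y) <= Rabs r * v)%R; [|lra].
      eapply Rle_trans; [apply Rle_abs|]; rewrite Rabs_mult; apply Rmult_le_compat_l; [apply Rabs_pos|].
      apply Rabs_le; lra.
Qed.

Lemma growth_Gamma al be c sg : (sg = 1 \/ sg = -1)%R ->
  growth al be (- (PI / 2)) (fun s => Gamma (c + RtoC sg * s)).
Proof.
  intros H; apply growth_affine; auto; intros a b; destruct (Gamma_strip_bounds a b) as [D [A [HD HB]]].
  exists D, A; split; auto; intros u Hu Hy; destruct (HB u Hu Hy) as [H1 _].
  rewrite <- Ropp_mult_distr_l; exact H1.
Qed.

Lemma growth_rGamma al be c sg : (sg = 1 \/ sg = -1)%R ->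
  growth al be (PI / 2) (fun s => / Gamma (c + RtoC sg * s)).
Proof.
  intros H; apply (growth_affine al be (PI / 2) (fun u => / Gamma u)); auto; intros a b.
  destruct (Gamma_strip_bounds a b) as [D [A [HD HB]]].
  exists D, A; split; auto; intros u Hu Hy; destruct (HB u Hu Hy) as [_ H1]; exact H1.
Qed.

(** * Contours compared with vertical lines *)

Definition at_ends (P : R -> R -> Prop) : Prop :=
  exists M : R, forall t1 t2, (t1 < - M)%R -> (M < t2)%R -> P t1 t2.

Lemma at_ends_filter (P : R -> R -> Prop) :
  filter_prod (Rbar_locally m_infty) (Rbar_locally p_infty) (fun ab => P (fst ab) (snd ab)) <-> at_ends P.
Proof.
  split.
  - intros [Q R' [M1 H1] [M2 H2] H]; exists (Rmax (- M1) M2); intros t1 t2 Ht1 Ht2.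
    apply (H t1 t2); [apply H1|apply H2].
    + generalize (Rmax_l (- M1) M2); lra.
    + generalize (Rmax_r (- M1) M2); lra.
  - intros [M H]; exists (fun t => (t < - M)%R) (fun t => (M < t)%R).
    + exists (- M)%R; auto.
    + exists M; auto.
    + intros t1 t2 H1 H2; simpl; auto.
Qed.

Lemma at_ends_and P Q : at_ends P -> at_ends Q -> at_ends (fun a b => P a b /\ Q a b).
Proof.
  intros [M H] [N K]; exists (Rmax M N); intros a b Ha Hb.
  generalize (Rmax_l M N) (Rmax_r M N); intros; split; [apply H|apply K]; lra.
Qed.

Lemma at_ends_imp (P Q : R -> R -> Prop) : (forall a b, P a b -> Q a b) -> at_ends P -> at_ends Q.
Proof. intros H [M K]; exists M; auto. Qed.

Lemma is_RInt_gen_R_ends (f : R -> R) (v : R) :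
  is_RInt_gen f (Rbar_locally m_infty) (Rbar_locally p_infty) v <->
  forall e, (0 < e)%R -> at_ends (fun a b => exists z, is_RInt f a b z /\ (Rabs (z - v) < e)%R).
Proof.
  unfold is_RInt_gen; split.
  - intros H e He; apply at_ends_filter.
    apply (proj1 (filterlimi_locally _ _) H (mkposreal e He)).
  - intros H; apply filterlimi_locally; intros e.
    apply (proj2 (at_ends_filter _) (H e (cond_pos e))).
Qed.

Lemma is_RInt_gen_C_ends (f : R -> C) (v : C) :
  @is_RInt_gen C_R_NormedModule f (Rbar_locally m_infty) (Rbar_locally p_infty) v <->
  forall e, (0 < e)%R -> at_ends (fun a b => exists z, is_CInt f a b z /\ (Cmod (z - v) < e)%R).
Proof.
  unfold is_RInt_gen; split.
  - intros H e He; apply at_ends_filter.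
    apply (H (fun z => (Cmod (z - v) < e)%R)).
    apply locally_C_iff; exists e; auto.
  - intros H P HP; apply locally_C_iff in HP; destruct HP as [d [Hd HP]].
    unfold filtermapi; generalize (proj2 (at_ends_filter _) (H d Hd)); apply filter_imp; intros ab [z [Hz Hz']]; eauto.
Qed.

Lemma filterlim_p_infty (f : R -> R) :
  filterlim f (Rbar_locally p_infty) (Rbar_locally p_infty) ->
  forall A, exists M, forall t, (M < t)%R -> (A < f t)%R.
Proof. intros H A; apply (H (fun x => (A < x)%R)); exists A; auto. Qed.

Lemma filterlim_m_infty (f : R -> R) :
  filterlim f (Rbar_locally m_infty) (Rbar_locally m_infty) ->
  forall A, exists M, forall t, (t < M)%R -> (f t < A)%R.
Proof. intros H A; apply (H (fun x => (x < A)%R)); exists A; auto. Qed.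

Lemma atan_near_PI2 (e : R) : (0 < e)%R -> exists M, forall x, (M < x)%R -> (PI / 2 - e < atan x < PI / 2)%R.
Proof.
  intros He; assert (P := PI_RGT_0).
  set (d := Rmin e (PI / 4)).
  assert (Hd : (0 < d <= PI / 4)%R) by (unfold d; split; [apply Rmin_case; lra|apply Rmin_r]).
  exists (tan (PI / 2 - d)); intros x Hx; split; [|apply atan_bound].
  assert (E : atan (tan (PI / 2 - d)) = (PI / 2 - d)%R) by (apply atan_tan; lra).
  apply atan_increasing in Hx; rewrite E in Hx; generalize (Rmin_l e (PI / 4)); fold d; lra.
Qed.

(** Up to a constant, the arctangent is the argument along a vertical line at signed distance [u] to
    the right of a point of height [v]; its total increase is PI or -PI according to the sign of
    [u]. *)
Lemma atan_spread (u v e : R) : (u <> 0)%R -> (0 < e)%R -> exists M, forall y1 y2, (y1 < - M)%R -> (M < y2)%R ->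
  (Rabs (atan ((y2 - v) / u) - atan ((y1 - v) / u) - (if Rlt_dec 0 u then PI else - PI)) < e)%R.
Proof.
  intros Hu He; destruct (atan_near_PI2 (e / 2) ltac:(lra)) as [M0 HM0].
  set (M := (Rabs u * Rabs M0 + Rabs v)%R).
  assert (G : forall w, (0 < w)%R -> (w = Rabs u) -> forall y, (M < y)%R ->
     (PI / 2 - e / 2 < atan ((y - v) / w) < PI / 2)%R /\ (PI / 2 - e / 2 < atan ((y + v) / w) < PI / 2)%R).
  { intros w Hw Ew y Hy.
    assert (T : forall x, (w * Rabs M0 < x)%R -> (M0 < x / w)%R).
    { intros x Hx; apply Rmult_lt_reg_r with w; auto; unfold Rdiv; rewrite Rmult_assoc, Rinv_l, Rmult_1_r by lra.
      eapply Rle_lt_trans; [|exact Hx]; rewrite Rmult_comm; apply Rmult_le_compat_l; [lra|apply Rle_abs]. }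
    unfold M in Hy; rewrite <- Ew in Hy.
    split; apply HM0, T; revert Hy; unfold Rabs at 2; destruct Rcase_abs; lra. }
  exists M; intros y1 y2 H1 H2; destruct (Rlt_dec 0 u) as [Hp|Hp].
  - destruct (G u Hp ltac:(symmetry; apply Rabs_pos_eq; lra) y2 H2) as [A _].
    destruct (G u Hp ltac:(symmetry; apply Rabs_pos_eq; lra) (- y1)%R ltac:(lra)) as [_ B].
    replace ((- y1 + v) / u)%R with (- ((y1 - v) / u))%R in B by (field; lra); rewrite atan_opp in B.
    apply Rabs_def1; lra.
  - assert (Hn : (0 < - u)%R) by lra.
    assert (En : (- u)%R = Rabs u) by (rewrite Rabs_left; lra).
    destruct (G (- u)%R Hn En y2 H2) as [A _].
    destruct (G (- u)%R Hn En (- y1)%R ltac:(lra)) as [_ B].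
    replace ((- y1 + v) / - u)%R with ((y1 - v) / u)%R in B by (field; lra).
    replace ((y2 - v) / - u)%R with (- ((y2 - v) / u))%R in A by (field; lra); rewrite atan_opp in A.
    apply Rabs_def1; lra.
Qed.

Lemma is_derive_ln_sq (x y : R -> R) (t dx dy : R) :
  is_derive x t dx -> is_derive y t dy -> (0 < x t * x t + y t * y t)%R ->
  is_derive (fun u => ln (x u * x u + y u * y u) / 2)%R t ((x t * dx + y t * dy) / (x t * x t + y t * y t))%R.
Proof.
  intros Hx Hy Hp.
  assert (A := is_derive_plus (K := R_AbsRing) (V := R_NormedModule) _ _ _ _ _
    (Derive.is_derive_mult _ _ _ _ _ Hx Hx) (Derive.is_derive_mult _ _ _ _ _ Hy Hy)).
  assert (B := is_derive_comp ln _ t _ _ (is_derive_ln _ Hp) A).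
  assert (D := is_derive_scal _ _ (/ 2)%R _ B).
  match type of D with is_derive _ _ ?l => replace ((x t * dx + y t * dy) / (x t * x t + y t * y t))%R with l end.
  - revert D; apply is_derive_ext; intros u; unfold plus; simpl; unfold Rdiv; ring.
  - unfold scal, plus; simpl; unfold mult; simpl; field; lra.
Qed.

(** The real part of ds / (s - p) is the differential of ln |s - p|, a single-valued function, so no
    branch of the logarithm enters. *)
Lemma log_path (g g' : R -> C) (p : C) (a b : R) :
  (forall t, (Rmin a b <= t <= Rmax a b)%R -> is_derive_C g t (g' t) /\ cont_C g' t /\ g t <> p) ->
  is_RInt (fun t => Re (/ (g t - p) * g' t)) a b (ln (Cmod (g b - p)) - ln (Cmod (g a - p)))%R.
Proof.
  intros H.
  set (x := fun t => (Re (g t) - Re p)%R); set (y := fun t => (Im (g t) - Im p)%R).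
  assert (Hpos : forall t, (Rmin a b <= t <= Rmax a b)%R -> (0 < x t * x t + y t * y t)%R).
  { intros t Ht; destruct (H t Ht) as [_ [_ N]].
    assert (N' : g t - p <> 0) by (intros E; apply N, Ceq_minus, E).
    apply Cmod_gt_0 in N'; unfold x, y.
    assert (S := Cmod_sq (g t - p)); change (Re (g t - p)) with (Re (g t) - Re p)%R in S.
    change (Im (g t - p)) with (Im (g t) - Im p)%R in S; rewrite <- S; apply Rmult_lt_0_compat; auto. }
  assert (E : forall t, (Rmin a b <= t <= Rmax a b)%R -> ln (Cmod (g t - p)) = (ln (x t * x t + y t * y t) / 2)%R).
  { intros t Ht; assert (S := Cmod_sq (g t - p)); change (Re (g t - p)) with (x t) in S.
    change (Im (g t - p)) with (y t) in S; rewrite <- S.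
    assert (0 < Cmod (g t - p))%R.
    { apply Cmod_gt_0; intros E; apply (proj2 (proj2 (H t Ht))), Ceq_minus, E. }
    rewrite ln_mult by auto; lra. }
  assert (Hb : (Rmin a b <= b <= Rmax a b)%R) by (split; [apply Rmin_r|apply Rmax_r]).
  assert (Ha : (Rmin a b <= a <= Rmax a b)%R) by (split; [apply Rmin_l|apply Rmax_l]).
  rewrite (E b Hb), (E a Ha).
  apply (is_RInt_derive (V := R_CompleteNormedModule) (fun t => (ln (x t * x t + y t * y t) / 2)%R)).
  - intros t Ht; destruct (H t Ht) as [D _].
    assert (Hp := Hpos t Ht).
    replace (Re (/ (g t - p) * g' t)) with ((x t * Re (g' t) + y t * Im (g' t)) / (x t * x t + y t * y t))%R.
    + assert (Dx : is_derive x t (Re (g' t))).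
      { replace (Re (g' t)) with (Re (g' t) - 0)%R by ring.
        apply (is_derive_minus (K := R_AbsRing) (V := R_NormedModule)); [apply is_derive_C_Re, D|apply @is_derive_const]. }
      assert (Dy : is_derive y t (Im (g' t))).
      { replace (Im (g' t)) with (Im (g' t) - 0)%R by ring.
        apply (is_derive_minus (K := R_AbsRing) (V := R_NormedModule)); [apply is_derive_C_Im, D|apply @is_derive_const]. }
      apply is_derive_ln_sq; auto.
    + unfold x, y, Cinv, Cminus, Cplus, Copp, Cmult, Re, Im in *; simpl in *.
      field; lra.
  - intros t Ht; destruct (H t Ht) as [D [C' N]].
    apply (cont_Re (fun t => / (g t - p) * g' t)); apply cont_mult; auto; apply cont_inv.
    + intros E'; apply N, Ceq_minus, E'.
    + apply cont_minus; [eapply is_derive_C_cont, D|apply cont_const].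
Qed.

Lemma path_ftc (Phi f : C -> C) (g g' : R -> C) (a b : R) :
  (forall t, (Rmin a b <= t <= Rmax a b)%R -> is_derive_C g t (g' t) /\ cont_C g' t /\
     Cderiv Phi (g t) (f (g t)) /\ cont_C f (g t)) ->
  is_CInt (fun t => f (g t) * g' t) a b (Phi (g b) - Phi (g a)).
Proof.
  intros H; apply (is_CInt_derive (fun t => Phi (g t))); intros t Ht; destruct (H t Ht) as [D [Hg' [C2 C3]]].
  - apply is_derive_C_comp; auto.
  - apply cont_mult; auto; apply (cont_comp f g); auto; eapply is_derive_C_cont, D.
Qed.

Lemma path_CInt (f : C -> C) (g g' : R -> C) (a b : R) :
  (forall t, (Rmin a b <= t <= Rmax a b)%R -> cont_C g t /\ cont_C g' t /\ cont_C f (g t)) ->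
  is_CInt (fun t => f (g t) * g' t) a b (CInt (fun t => f (g t) * g' t) a b).
Proof.
  intros H; apply CInt_correct; intros t Ht; destruct (H t Ht) as [Cg [C2 C3]].
  apply cont_mult; auto; apply (cont_comp f g); auto.
Qed.

Lemma vline_derive (c y : R) : is_derive_C (fun y => (c, y)) y Ci.
Proof.
  apply is_derive_C_pair; simpl; [apply @is_derive_const|apply @is_derive_id].
Qed.

Lemma vline_cont (c y : R) : cont_C (fun y => (c, y)) y.
Proof. eapply is_derive_C_cont, vline_derive. Qed.

(** Meant for poles that are at most simple: the residue is the value at [p] of the continuous
    extension of (s - p) F(s). It depends only on [F] near [p], whatever its formula. *)
Definition is_residue (F : C -> C) (p r : C) : Prop :=
  exists g, @locally C_UniformSpace p (fun s => s <> p -> (s - p) * F s = g s) /\ cont_C g p /\ g p = r.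

Lemma is_residue_unique F p r r' : is_residue F p r -> is_residue F p r' -> r = r'.
Proof.
  intros [g [Lg [Cg Eg]]] [h [Lh [Ch Eh]]].
  assert (D := cont_minus g h p Cg Ch).
  apply Ceq_minus; rewrite <- Eg, <- Eh.
  destruct (Ceq_dec (g p - h p) 0) as [E|E]; auto; exfalso.
  assert (P := proj1 (Cmod_gt_0 _) E).
  destruct (proj1 (cont_eps _ _) D _ P) as [d [Hd Hd']].
  assert (Hd2 : @locally C_UniformSpace p (fun s => (Cmod (s - p) < d)%R)).
  { apply locally_C_iff; exists d; auto. }
  destruct (proj1 (locally_C_iff _ _) (filter_and _ _ Hd2 (filter_and _ _ Lg Lh))) as [d3 [Hd3 H3]].
  set (s := p + RtoC (d3 / 2)).
  assert (Es : s - p = RtoC (d3 / 2)) by (unfold s; ring).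
  assert (Hs : s <> p).
  { intros E'; rewrite E' in Es; replace (p - p) with (RtoC 0) in Es by ring; apply RtoC_inj in Es; lra. }
  destruct (H3 s) as [A [B1 B2]].
  { rewrite Es, Cmod_R, Rabs_pos_eq; lra. }
  specialize (Hd' s A); rewrite <- (B1 Hs), <- (B2 Hs) in Hd'.
  replace ((s - p) * F s - (s - p) * F s - (g p - h p)) with (- (g p - h p)) in Hd' by ring.
  rewrite Cmod_opp in Hd'; lra.
Qed.

Section Contour.
Variables (L dL : R -> C) (B al be c : R) (P : list C).
Hypothesis HL : forall t, is_derive_C L t (dL t).
Hypothesis HdL : forall t, cont_C dL t.
Hypothesis HB : forall t, (Rabs (Re (L t)) <= B)%R.
Hypothesis HLm : filterlim (fun t => Im (L t)) (Rbar_locally m_infty) (Rbar_locally m_infty).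
Hypothesis HLp : filterlim (fun t => Im (L t)) (Rbar_locally p_infty) (Rbar_locally p_infty).
Hypothesis Hal : (al < - B)%R.
Hypothesis Hbe : (B < be)%R.
Hypothesis Hc : (al < c < be)%R.
Hypothesis HPL : forall p t, In p P -> L t <> p.
Hypothesis HPc : forall p, In p P -> Re p <> c.

Definition strip (s : C) : Prop := (al < Re s < be)%R.
(** [P] lists the relevant poles in the strip; integrands are controlled only off them, and all
    paths below stay there. *)
Definition offP (s : C) : Prop := strip s /\ forall p, In p P -> s <> p.

Lemma strip_open : open_C strip.
Proof.
  intros z Hz; unfold strip in *; apply locally_C_iff.
  exists (Rmin (Re z - al) (be - Re z)); split; [apply Rmin_case; lra|]; intros y Hy.
  assert (H := re_le_Cmod (y - z)); change (Re (y - z)) with (Re y - Re z)%R in H; apply Rabs_le_between in H.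
  generalize (Rmin_l (Re z - al) (be - Re z)) (Rmin_r (Re z - al) (be - Re z)); lra.
Qed.

Lemma strip_convex : convex_C strip.
Proof.
  intros a b t Ha Hb Ht; unfold strip in *; rewrite Re_seg.
  destruct (Req_dec_T t 0) as [->|Hn]; [lra|].
  assert (0 < t * (Re b - al))%R by (apply Rmult_lt_0_compat; lra).
  assert (0 <= (1 - t) * (Re a - al))%R by (apply Rmult_le_pos; lra).
  assert (0 < t * (be - Re b))%R by (apply Rmult_lt_0_compat; lra).
  assert (0 <= (1 - t) * (be - Re a))%R by (apply Rmult_le_pos; lra). lra.
Qed.

Lemma L_strip t : strip (L t).
Proof. unfold strip; generalize (HB t); intros H; apply Rabs_le_between in H; lra. Qed.

Definition corner (t : R) : C := (c, Im (L t)).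

(** Integral of [f] around the region between the contour and the line Re s = c, truncated at two times [t1 < t2]. *)
Definition excess_upto (f : C -> C) (t1 t2 : R) (d : C) : Prop :=
  exists a b e g,
    is_CInt (fun t => f (L t) * dL t) t1 t2 a /\
    is_CInt (fun u => f (seg (corner t2) (L t2) u) * (L t2 - corner t2)) 0 1 b /\
    is_CInt (fun u => f (seg (corner t1) (L t1) u) * (L t1 - corner t1)) 0 1 e /\
    is_CInt (fun y => f (c, y) * Ci) (Im (L t1)) (Im (L t2)) g /\
    d = a - b + e - g.

(** Only the closed loop is required to converge; its four pieces need not. For 1 / (s - p) the real
    parts of the pieces are logarithms of distances, which cancel around the loop. *)
Definition excess (f : C -> C) (v : C) : Prop :=
  forall e, (0 < e)%R -> at_ends (fun t1 t2 => exists d, excess_upto f t1 t2 d /\ (Cmod (d - v) < e)%R).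

Lemma heights (A : R) : at_ends (fun t1 t2 => Im (L t1) < - A /\ A < Im (L t2))%R.
Proof.
  destruct (filterlim_p_infty _ HLp A) as [M1 H1]; destruct (filterlim_m_infty _ HLm (- A)%R) as [M2 H2].
  exists (Rmax M1 (- M2)); intros t1 t2 Ht1 Ht2; generalize (Rmax_l M1 (- M2)) (Rmax_r M1 (- M2)); intros.
  split; [apply H2|apply H1]; lra.
Qed.

Lemma max_Im : exists A, (0 <= A)%R /\ forall p, In p P -> (Rabs (Im p) <= A)%R.
Proof.
  clear HPL HPc; induction P as [|p l [A [HA IH]]].
  - exists 0%R; split; [lra|intros p []].
  - exists (Rmax A (Rabs (Im p))); split; [eapply Rle_trans; [exact HA|apply Rmax_l]|].
    intros q [<-|Hq]; [apply Rmax_r|eapply Rle_trans; [apply IH, Hq|apply Rmax_l]].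
Qed.

Lemma seg_corner_Im t u : Im (seg (corner t) (L t) u) = Im (L t).
Proof. rewrite Im_seg; unfold corner; simpl; ring. Qed.

Lemma seg_corner_strip t u : (0 <= u <= 1)%R -> strip (seg (corner t) (L t) u).
Proof. intros Hu; apply strip_convex; [exact Hc|apply L_strip|exact Hu]. Qed.

(** Beyond the largest |Im p| the horizontal segments pass above or below every point of [P]. *)
Lemma paths_off : at_ends (fun t1 t2 =>
  (forall t, offP (L t)) /\ (forall y, offP (c, y)) /\
  (forall u, (0 <= u <= 1)%R -> offP (seg (corner t2) (L t2) u)) /\
  (forall u, (0 <= u <= 1)%R -> offP (seg (corner t1) (L t1) u))).
Proof.
  destruct max_Im as [A [HA HP]]; generalize (heights A); apply at_ends_imp; intros t1 t2 [H1 H2].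
  split; [|split; [|split]].
  - intros t; split; [apply L_strip|intros p Hp; apply HPL, Hp].
  - intros y; split; [exact Hc|intros p Hp E; apply (HPc p Hp); rewrite <- E; auto].
  - intros u Hu; split; [apply seg_corner_strip, Hu|intros p Hp E].
    specialize (HP p Hp); rewrite <- E, seg_corner_Im in HP; apply Rabs_le_between in HP; lra.
  - intros u Hu; split; [apply seg_corner_strip, Hu|intros p Hp E].
    specialize (HP p Hp); rewrite <- E, seg_corner_Im in HP; apply Rabs_le_between in HP; lra.
Qed.

Lemma excess_ext f g v : (forall s, offP s -> f s = g s) -> excess f v -> excess g v.
Proof.
  intros E H e He; generalize (at_ends_and _ _ paths_off (H e He)); apply at_ends_imp.
  intros t1 t2 [[O1 [O2 [O3 O4]]] [d [[a [b [e' [g' [A1 [A2 [A3 [A4 Ed]]]]]]]] Hd]]].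
  exists d; split; auto; exists a, b, e', g'; repeat split; auto.
  - revert A1; apply is_CInt_ext; intros t _; rewrite E; auto.
  - revert A2; apply is_CInt_ext; rewrite Rmin_left, Rmax_right by lra; intros t Ht; rewrite E; auto; apply O3; lra.
  - revert A3; apply is_CInt_ext; rewrite Rmin_left, Rmax_right by lra; intros t Ht; rewrite E; auto; apply O4; lra.
  - revert A4; apply is_CInt_ext; intros t _; rewrite E; auto.
Qed.

Lemma excess_plus f g v w : excess f v -> excess g w -> excess (fun s => f s + g s) (v + w).
Proof.
  intros Hf Hg e He; generalize (at_ends_and _ _ (Hf (e / 2)%R ltac:(lra)) (Hg (e / 2)%R ltac:(lra))); apply at_ends_imp.
  intros t1 t2 [[d [[a [b [e1 [g1 [A1 [A2 [A3 [A4 Ed]]]]]]]] Hd]] [d' [[a' [b' [e1' [g1' [A1' [A2' [A3' [A4' Ed']]]]]]]] Hd']]].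
  exists (d + d'); split.
  - exists (a + a'), (b + b'), (e1 + e1'), (g1 + g1'); repeat split.
    + apply (is_CInt_ext (fun t => f (L t) * dL t + g (L t) * dL t)); [intros; ring|apply is_CInt_plus; auto].
    + eapply is_CInt_ext; [|apply is_CInt_plus; [exact A2|exact A2']]; intros; cbv beta; ring.
    + eapply is_CInt_ext; [|apply is_CInt_plus; [exact A3|exact A3']]; intros; cbv beta; ring.
    + eapply is_CInt_ext; [|apply is_CInt_plus; [exact A4|exact A4']]; intros; cbv beta; ring.
    + rewrite Ed, Ed'; ring.
  - replace (d + d' - (v + w)) with ((d - v) + (d' - w)) by ring.
    generalize (Cmod_triangle (d - v) (d' - w)); lra.
Qed.

Lemma excess_scal f v k : excess f v -> excess (fun s => k * f s) (k * v).
Proof.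
  intros Hf e He; assert (Pk := Cmod_ge_0 k).
  assert (He' : (0 < e / (Cmod k + 1))%R) by (apply Rdiv_lt_0_compat; lra).
  generalize (Hf _ He'); apply at_ends_imp.
  intros t1 t2 [d [[a [b [e1 [g1 [A1 [A2 [A3 [A4 Ed]]]]]]]] Hd]].
  exists (k * d); split.
  - exists (k * a), (k * b), (k * e1), (k * g1); repeat split.
    + eapply is_CInt_ext; [|apply is_CInt_scal; exact A1]; intros; cbv beta; ring.
    + eapply is_CInt_ext; [|apply is_CInt_scal; exact A2]; intros; cbv beta; ring.
    + eapply is_CInt_ext; [|apply is_CInt_scal; exact A3]; intros; cbv beta; ring.
    + eapply is_CInt_ext; [|apply is_CInt_scal; exact A4]; intros; cbv beta; ring.
    + rewrite Ed; ring.
  - replace (k * d - k * v) with (k * (d - v)) by ring; rewrite Cmod_mult.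
    apply Rle_lt_trans with (Cmod k * (e / (Cmod k + 1)))%R; [apply Rmult_le_compat_l; lra|].
    apply Rmult_lt_reg_r with (Cmod k + 1)%R; [lra|].
    replace (Cmod k * (e / (Cmod k + 1)) * (Cmod k + 1))%R with (Cmod k * e)%R by (field; lra); lra.
Qed.

Lemma excess_primitive Phi f : (forall s, offP s -> Cderiv Phi s (f s) /\ cont_C f s) -> excess f 0.
Proof.
  intros H e He; generalize paths_off; apply at_ends_imp; intros t1 t2 [O1 [O2 [O3 O4]]].
  exists 0; split; [|replace (0 - 0) with (RtoC 0) by ring; rewrite Cmod_0; auto].
  exists (Phi (L t2) - Phi (L t1)), (Phi (L t2) - Phi (corner t2)),
    (Phi (L t1) - Phi (corner t1)), (Phi (corner t2) - Phi (corner t1)); repeat split; [| | | |ring].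
  - apply (path_ftc Phi f L dL); intros t _; destruct (H _ (O1 t)); auto.
  - assert (I := path_ftc Phi f (seg (corner t2) (L t2)) (fun _ => L t2 - corner t2) 0 1).
    rewrite seg_1, seg_0 in I; apply I; clear I.
    rewrite Rmin_left, Rmax_right by lra; intros t Ht; destruct (H _ (O3 t Ht)).
    split; [apply seg_derive|split; [apply cont_const|auto]].
  - assert (I := path_ftc Phi f (seg (corner t1) (L t1)) (fun _ => L t1 - corner t1) 0 1).
    rewrite seg_1, seg_0 in I; apply I; clear I.
    rewrite Rmin_left, Rmax_right by lra; intros t Ht; destruct (H _ (O4 t Ht)).
    split; [apply seg_derive|split; [apply cont_const|auto]].
  - apply (path_ftc Phi f (fun y => (c, y)) (fun _ => Ci)); intros t _; destruct (H _ (O2 t)).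
    split; [apply vline_derive|split; [apply cont_const|auto]].
Qed.

Lemma excess_smooth f : smooth strip f -> excess f 0.
Proof.
  intros Sf; apply (excess_primitive (fun s => (s - L 0) * seg_moment 0 f (L 0) s)); intros s [Hs _]; split.
  - apply (smooth_primitive strip f (L 0)); auto using strip_open, strip_convex, L_strip.
  - apply (smooth_cont strip); auto.
Qed.

Lemma offP_neq s p : offP s -> In p P -> s - p <> 0.
Proof. intros [_ H] Hp E; apply (H p Hp), Ceq_minus, E. Qed.

(** Powers with exponent at least 2 have the primitive - (s - p)^(-j-1) / (j + 1), single-valued off
    [p]; no information on the winding about [p] is involved. *)
Lemma excess_pow p j : In p P -> excess (fun s => (/ (s - p)) ^ S (S j)) 0.
Proof.
  intros Hp; apply (excess_primitive (fun s => (- / Cnat (S j)) * (/ (s + - p)) ^ S j)); intros s Hs.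
  assert (N := offP_neq s p Hs Hp); split.
  - eapply Cderiv_eq; [apply Cderiv_mult; [apply Cderiv_const|apply Cderiv_pow_inv, N]|].
    cbv beta; assert (Nj := Cnat_neq_0 (S j) ltac:(lia)); fold (s - p).
    generalize ((/ (s - p)) ^ S (S j)); intros X; field; auto.
  - apply cont_pow, cont_inv; [exact N|apply cont_minus; [apply cont_id|apply cont_const]].
Qed.

(** The variation of arg(s - p) along the upward line Re s = c, to be compared with that along the
    contour. The borderline Re p = c is excluded by [HPc]. *)
Definition wline (p : C) : R := if Rlt_dec (Re p) c then PI else (- PI)%R.

(** The real parts telescope exactly, being differences of [ln |s - p|]; along the line the imaginary part is an arctangent,
    and the horizontal segments are negligible far from the real axis. *)
Lemma excess_simple p v : In p P -> arg_variation L dL p v -> excess (fun s => / (s - p)) (Ci * RtoC (v - wline p)).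
Proof.
  intros Hp [HLne Hv] e He.
  assert (Hu : (c - Re p <> 0)%R) by (generalize (HPc p Hp); lra).
  destruct (atan_spread (c - Re p) (Im p) (e / 4) Hu ltac:(lra)) as [M1 HM1].
  set (W := (be - al)%R).
  assert (HW : (0 < W)%R) by (unfold W; lra).
  (* Beyond height [A] a horizontal segment, of length less than [W], stays farther than 4 W / e
     from [p] and so contributes less than e / 4. *)
  set (A := (Rabs (Im p) + 4 * W / e + 1)%R).
  assert (A4 : (0 < 4 * W / e)%R) by (apply Rdiv_lt_0_compat; lra).
  generalize (at_ends_and _ _ paths_off (at_ends_and _ _ (heights A)
    (at_ends_and _ _ (heights M1) (proj1 (is_RInt_gen_R_ends _ _) Hv (e / 4)%R ltac:(lra))))); apply at_ends_imp.
  intros t1 t2 [[O1 [O2 [O3 O4]]] [[Hh1 Hh2] [[Hm1 Hm2] [z [Hz Hzv]]]]].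
  set (f := fun s => / (s - p)).
  assert (Cf : forall s, offP s -> cont_C f s).
  { intros s Hs; apply cont_inv; [apply offP_neq; auto|apply cont_minus; [apply cont_id|apply cont_const]]. }
  set (a := CInt (fun t => f (L t) * dL t) t1 t2).
  assert (Ia : is_CInt (fun t => f (L t) * dL t) t1 t2 a).
  { apply path_CInt; intros t _; split; [eapply is_derive_C_cont, HL|split; auto]. }
  set (b := CInt (fun u => f (seg (corner t2) (L t2) u) * (L t2 - corner t2)) 0 1).
  assert (Ib : is_CInt (fun u => f (seg (corner t2) (L t2) u) * (L t2 - corner t2)) 0 1 b).
  { apply (path_CInt f (seg (corner t2) (L t2)) (fun _ => L t2 - corner t2)).
    rewrite Rmin_left, Rmax_right by lra; intros t Ht; split; [apply seg_cont|split; [apply cont_const|auto]]. }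
  set (e1 := CInt (fun u => f (seg (corner t1) (L t1) u) * (L t1 - corner t1)) 0 1).
  assert (Ie : is_CInt (fun u => f (seg (corner t1) (L t1) u) * (L t1 - corner t1)) 0 1 e1).
  { apply (path_CInt f (seg (corner t1) (L t1)) (fun _ => L t1 - corner t1)).
    rewrite Rmin_left, Rmax_right by lra; intros t Ht; split; [apply seg_cont|split; [apply cont_const|auto]]. }
  set (g := CInt (fun y => f (c, y) * Ci) (Im (L t1)) (Im (L t2))).
  assert (Ig : is_CInt (fun y => f (c, y) * Ci) (Im (L t1)) (Im (L t2)) g).
  { apply (path_CInt f (fun y => (c, y)) (fun _ => Ci)).
    intros t _; split; [apply vline_cont|split; [apply cont_const|auto]]. }
  exists (a - b + e1 - g); split; [exists a, b, e1, g; auto|].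
  assert (Hseg : forall t, (A < Rabs (Im (L t)))%R -> forall x,
     is_CInt (fun u => f (seg (corner t) (L t) u) * (L t - corner t)) 0 1 x -> (Cmod x < e / 4)%R).
  { intros t Ht x Hx.
    assert (Hlen : (Cmod (L t - corner t) < W)%R).
    { eapply Rle_lt_trans; [apply Cmod_le_Re_Im|]; unfold corner.
      change (Re (L t - (c, Im (L t)))) with (Re (L t) - c)%R.
      change (Im (L t - (c, Im (L t)))) with (Im (L t) - Im (L t))%R.
      replace (Im (L t) - Im (L t))%R with 0%R by ring; rewrite Rabs_R0, Rplus_0_r.
      generalize (L_strip t); unfold strip, W; intros; apply Rabs_def1; lra. }
    assert (Hden : (4 * W / e < Rabs (Im (L t)) - Rabs (Im p))%R) by (unfold A in Ht; lra).
    assert (HBd : (Cmod x <= (1 - 0) * (/ (Rabs (Im (L t)) - Rabs (Im p)) * Cmod (L t - corner t)))%R).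
    { eapply is_CInt_bound; [lra| |exact Hx]; intros u Hu'; cbv beta; rewrite Cmod_mult.
      apply Rmult_le_compat_r; [apply Cmod_ge_0|].
      assert (Hd : (Rabs (Im (L t)) - Rabs (Im p) <= Cmod (seg (corner t) (L t) u - p))%R).
      { eapply Rle_trans; [|apply im_le_Cmod].
        change (Im (seg (corner t) (L t) u - p)) with (Im (seg (corner t) (L t) u) - Im p)%R.
        rewrite seg_corner_Im; apply Rabs_triang_inv. }
      unfold f; rewrite Cmod_inv by (apply Cmod_gt_0; lra); apply Rinv_le_contravar; lra. }
    eapply Rle_lt_trans; [exact HBd|]; rewrite Rminus_0_r, Rmult_1_l.
    set (den := (Rabs (Im (L t)) - Rabs (Im p))%R) in *.
    apply Rle_lt_trans with (/ den * W)%R.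
    { apply Rmult_le_compat_l; [apply Rlt_le, Rinv_0_lt_compat|]; lra. }
    apply Rmult_lt_reg_l with den; [lra|]; rewrite <- Rmult_assoc, Rinv_r, Rmult_1_l by lra.
    replace W with (4 * W / e * (e / 4))%R by (field; lra); apply Rmult_lt_compat_r; lra. }
  assert (Sb := Hseg t2 ltac:(eapply Rlt_le_trans; [exact Hh2|apply Rle_abs]) b Ib).
  assert (Se := Hseg t1 ltac:(rewrite <- Rabs_Ropp; eapply Rlt_le_trans; [|apply Rle_abs]; lra) e1 Ie).
  assert (Ra : Re a = (ln (Cmod (L t2 - p)) - ln (Cmod (L t1 - p)))%R).
  { assert (H1 := proj1 (proj1 (is_CInt_iff _ _ _ _) Ia)).
    rewrite <- (is_RInt_unique _ _ _ _ H1); apply is_RInt_unique, log_path; intros t _; auto. }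
  assert (Rb : Re b = (ln (Cmod (L t2 - p)) - ln (Cmod (corner t2 - p)))%R).
  { assert (H1 := proj1 (proj1 (is_CInt_iff _ _ _ _) Ib)).
    rewrite <- (is_RInt_unique _ _ _ _ H1); apply is_RInt_unique.
    replace (L t2 - p) with (seg (corner t2) (L t2) 1 - p) by (rewrite seg_1; auto).
    replace (corner t2 - p) with (seg (corner t2) (L t2) 0 - p) by (rewrite seg_0; auto).
    apply (log_path (seg (corner t2) (L t2)) (fun _ => L t2 - corner t2)).
    rewrite Rmin_left, Rmax_right by lra; intros t Ht.
    split; [apply seg_derive|split; [apply cont_const|apply O3; auto]]. }
  assert (Re1 : Re e1 = (ln (Cmod (L t1 - p)) - ln (Cmod (corner t1 - p)))%R).
  { assert (H1 := proj1 (proj1 (is_CInt_iff _ _ _ _) Ie)).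
    rewrite <- (is_RInt_unique _ _ _ _ H1); apply is_RInt_unique.
    replace (L t1 - p) with (seg (corner t1) (L t1) 1 - p) by (rewrite seg_1; auto).
    replace (corner t1 - p) with (seg (corner t1) (L t1) 0 - p) by (rewrite seg_0; auto).
    apply (log_path (seg (corner t1) (L t1)) (fun _ => L t1 - corner t1)).
    rewrite Rmin_left, Rmax_right by lra; intros t Ht.
    split; [apply seg_derive|split; [apply cont_const|apply O4; auto]]. }
  assert (Rg : Re g = (ln (Cmod (corner t2 - p)) - ln (Cmod (corner t1 - p)))%R).
  { assert (H1 := proj1 (proj1 (is_CInt_iff _ _ _ _) Ig)).
    rewrite <- (is_RInt_unique _ _ _ _ H1); apply is_RInt_unique.
    apply (log_path (fun y => (c, y)) (fun _ => Ci)); intros t _.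
    split; [apply vline_derive|split; [apply cont_const|apply O2; auto]]. }
  assert (Za : Im a = z).
  { assert (H1 := proj2 (proj1 (is_CInt_iff _ _ _ _) Ia)).
    rewrite <- (is_RInt_unique _ _ _ _ H1); apply is_RInt_unique; revert Hz; apply is_RInt_ext; intros t _.
    unfold f, Cdiv; rewrite Cmult_comm; reflexivity. }
  assert (Zg : Im g = (atan ((Im (L t2) - Im p) / (c - Re p)) - atan ((Im (L t1) - Im p) / (c - Re p)))%R).
  { assert (H1 := proj2 (proj1 (is_CInt_iff _ _ _ _) Ig)).
    rewrite <- (is_RInt_unique _ _ _ _ H1); apply is_RInt_unique.
    apply (is_RInt_derive (V := R_CompleteNormedModule) (fun y => atan ((y - Im p) / (c - Re p)))).
    - intros y _; auto_derive; auto.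
      unfold f, Cinv, Cmult, Cminus, Cplus, Copp, Ci, Re, Im in *; simpl in *.
      assert (0 < (c - fst p) * (c - fst p))%R by (destruct (Rlt_dec 0 (c - fst p)); [apply Rmult_lt_0_compat; lra|];
        replace ((c - fst p) * (c - fst p))%R with (- (c - fst p) * - (c - fst p))%R by ring; apply Rmult_lt_0_compat; lra).
      assert (0 <= (y - snd p) * (y - snd p))%R by apply Rle_0_sqr.
      field; repeat split; lra.
    - intros y _; apply (cont_Im (fun y => f (c, y) * Ci)); apply cont_mult; [|apply cont_const].
      apply (cont_comp f (fun y => (c, y))); [apply vline_cont|apply Cf, O2]. }
  assert (Ew : wline p = (if Rlt_dec 0 (c - Re p) then PI else - PI)%R).
  { unfold wline; repeat destruct Rlt_dec; lra. }
  assert (HG := HM1 _ _ Hm1 Hm2); rewrite <- Zg, <- Ew in HG.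
  eapply Rle_lt_trans; [apply Cmod_le_Re_Im|].
  replace (Re (a - b + e1 - g - Ci * RtoC (v - wline p))) with 0%R.
  2:{ transitivity (Re a - Re b + Re e1 - Re g - 0)%R; [rewrite Ra, Rb, Re1, Rg; ring|].
      unfold Re, Ci; simpl; ring. }
  rewrite Rabs_R0, Rplus_0_l.
  replace (Im (a - b + e1 - g - Ci * RtoC (v - wline p))) with ((Im a - v) - Im b + Im e1 - (Im g - wline p))%R
    by (unfold Im, Ci; simpl; ring).
  rewrite Za; generalize (im_le_Cmod b) (im_le_Cmod e1); intros J1 J2.
  apply Rabs_def2 in Hzv; apply Rabs_def2 in HG.
  assert (K1 := Rle_lt_trans _ _ _ J1 Sb); assert (K2 := Rle_lt_trans _ _ _ J2 Se).
  apply Rabs_def2 in K1; apply Rabs_def2 in K2; apply Rabs_def1; lra.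
Qed.

(** * Partial fractions and residues *)

Definition lprod (l : list C) (s : C) : C := Cprod (map (fun p => s - p) l).

Lemma lprod_cons p l s : lprod (p :: l) s = (s - p) * lprod l s.
Proof. reflexivity. Qed.

Lemma lprod_app l1 l2 s : lprod (l1 ++ l2) s = lprod l1 s * lprod l2 s.
Proof. unfold lprod; rewrite map_app, Cprod_app; auto. Qed.

Lemma lprod_neq_0 l s : (forall p, In p l -> s - p <> 0) -> lprod l s <> 0.
Proof.
  induction l as [|p l IH]; intros H; [apply C1_nz|]; rewrite lprod_cons.
  apply Cmult_neq_0; [apply H; left; auto|apply IH; intros; apply H; right; auto].
Qed.

Lemma lprod_smooth U l : smooth U (lprod l).
Proof.
  apply (smooth_prod U l (fun p s => s - p)); intros p _.
  apply smooth_plus; [apply smooth_id|apply smooth_const].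
Qed.

(** Points that the contour and the line leave on the same side. Roots of a denominator may be
    repeated as long as they are neutral. *)
Definition neutral (p : C) : Prop := In p P /\ strip p /\ arg_variation L dL p (wline p).

Lemma excess_simple_neutral p : neutral p -> excess (fun s => / (s - p)) 0.
Proof.
  intros [Hp [_ Hv]]; replace (RtoC 0) with (Ci * RtoC (wline p - wline p)); [apply excess_simple; auto|].
  replace (wline p - wline p)%R with 0%R by ring; ring.
Qed.

(** Induction on the degree. Two distinct roots p, q are separated by 1 / ((s - p) (s - q)) = (1/(s
    - p) - 1/(s - q)) / (p - q), which lowers the degree. If all roots coincide, the function is a
    neutral simple pole or a higher power with a primitive. *)
Lemma excess_inv_lprod l : (forall p, In p l -> neutral p) -> excess (fun s => / lprod l s) 0.
Proof.
  remember (length l) as n eqn:En; revert l En; induction n as [n IH] using lt_wf_ind; intros l En Hl.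
  destruct l as [|p l].
  { apply (excess_ext (fun _ => / 1)); [reflexivity|]; apply excess_smooth, smooth_const. }
  destruct (excluded_middle_informative (exists q, In q l /\ q <> p)) as [[q [Hq Hqp]]|Hall].
  - destruct (in_split q l Hq) as [l1 [l2 El]].
    assert (Npq : p - q <> 0) by (intros E; apply Hqp; symmetry; apply Ceq_minus, E).
    apply (excess_ext (fun s => / (p - q) * (/ lprod (p :: l1 ++ l2) s + RtoC (-1) * / lprod (q :: l1 ++ l2) s))).
    + intros s Hs.
      assert (N : forall x, In x (p :: l) -> s - x <> 0) by (intros x Hx; apply offP_neq; auto; apply Hl, Hx).
      assert (N1 : lprod (l1 ++ l2) s <> 0).
      { apply lprod_neq_0; intros x Hx; apply N; right; rewrite El; apply in_or_app.
        apply in_app_or in Hx; destruct Hx; [left|right; right]; auto. }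
      assert (N2 := N p (or_introl eq_refl)); assert (N3 := N q (or_intror Hq)).
      rewrite lprod_app in N1; rewrite El, !lprod_cons, !lprod_app, lprod_cons.
      assert (lprod l1 s <> 0) by (intros E; apply N1; rewrite E; ring).
      assert (lprod l2 s <> 0) by (intros E; apply N1; rewrite E; ring).
      field; repeat split; auto.
    + replace (RtoC 0) with (/ (p - q) * (0 + RtoC (-1) * 0)) by ring.
      assert (Hlen : length (p :: l1 ++ l2) = length l).
      { rewrite El; simpl; rewrite !length_app; simpl; lia. }
      apply excess_scal, excess_plus; [|apply excess_scal]; apply (IH (length l)); simpl in En; try lia;
        try (symmetry; exact Hlen).
      * intros x [<-|Hx]; [apply Hl; left; auto|]; apply Hl; right; rewrite El; apply in_or_app.
        apply in_app_or in Hx; destruct Hx; [left|right; right]; auto.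
      * intros x [<-|Hx]; [apply Hl; right; auto|]; apply Hl; right; rewrite El; apply in_or_app.
        apply in_app_or in Hx; destruct Hx; [left|right; right]; auto.
  - assert (El : forall s, offP s -> / lprod (p :: l) s = (/ (s - p)) ^ S (length l)).
    { intros s Hs; assert (N : s - p <> 0) by (apply offP_neq; auto; apply Hl; left; auto).
      clear - N Hall; induction l as [|q l IHl]; [unfold lprod, Cprod; simpl; field; auto|].
      rewrite !lprod_cons in *.
      assert (q = p) by (apply Classical_Prop.NNPP; intros E; apply Hall; exists q; split; [left|]; auto); subst q.
      transitivity (/ (s - p) * / ((s - p) * lprod l s)).
      - assert (lprod l s <> 0).
        { apply lprod_neq_0; intros x Hx E; apply Hall; exists x; split; [right; auto|].
          intros E'; subst; auto. }
        field; auto.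
      - rewrite IHl; [reflexivity|].
        intros [x [Hx Hx']]; apply Hall; exists x; split; [right|]; auto. }
    destruct l as [|q l].
    + apply (excess_ext (fun s => / (s - p))); [|apply excess_simple_neutral, Hl; left; auto].
      intros s Hs; rewrite El by auto; simpl; ring.
    + apply (excess_ext (fun s => (/ (s - p)) ^ S (S (length l)))); [intros s Hs; rewrite El; auto|].
      apply excess_pow, Hl; left; auto.
Qed.

(** Hadamard's lemma writes H = H(p) + (s - p) H1: the constant part is [excess_inv_lprod], and in
    the other part one root is cancelled. *)
Lemma excess_quotient l H : (forall p, In p l -> neutral p) -> smooth strip H -> excess (fun s => H s / lprod l s) 0.
Proof.
  revert H; induction l as [|p l IH]; intros H Hl SH.
  - apply (excess_ext H); [intros s _; unfold lprod, Cprod; simpl; field; apply C1_nz|apply excess_smooth, SH].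
  - assert (Hp := Hl p (or_introl eq_refl)).
    destruct (smooth_quotient strip H p strip_open strip_convex SH (proj1 (proj2 Hp))) as [H1 [S1 E1]].
    apply (excess_ext (fun s => H p * / lprod (p :: l) s + H1 s / lprod l s)).
    + intros s Hs; rewrite (E1 s (proj1 Hs)).
      assert (N := offP_neq s p Hs (proj1 Hp)).
      assert (N1 : lprod l s <> 0) by (apply lprod_neq_0; intros q Hq; apply offP_neq; auto; apply Hl; right; auto).
      rewrite lprod_cons; field; auto.
    + replace (RtoC 0) with (H p * 0 + 0) by ring; apply excess_plus.
      * apply excess_scal, excess_inv_lprod, Hl.
      * apply IH; auto; intros q Hq; apply Hl; right; auto.
Qed.

Lemma locally_off (p : C) : strip p ->
  @locally C_UniformSpace p (fun s => s <> p -> offP s).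
Proof.
  intros Hp.
  assert (G : @locally C_UniformSpace p (fun s => forall q, In q P -> s <> p -> s <> q)).
  { clear HPL HPc; induction P as [|q l IH]; [apply filter_forall; intros s q []|].
    destruct (Ceq_dec q p) as [->|Hn].
    - revert IH; apply filter_imp; intros s Hs x [<-|Hx]; auto.
    - assert (Hq : @locally C_UniformSpace p (fun s => s <> q)).
      { assert (N : p - q <> 0) by (intros E; apply Hn; symmetry; apply Ceq_minus, E).
        apply locally_C_iff; exists (Cmod (p - q)); split; [apply Cmod_gt_0; auto|].
        intros s Hs E; subst; rewrite Cmod_sub_sym in Hs; lra. }
      generalize (filter_and _ _ IH Hq); apply filter_imp; intros s [H1 H2] x [<-|Hx]; auto. }
  generalize (filter_and _ _ G (strip_open p Hp)); apply filter_imp; intros s [H1 H2] Hs; split; auto.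
Qed.

(** [pl] holds the simple poles between the line and the contour. About each of them the variations
    are PI for the contour and -PI for the line, so r / (s - p) contributes 2 PI i r. Subtracting it
    leaves a quotient with one pole less. *)
Lemma excess_residues (pl l0 : list C) (res : C -> C) (H F : C -> C) :
  (forall p, In p l0 -> neutral p) ->
  (forall p, In p pl -> In p P /\ strip p /\ arg_variation L dL p PI /\ ~ In p l0 /\ (c < Re p)%R) ->
  NoDup pl -> smooth strip H ->
  (forall s, offP s -> F s = H s / (lprod pl s * lprod l0 s)) ->
  (forall p, In p pl -> is_residue F p (res p)) ->
  excess F (2 * RtoC PI * Ci * fold_right Cplus 0 (map res pl)).
Proof.
  intros Hl0; revert H F; induction pl as [|p pl IH]; intros H F Hpl Hnd SH HF Hres.
  - simpl; replace (2 * RtoC PI * Ci * 0) with (RtoC 0) by ring.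
    apply (excess_ext (fun s => H s / lprod l0 s)); [|apply excess_quotient; auto].
    intros s Hs; rewrite HF by auto; unfold lprod at 2, Cprod; simpl map; simpl fold_right; rewrite Cmult_1_l; auto.
  - destruct (Hpl p (or_introl eq_refl)) as [HpP [Hps [Hpv [Hpl0 Hpc]]]].
    inversion Hnd as [|x l Hnin Hnd' Eq]; subst x l.
    set (Q := fun s => lprod pl s * lprod l0 s).
    assert (SQ : smooth strip Q) by (apply smooth_mult; apply lprod_smooth).
    assert (NQ : Q p <> 0).
    { apply Cmult_neq_0; apply lprod_neq_0; intros q Hq E; apply Ceq_minus in E; subst q; auto. }
    set (r := H p / Q p).
    assert (Hr : res p = r).
    { apply (is_residue_unique F p); [apply Hres; left; auto|].
      exists (fun s => H s / Q s); split; [|split; [|reflexivity]].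
      - assert (CQ := smooth_cont strip Q p SQ Hps).
        assert (NQl : @locally C_UniformSpace p (fun s => Q s <> 0)).
        { apply (CQ (fun y : C => y <> 0)), locally_C_iff; exists (Cmod (Q p)); split; [apply Cmod_gt_0; auto|].
          intros y Hy E; subst y; revert Hy; replace (0 - Q p) with (- Q p) by ring; rewrite Cmod_opp; lra. }
        generalize (filter_and _ _ (locally_off p Hps) NQl); apply filter_imp; intros s [H1 H2] Hs.
        assert (Hso := H1 Hs); rewrite HF, lprod_cons by auto.
        assert (N := offP_neq s p Hso HpP); unfold Q in *.
        assert (lprod pl s <> 0) by (intros E; apply H2; rewrite E; ring).
        assert (lprod l0 s <> 0) by (intros E; apply H2; rewrite E; ring).
        Cvars; field; auto.
      - apply cont_div; auto; apply (smooth_cont strip); auto. }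
    (* The numerator after subtracting r / (s - p); it vanishes at [p] by the choice of r, so s - p
       can be divided out. *)
    set (H2 := fun s => H s + RtoC (-1) * r * Q s).
    assert (S2 : smooth strip H2) by (apply smooth_plus; auto; apply smooth_mult; auto; apply smooth_const).
    destruct (smooth_quotient strip H2 p strip_open strip_convex S2 Hps) as [H3 [S3 E3]].
    assert (E2 : H2 p = 0) by (unfold H2, r; field; auto).
    set (F' := fun s => H3 s / (lprod pl s * lprod l0 s)).
    assert (EF : forall s, offP s -> F s = r * / (s - p) + F' s).
    { intros s Hs; rewrite HF by auto; unfold F'.
      assert (N := offP_neq s p Hs HpP).
      assert (N1 : lprod pl s <> 0).
      { apply lprod_neq_0; intros q Hq; apply offP_neq; auto; apply Hpl; right; auto. }
      assert (N2 : lprod l0 s <> 0) by (apply lprod_neq_0; intros q Hq; apply offP_neq; auto; apply Hl0, Hq).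
      assert (E := E3 s (proj1 Hs)); rewrite E2 in E; unfold H2, Q in E.
      replace (H s) with (r * (lprod pl s * lprod l0 s) + (s - p) * H3 s).
      2:{ replace ((s - p) * H3 s) with (0 + (s - p) * H3 s) by ring; rewrite <- E; ring. }
      rewrite lprod_cons; field; auto. }
    apply (excess_ext (fun s => r * / (s - p) + F' s)); [intros; symmetry; auto|].
    simpl map; simpl fold_right.
    replace (2 * RtoC PI * Ci * (res p + fold_right Cplus 0 (map res pl)))
      with (r * (Ci * RtoC (PI - wline p)) + 2 * RtoC PI * Ci * fold_right Cplus 0 (map res pl)).
    2:{ rewrite Hr; unfold wline; destruct Rlt_dec; [lra|].
        replace (PI - - PI)%R with (2 * PI)%R by ring; rewrite RtoC_mult; ring. }
    apply excess_plus; [apply excess_scal, excess_simple; auto|].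
    apply (IH H3); auto; [intros q Hq; apply Hpl; right; auto|].
    intros q Hq; destruct (Hres q (or_intror Hq)) as [g [Lg [Cg Eg]]].
    assert (Hqp : q - p <> 0) by (intros E; apply Ceq_minus in E; subst q; auto).
    destruct (Hpl q (or_intror Hq)) as [HqP [Hqs _]].
    exists (fun s => g s - (s - q) * (r * / (s - p))); split; [|split].
    + generalize (filter_and _ _ Lg (locally_off q Hqs)); apply filter_imp; intros s [H1 H4] Hs.
      rewrite <- (H1 Hs), (EF s (H4 Hs)); Cring.
    + apply cont_minus; auto; apply cont_mult; [apply cont_minus; [apply cont_id|apply cont_const]|].
      apply cont_mult; [apply cont_const|apply cont_inv; auto; apply cont_minus; [apply cont_id|apply cont_const]].
    + rewrite Eg; ring.
Qed.

(** Once the horizontal segments contribute nothing, [excess] compares the contour with the vertical line. *)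
Lemma contour_of_excess F v J : excess F v ->
  (forall e, (0 < e)%R -> exists T, forall s, strip s -> (T <= Rabs (Im s))%R -> (Cmod (F s) <= e)%R) ->
  (forall e, (0 < e)%R -> exists M, forall y1 y2 z, (y1 < - M)%R -> (M < y2)%R ->
     is_CInt (fun y => F (c, y) * Ci) y1 y2 z -> (Cmod (z - J) < e)%R) ->
  @is_RInt_gen C_R_NormedModule (fun t => F (L t) * dL t) (Rbar_locally m_infty) (Rbar_locally p_infty) (v + J).
Proof.
  intros HZ Hdec HJ; apply is_RInt_gen_C_ends; intros e He.
  set (W := (be - al)%R); assert (HW : (0 < W)%R) by (unfold W; lra).
  destruct (Hdec (e / (8 * W))%R) as [T HT]; [apply Rdiv_lt_0_compat; lra|].
  destruct (HJ (e / 4)%R ltac:(lra)) as [M HM].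
  generalize (at_ends_and _ _ (heights T) (at_ends_and _ _ (heights M) (HZ (e / 4)%R ltac:(lra)))); apply at_ends_imp.
  intros t1 t2 [[Hh1 Hh2] [[Hm1 Hm2] [d [[a [b [e1 [g [Ia [Ib [Ie [Ig Ed]]]]]]]] Hd]]]].
  exists a; split; auto.
  assert (Hg := HM _ _ _ Hm1 Hm2 Ig).
  assert (Hseg : forall t, (T <= Rabs (Im (L t)))%R -> forall x,
     is_CInt (fun u => F (seg (corner t) (L t) u) * (L t - corner t)) 0 1 x -> (Cmod x <= e / 8)%R).
  { intros t Ht x Hx.
    assert (Hlen : (Cmod (L t - corner t) <= W)%R).
    { eapply Rle_trans; [apply Cmod_le_Re_Im|]; unfold corner.
      change (Re (L t - (c, Im (L t)))) with (Re (L t) - c)%R.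
      change (Im (L t - (c, Im (L t)))) with (Im (L t) - Im (L t))%R.
      replace (Im (L t) - Im (L t))%R with 0%R by ring; rewrite Rabs_R0, Rplus_0_r.
      generalize (L_strip t); unfold strip, W; intros; apply Rabs_le; lra. }
    assert (HBd : (Cmod x <= (1 - 0) * (e / (8 * W) * W))%R).
    { eapply is_CInt_bound; [lra| |exact Hx]; intros u Hu'; cbv beta; rewrite Cmod_mult.
      apply Rmult_le_compat; try apply Cmod_ge_0; auto.
      apply HT; [apply seg_corner_strip; auto|rewrite seg_corner_Im; auto]. }
    replace ((1 - 0) * (e / (8 * W) * W))%R with (e / 8)%R in HBd by (field; lra); auto. }
  assert (Sb := Hseg t2 ltac:(eapply Rle_trans; [apply Rlt_le, Hh2|apply Rle_abs]) b Ib).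
  assert (Se := Hseg t1 ltac:(rewrite <- Rabs_Ropp; eapply Rle_trans; [|apply Rle_abs]; lra) e1 Ie).
  replace (a - (v + J)) with (((d - v) + (g - J)) + (b - e1)) by (rewrite Ed; ring).
  eapply Rle_lt_trans; [apply Cmod_triangle|].
  generalize (Cmod_triangle (d - v) (g - J)) (Cmod_triangle_sub b e1); lra.
Qed.

End Contour.

(** * Existence of contours *)

Definition C1_path (f df : R -> C) : Prop := forall t, is_derive_C f t (df t) /\ cont_C df t.

Definition glue (f g : R -> C) (k t : R) : C := if Rle_dec t k then f t else g t.

Lemma glue_cont (f g : R -> C) (k t : R) :
  cont_C f t -> cont_C g t -> f k = g k -> cont_C (glue f g k) t.
Proof.
  intros Hf Hg E; unfold cont_C, continuous in *; rewrite !filterlim_C in * by apply locally_filter.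
  intros e He; unfold glue; destruct (Req_dec_T t k) as [->|Hn].
  - generalize (filter_and _ _ (Hf e He) (Hg e He)); apply filter_imp; intros u [A B].
    destruct (Rle_dec k k) as [_|N]; [|exfalso; apply N; lra].
    destruct (Rle_dec u k); [exact A|rewrite E; exact B].
  - assert (Hd : (0 < Rabs (t - k))%R) by (apply Rabs_pos_lt; lra).
    assert (Hl : locally t (fun u => (Rabs (u - t) < Rabs (t - k))%R)).
    { exists (mkposreal _ Hd); intros u Hu; exact Hu. }
    generalize (filter_and _ _ Hl (filter_and _ _ (Hf e He) (Hg e He))); apply filter_imp; intros u [H [A B]].
    revert H; unfold Rabs; destruct (Rle_dec t k), (Rle_dec u k); repeat destruct Rcase_abs; auto; intros; exfalso; lra.
Qed.

Lemma glue_C1 (f df g dg : R -> C) (k : R) :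
  C1_path f df -> C1_path g dg -> f k = g k -> df k = dg k -> C1_path (glue f g k) (glue df dg k).
Proof.
  intros Hf Hg E E' t; destruct (Hf t) as [F1 F2], (Hg t) as [G1 G2]; split; [|apply glue_cont; auto].
  destruct (Req_dec_T t k) as [->|Hn].
  - unfold glue at 2; destruct (Rle_dec k k) as [_|N]; [|exfalso; apply N; lra].
    apply (@extension_cont_is_derive C_R_NormedModule f g k (df k)); auto.
    rewrite E'; exact G1.
  - assert (Hd : (0 < Rabs (t - k))%R) by (apply Rabs_pos_lt; lra).
    assert (Hl : locally t (fun u => (Rabs (u - t) < Rabs (t - k))%R)).
    { exists (mkposreal _ Hd); intros u Hu; exact Hu. }
    unfold glue at 2; destruct (Rle_dec t k) as [Ht|Ht].
    + apply (@is_derive_ext_loc R_AbsRing C_R_NormedModule f); auto.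
      revert Hl; apply filter_imp; intros u Hu; unfold glue; destruct (Rle_dec u k); auto.
      exfalso; revert Hu; unfold Rabs; repeat destruct Rcase_abs; lra.
    + apply (@is_derive_ext_loc R_AbsRing C_R_NormedModule g); auto.
      revert Hl; apply filter_imp; intros u Hu; unfold glue; destruct (Rle_dec u k); auto.
      exfalso; revert Hu; unfold Rabs; repeat destruct Rcase_abs; lra.
Qed.

Lemma shift_C1 (f df : R -> C) (k : R) : C1_path f df -> C1_path (fun t => f (t - k)%R) (fun t => df (t - k)%R).
Proof.
  intros H t; destruct (H (t - k)%R) as [D Cd]; split.
  - assert (Ds : is_derive (fun t => t - k)%R t 1%R) by (auto_derive; auto; ring).
    assert (K := @is_derive_comp R_AbsRing C_R_NormedModule f (fun t => t - k)%R t _ _ D Ds).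
    rewrite scal_R_Cmult, Cmult_1_l in K; exact K.
  - apply (continuous_comp (fun t => t - k)%R df); [|exact Cd].
    apply (ex_derive_continuous (K := R_AbsRing) (V := R_NormedModule)); auto_derive; auto.
Qed.

(** Follows [L] until time [k], runs the closed loop [l] for one unit of time, and resumes [L] with
    delay 1. The result is C^1 when path and loop are at rest at the junctions. *)
Definition insert (L l : R -> C) (k : R) : R -> C :=
  glue L (glue (fun t => l (t - k)%R) (fun t => L (t - 1)%R) (k + 1)) k.

Definition darg (L dL : R -> C) (p : C) (t : R) : R := Im (dL t / (L t - p)).

Section Insertion.
Variables (L dL l dl : R -> C) (k : R).
Hypothesis HL : C1_path L dL.
Hypothesis Hl : C1_path l dl.
Hypothesis H0 : l 0%R = L k.
Hypothesis H1 : l 1%R = L k.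
Hypothesis Hk : dL k = 0.
Hypothesis D0 : dl 0%R = 0.
Hypothesis D1 : dl 1%R = 0.

Lemma insert_C1 : C1_path (insert L l k) (insert dL dl k).
Proof.
  unfold insert; apply glue_C1; auto.
  - apply glue_C1; try apply shift_C1; auto; replace (k + 1 - k)%R with 1%R by ring;
      replace (k + 1 - 1)%R with k by ring; congruence.
  - unfold glue; destruct (Rle_dec k (k + 1)); [|exfalso; lra]; replace (k - k)%R with 0%R by ring; auto.
  - unfold glue; destruct (Rle_dec k (k + 1)); [|exfalso; lra]; replace (k - k)%R with 0%R by ring; congruence.
Qed.

Lemma insert_before (f g : R -> C) t : (t <= k)%R -> insert f g k t = f t.
Proof. intros Ht; unfold insert, glue; destruct (Rle_dec t k); auto; exfalso; lra. Qed.

Lemma insert_during (f g : R -> C) t : (k < t <= k + 1)%R -> insert f g k t = g (t - k)%R.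
Proof.
  intros Ht; unfold insert, glue; destruct (Rle_dec t k); [exfalso; lra|].
  destruct (Rle_dec t (k + 1)); auto; exfalso; lra.
Qed.

Lemma insert_after (f g : R -> C) t : (k + 1 < t)%R -> insert f g k t = f (t - 1)%R.
Proof.
  intros Ht; unfold insert, glue; destruct (Rle_dec t k); [exfalso; lra|].
  destruct (Rle_dec t (k + 1)); auto; exfalso; lra.
Qed.

Lemma darg_cont (f df : R -> C) p t : C1_path f df -> f t <> p -> continuous (darg f df p) t.
Proof.
  intros H N; destruct (H t) as [D Cd]; apply (cont_Im (fun t => df t / (f t - p))).
  apply cont_div; auto; [intros E; apply N, Ceq_minus, E|].
  apply cont_minus; [eapply is_derive_C_cont, D|apply cont_const].
Qed.

Lemma is_RInt_shift (f : R -> R) (a b m v : R) :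
  is_RInt f a b v -> is_RInt (fun t => f (t - m)%R) (a + m) (b + m) v.
Proof.
  intros H.
  assert (K := is_RInt_comp_lin (V := R_NormedModule) f 1 (- m) (a + m) (b + m) v).
  replace (1 * (a + m) + - m)%R with a in K by ring; replace (1 * (b + m) + - m)%R with b in K by ring.
  specialize (K H); revert K; apply is_RInt_ext; intros t _.
  unfold scal; simpl; unfold mult; simpl; rewrite Rmult_1_l; f_equal; ring.
Qed.

Lemma insert_variation p v w : arg_variation L dL p v ->
  (forall u, (0 <= u <= 1)%R -> l u <> p) -> is_RInt (darg l dl p) 0 1 w ->
  arg_variation (insert L l k) (insert dL dl k) p (v + w).
Proof.
  intros [N Hv] Nl Hw; split.
  - intros t; destruct (Rle_lt_dec t k); [rewrite insert_before by lra; auto|].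
    destruct (Rle_lt_dec t (k + 1)); [rewrite insert_during by lra; apply Nl; lra|rewrite insert_after by lra; auto].
  - apply is_RInt_gen_R_ends; intros e He.
    destruct (proj1 (is_RInt_gen_R_ends _ _) Hv e He) as [M HM].
    exists (Rabs M + Rabs k + 1)%R; intros a b Ha Hb.
    assert (Hk1 := Rle_abs k); assert (Hk2 := Rle_abs (- k)); rewrite Rabs_Ropp in Hk2.
    assert (HM1 := Rle_abs M); assert (HM2 := Rabs_pos M).
    destruct (HM a (b - 1)%R ltac:(lra) ltac:(lra)) as [z [Hz Hzv]].
    exists (z + w)%R; split; [|replace (z + w - (v + w))%R with (z - v)%R by ring; auto].
    assert (Ex : forall x y, ex_RInt (darg L dL p) x y).
    { intros x y; apply (ex_RInt_continuous (V := R_CompleteNormedModule)); intros t _; apply darg_cont; auto. }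
    destruct (Ex a k) as [z1 Hz1]; destruct (Ex k (b - 1)%R) as [z2 Hz2].
    assert (Ez : z = (z1 + z2)%R).
    { rewrite <- (is_RInt_unique _ _ _ _ Hz); apply is_RInt_unique.
      apply (is_RInt_Chasles (V := R_NormedModule) _ a k (b - 1)); auto. }
    replace (z + w)%R with (z1 + (w + z2))%R by (rewrite Ez; ring).
    apply (is_RInt_Chasles (V := R_NormedModule) _ a k b).
    + revert Hz1; apply is_RInt_ext; rewrite Rmin_left, Rmax_right by lra; intros t Ht.
      rewrite !insert_before by lra; reflexivity.
    + apply (is_RInt_Chasles (V := R_NormedModule) _ k (k + 1) b).
      * assert (S := is_RInt_shift _ _ _ k _ Hw); rewrite Rplus_0_l, (Rplus_comm 1) in S.
        revert S; apply is_RInt_ext; rewrite Rmin_left, Rmax_right by lra; intros t Ht.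
        rewrite !insert_during by lra; reflexivity.
      * assert (S := is_RInt_shift _ _ _ 1 _ Hz2); replace (b - 1 + 1)%R with b in S by ring.
        revert S; apply is_RInt_ext; rewrite Rmin_left, Rmax_right by lra; intros t Ht.
        rewrite !insert_after by lra; reflexivity.
Qed.

Lemma insert_contour (Bl : R) : contour L dL -> (forall u, (Rabs (Re (l u)) <= Bl)%R) ->
  contour (insert L l k) (insert dL dl k).
Proof.
  intros [_ [_ [[B HB] [Hm Hp]]]] HBl; split; [|split; [|split; [|split]]].
  - intros t; apply insert_C1.
  - intros t; apply insert_C1.
  - exists (Rmax B Bl); intros t.
    destruct (Rle_lt_dec t k); [rewrite insert_before by lra; eapply Rle_trans; [apply HB|apply Rmax_l]|].
    destruct (Rle_lt_dec t (k + 1)).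
    + rewrite insert_during by lra; eapply Rle_trans; [apply HBl|apply Rmax_r].
    + rewrite insert_after by lra; eapply Rle_trans; [apply HB|apply Rmax_l].
  - intros Q [A HA]; destruct (filterlim_m_infty _ Hm A) as [M HM].
    exists (Rmin M k); intros t Ht; rewrite insert_before.
    + apply HA, HM; eapply Rlt_le_trans; [exact Ht|apply Rmin_l].
    + apply Rlt_le; eapply Rlt_le_trans; [exact Ht|apply Rmin_r].
  - intros Q [A HA]; destruct (filterlim_p_infty _ Hp A) as [M HM].
    exists (Rmax (M + 1) (k + 1)); intros t Ht.
    assert (G1 := Rmax_l (M + 1) (k + 1)); assert (G2 := Rmax_r (M + 1) (k + 1)); rewrite insert_after by lra.
    apply HA, HM; lra.
Qed.
End Insertion.

(** While [(g - p) / m] stays in the right half-plane, its argument is an arctangent. *)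
Lemma half_plane_variation (g dg : R -> C) (p m : C) (a b : R) : C1_path g dg -> m <> 0 ->
  (forall t, (Rmin a b <= t <= Rmax a b)%R -> (0 < Re ((g t - p) * / m))%R) ->
  is_RInt (darg g dg p) a b
    (atan (Im ((g b - p) * / m) / Re ((g b - p) * / m)) - atan (Im ((g a - p) * / m) / Re ((g a - p) * / m)))%R.
Proof.
  intros Hg Hm Hpos.
  assert (Dh : forall t, is_derive_C (fun t => (g t - p) * / m) t (dg t * / m)).
  { intros t; destruct (Hg t) as [D _].
    assert (D2 := is_derive_C_mult _ _ _ _ _
      (@is_derive_minus R_AbsRing C_R_NormedModule _ _ _ _ _ D (@is_derive_const R_AbsRing C_R_NormedModule p t))
      (@is_derive_const R_AbsRing C_R_NormedModule (/ m) t)).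
    eapply is_derive_C_eq; [exact D2|].
    change ((dg t - 0) * / m + (g t - p) * 0 = dg t * / m); ring. }
  apply (is_RInt_derive (V := R_CompleteNormedModule)
    (fun t => atan (Im ((g t - p) * / m) / Re ((g t - p) * / m)))).
  - intros t Ht; specialize (Hpos t Ht).
    assert (Dx := is_derive_C_Re _ _ _ (Dh t)); assert (Dy := is_derive_C_Im _ _ _ (Dh t)).
    set (h := (g t - p) * / m) in *; set (h' := dg t * / m) in *.
    assert (Nh : h <> 0) by (intros E; rewrite E in Hpos; simpl in Hpos; lra).
    assert (D := is_derive_comp atan _ t _ _ (is_derive_atan _)
      (is_derive_div _ _ _ _ _ Dy Dx ltac:(cbv beta; fold h; lra))).
    cbv beta in D; fold h in D.
    replace (darg g dg p t) with ((Im h' * Re h - Im h * Re h') / (Re h * Re h + Im h * Im h))%R.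
    + match type of D with is_derive _ _ ?x => replace ((Im h' * Re h - Im h * Re h') / (Re h * Re h + Im h * Im h))%R with x end; [exact D|].
      clear D; clear - Hpos; revert Hpos; generalize (Re h) (Im h) (Re h') (Im h'); intros x y x' y' Hx.
      assert (0 <= y * y)%R by apply Rle_0_sqr.
      assert (0 < x * x)%R by (apply Rmult_lt_0_compat; auto).
      unfold scal; simpl; unfold mult; simpl; unfold Rsqr; field; lra.
    + assert (E : darg g dg p t = Im (h' / h)).
      { unfold darg; f_equal; unfold h, h'; field; split; auto.
        intros E; apply Nh; unfold h; rewrite E; ring. }
      rewrite E; clearbody h h'; destruct h as [x y], h' as [x' y']; unfold Cdiv, Cinv, Cmult, Re, Im in *; simpl in *.
      assert (0 <= y * y)%R by apply Rle_0_sqr.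
      assert (0 < x * x)%R by (apply Rmult_lt_0_compat; auto).
      field; lra.
  - intros t Ht; apply darg_cont; auto; intros E; specialize (Hpos t Ht).
    rewrite E in Hpos; replace ((p - p) * / m) with (RtoC 0) in Hpos by ring; simpl in Hpos; lra.
Qed.

(** * Loops: horizontal excursions and turns around a point *)

(** From (c, y) out to (c + W, y) and back. The velocity vanishes at times 0, 1/2 and 1, so the
    excursion can be inserted and a further loop can be inserted at its far end. *)
Definition back_forth (c y W t : R) : C := ((c + W * (1 - cos (2 * PI * t)) / 2)%R, y).
Definition dback_forth (W t : R) : C := ((W * PI * sin (2 * PI * t))%R, 0%R).

Lemma back_forth_C1 c y W : C1_path (back_forth c y W) (dback_forth W).
Proof.
  intros t; split.
  - apply is_derive_C_pair; simpl; [auto_derive; auto; field|apply @is_derive_const].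
  - apply cont_pair; [|apply continuous_const].
    apply (ex_derive_continuous (K := R_AbsRing) (V := R_NormedModule)); auto_derive; auto.
Qed.

(** The angular velocity vanishes at both ends, so that the turn can be inserted into a [C^1] path. *)
Definition turn_phase (t : R) : R := (2 * PI * t - sin (2 * PI * t))%R.

Definition turn (p : C) (e t : R) : C := p + Ci * RtoC e * Cexp (RtoC (turn_phase t) * Ci).
Definition dturn (e t : R) : C :=
  Ci * RtoC e * (Ci * Cexp (RtoC (turn_phase t) * Ci) * RtoC (2 * PI - 2 * PI * cos (2 * PI * t))).

Lemma turn_C1 p e : C1_path (turn p e) (dturn e).
Proof.
  intros t.
  assert (Dp : is_derive turn_phase t (2 * PI - 2 * PI * cos (2 * PI * t))%R) by (unfold turn_phase; auto_derive; auto; ring).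
  assert (DE : is_derive_C (fun t => Cexp (RtoC (turn_phase t) * Ci)) t
     (Ci * Cexp (RtoC (turn_phase t) * Ci) * RtoC (2 * PI - 2 * PI * cos (2 * PI * t)))).
  { assert (K := @is_derive_comp R_AbsRing C_R_NormedModule (fun u => Cexp (RtoC u * Ci)) turn_phase t _ _
      (is_derive_C_Cexp_lin Ci (turn_phase t)) Dp).
    eapply is_derive_C_eq; [exact K|]; rewrite scal_R_Cmult; Cring. }
  split.
  - assert (K := @is_derive_plus R_AbsRing C_R_NormedModule _ _ _ _ _
      (@is_derive_const R_AbsRing C_R_NormedModule p t)
      (is_derive_C_mult _ _ _ _ _ (@is_derive_const R_AbsRing C_R_NormedModule (Ci * RtoC e) t) DE)).
    eapply is_derive_C_eq; [exact K|]; unfold dturn.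
    match goal with |- plus zero (zero * ?x + ?y * ?z) = _ => change (0 + (0 * x + Ci * RtoC e * z) = Ci * RtoC e * z) end; ring.
  - unfold dturn; apply cont_mult; [apply cont_const|apply cont_mult; [apply cont_mult; [apply cont_const|]|]].
    + eapply is_derive_C_cont, DE.
    + apply cont_RtoC; apply (ex_derive_continuous (K := R_AbsRing) (V := R_NormedModule)); auto_derive; auto.
Qed.

Lemma Cexp_2PI_i : Cexp (RtoC (2 * PI) * Ci) = 1.
Proof.
  unfold Cexp, Ci, Cmult, RtoC, Re, Im; simpl.
  replace (2 * PI * 0 - 0 * 1)%R with 0%R by ring; replace (2 * PI * 1 + 0 * 0)%R with (2 * PI)%R by ring.
  rewrite exp_0, cos_2PI, sin_2PI; f_equal; ring.
Qed.

Lemma turn_0 p e : turn p e 0 = p + Ci * RtoC e.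
Proof.
  unfold turn, turn_phase; rewrite Rmult_0_r, sin_0, Rminus_0_r.
  replace (RtoC 0 * Ci) with (RtoC 0) by ring; rewrite Cexp_0; ring.
Qed.

Lemma turn_1 p e : turn p e 1 = p + Ci * RtoC e.
Proof. unfold turn, turn_phase; rewrite Rmult_1_r, sin_2PI, Rminus_0_r, Cexp_2PI_i; ring. Qed.

Lemma dturn_0 e : dturn e 0 = 0.
Proof. unfold dturn; rewrite Rmult_0_r, cos_0; replace (2 * PI - 2 * PI * 1)%R with 0%R by ring; ring. Qed.

Lemma dturn_1 e : dturn e 1 = 0.
Proof. unfold dturn; rewrite Rmult_1_r, cos_2PI; replace (2 * PI - 2 * PI * 1)%R with 0%R by ring; ring. Qed.

Lemma Cmod_turn p e t : (0 < e)%R -> Cmod (turn p e t - p) = e.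
Proof.
  intros He; unfold turn; replace (p + Ci * RtoC e * Cexp (RtoC (turn_phase t) * Ci) - p)
    with (Ci * RtoC e * Cexp (RtoC (turn_phase t) * Ci)) by ring.
  rewrite !Cmod_mult, Cmod_Ci, Cmod_R, Rabs_pos_eq, Cmod_Cexp by lra.
  replace (Re (RtoC (turn_phase t) * Ci)) with 0%R by (unfold Re, Ci; simpl; ring); rewrite exp_0; ring.
Qed.

Lemma turn_variation_in p e : (0 < e)%R -> is_RInt (darg (turn p e) (dturn e) p) 0 1 (2 * PI)%R.
Proof.
  intros He.
  assert (K : is_RInt (fun t => 2 * PI - 2 * PI * cos (2 * PI * t))%R 0 1 (2 * PI)%R).
  { assert (E : minus (turn_phase 1) (turn_phase 0) = (2 * PI)%R).
    { unfold turn_phase, minus, plus, opp; simpl; rewrite Rmult_1_r, Rmult_0_r, sin_2PI, sin_0; ring. }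
    apply (eq_rect _ (fun l => is_RInt _ 0 1 l)) with (2 := E).
    apply (is_RInt_derive (V := R_CompleteNormedModule) turn_phase); intros t _.
    - unfold turn_phase; auto_derive; auto; ring.
    - apply (ex_derive_continuous (K := R_AbsRing) (V := R_NormedModule)); auto_derive; auto. }
  revert K; apply is_RInt_ext; intros t _; unfold darg, dturn, turn.
  assert (Ne : RtoC e <> 0) by (intros E; apply RtoC_inj in E; lra).
  replace (Ci * RtoC e * (Ci * Cexp (RtoC (turn_phase t) * Ci) * RtoC (2 * PI - 2 * PI * cos (2 * PI * t))) /
    (p + Ci * RtoC e * Cexp (RtoC (turn_phase t) * Ci) - p)) with (Ci * RtoC (2 * PI - 2 * PI * cos (2 * PI * t))).
  - unfold Im, Ci; simpl; ring.
  - assert (Nc := Cexp_neq_0 (RtoC (turn_phase t) * Ci)); assert (Ni := Ci_nz).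
    generalize dependent (Cexp (RtoC (turn_phase t) * Ci)); intros X NX; field; repeat split; auto.
    replace (p + Ci * e * X - p) with (Ci * RtoC e * X) by ring; repeat apply Cmult_neq_0; auto.
Qed.

(** Divided by p - q, the point seen from [q] is 1 plus a number of modulus less than 1; it stays in
    the right half-plane and returns to its start. *)
Lemma turn_variation_out p e q : (0 < e)%R -> (e < Cmod (q - p))%R ->
  is_RInt (darg (turn p e) (dturn e) q) 0 1 0%R.
Proof.
  intros He Hq.
  assert (N : p - q <> 0) by (intros E; rewrite Cmod_sub_sym, E, Cmod_0 in Hq; lra).
  assert (P := proj1 (Cmod_gt_0 _) N).
  assert (H := half_plane_variation (turn p e) (dturn e) q (p - q) 0 1 (turn_C1 p e) N).
  rewrite turn_0, turn_1, Rminus_diag_eq in H by reflexivity; apply H; intros t _.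
  replace ((turn p e t - q) * / (p - q)) with (1 + (turn p e t - p) * / (p - q)) by (field; auto).
  change (Re (1 + (turn p e t - p) * / (p - q))) with (1 + Re ((turn p e t - p) * / (p - q)))%R.
  assert (B : (Cmod ((turn p e t - p) * / (p - q)) < 1)%R).
  { rewrite Cmod_mult, Cmod_inv, Cmod_turn by auto; rewrite Cmod_sub_sym in Hq.
    apply Rmult_lt_reg_r with (Cmod (p - q)); auto; rewrite Rmult_assoc, Rinv_l by lra; lra. }
  generalize (re_le_Cmod ((turn p e t - p) * / (p - q))); intros B2; apply Rabs_le_between in B2; lra.
Qed.

Lemma back_forth_variation c y W q : (y <> Im q)%R -> is_RInt (darg (back_forth c y W) (dback_forth W) q) 0 1 0%R.
Proof.
  (* Seen from [q], the excursion stays strictly above or strictly below; dividing by i (y - Im q)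
     turns this into the real part being constantly 1. *)
  intros Hy; set (m := Ci * RtoC (y - Im q)).
  assert (Nm : m <> 0).
  { apply Cmult_neq_0; [apply Ci_nz|]; intros E; apply RtoC_inj in E; lra. }
  assert (H := half_plane_variation (back_forth c y W) (dback_forth W) q m 0 1 (back_forth_C1 c y W) Nm).
  assert (E : back_forth c y W 1 = back_forth c y W 0).
  { unfold back_forth; rewrite Rmult_1_r, Rmult_0_r, cos_2PI, cos_0; auto. }
  rewrite E, Rminus_diag_eq in H by reflexivity; apply H; intros t _.
  replace (Re ((back_forth c y W t - q) * / m)) with 1%R; [lra|].
  assert (y - Im q <> 0)%R by lra.
  unfold m, back_forth, Ci, Cinv, Cmult, Cminus, Cplus, Copp, RtoC, Re, Im in *; simpl in *; field; auto.
Qed.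

Lemma back_forth_0 c y W : back_forth c y W 0 = (c, y).
Proof. unfold back_forth; rewrite Rmult_0_r, cos_0; f_equal; field. Qed.
Lemma back_forth_1 c y W : back_forth c y W 1 = (c, y).
Proof. unfold back_forth; rewrite Rmult_1_r, cos_2PI; f_equal; field. Qed.
Lemma back_forth_half c y W : back_forth c y W (1 / 2) = ((c + W)%R, y).
Proof. unfold back_forth; replace (2 * PI * (1 / 2))%R with PI by field; rewrite cos_PI; f_equal; field. Qed.
Lemma dback_forth_0 W : dback_forth W 0 = 0.
Proof. unfold dback_forth; rewrite Rmult_0_r, sin_0, Rmult_0_r; auto. Qed.
Lemma dback_forth_1 W : dback_forth W 1 = 0.
Proof. unfold dback_forth; rewrite Rmult_1_r, sin_2PI, Rmult_0_r; auto. Qed.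
Lemma dback_forth_half W : dback_forth W (1 / 2) = 0.
Proof. unfold dback_forth; replace (2 * PI * (1 / 2))%R with PI by field; rewrite sin_PI, Rmult_0_r; auto. Qed.

(** The detour travels at height [Im p + e] to the point above [p], turns once around [p], and comes back. *)
Lemma detour (L dL : R -> C) (c e : R) (p : C) :
  contour L dL -> L 0%R = (c, (Im p + e)%R) -> dL 0%R = 0 -> (0 < e)%R ->
  exists L' dL', contour L' dL' /\ L' 0%R = (c, (Im p + e)%R) /\ dL' 0%R = 0 /\
    (forall v, (arg_variation L dL p v -> arg_variation L' dL' p (v + 2 * PI)%R)) /\
    (forall q v, Im q <> (Im p + e)%R -> (e < Cmod (q - p))%R ->
       arg_variation L dL q v -> arg_variation L' dL' q v).
Proof.
  intros HL L0 dL0 He; set (y := (Im p + e)%R) in *; set (W := (Re p - c)%R).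
  assert (CL : C1_path L dL) by (destruct HL as [D [Cd _]]; intros t; split; [apply D|apply Cd]).
  set (L1 := insert L (back_forth c y W) 0); set (dL1 := insert dL (dback_forth W) 0).
  assert (E0 : back_forth c y W 0 = L 0%R) by (rewrite back_forth_0, L0; auto).
  assert (E1 : back_forth c y W 1 = L 0%R) by (rewrite back_forth_1, L0; auto).
  assert (CL1 : C1_path L1 dL1) by (apply insert_C1; auto using back_forth_C1, dback_forth_0, dback_forth_1).
  assert (HL1 : contour L1 dL1).
  { apply (insert_contour L dL (back_forth c y W) (dback_forth W) 0 CL (back_forth_C1 c y W) E0 E1 dL0 (dback_forth_0 W) (dback_forth_1 W) (Rabs c + Rabs W));
      auto; intros u; unfold back_forth; simpl Re.
    eapply Rle_trans; [apply Rabs_triang|]; apply Rplus_le_compat_l.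
    unfold Rdiv; rewrite Rmult_assoc, Rabs_mult; rewrite <- (Rmult_1_r (Rabs W)) at 2.
    apply Rmult_le_compat_l; [apply Rabs_pos|]; apply Rabs_le; generalize (COS_bound (2 * PI * u)); lra. }
  assert (Lh : L1 (1 / 2)%R = p + Ci * RtoC e).
  { unfold L1; rewrite insert_during by lra; rewrite Rminus_0_r, back_forth_half; unfold W, y.
    destruct p as [p1 p2]; unfold Cplus, Cmult, Ci, RtoC, Re, Im; simpl; f_equal; ring. }
  assert (dLh : dL1 (1 / 2)%R = 0) by (unfold dL1; rewrite insert_during by lra; rewrite Rminus_0_r, dback_forth_half; auto).
  (* The turn starts at time 1/2, when the excursion rests at the top point p + i e of the
     circle. *)
  exists (insert L1 (turn p e) (1 / 2)), (insert dL1 (dturn e) (1 / 2)).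
  assert (T0 : turn p e 0 = L1 (1 / 2)%R) by (rewrite turn_0; auto).
  assert (T1 : turn p e 1 = L1 (1 / 2)%R) by (rewrite turn_1; auto).
  split; [|split; [|split; [|split]]].
  - apply (insert_contour L1 dL1 (turn p e) (dturn e) (1 / 2) CL1 (turn_C1 p e) T0 T1 dLh (dturn_0 e) (dturn_1 e) (Cmod p + e));
      auto; intros u; eapply Rle_trans; [apply re_le_Cmod|].
    replace (turn p e u) with (p + (turn p e u - p)) by ring; eapply Rle_trans; [apply Cmod_triangle|].
    rewrite Cmod_turn; lra.
  - rewrite insert_before by lra; unfold L1; rewrite insert_before by lra; auto.
  - rewrite insert_before by lra; unfold dL1; rewrite insert_before by lra; auto.
  - intros v Hv; apply insert_variation; auto.
    + rewrite <- (Rplus_0_r v); apply insert_variation; auto.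
      * intros u _ E; apply (f_equal Im) in E; unfold back_forth, y in E; simpl in E; unfold Im in *; lra.
      * apply back_forth_variation; unfold y; lra.
    + intros u _ E; assert (K := Cmod_turn p e u He); rewrite E in K.
      replace (p - p) with (RtoC 0) in K by ring; rewrite Cmod_0 in K; lra.
    + apply turn_variation_in, He.
  - intros q v Hq Hqe Hv; rewrite <- (Rplus_0_r v); apply insert_variation; auto.
    + rewrite <- (Rplus_0_r v); apply insert_variation; auto.
      * intros u _ E; apply (f_equal Im) in E; unfold back_forth in E; simpl in E; unfold Im in *; lra.
      * apply back_forth_variation; auto.
    + intros u _ E; assert (K := Cmod_turn p e u He); rewrite E in K; lra.
    + apply turn_variation_out; auto.
Qed.

(** A vertical line at rest at time [0], where detours are inserted. *)
Definition base (c y t : R) : C := (c, (y + t * t * t)%R).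
Definition dbase (t : R) : C := (0%R, (3 * t * t)%R).

Lemma base_C1 c y : C1_path (base c y) dbase.
Proof.
  intros t; split.
  - apply is_derive_C_pair; simpl; [apply @is_derive_const|auto_derive; auto; ring].
  - apply cont_pair; [apply continuous_const|].
    apply (ex_derive_continuous (K := R_AbsRing) (V := R_NormedModule)); auto_derive; auto.
Qed.

Lemma cube_ge A t : (1 + Rabs A < t)%R -> (A < t * t * t)%R.
Proof.
  intros H; generalize (Rle_abs A) (Rabs_pos A); intros.
  assert (1 * 1 <= t * t)%R by (apply Rmult_le_compat; lra).
  assert (1 * t <= t * t * t)%R by (apply Rmult_le_compat_r; lra); lra.
Qed.

Lemma base_contour c y : contour (base c y) dbase.
Proof.
  split; [|split; [|split; [|split]]].
  - intros t; apply base_C1.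
  - intros t; apply (base_C1 c y).
  - exists (Rabs c); intros t; simpl; lra.
  - intros Q [A HA]; exists (- (1 + Rabs (y - A)))%R; intros t Ht; apply HA; simpl.
    assert (K := cube_ge (y - A) (- t)%R ltac:(lra)); lra.
  - intros Q [A HA]; exists (1 + Rabs (A - y))%R; intros t Ht; apply HA; simpl.
    assert (K := cube_ge (A - y) t ltac:(lra)); lra.
Qed.

Lemma base_variation c y q : (Re q <> c)%R ->
  arg_variation (base c y) dbase q (if Rlt_dec (Re q) c then PI else - PI)%R.
Proof.
  intros Hq; set (u := (c - Re q)%R).
  assert (Hu : (u <> 0)%R) by (unfold u; lra).
  assert (Nu : RtoC u <> 0) by (intros E; apply RtoC_inj in E; lra).
  split; [intros t E; apply (f_equal Re) in E; simpl in E; unfold Re in *; lra|].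
  apply is_RInt_gen_R_ends; intros e He.
  destruct (atan_spread u (Im q) e Hu He) as [M HM].
  exists (1 + Rabs (Rabs M + Rabs y))%R; intros a b Ha Hb.
  assert (H := half_plane_variation (base c y) dbase q (RtoC u) a b (base_C1 c y) Nu).
  assert (Er : forall t, Re ((base c y t - q) * / RtoC u) = 1%R).
  { intros t; unfold u, base, Cinv, Cmult, Cminus, Cplus, Copp, RtoC, Re, Im in *; simpl in *; field; auto. }
  assert (Ei : forall t, (Im ((base c y t - q) * / RtoC u) / Re ((base c y t - q) * / RtoC u))%R = ((y + t * t * t - Im q) / u)%R).
  { intros t; rewrite Er; unfold u, base, Cinv, Cmult, Cminus, Cplus, Copp, RtoC, Re, Im in *; simpl in *; field; auto. }
  rewrite !Ei in H.
  eexists; split; [apply H; intros t _; rewrite Er; lra|].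
  assert (K1 := cube_ge (Rabs M + Rabs y) b ltac:(lra)).
  assert (K2 := cube_ge (Rabs M + Rabs y) (- a)%R ltac:(lra)).
  assert (Ed : (if Rlt_dec (Re q) c then PI else (- PI)%R) = (if Rlt_dec 0 u then PI else (- PI)%R)).
  { unfold u; clear; destruct (Rlt_dec (Re q) c), (Rlt_dec 0 (c - Re q)); try reflexivity; exfalso; lra. }
  rewrite Ed.
  generalize (Rle_abs M) (Rle_abs y) (Rle_abs (- y)%R); rewrite Rabs_Ropp; intros.
  apply HM; lra.
Qed.

(** * Construction of an admissible contour *)

(** Used with d = b - a + 1: no b + n then lies at the height Im a + e of the excursions, nor inside
    or on a circle of radius e about a pole a - 1 - k. A single radius works for all n because the
    translates recede. *)
Lemma shift_gap (d : C) : (forall n, d + Cnat n <> 0) ->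
  exists e0, (0 < e0)%R /\ forall e, (0 < e <= e0)%R -> Im d <> e /\ forall n, (e < Cmod (d + Cnat n))%R.
Proof.
  intros H; destruct (Req_dec_T (Im d) 0) as [E|N].
  - assert (HR : forall n, (Re d + INR n <> 0)%R).
    { intros n En; apply (H n); unfold Cnat, Cplus, RtoC; destruct d as [x y]; simpl in *.
      rewrite E, En; unfold RtoC; f_equal; ring. }
    assert (G : exists e0, (0 < e0)%R /\ forall n, (e0 < Rabs (Re d + INR n))%R).
    { destruct (Rlt_dec 0 (Re d)) as [Hp|Hp].
      - exists (Re d / 2)%R; split; [lra|]; intros n; generalize (pos_INR n); intros; rewrite Rabs_pos_eq; lra.
      - destruct (nfloor_ex (- Re d)%R ltac:(lra)) as [k [K1 K2]].
        assert (K1' : (INR k < - Re d)%R) by (generalize (HR k); lra).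
        exists (Rmin (- Re d - INR k) (INR k + 1 + Re d) / 2)%R.
        assert (P : (0 < Rmin (- Re d - INR k) (INR k + 1 + Re d))%R) by (apply Rmin_case; lra).
        split; [lra|]; intros n.
        assert (G1 := Rmin_l (- Re d - INR k) (INR k + 1 + Re d)); assert (G2 := Rmin_r (- Re d - INR k) (INR k + 1 + Re d)).
        destruct (Nat.le_gt_cases n k) as [Hn|Hn].
        + apply le_INR in Hn; rewrite Rabs_left; lra.
        + assert (Hn' : (S k <= n)%nat) by lia; apply le_INR in Hn'; rewrite S_INR in Hn'.
          rewrite Rabs_pos_eq; lra. }
    destruct G as [e0 [He0 G]]; exists e0; split; auto; intros e He; split; [lra|]; intros n.
    eapply Rle_lt_trans; [apply He|]; eapply Rlt_le_trans; [apply (G n)|rewrite <- Re_plus_Cnat; apply re_le_Cmod].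
  - assert (P : (0 < Rabs (Im d))%R) by (apply Rabs_pos_lt, N).
    exists (Rabs (Im d) / 2)%R; split; [lra|]; intros e He; split.
    + intros E; rewrite E, Rabs_pos_eq in He by lra; lra.
    + intros n; eapply Rlt_le_trans; [|apply im_le_Cmod].
      replace (Im (d + Cnat n)) with (Im d) by (unfold Im, Cnat; simpl; ring); lra.
Qed.

Lemma common_shift_gap (ds : list C) : (forall d n, In d ds -> d + Cnat n <> 0) ->
  exists e0, (0 < e0)%R /\ forall e d, (0 < e <= e0)%R -> In d ds ->
    Im d <> e /\ forall n, (e < Cmod (d + Cnat n))%R.
Proof.
  induction ds as [|d ds IH]; intros H.
  - exists 1%R; split; [lra|intros e d _ []].
  - destruct IH as [e1 [He1 H1]]; [intros; apply H; right; auto|].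
    destruct (shift_gap d) as [e2 [He2 H2]]; [intros; apply H; left; auto|].
    exists (Rmin e1 e2); split; [apply Rmin_case; auto|]; intros e x He [<-|Hx].
    + apply H2; generalize (Rmin_r e1 e2); lra.
    + apply H1; auto; generalize (Rmin_l e1 e2); lra.
Qed.

Lemma lower_bound (bs : list C) (x : R) : exists M : nat, forall b, In b bs -> (x - INR M < Re b)%R.
Proof.
  induction bs as [|b bs [M IH]]; [exists O; intros b []|].
  destruct (nfloor_ex (Rabs (x - Re b)) (Rabs_pos _)) as [k [_ Hk]].
  exists (M + S k)%nat; intros b' [<-|Hb]; rewrite plus_INR, S_INR.
  - generalize (Rle_abs (x - Re b)) (pos_INR M); lra.
  - generalize (IH b' Hb) (pos_INR k); lra.
Qed.

(** The line Re s = c is to the left of all poles b + n but also of the M + 1 poles a - 1 - k with k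
    <= M. One detour for each of these raises its variation from -PI to PI. They share the imaginary
    part Im a, so all excursions run at the same height. *)
Lemma contour_exists (a : C) (b1 : list C) : MeijerG_defined [a] b1 ->
  exists L dL, contour L dL /\ separates L dL [a] b1.
Proof.
  intros Hdef.
  destruct (lower_bound b1 (Re a - 1)) as [M HM].
  set (c := (Re a - 1 - INR M - 1 / 2)%R).
  destruct (common_shift_gap (map (fun b => b - a + 1) b1)) as [e0 [He0 Hgap]].
  { intros d n Hd; apply in_map_iff in Hd; destruct Hd as [b [<- Hb]] ; intros E.
    apply (Hdef a b (or_introl eq_refl) Hb n); rewrite Cnat_S; apply Ceq_minus.
    transitivity (- (b - a + 1 + Cnat n)); [ring|rewrite E; ring]. }
  (* At most 1/2, so that a circle about one pole a - 1 - k excludes the others, which are at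
     distance at least 1. *)
  set (e := Rmin e0 (1 / 2)).
  assert (He : (0 < e)%R) by (unfold e; apply Rmin_case; lra).
  assert (He1 : (e <= 1 / 2)%R) by apply Rmin_r.
  assert (Hg : forall b, In b b1 -> Im b <> (Im a + e)%R /\ forall n, (e < Cmod (b - a + 1 + Cnat n))%R).
  { intros b Hb; destruct (Hgap e (b - a + 1) (conj He (Rmin_l _ _))) as [G1 G2].
    - apply in_map_iff; eauto.
    - split; auto; intros E; apply G1; unfold Im in *; simpl; lra. }
  set (lp := fun k : nat => a - 1 - Cnat k).
  assert (Iml : forall k, Im (lp k) = Im a) by (intros k; unfold lp, Im, Cnat; simpl; ring).
  assert (Rel : forall k, Re (lp k) = (Re a - 1 - INR k)%R) by (intros k; unfold lp, Re, Cnat; simpl; ring).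
  assert (MAIN : forall K, (K <= S M)%nat -> exists L dL, contour L dL /\ L 0%R = (c, (Im a + e)%R) /\ dL 0%R = 0 /\
    (forall k, (k < K \/ M < k)%nat -> arg_variation L dL (lp k) PI) /\
    (forall k, (K <= k <= M)%nat -> arg_variation L dL (lp k) (- PI)) /\
    (forall b n, In b b1 -> arg_variation L dL (b + Cnat n) (- PI))).
  { induction K as [|K IH]; intros HK.
    - exists (base c (Im a + e)), dbase; split; [apply base_contour|split; [|split; [|split; [|split]]]].
      + unfold base; f_equal; ring.
      + unfold dbase, RtoC; f_equal; ring.
      + intros k [Hk|Hk]; [lia|].
        assert (Hk' : (S M <= k)%nat) by lia; apply le_INR in Hk'; rewrite S_INR in Hk'.
        assert (V := base_variation c (Im a + e) (lp k)); rewrite Rel in V; unfold c in *.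
        destruct Rlt_dec in V; [apply V; lra|exfalso; lra].
      + intros k [_ Hk]; apply le_INR in Hk.
        assert (V := base_variation c (Im a + e) (lp k)); rewrite Rel in V; unfold c in *.
        destruct Rlt_dec in V; [exfalso; lra|apply V; lra].
      + intros b n Hb; specialize (HM b Hb); assert (Hn := pos_INR n).
        assert (V := base_variation c (Im a + e) (b + Cnat n)); rewrite Re_plus_Cnat in V; unfold c in *.
        destruct Rlt_dec in V; [exfalso; lra|apply V; lra].
    - destruct (IH ltac:(lia)) as [L [dL [HL [L0 [dL0 [V1 [V2 V3]]]]]]].
      destruct (detour L dL c e (lp K)) as [L' [dL' [HL' [L0' [dL0' [W1 W2]]]]]]; auto.
      { rewrite Iml; auto. }
      rewrite Iml in *.
      assert (Hll : forall k, k <> K -> (e < Cmod (lp k - lp K))%R).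
      { intros k Hk; eapply Rlt_le_trans; [|apply re_le_Cmod].
        change (Re (lp k - lp K)) with (Re (lp k) - Re (lp K))%R; rewrite !Rel.
        destruct (Nat.lt_gt_cases k K) as [Hc _]; destruct (Hc Hk) as [H|H].
        - assert (H' : (S k <= K)%nat) by lia; apply le_INR in H'; rewrite S_INR in H'; rewrite Rabs_pos_eq; lra.
        - assert (H' : (S K <= k)%nat) by lia; apply le_INR in H'; rewrite S_INR in H'; rewrite Rabs_left; lra. }
      assert (Hi : forall k, Im (lp k) <> (Im a + e)%R) by (intros k; rewrite Iml; lra).
      exists L', dL'; split; [auto|split; [auto|split; [auto|split; [|split]]]].
      + intros k Hk; destruct (Nat.eq_dec k K) as [->|Hn].
        * replace PI with (- PI + 2 * PI)%R by ring; apply W1, V2; lia.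
        * apply W2; auto; apply V1; lia.
      + intros k Hk; apply W2; auto; [apply Hll; lia|apply V2; lia].
      + intros b n Hb; apply W2; auto.
        * destruct (Hg b Hb) as [G _]; replace (Im (b + Cnat n)) with (Im b) by (unfold Im, Cnat; simpl; ring); auto.
        * destruct (Hg b Hb) as [_ G]; specialize (G (n + K)%nat).
          replace (b + Cnat n - lp K) with (b - a + 1 + Cnat (n + K)); auto.
          unfold lp, Cnat; rewrite plus_INR, RtoC_plus; ring. }
  destruct (MAIN (S M) (le_n _)) as [L [dL [HL [_ [_ [V1 [_ V3]]]]]]].
  exists L, dL; split; auto; split.
  - intros a' n [<-|[]]; apply V1; lia.
  - intros b n Hb; apply V3, Hb.
Qed.

(** With k = h / (A + 1), 1 + y <= e^(ky) / min(1, k); the A-th power of the exponential is at most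
    e^(hy). *)
Lemma pow_le_exp (A : nat) (h : R) : (0 < h)%R ->
  exists D, (0 < D)%R /\ forall y, (0 <= y)%R -> ((1 + y) ^ A <= D * exp (h * y))%R.
Proof.
  intros Hh; set (k := (h / (INR A + 1))%R).
  assert (HA := pos_INR A).
  assert (Hk : (0 < k)%R) by (apply Rdiv_lt_0_compat; lra).
  set (q := Rmin 1 k); assert (Hq : (0 < q)%R) by (apply Rmin_case; lra).
  exists ((/ q) ^ A)%R; split; [apply pow_lt, Rinv_0_lt_compat, Hq|]; intros y Hy.
  apply Rle_trans with ((/ q * exp (k * y)) ^ A)%R.
  - apply pow_incr; split; [lra|].
    apply Rmult_le_reg_l with q; auto; rewrite <- Rmult_assoc, Rinv_r, Rmult_1_l by lra.
    generalize (exp_ineq1_le (k * y)) (Rmin_l 1 k) (Rmin_r 1 k); fold q; intros.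
    assert (q * y <= k * y)%R by (apply Rmult_le_compat_r; lra); lra.
  - rewrite Rpow_mult_distr; apply Rmult_le_compat_l; [apply Rlt_le, pow_lt, Rinv_0_lt_compat, Hq|].
    assert (E : forall n, (exp (k * y) ^ n = exp (INR n * (k * y)))%R).
    { induction n; [simpl; rewrite Rmult_0_l, exp_0; auto|].
      rewrite S_INR; simpl pow; rewrite IHn, <- exp_plus; f_equal; ring. }
    rewrite E; apply exp_le.
    assert (E2 : h = (k * (INR A + 1))%R) by (unfold k; field; lra); rewrite E2.
    assert (0 <= k * y)%R by (apply Rmult_le_pos; lra); lra.
Qed.

(** * Improper integrals along a vertical line *)

Lemma exp_tail (G : R -> C) (A h a b : R) (z : C) : (0 < h)%R -> (0 <= A)%R ->
  (forall y, (Cmod (G y) <= A * exp (- (h * Rabs y)))%R) -> (a <= b)%R -> is_CInt G a b z ->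
  ((0 <= a)%R -> (Cmod z <= A / h * exp (- (h * a)))%R) /\
  ((b <= 0)%R -> (Cmod z <= A / h * exp (h * b))%R).
Proof.
  intros Hh HA HG Hab Hz; assert (HAh : (0 <= A / h)%R) by (apply Rmult_le_pos; [auto|apply Rlt_le, Rinv_0_lt_compat, Hh]).
  assert (C : forall f : R -> R, (forall y, ex_derive f y) -> forall y, continuous f y).
  { intros f Hf y; apply (ex_derive_continuous (K := R_AbsRing) (V := R_NormedModule)), Hf. }
  split; intros H0.
  - assert (I : is_RInt (fun y => A * exp (- (h * y)))%R a b (minus (- (A / h) * exp (- (h * b))) (- (A / h) * exp (- (h * a))))%R).
    { apply (is_RInt_derive (V := R_CompleteNormedModule) (fun y => - (A / h) * exp (- (h * y)))%R); intros y _.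
      - auto_derive; auto; field; lra.
      - apply C; intros; auto_derive; auto. }
    eapply Rle_trans; [eapply is_CInt_bound_fun; [exact Hab| |exact Hz|exact I]|].
    + intros y Hy; generalize (HG y); rewrite Rabs_pos_eq by lra; auto.
    + unfold minus, plus, opp; simpl.
      assert (0 <= A / h * exp (- (h * b)))%R by (apply Rmult_le_pos; [auto|apply Rlt_le, exp_pos]); lra.
  - assert (I : is_RInt (fun y => A * exp (h * y))%R a b (minus (A / h * exp (h * b)) (A / h * exp (h * a)))%R).
    { apply (is_RInt_derive (V := R_CompleteNormedModule) (fun y => A / h * exp (h * y))%R); intros y _.
      - auto_derive; auto; field; lra.
      - apply C; intros; auto_derive; auto. }
    eapply Rle_trans; [eapply is_CInt_bound_fun; [exact Hab| |exact Hz|exact I]|].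
    + intros y Hy; generalize (HG y); rewrite Rabs_left1 by lra.
      replace (- (h * - y))%R with (h * y)%R by ring; auto.
    + unfold minus, plus, opp; simpl.
      assert (0 <= A / h * exp (h * a))%R by (apply Rmult_le_pos; [auto|apply Rlt_le, exp_pos]); lra.
Qed.

Lemma lim_exp_n (A h : R) : (0 < h)%R -> is_lim_seq (fun n => A * exp (- (h * INR n)))%R 0.
Proof.
  intros Hh; replace (Finite 0) with (Rbar_mult A 0) by (simpl; f_equal; ring); apply is_lim_seq_scal_l.
  apply (is_lim_seq_ext (fun n => exp (- h) ^ n)%R).
  - induction n; [simpl; rewrite Rmult_0_r, Ropp_0, exp_0; auto|].
    rewrite S_INR; simpl pow; rewrite IHn, <- exp_plus; f_equal; ring.
  - apply is_lim_seq_geom; rewrite Rabs_pos_eq by (apply Rlt_le, exp_pos).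
    rewrite <- exp_0; apply exp_increasing; lra.
Qed.

(** The integrals over [-n, n] form a Cauchy sequence with rate 2 (A / h) e^(-hn), which also
    controls every larger interval. *)
Lemma improper_exp (G : R -> C) (A h : R) : (0 < h)%R -> (0 <= A)%R ->
  (forall y, cont_C G y) -> (forall y, (Cmod (G y) <= A * exp (- (h * Rabs y)))%R) ->
  exists J : C, (Cmod J <= 2 * (A / h))%R /\
    forall e, (0 < e)%R -> exists M, forall y1 y2 z, (y1 < - M)%R -> (M < y2)%R ->
      is_CInt G y1 y2 z -> (Cmod (z - J) < e)%R.
Proof.
  intros Hh HA HC HG.
  set (u := fun n : nat => CInt G (- INR n) (INR n)).
  assert (Iall : forall a b, is_CInt G a b (CInt G a b)) by (intros; apply CInt_correct; auto).
  assert (Key : forall (n : nat) y1 y2 z, (y1 <= - INR n)%R -> (INR n <= y2)%R -> is_CInt G y1 y2 z ->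
     (Cmod (z - u n) <= 2 * (A / h) * exp (- (h * INR n)))%R).
  { intros n y1 y2 z H1 H2 Hz.
    assert (E := is_CInt_unique _ _ _ _ (is_CInt_Chasles _ _ _ _ _ _ (Iall y1 (- INR n)%R)
      (is_CInt_Chasles _ _ _ _ _ _ (Iall (- INR n)%R (INR n)) (Iall (INR n) y2)))).
    rewrite (is_CInt_unique _ _ _ _ Hz) in E; fold (u n) in E.
    replace (z - u n) with (CInt G y1 (- INR n) + CInt G (INR n) y2) by (rewrite E; ring).
    eapply Rle_trans; [apply Cmod_triangle|].
    destruct (exp_tail G A h y1 (- INR n) _ Hh HA HG H1 (Iall _ _)) as [_ T1].
    destruct (exp_tail G A h (INR n) y2 _ Hh HA HG H2 (Iall _ _)) as [T2 _].
    specialize (T1 ltac:(generalize (pos_INR n); lra)); specialize (T2 (pos_INR n)).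
    replace (h * - INR n)%R with (- (h * INR n))%R in T1 by ring; lra. }
  destruct (cauchy_rate u (fun n => 2 * (A / h) * exp (- (h * INR n)))%R) as [J HJ].
  - intros n m Hnm; apply le_INR in Hnm; apply (Key n (- INR m) (INR m))%R; [lra|lra|apply Iall].
  - apply lim_exp_n, Hh.
  - exists J; split.
    (* The rate at n = 0, where the integral is over a single point, is the bound on [J]. *)
    + specialize (HJ O); unfold u in HJ; simpl INR in HJ; rewrite Rmult_0_r, Ropp_0, exp_0, Rmult_1_r in HJ.
      replace (CInt G 0 0) with (RtoC 0) in HJ.
      * replace (0 - J) with (- J) in HJ by ring; rewrite Cmod_opp in HJ; auto.
      * symmetry; apply is_CInt_unique, (is_RInt_point (V := C_R_NormedModule)).
    + intros e He.
      destruct (small_eventually _ (e / 2) (lim_exp_n (2 * (A / h)) h Hh) ltac:(lra)) as [N HN].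
      exists (INR N); intros y1 y2 z H1 H2 Hz.
      assert (K := Key N y1 y2 z ltac:(lra) ltac:(lra) Hz); assert (K2 := HJ N); specialize (HN N (le_n _)); cbv beta in *.
      replace (z - J) with ((z - u N) + (u N - J)) by ring.
      eapply Rle_lt_trans; [apply Cmod_triangle|]; lra.
Qed.

(** * Factoring the poles out of the Gamma functions *)

Lemma least_shift (x be : R) : exists K : nat, (be <= x + INR K)%R /\ forall n, (n < K)%nat -> (x + INR n < be)%R.
Proof.
  destruct (nfloor_ex (Rabs (be - x)) (Rabs_pos _)) as [k [_ Hk]].
  assert (H : (be <= x + INR (S k))%R) by (rewrite S_INR; generalize (Rle_abs (be - x)); lra).
  revert H; generalize (S k); clear k Hk; intros k; induction k; intros H.
  - exists O; split; [auto|intros; lia].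
  - destruct (Rle_lt_dec be (x + INR k)) as [H1|H1]; [apply IHk, H1|].
    exists (S k); split; auto; intros n Hn; assert (Hn' : (n <= k)%nat) by lia; apply le_INR in Hn'; lra.
Qed.

Lemma Gamma_affine_smooth (U : C -> Prop) (c d : C) :
  (forall z, U z -> rhp (c * z + d)) -> smooth U (fun s => Gamma (c * s + d)).
Proof. intros H; apply (smooth_affine U rhp Gamma); [apply Gamma_smooth|auto]. Qed.

Lemma rGamma_affine_smooth (al be : R) (c : C) : 
  smooth (strip al be) (fun s => / Gamma (1 - c + s)).
Proof.
  destruct (least_shift (1 - Re c + al) 0) as [K [HK _]].
  assert (HR : forall z, strip al be z -> rhp (1 * z + (1 - c + Cnat (S K)))).
  { intros z Hz; unfold strip, rhp in *.
    replace (Re (1 * z + (1 - c + Cnat (S K)))) with (Re z + (1 - Re c) + INR (S K))%R by (unfold Re, Cnat; simpl; ring).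
    rewrite S_INR; lra. }
  apply (smooth_ext _ (fun s => poch (S K) (1 * s + (1 - c)) * / Gamma (1 * s + (1 - c + Cnat (S K))))).
  - apply strip_open.
  - intros z _; rewrite (rGamma_poch (S K) (1 - c + z)); f_equal; [f_equal; ring|do 2 f_equal; ring].
  - apply smooth_mult.
    + apply (smooth_prod _ (seq 0 (S K)) (fun k s => 1 * s + (1 - c) + Cnat k)); intros k _.
      repeat apply smooth_plus; try apply smooth_const; apply smooth_mult; [apply smooth_const|apply smooth_id].
    + apply smooth_inv; [|apply Gamma_affine_smooth, HR].
      intros z Hz; apply Gamma_neq_0, rhp_regular, HR, Hz.
Qed.

(** Gamma(b - s) = Gamma(b - s + K) / ((b - s) ... (b - s + K - 1)). K is large enough for the
    numerator to be pole-free in the strip, and least, so that all the roots listed lie inside the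
    strip. *)
Lemma Gamma_right_poles (al be : R) (b : C) : (al < Re b)%R -> exists (l : list C) (H : C -> C),
  smooth (strip al be) H /\ (forall p, In p l -> strip al be p /\ exists n, p = b + Cnat n) /\
  forall s, Gamma (b - s) = H s / lprod l s.
Proof.
  intros Hb; destruct (least_shift (Re b) be) as [K [HK1 HK2]].
  set (l := map (fun n => b + Cnat n) (seq 0 K)).
  exists l, (fun s => RtoC ((-1) ^ K) * Gamma (RtoC (-1) * s + (b + Cnat K))); split; [|split].
  - apply smooth_mult; [apply smooth_const|]; apply Gamma_affine_smooth; intros z Hz; unfold strip, rhp in *.
    replace (Re (RtoC (-1) * z + (b + Cnat K))) with (Re b + INR K - Re z)%R by (unfold Re, Cnat; simpl; ring); lra.
  - intros p Hp; apply in_map_iff in Hp; destruct Hp as [n [<- Hn]]; apply in_seq in Hn; split; [|eauto].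
    unfold strip; rewrite Re_plus_Cnat; generalize (pos_INR n) (HK2 n ltac:(lia)); lra.
  - intros s; rewrite (Gamma_poch K (b - s)).
    replace (RtoC (-1) * s + (b + Cnat K)) with (b - s + Cnat K) by ring.
    assert (E : poch K (b - s) = RtoC ((-1) ^ K) * lprod l s).
    { unfold l, poch, lprod; clear HK1 HK2 l; rewrite map_map.
      assert (G : forall j, Cprod (map (fun k => b - s + Cnat k) (seq j K)) =
        RtoC ((-1) ^ K) * Cprod (map (fun k => s - (b + Cnat k)) (seq j K))).
      { induction K; intros j; [simpl; ring|].
        cbn [seq map]; rewrite !Cprod_cons, IHK; simpl pow; rewrite RtoC_mult; ring. }
      apply G. }
    assert (N : RtoC ((-1) ^ K) <> 0) by (intros E0; apply RtoC_inj in E0; apply (pow_nonzero (-1) K); lra).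
    assert (S1 : RtoC ((-1) ^ K) * RtoC ((-1) ^ K) = 1).
    { rewrite <- RtoC_mult; f_equal; rewrite <- Rpow_mult_distr; replace (-1 * -1)%R with 1%R by ring; apply pow1. }
    rewrite E; unfold Cdiv; rewrite Cinv_total.
    replace (/ RtoC ((-1) ^ K)) with (RtoC ((-1) ^ K)); [ring|].
    transitivity (RtoC ((-1) ^ K) * RtoC ((-1) ^ K) / RtoC ((-1) ^ K)); [field; auto|rewrite S1; unfold Cdiv; ring].
Qed.

Lemma Gamma_prod_right_poles (al be : R) (bs : list C) : (forall b, In b bs -> (al < Re b)%R) ->
  exists (l : list C) (H : C -> C), smooth (strip al be) H /\
    (forall p, In p l -> strip al be p /\ exists b n, In b bs /\ p = b + Cnat n) /\
    forall s, Cprod (map (fun b => Gamma (b - s)) bs) = H s / lprod l s.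
Proof.
  induction bs as [|b bs IH]; intros Hbs.
  - exists [], (fun _ => RtoC 1); split; [apply smooth_const|split; [intros p []|]].
    intros s; unfold lprod, Cprod; simpl; field; apply C1_nz.
  - destruct IH as [l [H [SH [Hl E]]]]; [intros; apply Hbs; right; auto|].
    destruct (Gamma_right_poles al be b) as [l' [H' [SH' [Hl' E']]]]; [apply Hbs; left; auto|].
    exists (l' ++ l), (fun s => H' s * H s); split; [apply smooth_mult; auto|split].
    + intros p Hp; apply in_app_or in Hp; destruct Hp as [Hp|Hp].
      * destruct (Hl' p Hp) as [Sp [n ->]]; split; auto; exists b, n; split; [left|]; auto.
      * destruct (Hl p Hp) as [Sp [b' [n [Hb' ->]]]]; split; auto; exists b', n; split; [right|]; auto.
    + intros s; cbn [map]; rewrite Cprod_cons, E, E', lprod_app; unfold Cdiv; rewrite Cinv_total; ring.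
Qed.

Definition lpole (a : C) (k : nat) : C := a - 1 - Cnat k.

Lemma Re_lpole a k : Re (lpole a k) = (Re a - 1 - INR k)%R.
Proof. unfold lpole, Re, Cnat; simpl; ring. Qed.

Lemma poch_lpole (a s : C) K : poch K (1 - a + s) = lprod (map (lpole a) (seq 0 K)) s.
Proof.
  unfold poch, lprod; rewrite map_map; f_equal; apply map_ext; intros k; unfold lpole; ring.
Qed.

(** * The Meijer G-function with one upper parameter *)

Section Meijer.
Variables (a : C) (b1 b2 : list C).
Hypothesis Hdef : MeijerG_defined [a] b1.

Definition gpart (s : C) : C :=
  Cprod (map (fun b => Gamma (b - s)) b1) * Gamma (1 - a + s) * Cprod (map (fun b => / Gamma (1 - b + s)) b2).

Lemma integrand_gpart X s : MeijerG_integrand [a] [] b1 b2 X s = gpart s * Cpowc X s.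
Proof.
  unfold MeijerG_integrand, gpart; cbn [map]; rewrite Cprod_cons.
  assert (E : forall l, / Cprod (map (fun b => Gamma (1 - b + s)) l) = Cprod (map (fun b => / Gamma (1 - b + s)) l)).
  { induction l; [unfold Cprod; simpl; field; apply C1_nz|].
    cbn [map]; rewrite !Cprod_cons, Cinv_total, IHl; auto. }
  unfold Cdiv; rewrite Cinv_total, E.
  replace (Cprod []) with (RtoC 1) by reflexivity.
  replace (/ RtoC 1) with (RtoC 1) by (field; apply C1_nz); ring.
Qed.

(** The residue of [gpart] at [a - 1 - k]; the factor [Gamma (1 - a + s)] contributes [(-1)^k / k!]. *)
Definition gres (k : nat) : C :=
  (- (1)) ^ k / Cnat (fact k) * Cprod (map (fun b => Gamma (b - lpole a k)) b1)
  * Cprod (map (fun b => / Gamma (1 - b + lpole a k)) b2).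

(** The exponential rate of decay of [gpart] along vertical lines: PI/2 for every Gamma in the
    numerator, -PI/2 for every one in the denominator. *)
Definition rate : R := (INR (length b1) * (PI / 2) + PI / 2 - INR (length b2) * (PI / 2))%R.

Lemma gpart_growth al be : growth al be (- rate) gpart.
Proof.
  unfold gpart, rate.
  replace (- (INR (length b1) * (PI / 2) + PI / 2 - INR (length b2) * (PI / 2)))%R with
    ((INR (length b1) * - (PI / 2) + - (PI / 2)) + INR (length b2) * (PI / 2))%R by ring.
  apply growth_mult; [apply growth_mult|].
  - apply growth_prod; intros b _.
    apply (growth_ext _ _ _ (fun s => Gamma (b + RtoC (-1) * s))); [intros; f_equal; ring|].
    apply growth_Gamma; auto.
  - apply (growth_ext _ _ _ (fun s => Gamma (1 - a + RtoC 1 * s))); [intros; f_equal; ring|].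
    apply growth_Gamma; auto.
  - apply (growth_prod al be (PI / 2) b2 (fun b s => / Gamma (1 - b + s))); intros b _.
    apply (growth_ext _ _ _ (fun s => / Gamma (1 - b + RtoC 1 * s))); [intros; do 2 f_equal; ring|].
    apply growth_rGamma; auto.
Qed.

Lemma cont_const_minus (c s : C) : cont_C (fun s : C => c - s) s.
Proof. apply cont_minus; [apply cont_const|apply cont_id]. Qed.
Lemma cont_const_plus (c s : C) : cont_C (fun s : C => c + s) s.
Proof. apply cont_plus; [apply cont_const|apply cont_id]. Qed.

Lemma rest_cont (s : C) : (forall b, In b b1 -> Gamma_regular (b - s)) ->
  cont_C (fun s => Cprod (map (fun b => Gamma (b - s)) b1)) s /\
  cont_C (fun s => Cprod (map (fun b => / Gamma (1 - b + s)) b2)) s.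
Proof.
  intros Hs; split.
  - apply (cont_prod b1 (fun b s => Gamma (b - s))); intros b Hb.
    apply (cont_comp Gamma (fun s => b - s)); [apply cont_const_minus|apply Gamma_cont, Hs, Hb].
  - apply (cont_prod b2 (fun b s => / Gamma (1 - b + s))); intros b Hb.
    apply (cont_comp (fun u => / Gamma u) (fun s => 1 - b + s)); [apply cont_const_plus|apply rGamma_cont].
Qed.

(** Otherwise a - b would be the positive integer n + k + 1, against the parameter condition. *)
Lemma lpole_regular b k : In b b1 -> Gamma_regular (b - lpole a k).
Proof.
  intros Hb; apply Gamma_regular_iff; intros n E.
  apply (Hdef a b (or_introl eq_refl) Hb (n + k)%nat); apply Ceq_minus.
  transitivity (- (b - lpole a k + Cnat n)); [|rewrite E; ring].
  rewrite Cnat_S; unfold lpole, Cnat; rewrite plus_INR, RtoC_plus; ring.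
Qed.

Lemma poch_opp_nat k : poch k (- Cnat k) = (- (1)) ^ k * Cnat (fact k).
Proof.
  induction k; [unfold poch, Cprod, Cnat; simpl; ring|].
  rewrite poch_S_l; replace (- Cnat (S k) + 1) with (- Cnat k) by (rewrite Cnat_S; ring).
  rewrite IHk, fact_simpl, Cnat_mult; simpl Cpow; ring.
Qed.

Lemma sign_sq k : (- (1)) ^ k * (- (1)) ^ k = 1.
Proof.
  induction k; [simpl; ring|]; simpl Cpow.
  transitivity ((- (1)) ^ k * (- (1)) ^ k); [ring|auto].
Qed.

Lemma Gamma_1 : Gamma 1 = 1.
Proof.
  apply Gamma_of_lim; apply (flim_ext eventually (fun n => Cnat n / Cnat (S n))); [|apply lim_n_Sn].
  exists 1%nat; intros n Hn; symmetry; apply Gamma_seq_1, Hn.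
Qed.

(** Shifting Gamma(1 - a + s) by k + 1 steps isolates the factor s - p in the denominator. At the
    pole the shifted Gamma is Gamma(1) = 1, and the remaining product is (-k) ... (-1) = (-1)^k
    k!. *)
Lemma gpart_residue (X : C) k :
  is_residue (fun s => gpart s * Cpowc X s) (lpole a k) (gres k * Cpowc X (lpole a k)).
Proof.
  set (p := lpole a k).
  assert (Ep : 1 - a + p = - Cnat k) by (unfold p, lpole; ring).
  assert (Nf : Cnat (fact k) <> 0) by (apply Cnat_neq_0, lt_O_fact).
  assert (Ns : (- (1)) ^ k <> 0) by (intros E; assert (S := sign_sq k); rewrite E in S; apply C1_nz; rewrite <- S; ring).
  assert (Np : poch k (1 - a + p) <> 0) by (rewrite Ep, poch_opp_nat; apply Cmult_neq_0; auto).
  destruct (rest_cont p) as [C1' C2']; [intros b Hb; apply lpole_regular, Hb|].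
  exists (fun s => Cprod (map (fun b => Gamma (b - s)) b1) * (Gamma (1 - a + s + Cnat (S k)) / poch k (1 - a + s))
    * Cprod (map (fun b => / Gamma (1 - b + s)) b2) * Cexp (s * Clog X)); split; [|split].
  - apply filter_forall; intros s Hs; Cvars; unfold gpart, Cpowc; rewrite (Gamma_poch (S k) (1 - a + s)), poch_S.
    assert (N : s - p <> 0) by (intros E; apply Hs, Ceq_minus, E).
    replace (1 - a + s + Cnat k) with (s - p) by (unfold p, lpole; ring).
    unfold Cdiv; rewrite Cinv_total.
    generalize (/ poch k (1 - a + s)) (Gamma (1 - a + s + Cnat (S k))); intros u v.
    field; auto.
  - apply cont_mult; [apply cont_mult; [apply cont_mult; [exact C1'|]|exact C2']|].
    + apply cont_div; [exact Np| |].
      * apply (cont_comp Gamma (fun s => 1 - a + s + Cnat (S k))).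
        -- apply cont_plus; [apply cont_const_plus|apply cont_const].
        -- apply Gamma_cont; rewrite Ep, Cnat_S; replace (- Cnat k + (Cnat k + 1)) with (RtoC 1) by ring.
           apply rhp_regular, rhp_1.
      * apply (cont_comp (poch k) (fun s => 1 - a + s)); [apply cont_const_plus|apply cont_poch].
    + apply (cont_comp Cexp (fun s => s * Clog X)); [|apply cont_Cexp].
      apply cont_mult; [apply cont_id|apply cont_const].
  - cbv beta; rewrite Ep, Cnat_S; replace (- Cnat k + (Cnat k + 1)) with (RtoC 1) by ring.
    rewrite Gamma_1, poch_opp_nat; unfold gres, Cpowc; fold p.
    replace (1 / ((- (1)) ^ k * Cnat (fact k))) with ((- (1)) ^ k / Cnat (fact k)); [ring|].
    transitivity ((- (1)) ^ k * (- (1)) ^ k / ((- (1)) ^ k * Cnat (fact k))); [field; auto|rewrite sign_sq; auto].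
Qed.

Variable M : nat.
(** Half-way between the poles a - 1 - M and a - 1 - (M + 1), hence off all of them. *)
Definition lineM : R := (Re a - 1 - INR M - 1 / 2)%R.
Hypothesis HM : forall b, In b b1 -> (lineM < Re b)%R.

Lemma Cmod_Cpowc X s : Cmod (Cpowc X s) = exp (Re s * ln (Cmod X) - Im s * Carg X).
Proof. unfold Cpowc; rewrite Cmod_Cexp; f_equal. Qed.

Lemma gpart_line_cont y : cont_C (fun y => gpart (lineM, y)) y.
Proof.
  apply (cont_comp gpart (fun y => (lineM, y))); [apply vline_cont|].
  destruct (rest_cont (lineM, y)) as [A1 A2].
  { intros b Hb; apply rhp_regular; unfold rhp; generalize (HM b Hb); simpl; unfold Re; lra. }
  apply cont_mult; [apply cont_mult|]; auto.
  apply (cont_comp Gamma (fun s => 1 - a + s)); [apply cont_const_plus|apply Gamma_cont].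
  apply Gamma_regular_iff; intros n E; apply (f_equal Re) in E.
  assert (E2 : (1 - Re a + lineM + INR n = 0)%R) by (transitivity (Re (1 - a + (lineM, y) + Cnat n)); [unfold Re, Cnat; simpl; ring|rewrite E; reflexivity]).
  unfold lineM in E2; assert (E3 : (2 * INR n = 2 * INR M + 1)%R) by lra.
  assert (E4 : INR (2 * n) = INR (2 * M + 1)) by (rewrite plus_INR, !mult_INR; simpl; lra).
  apply INR_eq in E4; lia.
Qed.

(** Far out this is [gpart_growth], the polynomial factor being paid for by the loss [h] in the
    rate; on the remaining compact piece continuity gives a maximum. *)
Lemma gpart_line_bound (h : R) : (0 < h)%R -> exists D, (0 <= D)%R /\
  forall y, (Cmod (gpart (lineM, y)) <= D * exp (- ((rate - h) * Rabs y)))%R.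
Proof.
  intros Hh; destruct (gpart_growth lineM lineM) as [D [A [T [HD HB]]]].
  destruct (pow_le_exp A h Hh) as [E [HE1 HE2]].
  set (q := fun y => (Cmod (gpart (lineM, y)) * exp ((rate - h) * Rabs y))%R).
  destruct (continuity_ab_maj q (- Rabs T) (Rabs T)) as [y0 [Hy0 _]].
  { generalize (Rabs_pos T); lra. }
  { intros y _; apply continuity_pt_filterlim; apply (continuous_mult (K := R_AbsRing)).
    - apply (cont_Cmod (fun y => gpart (lineM, y))), gpart_line_cont.
    - apply (continuous_comp (fun y => (rate - h) * Rabs y)%R exp).
      + apply (continuous_scal_r (K := R_AbsRing) (V := R_NormedModule)), continuous_Rabs.
      + apply continuity_pt_filterlim, derivable_continuous_pt, derivable_pt_exp. }
  assert (Pq : (0 <= q y0)%R) by (apply Rmult_le_pos; [apply Cmod_ge_0|apply Rlt_le, exp_pos]).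
  assert (PDE : (0 <= D * E)%R) by (apply Rmult_le_pos; lra).
  exists (q y0 + D * E)%R; split; [lra|]; intros y.
  assert (Pe := exp_pos (- ((rate - h) * Rabs y))).
  destruct (Rle_lt_dec (Rabs T) (Rabs y)) as [H|H].
  - apply Rle_trans with (D * E * exp (- ((rate - h) * Rabs y)))%R; [|apply Rmult_le_compat_r; lra].
    eapply Rle_trans; [apply HB; [simpl; lra|simpl; eapply Rle_trans; [apply Rle_abs|exact H]]|]; simpl Im.
    replace (D * E * exp (- ((rate - h) * Rabs y)))%R with (D * (E * exp (h * Rabs y)) * exp (- rate * Rabs y))%R.
    + apply Rmult_le_compat_r; [apply Rlt_le, exp_pos|]; apply Rmult_le_compat_l; auto; apply HE2, Rabs_pos.
    + replace (D * (E * exp (h * Rabs y)) * exp (- rate * Rabs y))%R with (D * E * (exp (h * Rabs y) * exp (- rate * Rabs y)))%R by ring.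
      rewrite <- exp_plus; do 2 f_equal; ring.
  - apply Rle_trans with (q y0 * exp (- ((rate - h) * Rabs y)))%R; [|apply Rmult_le_compat_r; lra].
    specialize (Hy0 y ltac:(apply Rabs_def2 in H; lra)).
    apply Rle_trans with (q y * exp (- ((rate - h) * Rabs y)))%R; [|apply Rmult_le_compat_r; lra].
    unfold q; rewrite Rmult_assoc, <- exp_plus, Rplus_opp_r, exp_0; lra.
Qed.

Variable th : R.
Hypothesis Hth : (th < rate)%R.

(** The constant [D] does not depend on [X]; this uniformity in the sector is what the error term
    requires. *)
Lemma line_integral : exists D, (0 <= D)%R /\ forall X : C, X <> 0 -> (Rabs (Carg X) <= th)%R ->
  exists J : C, (Cmod J <= D * exp (lineM * ln (Cmod X)))%R /\
    forall e, (0 < e)%R -> exists T, forall y1 y2 z, (y1 < - T)%R -> (T < y2)%R ->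
      is_CInt (fun y => gpart (lineM, y) * Cpowc X (lineM, y) * Ci) y1 y2 z -> (Cmod (z - J) < e)%R.
Proof.
  (* Half of the margin between [rate] and the opening [th] absorbs powers of |Im s|; the other half
     makes the integral converge. *)
  set (h := ((rate - th) / 2)%R); assert (Hh : (0 < h)%R) by (unfold h; lra).
  destruct (gpart_line_bound h Hh) as [D [HD HB]].
  exists (2 * (D / h))%R; split.
  { assert (0 <= D / h)%R by (apply Rmult_le_pos; [auto|apply Rlt_le, Rinv_0_lt_compat, Hh]); lra. }
  intros X HX HA; set (P := exp (lineM * ln (Cmod X))).
  assert (PP : (0 < P)%R) by apply exp_pos.
  destruct (improper_exp (fun y => gpart (lineM, y) * Cpowc X (lineM, y) * Ci) (D * P) h Hh) as [J [HJ1 HJ2]].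
  - apply Rmult_le_pos; lra.
  - intros y; apply cont_mult; [apply cont_mult; [apply gpart_line_cont|]|apply cont_const].
    unfold Cpowc; apply (cont_comp Cexp (fun y => ((lineM, y) : C) * Clog X)); [|apply cont_Cexp].
    apply cont_mult; [apply vline_cont|apply cont_const].
  - intros y; rewrite !Cmod_mult, Cmod_Ci, Rmult_1_r, Cmod_Cpowc; simpl Re; simpl Im.
    unfold Rminus; rewrite exp_plus; fold P.
    replace (D * P * exp (- (h * Rabs y)))%R with (D * exp (- ((rate - h) * Rabs y)) * (P * exp (th * Rabs y)))%R.
    + apply Rmult_le_compat; [apply Cmod_ge_0| |apply HB|].
      * apply Rmult_le_pos; apply Rlt_le; [auto|apply exp_pos].
      * apply Rmult_le_compat_l; [lra|]; apply exp_le.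
        eapply Rle_trans; [apply Rle_abs|]; rewrite Rabs_Ropp, Rabs_mult, Rmult_comm.
        apply Rmult_le_compat_r; [apply Rabs_pos|auto].
    + replace (D * exp (- ((rate - h) * Rabs y)) * (P * exp (th * Rabs y)))%R with
        (D * P * (exp (- ((rate - h) * Rabs y)) * exp (th * Rabs y)))%R by ring.
      rewrite <- exp_plus; do 2 f_equal; unfold h; field.
  - exists J; split; [|exact HJ2]; eapply Rle_trans; [exact HJ1|]; right; unfold Rdiv; ring.
Qed.

Lemma integrand_decay (al be : R) (X : C) : X <> 0 -> (Rabs (Carg X) <= th)%R ->
  forall e, (0 < e)%R -> exists T, forall s, strip al be s -> (T <= Rabs (Im s))%R ->
    (Cmod (gpart s * Cpowc X s) <= e)%R.
Proof.
  intros HX HA e He; set (h := ((rate - th) / 2)%R); assert (Hh : (0 < h)%R) by (unfold h; lra).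
  destruct (gpart_growth al be) as [D [A [T [HD HB]]]].
  destruct (pow_le_exp A h Hh) as [E [HE1 HE2]].
  set (P := exp ((Rabs al + Rabs be) * Rabs (ln (Cmod X)))).
  assert (PP : (0 < P)%R) by apply exp_pos.
  set (Q := (D * E * P)%R).
  assert (HQ : (0 <= Q)%R) by (unfold Q; repeat apply Rmult_le_pos; lra).
  destruct (small_eventually _ e (lim_exp_n Q h Hh) He) as [N HN]; specialize (HN N (le_n _)); cbv beta in HN.
  exists (Rmax T (INR N)); intros s Hs HT.
  assert (H1 : (T <= Rabs (Im s))%R) by (eapply Rle_trans; [apply Rmax_l|exact HT]).
  assert (H2 : (INR N <= Rabs (Im s))%R) by (eapply Rle_trans; [apply Rmax_r|exact HT]).
  unfold strip in Hs; assert (B := HB s ltac:(lra) H1).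
  set (y := Rabs (Im s)) in *.
  rewrite Cmod_mult, Cmod_Cpowc.
  assert (B2 : (exp (Re s * ln (Cmod X) - Im s * Carg X) <= P * exp (th * y))%R).
  { unfold P; rewrite <- exp_plus; apply exp_le.
    assert (K1 : (Re s * ln (Cmod X) <= (Rabs al + Rabs be) * Rabs (ln (Cmod X)))%R).
    { eapply Rle_trans; [apply Rle_abs|]; rewrite Rabs_mult; apply Rmult_le_compat_r; [apply Rabs_pos|].
      unfold Rabs; repeat destruct Rcase_abs; lra. }
    assert (K2 : (- (Im s * Carg X) <= th * y)%R).
    { eapply Rle_trans; [apply Rle_abs|]; rewrite Rabs_Ropp, Rabs_mult, Rmult_comm; apply Rmult_le_compat_r; auto; apply Rabs_pos. }
    lra. }
  apply Rle_trans with (D * (E * exp (h * y)) * exp (- rate * y) * (P * exp (th * y)))%R.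
  - apply Rmult_le_compat; [apply Cmod_ge_0|apply Rlt_le, exp_pos| |exact B2].
    eapply Rle_trans; [exact B|]; apply Rmult_le_compat_r; [apply Rlt_le, exp_pos|].
    apply Rmult_le_compat_l; auto; apply HE2, Rabs_pos.
  - replace (D * (E * exp (h * y)) * exp (- rate * y) * (P * exp (th * y)))%R
      with (Q * (exp (h * y) * exp (- rate * y) * exp (th * y)))%R by (unfold Q; ring).
    rewrite <- !exp_plus; replace (h * y + - rate * y + th * y)%R with (- (h * y))%R by (unfold h; field).
    eapply Rle_trans; [|apply Rlt_le, HN]; apply Rmult_le_compat_l; auto; apply exp_le.
    assert (h * INR N <= h * y)%R by (apply Rmult_le_compat_l; lra); lra.
Qed.

Definition csum (f : nat -> C) (n : nat) : C := fold_right Cplus 0 (map f (seq 0 n)).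

(** Holds for every admissible contour with the same right-hand side, which gives both convergence
    for the constructed contour and independence of the choice. *)
Lemma contour_integral (L dL : R -> C) (X J : C) : contour L dL -> separates L dL [a] b1 ->
  X <> 0 -> (Rabs (Carg X) <= th)%R ->
  (forall e, (0 < e)%R -> exists T, forall y1 y2 z, (y1 < - T)%R -> (T < y2)%R ->
     is_CInt (fun y => gpart (lineM, y) * Cpowc X (lineM, y) * Ci) y1 y2 z -> (Cmod (z - J) < e)%R) ->
  @is_RInt_gen C_R_NormedModule (fun t => MeijerG_integrand [a] [] b1 b2 X (L t) * dL t)
    (Rbar_locally m_infty) (Rbar_locally p_infty)
    (2 * RtoC PI * Ci * csum (fun k => gres k * Cpowc X (lpole a k)) (S M) + J).
Proof.
  intros [HL [HdL [[B HB] [HLm HLp]]]] [Sa Sb] HX HA HJ.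
  set (F := fun s => gpart s * Cpowc X s).
  (* The margins of 1 put the contour and the line strictly inside the strip; [be] also exceeds Re
     a, so every pole a - 1 - k is to the left of the right edge. *)
  set (al := (Rmin (- B) lineM - 1)%R); set (be := (Rmax B (Rmax lineM (Re a)) + 1)%R).
  assert (M1 := Rmin_l (- B) lineM); assert (M2 := Rmin_r (- B) lineM).
  assert (M3 := Rmax_l B (Rmax lineM (Re a))); assert (M4 := Rmax_r B (Rmax lineM (Re a))).
  assert (M5 := Rmax_l lineM (Re a)); assert (M6 := Rmax_r lineM (Re a)).
  destruct (Gamma_prod_right_poles al be b1) as [lr [Hr [SHr [Hlr Er]]]].
  { intros b Hb; generalize (HM b Hb); unfold al; lra. }
  (* [K0] is the number of poles a - 1 - k in the strip, and Gamma(1 - a + s + K0) is pole-free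
     there. *)
  destruct (least_shift (1 - Re a + al) 0) as [K0 [HK0 HK0']].
  assert (HlM : (Re a - 1 - INR M = lineM + 1 / 2)%R) by (unfold lineM; lra).
  assert (HMK : (M < K0)%nat).
  { apply INR_lt; unfold al in HK0; lra. }
  (* [pl]: poles between the line and the contour. [ll]: poles to the left of both. [lr]: poles b +
     n, to the right of both. The last two lists are neutral. *)
  set (pl := map (lpole a) (seq 0 (S M))).
  set (ll := map (lpole a) (seq (S M) (K0 - S M))).
  set (l0 := ll ++ lr).
  assert (Hllp : forall p, In p ll -> exists k, (M < k < K0)%nat /\ p = lpole a k).
  { intros p Hp; apply in_map_iff in Hp; destruct Hp as [k [<- Hk]]; apply in_seq in Hk; exists k; split; [lia|auto]. }
  assert (Hplp : forall p, In p pl -> exists k, (k <= M)%nat /\ p = lpole a k).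
  { intros p Hp; apply in_map_iff in Hp; destruct Hp as [k [<- Hk]]; apply in_seq in Hk; exists k; split; [lia|auto]. }
  assert (Hstrip : forall k, (k < K0)%nat -> strip al be (lpole a k)).
  { intros k Hk; unfold strip; rewrite Re_lpole; generalize (HK0' k Hk) (pos_INR k); unfold be; lra. }
  assert (Hleft : forall k, (M < k)%nat -> (Re (lpole a k) < lineM)%R).
  { intros k Hk; rewrite Re_lpole; assert (Hk' : (S M <= k)%nat) by lia; apply le_INR in Hk'; rewrite S_INR in Hk'; lra. }
  assert (Hright : forall k, (k <= M)%nat -> (lineM < Re (lpole a k))%R).
  { intros k Hk; rewrite Re_lpole; apply le_INR in Hk; lra. }
  assert (Hbr : forall b n, In b b1 -> (lineM < Re (b + Cnat n))%R).
  { intros b n Hb; rewrite Re_plus_Cnat; generalize (HM b Hb) (pos_INR n); lra. }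
  set (P := pl ++ l0).
  assert (HPcase : forall p, In p P -> (exists k, p = lpole a k) \/ (exists b n, In b b1 /\ p = b + Cnat n)).
  { intros p Hp; apply in_app_or in Hp; destruct Hp as [Hp|Hp]; [|apply in_app_or in Hp; destruct Hp as [Hp|Hp]].
    - destruct (Hplp p Hp) as [k [_ ->]]; left; eauto.
    - destruct (Hllp p Hp) as [k [_ ->]]; left; eauto.
    - destruct (Hlr p Hp) as [_ [b [n [Hb ->]]]]; right; eauto. }
  assert (HPL : forall p t, In p P -> L t <> p).
  { intros p t Hp; destruct (HPcase p Hp) as [[k ->]|[b [n [Hb ->]]]].
    - apply (proj1 (Sa a k (or_introl eq_refl))).
    - apply (proj1 (Sb b n Hb)). }
  assert (HPc : forall p, In p P -> Re p <> lineM).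
  { intros p Hp; destruct (HPcase p Hp) as [[k ->]|[b [n [Hb ->]]]].
    - destruct (Nat.le_gt_cases k M) as [Hk|Hk]; [generalize (Hright k Hk)|generalize (Hleft k Hk)]; lra.
    - generalize (Hbr b n Hb); lra. }
  assert (Hal : (al < - B)%R) by (unfold al; lra).
  assert (Hbe : (B < be)%R) by (unfold be; lra).
  assert (Hc : (al < lineM < be)%R) by (unfold al, be; lra).
  assert (HG : @is_RInt_gen C_R_NormedModule (fun t => F (L t) * dL t) (Rbar_locally m_infty) (Rbar_locally p_infty)
    (2 * RtoC PI * Ci * csum (fun k => gres k * Cpowc X (lpole a k)) (S M) + J)).
  2:{ revert HG; apply (is_RInt_gen_ext (V := C_R_NormedModule)).
      apply filter_forall; intros ab x _; rewrite integrand_gpart; reflexivity. }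
  apply (contour_of_excess L dL B al be lineM HB HLm HLp Hal Hbe Hc F).
  2:{ exact (integrand_decay al be X HX HA). }
  2:{ exact HJ. }
  (* What remains of the integrand in the strip once every pole has been moved into the
     denominator. *)
  set (H := fun s => Hr s * Gamma (1 * s + (1 - a + Cnat K0)) * Cprod (map (fun b => / Gamma (1 - b + s)) b2) * Cexp (s * Clog X)).
  assert (SH : smooth (strip al be) H).
  { apply smooth_mult; [apply smooth_mult; [apply smooth_mult; [exact SHr|]|]|].
    - apply Gamma_affine_smooth; intros z Hz; unfold strip, rhp in *.
      replace (Re (1 * z + (1 - a + Cnat K0))) with (Re z + (1 - Re a) + INR K0)%R by (unfold Re, Cnat; simpl; ring); lra.
    - apply (smooth_prod _ b2 (fun b s => / Gamma (1 - b + s))); intros b _; apply rGamma_affine_smooth.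
    - apply smooth_exp, smooth_mult; [apply smooth_id|apply smooth_const]. }
  set (res := fun p => epsilon (inhabits (RtoC 0)) (is_residue F p)).
  assert (Hres : forall k, res (lpole a k) = gres k * Cpowc X (lpole a k)).
  { intros k; apply (is_residue_unique F (lpole a k)); [|apply gpart_residue].
    unfold res; apply epsilon_spec; eexists; apply gpart_residue. }
  assert (Esum : csum (fun k => gres k * Cpowc X (lpole a k)) (S M) = fold_right Cplus 0 (map res pl)).
  { unfold csum, pl; rewrite map_map; f_equal; apply map_ext; intros k; symmetry; apply Hres. }
  rewrite Esum.
  apply (excess_residues L dL B al be lineM P HL HdL HB HLm HLp Hal Hbe Hc HPL HPc pl l0 res H F).
  - intros p Hp; split; [apply in_or_app; right; auto|]; unfold wline.
    apply in_app_or in Hp; destruct Hp as [Hp|Hp].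
    + destruct (Hllp p Hp) as [k [Hk ->]]; split; [apply Hstrip; lia|].
      destruct Rlt_dec as [_|N]; [apply (Sa a k (or_introl eq_refl))|exfalso; apply N, Hleft; lia].
    + destruct (Hlr p Hp) as [Hs [b [n [Hb ->]]]]; split; auto.
      destruct Rlt_dec as [N|_]; [generalize (Hbr b n Hb); lra|apply (Sb b n Hb)].
  - intros p Hp; split; [apply in_or_app; left; auto|].
    destruct (Hplp p Hp) as [k [Hk ->]]; split; [apply Hstrip; lia|]; split; [apply (Sa a k (or_introl eq_refl))|].
    split; [|apply Hright, Hk].
    intros H0; apply in_app_or in H0; destruct H0 as [H0|H0].
    + destruct (Hllp _ H0) as [j [Hj E]]; generalize (Hright k Hk) (Hleft j ltac:(lia)); rewrite E; lra.
    + destruct (Hlr _ H0) as [_ [b [n [Hb E]]]].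
      apply (proj1 (Gamma_regular_iff _) (lpole_regular b k Hb) n); rewrite E; ring.
  - apply Injective_map_NoDup; [|apply seq_NoDup].
    intros i j E; apply (f_equal Re) in E; rewrite !Re_lpole in E; apply INR_eq; lra.
  - exact SH.
  - intros s _; unfold F, gpart, H, Cpowc; rewrite Er, (Gamma_poch K0 (1 - a + s)), poch_lpole.
    replace (1 * s + (1 - a + Cnat K0)) with (1 - a + s + Cnat K0) by ring.
    unfold l0; rewrite lprod_app.
    replace (seq 0 K0) with (seq 0 (S M) ++ seq (S M) (K0 - S M)).
    2:{ rewrite <- seq_app; f_equal; lia. }
    rewrite map_app, lprod_app; fold pl; fold ll; unfold Cdiv; rewrite !Cinv_total; ring.
  - intros p Hp; destruct (Hplp p Hp) as [k [_ ->]]; rewrite Hres; apply gpart_residue.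
Qed.

Lemma is_RInt_gen_C_unique (f : R -> C) (u v : C) :
  @is_RInt_gen C_R_NormedModule f (Rbar_locally m_infty) (Rbar_locally p_infty) u ->
  @is_RInt_gen C_R_NormedModule f (Rbar_locally m_infty) (Rbar_locally p_infty) v -> u = v.
Proof.
  rewrite !is_RInt_gen_C_ends; intros Hu Hv; destruct (Ceq_dec u v) as [|N]; auto; exfalso.
  assert (P : (0 < Cmod (u - v))%R) by (apply Cmod_gt_0; intros E; apply N, Ceq_minus, E).
  destruct (at_ends_and _ _ (Hu (Cmod (u - v) / 2)%R ltac:(lra)) (Hv (Cmod (u - v) / 2)%R ltac:(lra))) as [T HT].
  destruct (HT (- Rabs T - 1)%R (Rabs T + 1)%R) as [[z [Iz Hz]] [w [Iw Hw]]];
    [generalize (Rle_abs T); lra|generalize (Rle_abs T); lra|].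
  assert (E : z = w) by (rewrite <- (is_CInt_unique _ _ _ _ Iz), <- (is_CInt_unique _ _ _ _ Iw); auto); subst w.
  replace (u - v) with ((z - v) - (z - u)) in Hz, Hw, P by ring.
  generalize (Cmod_triangle_sub (z - v) (z - u)); lra.
Qed.

(** [contour_exists] supplies the value that [epsilon] needs; whichever contour realises the chosen
    value, [contour_integral] computes it. *)
Lemma MeijerG_expansion : exists D, (0 <= D)%R /\ forall X : C, X <> 0 -> (Rabs (Carg X) <= th)%R ->
  (Cmod (MeijerG [a] [] b1 b2 X - csum (fun k => gres k * Cpowc X (lpole a k))%C (S M))
   <= D * exp (lineM * ln (Cmod X)))%R.
Proof.
  destruct line_integral as [D [HD HDl]]; exists D; split; auto; intros X HX HA.
  destruct (HDl X HX HA) as [J [HJ1 HJ2]].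
  assert (PP := PI_RGT_0).
  assert (NPi : 2 * RtoC PI * Ci <> 0).
  { apply Cmult_neq_0; [apply Cmult_neq_0|apply Ci_nz]; intros E; apply RtoC_inj in E; lra. }
  assert (Ex : is_MeijerG [a] [] b1 b2 X (MeijerG [a] [] b1 b2 X)).
  { unfold MeijerG; apply epsilon_spec; destruct (contour_exists a b1 Hdef) as [L [dL [HL HS]]].
    eexists; exists L, dL; eexists; split; [exact HL|split; [exact HS|split; [|reflexivity]]].
    exact (contour_integral L dL X J HL HS HX HA HJ2). }
  destruct Ex as [L [dL [I [HL [HS [HI ->]]]]]].
  rewrite (is_RInt_gen_C_unique _ _ _ HI (contour_integral L dL X J HL HS HX HA HJ2)).
  replace (/ (2 * RtoC PI * Ci) * (2 * RtoC PI * Ci * csum (fun k => gres k * Cpowc X (lpole a k)) (S M) + J) -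
    csum (fun k => gres k * Cpowc X (lpole a k)) (S M)) with (/ (2 * RtoC PI * Ci) * J).
  2:{ generalize (csum (fun k => gres k * Cpowc X (lpole a k)) (S M)); intros u.
      revert NPi; generalize (2 * RtoC PI * Ci); intros w Hw; field; auto. }
  rewrite Cmod_mult, Cmod_inv by auto; eapply Rle_trans; [|exact HJ1].
  rewrite <- (Rmult_1_l (Cmod J)) at 2; apply Rmult_le_compat_r; [apply Cmod_ge_0|].
  rewrite !Cmod_mult, Cmod_Ci, !Cmod_R, Rmult_1_r, !Rabs_pos_eq by lra.
  rewrite <- Rinv_1; apply Rinv_le_contravar; generalize PI2_3_2; unfold PI2; lra.
Qed.

End Meijer.

(** * Principal powers *)

Lemma Cexp_Clog (z : C) : z <> 0 -> Cexp (Clog z) = z.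
Proof.
  intros Hz; assert (P := proj1 (Cmod_gt_0 z) Hz).
  unfold Cexp, Clog; simpl Re; simpl Im; rewrite exp_ln by auto.
  set (x := (Re z / Cmod z)%R).
  assert (S := Cmod_sq z).
  assert (Hx : (-1 <= x <= 1)%R).
  { generalize (re_le_Cmod z); intros B; apply Rabs_le_between in B; unfold x; split.
    - apply Rmult_le_reg_r with (Cmod z); auto; unfold Rdiv; rewrite Rmult_assoc, Rinv_l by lra; lra.
    - apply Rmult_le_reg_r with (Cmod z); auto; unfold Rdiv; rewrite Rmult_assoc, Rinv_l by lra; lra. }
  assert (Hs : sqrt (1 - x²) = (Rabs (Im z) / Cmod z)%R).
  { apply sqrt_lem_1.
    - unfold Rsqr; assert (0 <= (1 - x) * (1 + x))%R by (apply Rmult_le_pos; lra); lra.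
    - apply Rmult_le_pos; [apply Rabs_pos|apply Rlt_le, Rinv_0_lt_compat, P].
    - assert (E : (Rabs (Im z) * Rabs (Im z) = Im z * Im z)%R).
      { rewrite <- Rabs_mult; apply Rabs_pos_eq, Rle_0_sqr. }
      replace (Rabs (Im z) / Cmod z * (Rabs (Im z) / Cmod z))%R with ((Rabs (Im z) * Rabs (Im z)) / (Cmod z * Cmod z))%R
        by (field; lra).
      rewrite E; unfold Rsqr, x; replace (Im z * Im z)%R with (Cmod z * Cmod z - Re z * Re z)%R by lra; field; lra. }
  unfold Carg; fold x.
  assert (Ec : forall a b : R, RtoC (Cmod z) * (a, b) = (Cmod z * a, Cmod z * b)%R).
  { intros; unfold Cmult, RtoC; simpl; f_equal; ring. }
  destruct (Rle_dec 0 (Im z)) as [Hi|Hi].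
  - rewrite cos_acos, sin_acos, Hs, Rabs_pos_eq, Ec by auto; unfold x; destruct z as [a b]; simpl in *.
    unfold Re, Im in *; simpl in *; f_equal; field; lra.
  - rewrite cos_neg, sin_neg, cos_acos, sin_acos, Hs, Rabs_left, Ec by (auto; lra); unfold x; destruct z as [a b]; simpl in *.
    unfold Re, Im in *; simpl in *; f_equal; field; lra.
Qed.

Lemma Clog_Cexp w : (- PI < Im w < PI)%R -> Clog (Cexp w) = w.
Proof.
  intros Hw; unfold Clog; rewrite Cmod_Cexp, ln_exp.
  assert (E : Carg (Cexp w) = Im w); [|rewrite E; destruct w; auto].
  unfold Carg; rewrite Cmod_Cexp.
  assert (P := exp_pos (Re w)).
  assert (Er : (Re (Cexp w) / exp (Re w))%R = cos (Im w)).
  { unfold Cexp, Cmult, RtoC, Re, Im; simpl; field; apply Rgt_not_eq, exp_pos. }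
  assert (Ei : Im (Cexp w) = (exp (Re w) * sin (Im w))%R) by (unfold Cexp, Cmult, RtoC, Re, Im; simpl; ring).
  rewrite Er, Ei; destruct (Rle_dec 0 (Im w)) as [H|H].
  - destruct Rle_dec as [_|N]; [apply acos_cos; lra|exfalso; apply N].
    apply Rmult_le_pos; [lra|apply sin_ge_0; lra].
  - destruct Rle_dec as [N|_].
    + exfalso; assert (sin (Im w) < 0)%R by (apply sin_lt_0_var; lra).
      assert (exp (Re w) * sin (Im w) < exp (Re w) * 0)%R by (apply Rmult_lt_compat_l; lra); lra.
    + rewrite <- cos_neg, acos_cos by lra; ring.
Qed.

Lemma Cpowc_plus z a b : Cpowc z (a + b) = Cpowc z a * Cpowc z b.
Proof. unfold Cpowc; rewrite <- Cexp_plus; f_equal; ring. Qed.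

Lemma Cpowc_opp z a : Cpowc z (- a) = / Cpowc z a.
Proof. unfold Cpowc; rewrite <- Cexp_opp; f_equal; ring. Qed.

Lemma Cpowc_Cnat (z : C) n : z <> 0 -> Cpowc z (Cnat n) = z ^ n.
Proof.
  intros Hz; induction n.
  - unfold Cpowc, Cnat; simpl; rewrite Cmult_0_l; apply Cexp_0.
  - rewrite Cnat_S, Cpowc_plus, IHn; unfold Cpowc; rewrite Cmult_1_l, Cexp_Clog by auto; simpl; ring.
Qed.

(** Since |arg z| < PI/2, doubling the argument stays within (-PI, PI) and the principal logarithm
    is simply doubled. *)
Lemma Clog_sq_div4 (z : C) : z <> 0 -> (Rabs (Carg z) < PI / 2)%R -> Clog (z ^ 2 / 4) = 2 * Clog z - RtoC (ln 4).
Proof.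
  intros Hz HA.
  rewrite <- (Clog_Cexp (2 * Clog z - RtoC (ln 4))).
  - f_equal; rewrite Cexp_minus, Cexp_RtoC, exp_ln by lra; f_equal.
    replace (2 * Clog z) with (Clog z + Clog z) by ring; rewrite Cexp_plus, Cexp_Clog by auto; ring.
  - replace (Im (2 * Clog z - RtoC (ln 4))) with (2 * Carg z)%R by (unfold Clog, Im; simpl; ring).
    apply Rabs_def2 in HA; lra.
Qed.

Lemma Cmod_Cpowc_le z s : (Rabs (Carg z) <= PI)%R ->
  (Cmod (Cpowc z s) <= exp (Rabs (Im s) * PI) * exp (Re s * ln (Cmod z)))%R.
Proof.
  intros HA; rewrite Cmod_Cpowc, <- exp_plus; apply exp_le.
  assert (- (Im s * Carg z) <= Rabs (Im s) * PI)%R; [|lra].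
  eapply Rle_trans; [apply Rle_abs|]; rewrite Rabs_Ropp, Rabs_mult; apply Rmult_le_compat_l; auto; apply Rabs_pos.
Qed.

(** * Finite products and sums *)

Lemma Cprod_map_mult {A : Type} (f g : A -> C) l :
  Cprod (map (fun i => f i * g i) l) = Cprod (map f l) * Cprod (map g l).
Proof.
  induction l; [unfold Cprod; simpl; ring|]; cbn [map]; rewrite !Cprod_cons, IHl; ring.
Qed.

Lemma Cprod_map_const {A : Type} (c : C) (l : list A) : Cprod (map (fun _ => c) l) = c ^ length l.
Proof. induction l; [reflexivity|]; cbn [map length]; rewrite Cprod_cons, IHl; auto. Qed.

Lemma Cprod_rev (g : nat -> C) n :
  Cprod (map (fun i => g (n + 2 - i)%nat) (seq 2 n)) = Cprod (map g (seq 1 n)).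
Proof.
  induction n; [reflexivity|].
  rewrite (seq_S n 1), map_app, Cprod_app, <- IHn; cbn [seq map]; rewrite Cprod_cons.
  replace (S n + 2 - 2)%nat with (1 + n)%nat by lia.
  rewrite <- (seq_shift n 2), map_map.
  replace (map (fun x => g (S n + 2 - S x)%nat) (seq 2 n)) with (map (fun i => g (n + 2 - i)%nat) (seq 2 n))
    by (apply map_ext; intros; f_equal; lia).
  cbn [map]; rewrite ?Cprod_cons; change (Cprod []) with (RtoC 1); ring.
Qed.

(** Odd indices come from the Gamma(b - s) with b = i/N, even ones from the reflected denominators.
    The latter run backwards as 2N + 2 - 2i so that i matches the sine factors. *)
Lemma Cprod_odd_even (f : nat -> C) N : (1 <= N)%nat ->
  Cprod (map f (seq 1 (2 * N - 1))) =
  Cprod (map (fun i => f (2 * i - 1)%nat) (seq 1 N)) * Cprod (map (fun i => f (2 * N + 2 - 2 * i)%nat) (seq 2 (N - 1))).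
Proof.
  intros HN; destruct N as [|n]; [lia|]; clear HN.
  replace (S n - 1)%nat with n by lia.
  replace (map (fun i => f (2 * S n + 2 - 2 * i)%nat) (seq 2 n)) with (map (fun i => f (2 * (n + 2 - i))%nat) (seq 2 n))
    by (apply map_ext; intros; f_equal; lia).
  rewrite (Cprod_rev (fun j => f (2 * j)%nat)).
  induction n; [unfold Cprod; simpl; ring|].
  replace (2 * S (S n) - 1)%nat with (S (S (2 * S n - 1))) by lia.
  rewrite (seq_S (S (2 * S n - 1))), (seq_S (2 * S n - 1)), !map_app, !Cprod_app, IHn.
  rewrite (seq_S (S n) 1), (seq_S n 1), !map_app, !Cprod_app.
  cbn [map]; rewrite !Cprod_cons.
  replace (1 + (2 * S n - 1))%nat with (2 * (1 + n))%nat by lia.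
  replace (1 + S (2 * S n - 1))%nat with (2 * (1 + S n) - 1)%nat by lia.
  change (Cprod []) with (RtoC 1); ring.
Qed.

Lemma csum_S f n : csum f (S n) = csum f n + f n.
Proof.
  unfold csum; rewrite seq_S, map_app, fold_right_app; simpl.
  generalize (map f (seq 0 n)); intros l; induction l; simpl; [ring|rewrite IHl; ring].
Qed.

Lemma csum_scal (c : C) f n : c * csum f n = csum (fun k => c * f k) n.
Proof. induction n; [unfold csum; simpl; ring|rewrite !csum_S, <- IHn; ring]. Qed.

Lemma csum_ext f g n : (forall k, f k = g k) -> csum f n = csum g n.
Proof. intros H; unfold csum; f_equal; apply map_ext, H. Qed.

Lemma csum_add f n m : csum f (n + m) = csum f n + csum (fun k => f (n + k)%nat) m.
Proof.
  induction m; [rewrite Nat.add_0_r; unfold csum at 3; simpl; ring|].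
  rewrite Nat.add_succ_r, !csum_S, IHm; ring.
Qed.

Lemma sum_n_csum (u : nat -> C) m : sum_n u m = csum u (S m).
Proof.
  induction m; [rewrite sum_O; unfold csum; simpl; ring|].
  rewrite sum_Sn, csum_S, IHm; reflexivity.
Qed.

Lemma csum_bound (f : nat -> C) (T : nat -> R) (Y : R) n : (forall k, (Cmod (f k) <= T k * Y)%R) ->
  (Cmod (csum f n) <= fold_right Rplus 0 (map T (seq 0 n)) * Y)%R.
Proof.
  intros H; unfold csum; generalize (seq 0 n); intros l; induction l as [|k l IH]; simpl.
  - rewrite Cmod_0; lra.
  - eapply Rle_trans; [apply Cmod_triangle|]; generalize (H k); lra.
Qed.

Lemma cont_csum {T : UniformSpace} (f : nat -> T -> C) x n : (forall k, cont_C (f k) x) ->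
  cont_C (fun y => csum (fun k => f k y) n) x.
Proof.
  intros H; induction n; [apply cont_const|].
  apply (cont_ext_loc (fun y => csum (fun k => f k y) n + f n y)).
  - apply filter_forall; intros y; symmetry; apply (csum_S (fun k => f k y)).
  - apply cont_plus; auto.
Qed.

(** * The coefficients *)

(** The residue coefficient with the denominators kept as reciprocal Gamma functions. It is
    continuous for all admissible parameters, even where the sines and Gammas of the statement form
    a zero times a pole. *)
Definition coefK (N : nat) (mu nu w : C) (k : nat) : C :=
  (- (1)) ^ k / Cnat (fact k)
  * (Gamma (1 / 2 + mu + w + Cnat k)
     * Cprod (map (fun i => Gamma (Cnat (2 * i - 1) / (2 * Cnat N) + mu + nu + w + Cnat k)) (seq 1 N)))
  * (/ Gamma (- (mu + nu + Cnat k))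
     * Cprod (map (fun i => / Gamma ((Cnat i - 1) / Cnat N - (mu + nu + w + Cnat k))) (seq 2 (N - 1)))).

Definition K_a (N : nat) (mu nu w : C) : C := 1 + 1 / (2 * Cnat N) - mu - nu - w.

Lemma gres_coefK N (mu nu w : C) k : (1 <= N)%nat ->
  gres (K_a N mu nu w) (K_b1 N nu) (K_b2 N w) k = coefK N mu nu w k.
Proof.
  intros HN; assert (NN := Cnat_neq_0 N HN); assert (N2 := C2_nz).
  unfold gres, coefK, K_b1, K_b2; cbn [map]; rewrite !Cprod_cons, !map_map.
  f_equal; [f_equal; f_equal|f_equal].
  - f_equal; unfold lpole, K_a; field; auto.
  - f_equal; apply map_ext_in; intros i Hi; apply in_seq in Hi; f_equal.
    assert (E : Cnat (2 * i - 1) = 2 * Cnat i - 1).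
    { unfold Cnat; rewrite minus_INR, mult_INR by lia; rewrite RtoC_minus, RtoC_mult; auto. }
    rewrite E; unfold lpole, K_a; field; auto.
  - do 2 f_equal; unfold lpole, K_a; field; auto.
  - f_equal; apply map_ext; intros i; do 2 f_equal; unfold lpole, K_a; field; auto.
Qed.

Lemma Cexp_i_pi : Cexp (Ci * RtoC PI) = - (1).
Proof.
  replace (Ci * RtoC PI) with ((0%R, PI) : C) by (unfold Ci, Cmult, RtoC; simpl; f_equal; ring).
  unfold Cexp; simpl; rewrite exp_0, cos_PI, sin_PI; unfold Cmult, Copp, RtoC; simpl; f_equal; ring.
Qed.

Lemma Csin_shift z k : Csin (z - RtoC PI * Cnat k) = (- (1)) ^ k * Csin z.
Proof.
  induction k; [unfold Cnat; simpl; rewrite Cmult_1_l; f_equal; ring|].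
  replace (z - RtoC PI * Cnat (S k)) with (z - RtoC PI * Cnat k - RtoC PI) by (rewrite Cnat_S; ring).
  simpl Cpow; rewrite <- Cmult_assoc, <- IHk; generalize (z - RtoC PI * Cnat k); intros u.
  unfold Csin; replace (Ci * (u - RtoC PI)) with (Ci * u - Ci * RtoC PI) by ring.
  rewrite Cexp_minus, Cexp_i_pi; replace (- (Ci * u - Ci * RtoC PI)) with (- (Ci * u) + Ci * RtoC PI) by ring.
  rewrite Cexp_plus, Cexp_i_pi.
  assert (Hi := Ci_nz); assert (H2 := C2_nz).
  replace (Cexp (Ci * u) / - (1)) with (- Cexp (Ci * u)) by (field; intros E; apply C1_nz; rewrite <- E; ring).
  unfold Cdiv; ring.
Qed.

Lemma rGamma_neg (t : C) k : Gamma_regular (1 + t + Cnat k) ->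
  / Gamma (- (t + Cnat k)) = Gamma (1 + t + Cnat k) * (- (- (1)) ^ k / RtoC PI) * Csin (RtoC PI * t).
Proof.
  intros H; rewrite rGamma_reflection.
  2:{ replace (1 - - (t + Cnat k)) with (1 + t + Cnat k) by ring; auto. }
  replace (1 - - (t + Cnat k)) with (1 + t + Cnat k) by ring.
  replace (RtoC PI * - (t + Cnat k)) with (- (RtoC PI * t) - RtoC PI * Cnat k) by ring.
  rewrite Csin_shift, Csin_opp; unfold Cdiv; ring.
Qed.

Lemma Gamma_regular_plus s k : Gamma_regular s -> Gamma_regular (s + Cnat k).
Proof.
  intros H; induction k; [unfold Cnat; simpl; rewrite Cplus_0_r; auto|].
  rewrite Cnat_S, Cplus_assoc; apply Gamma_regular_S, IHk.
Qed.

(** Each of the N reciprocal Gammas is reflected by [rGamma_neg], yielding a sine and the factor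
    -(-1)^k / PI. Their N-th power together with the (-1)^k of the residue gives the sign exponent k
    (N + 1) + N and the power PI^(-N). *)
Lemma coefK_reflection N (mu nu w : C) k : (1 <= N)%nat -> expansion_regular N (mu, nu, w) ->
  coefK N mu nu w k =
  (- (1)) ^ (k * (N + 1) + N) / Cnat (fact k)
  * Cprod (map (fun i => Gamma (Cnat i / (2 * Cnat N) + mu + nu + w + Cnat k)) (seq 1 (2 * N - 1)))
  * Gamma (1 / 2 + mu + w + Cnat k)
  * Gamma (1 + mu + nu + Cnat k)
  * / RtoC PI ^ N
  * (Csin (RtoC PI * (mu + nu))
     * Cprod (map (fun i => Csin (RtoC PI * (mu + nu + w - (Cnat i - 1) / Cnat N))) (seq 2 (N - 1)))).
Proof.
  intros HN [R1 [R2 R3]]; assert (NN := Cnat_neq_0 N HN); assert (N2 := C2_nz).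
  assert (NP : RtoC PI <> 0) by (intros E; apply RtoC_inj in E; generalize PI_RGT_0; lra).
  unfold coefK; rewrite (Cprod_odd_even _ N HN).
  replace (- (mu + nu + Cnat k)) with (- ((mu + nu) + Cnat k)) by ring.
  rewrite rGamma_neg.
  2:{ replace (1 + (mu + nu) + Cnat k) with (1 + mu + nu + Cnat k) by ring; apply Gamma_regular_plus, R3. }
  replace (1 + (mu + nu) + Cnat k) with (1 + mu + nu + Cnat k) by ring.
  set (sg := - (- (1)) ^ k / RtoC PI).
  replace (map (fun i => / Gamma ((Cnat i - 1) / Cnat N - (mu + nu + w + Cnat k))) (seq 2 (N - 1)))
    with (map (fun i => Gamma (Cnat (2 * N + 2 - 2 * i) / (2 * Cnat N) + mu + nu + w + Cnat k) *
       (sg * Csin (RtoC PI * (mu + nu + w - (Cnat i - 1) / Cnat N)))) (seq 2 (N - 1))).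
  2:{ apply map_ext_in; intros i Hi; apply in_seq in Hi.
      replace ((Cnat i - 1) / Cnat N - (mu + nu + w + Cnat k))
        with (- ((mu + nu + w - (Cnat i - 1) / Cnat N) + Cnat k)) by (unfold Cdiv; ring).
      assert (E : Cnat (2 * N + 2 - 2 * i) = 2 * Cnat N + 2 - 2 * Cnat i).
      { unfold Cnat; rewrite minus_INR, plus_INR, !mult_INR by lia.
        rewrite RtoC_minus, RtoC_plus, !RtoC_mult; auto. }
      assert (E2 : 1 + (mu + nu + w - (Cnat i - 1) / Cnat N) + Cnat k =
        Cnat (2 * N + 2 - 2 * i) / (2 * Cnat N) + mu + nu + w + Cnat k) by (rewrite E; field; auto).
      rewrite rGamma_neg, E2; [unfold sg; ring|].
      rewrite E2; apply Gamma_regular_plus, R1; lia. }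
  rewrite !Cprod_map_mult, Cprod_map_const, length_seq.
  assert (Es : sg * sg ^ (N - 1) = (- (1)) ^ (k * N + N) * / RtoC PI ^ N).
  { replace (sg * sg ^ (N - 1)) with (sg ^ N) by (destruct N; [lia|simpl; rewrite Nat.sub_0_r; auto]).
    clear - NP; unfold sg; induction N as [|n IH]; [rewrite Nat.mul_0_r; simpl; field; apply C1_nz|].
    simpl Cpow at 1; rewrite IH; replace (k * S n + S n)%nat with (S k + (k * n + n))%nat by lia.
    assert (A : forall i j, (- (1)) ^ (i + j) = (- (1)) ^ i * (- (1)) ^ j).
    { induction i; intros j; [simpl; ring|simpl Cpow; rewrite IHi; ring]. }
    rewrite (A (S k)); simpl Cpow; field; split; [apply Cpow_nz|]; auto. }
  assert (A : forall i j, (- (1)) ^ (i + j) = (- (1)) ^ i * (- (1)) ^ j).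
  { induction i; intros j; [simpl; ring|simpl Cpow; rewrite IHi; ring]. }
  replace (k * (N + 1) + N)%nat with (k + (k * N + N))%nat by lia; rewrite (A k).
  generalize dependent (Cprod (map (fun i => Gamma (Cnat (2 * i - 1) / (2 * Cnat N) + mu + nu + w + Cnat k)) (seq 1 N))).
  generalize (Cprod (map (fun i => Gamma (Cnat (2 * N + 2 - 2 * i) / (2 * Cnat N) + mu + nu + w + Cnat k)) (seq 2 (N - 1)))).
  generalize (Cprod (map (fun i => Csin (RtoC PI * (mu + nu + w - (Cnat i - 1) / Cnat N))) (seq 2 (N - 1)))).
  intros x y u; unfold Cdiv.
  transitivity ((- (1)) ^ k * / Cnat (fact k) * (Gamma (1 * / 2 + mu + w + Cnat k) * u) *
    (Gamma (1 + mu + nu + Cnat k) * Csin (RtoC PI * (mu + nu)) * y * x) * (sg * sg ^ (N - 1))); [ring|rewrite Es; ring].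
Qed.

(** The expansion with reciprocal Gamma functions in place of the sines. *)
Definition expansionK (N m : nat) (mu nu w z : C) : C :=
  Cpowc 2 (mu + 2 / Cnat N - 1) * Cpowc (RtoC PI) ((1 - Cnat N) * nu) * Cpowc z (w + nu - 2 / Cnat N)
  * csum (fun k => coefK N mu nu w k
       * (Cpowc z (2 * lpole (K_a N mu nu w) k) * Cexp (- lpole (K_a N mu nu w) k * RtoC (ln 4)))) (S m).

Lemma expansionK_regular N m (mu nu w z : C) : (1 <= N)%nat -> z <> 0 -> expansion_regular N (mu, nu, w) ->
  K_expansion N m mu nu w z = expansionK N m mu nu w z.
Proof.
  intros HN Hz HR; assert (NN := Cnat_neq_0 N HN); assert (N2 := C2_nz).
  assert (PP := PI_RGT_0).
  assert (NP : RtoC PI <> 0) by (intros E; apply RtoC_inj in E; lra).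
  unfold K_expansion, expansionK; rewrite sum_n_csum, !csum_scal; apply csum_ext; intros k.
  rewrite coefK_reflection by auto; unfold K_term.
  set (lp := lpole (K_a N mu nu w) k).
  assert (Elp : lp = 1 / (2 * Cnat N) - mu - nu - w - Cnat k) by (unfold lp, lpole, K_a; ring).
  assert (Nz : z ^ (2 * k) <> 0) by (apply Cpow_nz; auto).
  assert (N2k : RtoC 2 ^ (2 * k) <> 0) by (apply Cpow_nz; auto).
  assert (NPn : RtoC PI ^ N <> 0) by (apply Cpow_nz; auto).
  (* The exponents add up since 2 lp = 1/N - 2 mu - 2 nu - 2 w - 2 k. *)
  assert (Ez : Cpowc z (w + nu - 2 / Cnat N) * Cpowc z (2 * lp) =
     / Cpowc z (2 * mu + nu + w + 1 / Cnat N) * / z ^ (2 * k)).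
  { rewrite <- (Cpowc_Cnat z (2 * k)), <- !Cpowc_opp, <- !Cpowc_plus by auto; f_equal.
    rewrite Elp, Cnat_mult; replace (Cnat 2) with (RtoC 2) by (unfold Cnat; simpl; f_equal; ring); field; auto. }
  assert (E2 : Cpowc 2 (mu + 2 / Cnat N - 1) * Cexp (- lp * RtoC (ln 4)) =
     Cpowc 2 (3 * mu + 2 * nu + 2 * w + 1 / Cnat N - 1) * RtoC 2 ^ (2 * k)).
  { assert (H2 : (0 < 2)%R) by lra.
    rewrite <- (Cpowc_Cnat (RtoC 2) (2 * k)), <- !Cpowc_plus by auto.
    replace 4%R with (2 * 2)%R by ring; rewrite ln_mult, RtoC_plus by lra.
    rewrite !Cpowc_pos, <- Cexp_plus by lra; f_equal.
    rewrite Elp, Cnat_mult; replace (Cnat 2) with (RtoC 2) by (unfold Cnat; simpl; f_equal; ring); field; auto. }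
  assert (EP : Cpowc (RtoC PI) ((1 - Cnat N) * nu - Cnat N) = Cpowc (RtoC PI) ((1 - Cnat N) * nu) * / RtoC PI ^ N).
  { unfold Cminus at 1; rewrite Cpowc_plus, Cpowc_opp, Cpowc_Cnat by auto; auto. }
  assert (Ezd : (z / 2) ^ (2 * k) = z ^ (2 * k) * / RtoC 2 ^ (2 * k)).
  { generalize (2 * k)%nat; intros n; induction n; [simpl; field; apply C1_nz|].
    assert (RtoC 2 ^ n <> 0) by (apply Cpow_nz; auto); simpl Cpow; rewrite IHn; field; auto. }
  rewrite EP, Ezd, Cinv_total, Cinv_involutive.
  generalize dependent (Cpowc z (w + nu - 2 / Cnat N)); intros a1 Ea.
  generalize dependent (Cpowc z (2 * lp)); intros a2 Ea.
  generalize dependent (Cexp (- lp * RtoC (ln 4))); intros a3 Ea3.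
  generalize dependent (Cpowc 2 (mu + 2 / Cnat N - 1)); intros a4 Ea4.
  unfold Cdiv.
  match goal with |- ?l = ?X * ?Y * ?excess * (?U * (?V * ?W)) => transitivity (Y * U * (excess * V) * (X * W)); [|ring] end.
  rewrite Ea, Ea4; unfold Cdiv; ring.
Qed.

(** * Continuity in the parameters *)

Lemma K_defined_regular N (mu nu w : C) k : (1 <= N)%nat -> K_defined N mu nu w ->
  Gamma_regular (1 / 2 + mu + w + Cnat k) /\
  forall i, (1 <= i <= N)%nat -> Gamma_regular (Cnat (2 * i - 1) / (2 * Cnat N) + mu + nu + w + Cnat k).
Proof.
  intros HN HK; assert (NN := Cnat_neq_0 N HN); assert (N2 := C2_nz); split.
  - replace (1 / 2 + mu + w + Cnat k) with ((1 / 2 + 1 / (2 * Cnat N) - nu) - lpole (K_a N mu nu w) k)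
      by (unfold lpole, K_a; field; auto).
    apply (lpole_regular _ (K_b1 N nu) HK); left; auto.
  - intros i Hi.
    assert (E : Cnat (2 * i - 1) = 2 * Cnat i - 1).
    { unfold Cnat; rewrite minus_INR, mult_INR by lia; rewrite RtoC_minus, RtoC_mult; auto. }
    replace (Cnat (2 * i - 1) / (2 * Cnat N) + mu + nu + w + Cnat k) with (Cnat i / Cnat N - lpole (K_a N mu nu w) k)
      by (rewrite E; unfold lpole, K_a; field; auto).
    apply (lpole_regular _ (K_b1 N nu) HK); right; apply in_map_iff; exists i; split; auto; apply in_seq; lia.
Qed.

Lemma cont_mu (p : C * C * C) : cont_C (fun p : C * C * C => fst (fst p)) p.
Proof.
  apply (@continuous_comp (prod_UniformSpace (prod_UniformSpace C_UniformSpace C_UniformSpace) C_UniformSpace)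
    (prod_UniformSpace C_UniformSpace C_UniformSpace) C_UniformSpace fst fst); apply continuous_fst.
Qed.

Lemma cont_nu (p : C * C * C) : cont_C (fun p : C * C * C => snd (fst p)) p.
Proof.
  apply (@continuous_comp (prod_UniformSpace (prod_UniformSpace C_UniformSpace C_UniformSpace) C_UniformSpace)
    (prod_UniformSpace C_UniformSpace C_UniformSpace) C_UniformSpace fst snd);
    [apply continuous_fst|apply continuous_snd].
Qed.

Lemma cont_w (p : C * C * C) : cont_C (fun p : C * C * C => snd p) p.
Proof. apply continuous_snd. Qed.

Lemma cont_Cpowc {T : UniformSpace} (z : C) (f : T -> C) x : cont_C f x -> cont_C (fun y => Cpowc z (f y)) x.
Proof.
  intros H; unfold Cpowc; apply (cont_comp Cexp (fun y => f y * Clog z)); [|apply cont_Cexp].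
  apply cont_mult; [auto|apply cont_const].
Qed.

Ltac cont_params :=
  lazymatch goal with
  | |- cont_C (fun p => fst (fst p)) _ => apply cont_mu
  | |- cont_C (fun p => snd (fst p)) _ => apply cont_nu
  | |- cont_C (fun p => snd p) _ => apply cont_w
  | |- cont_C (fun p => Cplus (@?f p) (@?g p)) _ => apply (cont_plus f g); cont_params
  | |- cont_C (fun p => Cminus (@?f p) (@?g p)) _ => apply (cont_minus f g); cont_params
  | |- cont_C (fun p => Cmult (@?f p) (@?g p)) _ => apply (cont_mult f g); cont_params
  | |- cont_C (fun p => Copp (@?f p)) _ => apply (cont_opp f); cont_params
  | |- cont_C (fun p => Cpowc ?z (@?f p)) _ => apply (cont_Cpowc z f); cont_params
  | |- _ => apply cont_const
  end.

(** The only Gamma factors in numerators are those made regular by [K_defined]; the others are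
    reciprocals, continuous everywhere. *)
Lemma expansionK_cont N m (mu nu w z : C) : (1 <= N)%nat -> K_defined N mu nu w ->
  cont_C (fun p : C * C * C => expansionK N m (fst (fst p)) (snd (fst p)) (snd p) z) (mu, nu, w).
Proof.
  intros HN HK; unfold expansionK.
  apply cont_mult; [cont_params|].
  apply cont_csum; intros k; destruct (K_defined_regular N mu nu w k HN HK) as [R1 R2].
  apply cont_mult; [|apply cont_mult].
  - unfold coefK; apply cont_mult; [apply cont_mult; [apply cont_const|]|]; apply cont_mult.
    + apply (cont_comp Gamma (fun p : C * C * C => 1 / 2 + fst (fst p) + snd p + Cnat k)); [cont_params|].
      apply Gamma_cont, R1.
    + apply (cont_prod (seq 1 N) (fun i (p : C * C * C) =>
        Gamma (Cnat (2 * i - 1) / (2 * Cnat N) + fst (fst p) + snd (fst p) + snd p + Cnat k))); intros i Hi.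
      apply in_seq in Hi.
      apply (cont_comp Gamma (fun p : C * C * C =>
        Cnat (2 * i - 1) / (2 * Cnat N) + fst (fst p) + snd (fst p) + snd p + Cnat k)); [cont_params|].
      apply Gamma_cont, R2; lia.
    + apply (cont_comp (fun u => / Gamma u) (fun p : C * C * C => - (fst (fst p) + snd (fst p) + Cnat k)));
        [cont_params|apply rGamma_cont].
    + apply (cont_prod (seq 2 (N - 1)) (fun i (p : C * C * C) =>
        / Gamma ((Cnat i - 1) / Cnat N - (fst (fst p) + snd (fst p) + snd p + Cnat k)))); intros i Hi.
      apply (cont_comp (fun u => / Gamma u) (fun p : C * C * C =>
        (Cnat i - 1) / Cnat N - (fst (fst p) + snd (fst p) + snd p + Cnat k))); [cont_params|apply rGamma_cont].
  - unfold lpole, K_a; cont_params.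
  - apply (cont_comp Cexp (fun p : C * C * C =>
      - lpole (K_a N (fst (fst p)) (snd (fst p)) (snd p)) k * RtoC (ln 4))); [|apply cont_Cexp].
    unfold lpole, K_a; cont_params.
Qed.

(** [expansionK] agrees with the stated expansion at regular parameters and is continuous at the
    given ones, so it is the limit sought. *)
Lemma expansionK_value N m (mu nu w z : C) : (1 <= N)%nat -> K_defined N mu nu w -> z <> 0 ->
  K_expansion_value N m mu nu w z (expansionK N m mu nu w z).
Proof.
  intros HN HK Hz; unfold K_expansion_value.
  apply filterlim_within_ext with (f := fun p : C * C * C => expansionK N m (fst (fst p)) (snd (fst p)) (snd p) z).
  - intros [[mu' nu'] w'] HR; symmetry; apply expansionK_regular; auto.
  - eapply filterlim_filter_le_1; [apply filter_le_within|]; exact (expansionK_cont N m mu nu w z HN HK).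
Qed.

(** * The error bound *)

(** (N + 1) + 1 - N = 2 halves of PI. *)
Lemma K_rate N nu w : (1 <= N)%nat -> rate (K_b1 N nu) (K_b2 N w) = PI.
Proof.
  intros HN; unfold rate, K_b1, K_b2; cbn [length]; rewrite !length_map, !length_seq.
  rewrite !S_INR, minus_INR by auto; simpl; field.
Qed.

Theorem theorem2p2 :
  forall (N : nat) (mu nu w : C) (m : nat) (delta : R),
    (1 <= N)%nat ->
    K_defined N mu nu w ->
    (0 < delta)%R ->
    exists E : C -> C,
      (forall z : C, z <> 0 -> K_expansion_value N m mu nu w z (E z)) /\
      exists M R0 : R, (0 < R0)%R /\
        forall z : C, (R0 <= Cmod z)%R ->
          (Rabs (Carg z) <= PI / 2 - delta)%R ->
          (Cmod (K N mu nu z w - E z)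
           <= M * Rpower (Cmod z)
                    (Re (- 2 * Cnat m - 2 - 1 / Cnat N - 2 * mu - nu - w)))%R.
Proof.
  intros N mu nu w m delta HN HK Hd; exists (expansionK N m mu nu w); split.
  { intros z Hz; apply expansionK_value; auto. }
  assert (NN := Cnat_neq_0 N HN); assert (PP := PI_RGT_0).
  set (a := K_a N mu nu w); set (b1 := K_b1 N nu); set (b2 := K_b2 N w).
  destruct (lower_bound b1 (Re a - 1 - 1 / 2)) as [M0 HM0].
  (* [M0] pushes the line to the left of every b. The summand m + 1 makes twice the abscissa of the
     line at most [q], the exponent of the first omitted term. *)
  set (M := (m + 1 + M0)%nat).
  assert (HMM : INR M = (INR m + 1 + INR M0)%R) by (unfold M; rewrite !plus_INR; auto).
  assert (HM : forall b, In b b1 -> (lineM a M < Re b)%R).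
  { intros b Hb; generalize (HM0 b Hb) (pos_INR m); unfold lineM; rewrite HMM; lra. }
  (* The bound on |arg X| = 2 |arg z| in the sector. *)
  set (th := (PI - 2 * delta)%R).
  assert (Hth : (th < rate b1 b2)%R) by (unfold b1, b2; rewrite K_rate by auto; unfold th; lra).
  destruct (MeijerG_expansion a b1 b2 HK M HM th Hth) as [D [HD HG]].
  set (q := (2 * Re (lpole a (S m)))%R).
  set (kap := w + nu - 2 / Cnat N).
  set (c0 := Cpowc 2 (mu + 2 / Cnat N - 1) * Cpowc (RtoC PI) ((1 - Cnat N) * nu)).
  (* Bounds for the residues with index m + 1 + k, relative to |z|^q: the power of 4 comes from X =
     z^2/4, and the last factor bounds the effect of arg z on a complex power. *)
  set (T := fun k => (Cmod (gres a b1 b2 (S m + k)) * Cmod (Cexp (- lpole a (S m + k) * RtoC (ln 4))) *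
     exp (Rabs (Im (2 * lpole a (S m + k))) * PI))%R).
  set (ST := fold_right Rplus 0%R (map T (seq 0 (M - m)))).
  set (D' := (D * exp (- (lineM a M * ln 4)))%R).
  (* |z| >= 2 ensures ln |z| >= 0, so that lowering an exponent lowers the power. *)
  exists (Cmod c0 * exp (Rabs (Im kap) * PI) * (ST + D'))%R, 2%R; split; [lra|]; intros z Hz HA.
  assert (Hz0 : z <> 0) by (apply Cmod_gt_0; lra).
  assert (Hl : (0 <= ln (Cmod z))%R) by (rewrite <- ln_1; apply ln_le; lra).
  assert (HAp : (Rabs (Carg z) <= PI)%R) by lra.
  assert (HA2 : (Rabs (Carg z) < PI / 2)%R) by lra.
  set (X := z ^ 2 / 4).
  assert (HX : X <> 0).
  { unfold X; intros E; apply (Cpow_nz z 2 Hz0).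
    assert (H4 : RtoC 4 <> 0) by (intros E4; apply RtoC_inj in E4; lra).
    replace (z ^ 2) with (z ^ 2 / 4 * 4) by (field; auto); rewrite E; ring. }
  assert (EL : Clog X = 2 * Clog z - RtoC (ln 4)) by (apply Clog_sq_div4; auto).
  assert (EAX : Carg X = (2 * Carg z)%R).
  { change (Carg X) with (Im (Clog X)); rewrite EL; unfold Clog, Im; simpl; ring. }
  assert (ElX : ln (Cmod X) = (2 * ln (Cmod z) - ln 4)%R).
  { change (ln (Cmod X)) with (Re (Clog X)); rewrite EL; unfold Clog, Re; simpl; ring. }
  assert (HAX : (Rabs (Carg X) <= th)%R).
  { rewrite EAX, Rabs_mult, (Rabs_pos_eq 2) by lra; unfold th; lra. }
  assert (HGX := HG X HX HAX).
  set (f := fun k => gres a b1 b2 k * Cpowc X (lpole a k)) in HGX.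
  assert (EX : forall k, Cpowc X (lpole a k) = Cpowc z (2 * lpole a k) * Cexp (- lpole a k * RtoC (ln 4))).
  { intros k; unfold Cpowc; rewrite EL, <- Cexp_plus; f_equal; ring. }
  assert (EE : expansionK N m mu nu w z = c0 * Cpowc z kap * csum f (S m)).
  { unfold expansionK; fold c0; fold kap; f_equal; apply csum_ext; intros k.
    unfold f; rewrite EX; unfold a at 1, b1, b2; rewrite gres_coefK by auto; reflexivity. }
  assert (EK : K N mu nu z w = c0 * Cpowc z kap * MeijerG [a] [] b1 b2 X).
  { reflexivity. }
  assert (ES : csum f (S M) = csum f (S m) + csum (fun k => f (S m + k)%nat) (M - m)).
  { replace (S M) with (S m + (M - m))%nat by (unfold M; lia); apply csum_add. }
  set (Y := exp (q * ln (Cmod z))).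
  assert (HY : (0 < Y)%R) by apply exp_pos.
  assert (Hq : forall x, (x <= q)%R -> (exp (x * ln (Cmod z)) <= Y)%R).
  { intros x Hx; apply exp_le, Rmult_le_compat_r; auto. }
  assert (B1 : (Cmod (csum (fun k => f (S m + k)%nat) (M - m)) <= ST * Y)%R).
  { apply csum_bound; intros k; unfold f; rewrite EX, !Cmod_mult; unfold T.
    assert (H1 := Cmod_Cpowc_le z (2 * lpole a (S m + k)) HAp).
    assert (H2 : (exp (Re (2 * lpole a (S m + k)) * ln (Cmod z)) <= Y)%R).
    { apply Hq; unfold q; replace (Re (2 * lpole a (S m + k))) with (2 * Re (lpole a (S m + k)))%R
        by (unfold Re; simpl; ring).
      rewrite !Re_lpole, plus_INR; generalize (pos_INR k); lra. }
    set (g := Cmod (gres a b1 b2 (S m + k))); set (x := Cmod (Cexp (- lpole a (S m + k) * RtoC (ln 4)))).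
    assert (Hg : (0 <= g)%R) by apply Cmod_ge_0; assert (Hx : (0 <= x)%R) by apply Cmod_ge_0.
    assert (H3 : (Cmod (Cpowc z (2 * lpole a (S m + k))) <= exp (Rabs (Im (2 * lpole a (S m + k))) * PI) * Y)%R).
    { eapply Rle_trans; [exact H1|]; apply Rmult_le_compat_l; [apply Rlt_le, exp_pos|exact H2]. }
    apply Rle_trans with (g * ((exp (Rabs (Im (2 * lpole a (S m + k))) * PI) * Y) * x))%R; [|right; ring].
    apply Rmult_le_compat_l; auto; apply Rmult_le_compat_r; auto. }
  assert (B2 : (D * exp (lineM a M * ln (Cmod X)) <= D' * Y)%R).
  { rewrite ElX; unfold D'; rewrite Rmult_assoc; apply Rmult_le_compat_l; auto.
    replace (lineM a M * (2 * ln (Cmod z) - ln 4))%R with (- (lineM a M * ln 4) + 2 * lineM a M * ln (Cmod z))%R by ring.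
    rewrite exp_plus; apply Rmult_le_compat_l; [apply Rlt_le, exp_pos|]; apply Hq.
    unfold q; rewrite Re_lpole; unfold lineM; rewrite HMM, S_INR; generalize (pos_INR M0); lra. }
  rewrite EK, EE.
  replace (c0 * Cpowc z kap * MeijerG [a] [] b1 b2 X - c0 * Cpowc z kap * csum f (S m))
    with (c0 * Cpowc z kap * ((MeijerG [a] [] b1 b2 X - csum f (S M)) + csum (fun k => f (S m + k)%nat) (M - m)))
    by (rewrite ES; ring).
  rewrite !Cmod_mult.
  assert (B3 : (Cmod ((MeijerG [a] [] b1 b2 X - csum f (S M)) + csum (fun k => f (S m + k)%nat) (M - m)) <= (ST + D') * Y)%R).
  { eapply Rle_trans; [apply Cmod_triangle|]; lra. }
  assert (B4 := Cmod_Cpowc_le z kap HAp).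
  (* The exponent of the error term is that of the prefactor z^kap plus that of the first omitted
     residue, twice the pole a - 1 - (m + 1). *)
  assert (EY : Rpower (Cmod z) (Re (- 2 * Cnat m - 2 - 1 / Cnat N - 2 * mu - nu - w)) = (exp (Re kap * ln (Cmod z)) * Y)%R).
  { unfold Rpower, Y; rewrite <- exp_plus; f_equal; rewrite <- Rmult_plus_distr_r; f_equal.
    assert (E : - 2 * Cnat m - 2 - 1 / Cnat N - 2 * mu - nu - w = kap + 2 * lpole a (S m)).
    { assert (H2 := C2_nz); unfold kap, a, lpole, K_a; rewrite Cnat_S; field; auto. }
    rewrite E; unfold q, Re; simpl; ring. }
  rewrite EY.
  replace (Cmod c0 * exp (Rabs (Im kap) * PI) * (ST + D') * (exp (Re kap * ln (Cmod z)) * Y))%R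
    with (Cmod c0 * (exp (Rabs (Im kap) * PI) * exp (Re kap * ln (Cmod z))) * ((ST + D') * Y))%R by ring.
  apply Rmult_le_compat; [apply Rmult_le_pos; apply Cmod_ge_0|apply Cmod_ge_0| |exact B3].
  apply Rmult_le_compat_l; [apply Cmod_ge_0|exact B4].
Qed.
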